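(* For $(\nu_1,\nu_2)\in\mathbb{C}^2$ let $y(x;\nu_1,\nu_2)=\wp(\nu_1\omega_1+\nu_2\omega_2;\omega_1,\omega_2)+\frac{x+1}{3}$ be a Picard solution of PVI$_\mu$ with $\mu=\frac12$. The monodromy of the Picard solutions is described by the action of the group $\Gamma(2)$ on the parameters $(\nu_1,\nu_2)$: given a branch $y(x;\nu_1,\nu_2)$, all the other branches of the same solution (obtained by analytic continuation along loops in $\overline{\mathbb{C}}\setminus\{0,1,\infty\}$) are of the form $y(x;\tilde\nu_1,\tilde\nu_2)$ with all the $(\tilde\nu_1,\tilde\nu_2)$ such that $$\begin{pmatrix}\tilde\nu_1\\ \tilde\nu_2\end{pmatrix}=\begin{pmatrix}a&b\\ c&d\end{pmatrix}\begin{pmatrix}\nu_1\\ \nu_2\end{pmatrix}\quad\text{for}\quad \begin{pmatrix}a&b\\ c&d\end{pmatrix}\in\Gamma(2).$$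
   Context: PVI$_\mu$ is the equation $$y''=\tfrac12\Big(\tfrac1y+\tfrac1{y-1}+\tfrac1{y-x}\Big)(y')^2-\Big(\tfrac1x+\tfrac1{x-1}+\tfrac1{y-x}\Big)y'+\tfrac12\frac{y(y-1)(y-x)}{x^2(x-1)^2}\Big[(2\mu-1)^2+\frac{x(x-1)}{(y-x)^2}\Big].$$ $\wp(u;\omega_1,\omega_2)$ is the Weierstrass function with half-periods $\omega_1,\omega_2$. Here $\omega_{1},\omega_2$ are the linearly independent solutions of $x(1-x)\omega''+(1-2x)\omega'-\frac14\omega=0$ given near $x=0$ by $\omega_1=\frac{\pi}{2}F(\frac12,\frac12,1,x)$, $\omega_2=-\frac i2\, g(\frac12,\frac12,1,x)$, where $F$ is the Gauss hypergeometric series and, with $\psi$ the digamma function, $g(a,b,1,z)=\sum_{k\ge0}\frac{(a)_k(b)_k}{(k!)^2}z^k[\ln z+\psi(a+k)+\psi(b+k)-2\psi(k+1)]$; branches are taken with respect to the cuts $[-\infty,0]$ and $[1,+\infty]$ on the real axis. By periodicity of $\wp$, $(\nu_1,\nu_2)$ may be reduced to $0\le\mathrm{Re}\,\nu_i<2$. $\Gamma(2)$ is the group of matrices in $SL(2,\mathbb{Z})$ congruent to the identity modulo $2$. *)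

(* Defs.v *)
(* Stdlib reals and Coquelicot; [C] is Coquelicot's type of complex numbers. *)
From Stdlib Require Import Reals ZArith ClassicalEpsilon.
From Coquelicot Require Import Coquelicot.

Open Scope C_scope.

Definition CLim_seq (u : nat -> C) : C :=
  iota (T := C_CompleteNormedModule)
    (fun l : C => filterlim u eventually (locally l)).

Definition CSeries (a : nat -> C) : C :=
  iota (T := C_CompleteNormedModule) (fun l : C => is_series a l).

(* Principal branch, with values in (-PI, PI]. *)
Definition Carg (z : C) : R :=
  if Rle_dec 0 (Im z) then acos (Re z / Cmod z)
  else (- acos (Re z / Cmod z))%R.

Definition Cln (z : C) : C := (ln (Cmod z), Carg z).

(* Euler's integral and its logarithmic derivative; only positive real
   arguments are used below. *)
Definition Gamma (s : R) : R :=
  RInt_gen (fun t : R => (Rpower t (s - 1) * exp (- t))%R)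
    (at_right 0%R) (Rbar_locally p_infty).

Definition digamma (s : R) : R := (Derive Gamma s / Gamma s)%R.

Fixpoint pochhammer (a : R) (k : nat) : R :=
  match k with
  | O => 1%R
  | S k' => (pochhammer a k' * (a + INR k'))%R
  end.

Definition hypergeometric_F (a b c : R) (z : C) : C :=
  CSeries (fun k =>
    RtoC (pochhammer a k * pochhammer b k
          / (pochhammer c k * INR (fact k)))%R * z ^ k).

(* The companion g(a, b, 1, z) of F(a, b, 1, z), logarithmic at 0. *)
Definition hypergeometric_g (a b : R) (z : C) : C :=
  CSeries (fun k =>
    RtoC (pochhammer a k * pochhammer b k / INR (fact k) ^ 2)%R * z ^ k
    * (Cln z
       + RtoC (digamma (a + INR k) + digamma (b + INR k)
               - 2 * digamma (INR k + 1))%R)).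

(* The complement of the cuts (-oo, 0] and [1, +oo). *)
Definition cut_plane (x : C) : Prop :=
  ~ (Im x = 0%R /\ (Re x <= 0 \/ 1 <= Re x)%R).

Definition solves_period_equation (w : C -> C) : Prop :=
  exists w' w'' : C -> C, forall x : C, cut_plane x ->
    is_derive w x (w' x) /\ is_derive w' x (w'' x) /\
    x * (1 - x) * w'' x + (1 - 2 * x) * w' x - / 4 * w x = 0.

(* The series of F and g converge in the unit disc only.  By analytic
   continuation, at most one function on the (connected) cut plane satisfies
   this predicate for a given [w0]. *)
Definition is_period_given_by (w0 w : C -> C) : Prop :=
  solves_period_equation w /\
  forall x : C, cut_plane x -> (Cmod x < 1)%R -> w x = w0 x.

Definition omega1 : C -> C :=
  epsilon (inhabits (fun _ : C => RtoC 0))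
    (is_period_given_by
       (fun x => RtoC (PI / 2) * hypergeometric_F (1 / 2) (1 / 2) 1 x)).

Definition omega2 : C -> C :=
  epsilon (inhabits (fun _ : C => RtoC 0))
    (is_period_given_by
       (fun x => - (Ci / 2) * hypergeometric_g (1 / 2) (1 / 2) x)).

(* [w1], [w2] are half-periods: the lattice is 2 w1 Z + 2 w2 Z. *)
Definition lattice_point (w1 w2 : C) (m n : Z) : C :=
  2 * RtoC (IZR m) * w1 + 2 * RtoC (IZR n) * w2.

Definition wp_term (u w1 w2 : C) (m n : Z) : C :=
  if andb (Z.eqb m 0) (Z.eqb n 0) then 0
  else / (u - lattice_point w1 w2 m n) ^ 2 - / (lattice_point w1 w2 m n) ^ 2.

(* The lattice series converges absolutely, so that it may be summed over the
   squares |m|, |n| <= N.  The value is meaningless when u is a lattice point,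
   i.e. a pole. *)
Definition wp (u w1 w2 : C) : C :=
  / u ^ 2
  + CLim_seq (fun N : nat =>
      sum_n (fun i : nat =>
        sum_n (fun j : nat =>
          wp_term u w1 w2 (Z.of_nat i - Z.of_nat N) (Z.of_nat j - Z.of_nat N))
        (2 * N)) (2 * N)).

Definition picard (nu1 nu2 : C) (x : C) : C :=
  wp (nu1 * omega1 x + nu2 * omega2 x) (omega1 x) (omega2 x) + (x + 1) / 3.

(* For nu in (2Z)^2 the argument of wp is identically a lattice point, and
   y(x; nu1, nu2) is identically infinite. *)
Definition even_integral (nu1 nu2 : C) : Prop :=
  exists m n : Z, nu1 = RtoC (IZR (2 * m)) /\ nu2 = RtoC (IZR (2 * n)).

(* Germs of meromorphic functions at [a] are represented by functions C -> C
   whose values are irrelevant at [a] itself, so that [a] may be a pole;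
   accordingly they are compared on punctured neighbourhoods. *)
Definition germ_eq (a : C) (f g : C -> C) : Prop :=
  locally' a (fun z => f z = g z).

Definition meromorphic_at (a : C) (f : C -> C) : Prop :=
  exists (n : nat) (g : C -> C),
    locally a (fun z => ex_derive g z) /\
    locally' a (fun z => (z - a) ^ n * f z = g z).

Definition unit_interval (t : R) : Prop := (0 <= t <= 1)%R.

(* [F t] is the germ at [gam t]. *)
Definition continues_along (gam : R -> C) (f g : C -> C) : Prop :=
  exists F : R -> C -> C,
    germ_eq (gam 0%R) (F 0%R) f /\
    germ_eq (gam 1%R) (F 1%R) g /\
    forall t : R, unit_interval t ->
      meromorphic_at (gam t) (F t) /\
      exists delta : posreal, forall s : R,
        unit_interval s -> (Rabs (s - t) < delta)%R ->
        germ_eq (gam s) (F s) (F t).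

Definition loop_avoiding_0_1 (x0 : C) (gam : R -> C) : Prop :=
  continuous_on unit_interval gam /\
  gam 0%R = x0 /\ gam 1%R = x0 /\
  forall t : R, unit_interval t -> gam t <> 0 /\ gam t <> 1.

(* [g] is, near [x0], a branch of the multivalued function which has [f] as
   one of its branches there. *)
Definition is_branch (x0 : C) (f g : C -> C) : Prop :=
  exists gam : R -> C, loop_avoiding_0_1 x0 gam /\ continues_along gam f g.

(* Membership of the matrix (a b; c d) in Gamma(2). *)
Definition in_Gamma2 (a b c d : Z) : Prop :=
  (a * d - b * c = 1 /\
   a mod 2 = 1 /\ b mod 2 = 0 /\ c mod 2 = 0 /\ d mod 2 = 1)%Z.

(* Main.v *)
(* The half-periods are omega1 = EK(x) and omega2 = i EK(1-x), where
   EK(x) = int_0^(pi/2) (1 - x sin^2 t)^(-1/2) dt.  The function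
   EL(x) = int_0^(pi/2) (sin^2 t - x)^(-1/2) dt solves the same equation across
   the negative axis, and EL = EK(1-x) + i EK on the upper and EK(1-x) - i EK on
   the lower half-plane.  So EK(1-x) changes by 2 i EK or -2 i EK along a loop
   around 0 (and symmetrically around 1); since wp depends on the lattice only
   and is even, this acts on (nu1, nu2) by the elementary matrices of Gamma(2),
   which generate it together with -1.

   To identify the series with these integrals one compares them at the regular
   singular point 0, where a solution tending to 0 along the real axis vanishes.
   For g this needs the asymptotics EK(1-x) = 2 ln 2 - (ln x)/2 + o(1) and
   psi(1/2) - psi(1) = - 2 ln 2; the latter comes from the convexity of
   ln Gamma, which gives psi(s) = lim (ln n - sum_(k<n) 1/(s+k)).

   The periods are R-linearly independent because Re (conj(EK x) EK(1-x)) is a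
   double integral of a positive function.

   Germs are merely complex differentiable, so uniqueness of continuation rests
   on Goursat's theorem; applied to f (z + exp zeta) it gives the mean value
   property, and the mean value property of f(u)/(u-p)^n shows that a function
   vanishing near p vanishes on a disc of comparable size. *)
Require Import Defs.
From Stdlib Require Import Reals ZArith Lra Lia List Permutation.
From Stdlib Require Import Classical ClassicalEpsilon FunctionalExtensionality.
From Coquelicot Require Import Coquelicot.
Open Scope C_scope.


(** The parameters are complex, so real independence of the half-periods at a point does not prevent
    [nu1 omega1 + nu2 omega2] from meeting a lattice point to second order, where meromorphy would
    be in doubt. What prevents it is that the difference solves the period equation: a double zero
    would make it vanish identically and, the two periods being independent over the complex numbers
    as functions, put [(nu1, nu2)] into [(2Z)^2]. That exclusion is stable under unimodular integer
    matrices, so every germ met is meromorphic.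

    An arbitrary loop is never decomposed into generators. Three star-shaped charts cover the
    punctured plane and overlap only off the real axis. Passing between the cut plane and another
    chart multiplies the parameters by a unipotent matrix with off-diagonal entry 1 or -1; so the
    residue modulo 2 of the accumulated matrix depends on the chart alone, and this is carried along
    the loop by connectedness of the interval. Conversely, a loop through two charts realises an
    elementary matrix with entry 2 or -2, and Euclid's algorithm composes these. *)

(** * Arithmetic of complex numbers *)

Lemma Cmod_sub_comm (x y : C) : Cmod (x - y) = Cmod (y - x).
Proof. rewrite <- Cmod_opp. f_equal. ring. Qed.

Lemma Cmod_triangle_sub (x y z : C) : (Cmod (x - z) <= Cmod (x - y) + Cmod (y - z))%R.
Proof. replace (x - z) with ((x - y) + (y - z)) by ring. apply Cmod_triangle. Qed.

Lemma Cmod_sub_ge (x y : C) : (Cmod x - Cmod y <= Cmod (x - y))%R.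
Proof.
  pose proof (Cmod_triangle (x - y) y) as H. replace (x - y + y) with x in H by ring. lra.
Qed.

Lemma Cmod_sub_le (x y : C) : (Cmod (x - y) <= Cmod x + Cmod y)%R.
Proof. pose proof (Cmod_triangle x (- y)). rewrite Cmod_opp in H. exact H. Qed.

Lemma Cmod_sub_0 (x : C) : Cmod (x - x) = 0%R.
Proof. replace (x - x) with (RtoC 0) by ring. apply Cmod_0. Qed.

Lemma Cmod_eq_sub_0 (x y : C) : Cmod (x - y) = 0%R -> x = y.
Proof. intros H. apply Cmod_eq_0 in H. replace x with (x - y + y) by ring. rewrite H. ring. Qed.

Lemma Cmod_RtoC_sub (x y : R) : Cmod (RtoC x - RtoC y) = Rabs (x - y).
Proof. rewrite <- RtoC_minus. apply Cmod_R. Qed.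

Lemma Cmult_integral (x y : C) : x * y = 0 -> x = 0 \/ y = 0.
Proof.
  intros H. destruct (classic (x = 0)) as [| Hx]; [now left |]. right.
  replace y with (/ x * (x * y)) by (field; exact Hx). rewrite H. ring.
Qed.

Lemma C_ext (x y : C) : Re x = Re y -> Im x = Im y -> x = y.
Proof. destruct x, y; simpl; congruence. Qed.

Lemma Re_plus (x y : C) : Re (x + y) = (Re x + Re y)%R. Proof. reflexivity. Qed.
Lemma Im_plus (x y : C) : Im (x + y) = (Im x + Im y)%R. Proof. reflexivity. Qed.
Lemma Re_minus (x y : C) : Re (x - y) = (Re x - Re y)%R. Proof. reflexivity. Qed.
Lemma Im_minus (x y : C) : Im (x - y) = (Im x - Im y)%R. Proof. reflexivity. Qed.
Lemma Re_opp (x : C) : Re (- x) = (- Re x)%R. Proof. reflexivity. Qed.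
Lemma Im_opp (x : C) : Im (- x) = (- Im x)%R. Proof. reflexivity. Qed.
Lemma Re_mult (x y : C) : Re (x * y) = (Re x * Re y - Im x * Im y)%R. Proof. reflexivity. Qed.
Lemma Im_mult (x y : C) : Im (x * y) = (Re x * Im y + Im x * Re y)%R. Proof. reflexivity. Qed.
Lemma Re_RtoC (x : R) : Re (RtoC x) = x. Proof. reflexivity. Qed.
Lemma Im_RtoC (x : R) : Im (RtoC x) = 0%R. Proof. reflexivity. Qed.
Lemma Re_Ci : Re Ci = 0%R. Proof. reflexivity. Qed.
Lemma Im_Ci : Im Ci = 1%R. Proof. reflexivity. Qed.
Lemma Re_conj (x : C) : Re (Cconj x) = Re x. Proof. reflexivity. Qed.
Lemma Im_conj (x : C) : Im (Cconj x) = (- Im x)%R. Proof. reflexivity. Qed.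

Ltac reim := repeat (rewrite ?Re_plus, ?Im_plus, ?Re_minus, ?Im_minus, ?Re_opp, ?Im_opp,
  ?Re_mult, ?Im_mult, ?Re_RtoC, ?Im_RtoC, ?Re_Ci, ?Im_Ci, ?Re_conj, ?Im_conj).

Lemma Cmod_sqr (z : C) : (Cmod z * Cmod z = Re z * Re z + Im z * Im z)%R.
Proof. pose proof (Cmod2_alt z). nra. Qed.

Lemma Im_le_Cmod (z : C) : (Rabs (Im z) <= Cmod z)%R.
Proof. pose proof (Rmax_Cmod z). pose proof (Rmax_r (Rabs (fst z)) (Rabs (snd z))). unfold Im. lra. Qed.

Lemma Cmod_le_Re_Im (z : C) : (Cmod z <= Rabs (Re z) + Rabs (Im z))%R.
Proof.
  pose proof (Cmod_sqr z). pose proof (Cmod_ge_0 z).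
  pose proof (Rabs_pos (Re z)). pose proof (Rabs_pos (Im z)).
  pose proof (Rsqr_abs (Re z)) as h1. pose proof (Rsqr_abs (Im z)) as h2. unfold Rsqr in h1, h2. nra.
Qed.

(** * Continuity and differentiability *)

(* Functions of a complex variable ([io] the identity) and of a real variable
   ([io = RtoC]) are treated at once.  Differentiability is in Caratheodory's
   form. *)
Definition cont_at {T} (io : T -> C) (f : T -> C) (x : T) : Prop :=
  forall eps, (0 < eps)%R -> exists delta, (0 < delta)%R /\
    forall y, (Cmod (io y - io x) < delta)%R -> (Cmod (f y - f x) < eps)%R.

Definition near {T} (io : T -> C) (x : T) (P : T -> Prop) : Prop :=
  exists delta, (0 < delta)%R /\ forall y, (Cmod (io y - io x) < delta)%R -> P y.

Definition deriv_at {T} (io : T -> C) (f : T -> C) (x : T) (l : C) : Prop :=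
  exists phi, phi x = l /\ cont_at io phi x /\
    near io x (fun y => f y = f x + (io y - io x) * phi y).

Definition cid (z : C) : C := z.

Notation ccont := (cont_at cid).
Notation rcont := (cont_at RtoC).
Notation cderiv := (deriv_at cid).
Notation rderiv := (deriv_at RtoC).

Lemma near_and {T} (io : T -> C) x (P Q : T -> Prop) :
  near io x P -> near io x Q -> near io x (fun y => P y /\ Q y).
Proof.
  intros (d1 & h1 & H1) (d2 & h2 & H2). exists (Rmin d1 d2). split.
  - now apply Rmin_glb_lt.
  - intros y Hy. pose proof (Rmin_l d1 d2). pose proof (Rmin_r d1 d2).
    split; [apply H1 | apply H2]; lra.
Qed.

Lemma near_imp {T} (io : T -> C) x (P Q : T -> Prop) :
  (forall y, P y -> Q y) -> near io x P -> near io x Q.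
Proof. intros H (d & h & H1). exists d. split; auto. Qed.

Lemma near_at {T} (io : T -> C) x (P : T -> Prop) : near io x P -> P x.
Proof. intros (d & h & H). apply H. now rewrite Cmod_sub_0. Qed.

Lemma near_all {T} (io : T -> C) x (P : T -> Prop) : (forall y, P y) -> near io x P.
Proof. intros H. exists 1%R. split; [lra | auto]. Qed.

Lemma near_near {T} (io : T -> C) x (P : T -> Prop) :
  near io x P -> near io x (fun y => near io y P).
Proof.
  intros (d & h & H). exists (d / 2)%R. split; [lra |].
  intros y Hy. exists (d / 2)%R. split; [lra |]. intros z Hz. apply H.
  pose proof (Cmod_triangle_sub (io z) (io y) (io x)). lra.
Qed.

Lemma cont_near {T} (io : T -> C) (f : T -> C) x (P : C -> Prop) :
  cont_at io f x -> near cid (f x) P -> near io x (fun y => P (f y)).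
Proof.
  intros Hf (d & h & H). destruct (Hf d h) as (d' & h' & H').
  exists d'. split; [exact h' |]. intros y Hy. apply H. now apply H'.
Qed.

Lemma cont_ext {T} (io : T -> C) (f g : T -> C) x :
  near io x (fun y => f y = g y) -> cont_at io f x -> cont_at io g x.
Proof.
  intros He Hf eps h. pose proof (near_at _ _ _ He) as Hx. cbv beta in Hx.
  change (near io x (fun y => (Cmod (g y - g x) < eps)%R)).
  refine (near_imp _ _ _ _ _ (near_and _ _ _ _ He (Hf eps h))).
  intros y [E Hy]. rewrite <- E, <- Hx. exact Hy.
Qed.

Lemma cont_const {T} (io : T -> C) c x : cont_at io (fun _ => c) x.
Proof. intros eps h. exists 1%R. split; [lra |]. intros. now rewrite Cmod_sub_0. Qed.

Lemma cont_io {T} (io : T -> C) x : cont_at io io x.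
Proof. intros eps h. exists eps. now split. Qed.

Lemma cont_id z : ccont (fun z => z) z.
Proof. exact (cont_io cid z). Qed.

Lemma cont_plus {T} (io : T -> C) f g x :
  cont_at io f x -> cont_at io g x -> cont_at io (fun y => f y + g y) x.
Proof.
  intros Hf Hg eps h.
  refine (near_imp _ _ _ _ _ (near_and _ _ _ _ (Hf (eps / 2)%R _) (Hg (eps / 2)%R _))); try lra.
  intros y [H1 H2]. replace (f y + g y - (f x + g x)) with ((f y - f x) + (g y - g x)) by ring.
  pose proof (Cmod_triangle (f y - f x) (g y - g x)). lra.
Qed.

Lemma cont_opp {T} (io : T -> C) f x : cont_at io f x -> cont_at io (fun y => - f y) x.
Proof.
  intros Hf eps h. destruct (Hf eps h) as (d & hd & H). exists d. split; [exact hd |].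
  intros y Hy. replace (- f y - - f x) with (- (f y - f x)) by ring. rewrite Cmod_opp. auto.
Qed.

Lemma cont_minus {T} (io : T -> C) f g x :
  cont_at io f x -> cont_at io g x -> cont_at io (fun y => f y - g y) x.
Proof. intros Hf Hg. apply (cont_plus io f (fun y => - g y) x Hf). now apply cont_opp. Qed.

Lemma cont_mult {T} (io : T -> C) f g x :
  cont_at io f x -> cont_at io g x -> cont_at io (fun y => f y * g y) x.
Proof.
  intros Hf Hg eps h.
  pose proof (Cmod_ge_0 (f x)) as hf0. pose proof (Cmod_ge_0 (g x)) as hg0.
  set (e1 := Rmin 1 (eps / (2 * (1 + Cmod (g x))))%R).
  set (e2 := (eps / (2 * (2 + Cmod (f x))))%R).
  assert (h1 : (0 < e1)%R) by (apply Rmin_glb_lt; [lra | apply Rdiv_lt_0_compat; lra]).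
  assert (h2 : (0 < e2)%R) by (apply Rdiv_lt_0_compat; lra).
  refine (near_imp _ _ _ _ _ (near_and _ _ _ _ (Hf e1 h1) (Hg e2 h2))).
  intros y [H1 H2].
  replace (f y * g y - f x * g x) with ((f y - f x) * g x + (f x + (f y - f x)) * (g y - g x)) by ring.
  eapply Rle_lt_trans; [apply Cmod_triangle |]. rewrite !Cmod_mult.
  pose proof (Cmod_triangle (f x) (f y - f x)) as Ht.
  pose proof (Rmin_l 1 (eps / (2 * (1 + Cmod (g x))))%R) as m1.
  pose proof (Rmin_r 1 (eps / (2 * (1 + Cmod (g x))))%R) as m2. fold e1 in m1, m2.
  assert (m3 : (e1 * (1 + Cmod (g x)) <= eps / 2)%R).
  { replace (eps / 2)%R with ((eps / (2 * (1 + Cmod (g x)))) * (1 + Cmod (g x)))%R by (field; lra).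
    apply Rmult_le_compat_r; lra. }
  assert (m4 : (e2 * (2 + Cmod (f x)) = eps / 2)%R) by (unfold e2; field; lra).
  pose proof (Cmod_ge_0 (f y - f x)). pose proof (Cmod_ge_0 (g y - g x)).
  assert ((Cmod (f y - f x) * Cmod (g x) <= e1 * (1 + Cmod (g x)))%R) by (apply Rmult_le_compat; lra).
  assert ((Cmod (f x + (f y - f x)) * Cmod (g y - g x) <= (1 + Cmod (f x)) * e2)%R).
  { apply Rmult_le_compat; try lra. apply Cmod_ge_0. }
  lra.
Qed.

Lemma cont_comp {T} (io : T -> C) (f : C -> C) (g : T -> C) x :
  ccont f (g x) -> cont_at io g x -> cont_at io (fun y => f (g y)) x.
Proof.
  intros Hf Hg eps h. exact (cont_near _ _ _ (fun w => (Cmod (f w - f (g x)) < eps)%R) Hg (Hf eps h)).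
Qed.

Lemma cont_neq {T} (io : T -> C) f x : cont_at io f x -> f x <> 0 -> near io x (fun y => f y <> 0).
Proof.
  intros Hf H. apply Cmod_gt_0 in H.
  refine (near_imp _ _ _ _ _ (Hf _ H)). intros y Hy E. rewrite E in Hy.
  rewrite Cmod_sub_comm in Hy. replace (f x - 0) with (f x) in Hy by ring. lra.
Qed.

Lemma cont_inv_id (z : C) : z <> 0 -> ccont (fun w => / w) z.
Proof.
  intros Hz eps h. apply Cmod_gt_0 in Hz as Hm.
  exists (Rmin (Cmod z / 2) (eps * (Cmod z * Cmod z) / 2))%R. split.
  - apply Rmin_glb_lt; [lra |]. assert (0 < Cmod z * Cmod z)%R by nra. nra.
  - unfold cid. intros w Hw. pose proof (Rmin_l (Cmod z / 2) (eps * (Cmod z * Cmod z) / 2))%R.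
    pose proof (Rmin_r (Cmod z / 2) (eps * (Cmod z * Cmod z) / 2))%R.
    assert (hw : (Cmod z / 2 < Cmod w)%R).
    { pose proof (Cmod_sub_ge z w). rewrite Cmod_sub_comm in Hw. lra. }
    assert (w <> 0) by (intros ->; rewrite Cmod_0 in hw; lra).
    replace (/ w - / z) with (- ((w - z) / (w * z))) by (field; auto).
    rewrite Cmod_opp, Cmod_div, Cmod_mult.
    2:{ intros E. apply Cmult_integral in E. tauto. }
    assert (0 < Cmod w * Cmod z)%R by nra.
    apply (Rmult_lt_reg_r (Cmod w * Cmod z)); [assumption |].
    replace (Cmod (w - z) / (Cmod w * Cmod z) * (Cmod w * Cmod z))%R with (Cmod (w - z)) by (field; lra).
    assert (Cmod z * Cmod z / 2 < Cmod w * Cmod z)%R by nra. nra.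
Qed.

Lemma cont_inv {T} (io : T -> C) f x :
  cont_at io f x -> f x <> 0 -> cont_at io (fun y => / f y) x.
Proof. intros Hf H. apply (cont_comp io (fun w => / w)); [now apply cont_inv_id | exact Hf]. Qed.

Lemma cont_div {T} (io : T -> C) f g x :
  cont_at io f x -> cont_at io g x -> g x <> 0 -> cont_at io (fun y => f y / g y) x.
Proof. intros. apply cont_mult; [assumption | now apply cont_inv]. Qed.

Lemma cont_pow {T} (io : T -> C) f n x : cont_at io f x -> cont_at io (fun y => f y ^ n) x.
Proof. intros H. induction n; simpl; [apply cont_const | now apply cont_mult]. Qed.

Lemma deriv_eq {T} (io : T -> C) f x l l' : deriv_at io f x l -> l = l' -> deriv_at io f x l'.
Proof. now intros H <-. Qed.

Lemma deriv_ext {T} (io : T -> C) f g x l :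
  near io x (fun y => f y = g y) -> deriv_at io f x l -> deriv_at io g x l.
Proof.
  intros He (phi & E & Hc & Hn). exists phi. split; [exact E |]. split; [exact Hc |].
  pose proof (near_at _ _ _ He) as Hx. cbv beta in Hx.
  refine (near_imp _ _ _ _ _ (near_and _ _ _ _ He Hn)).
  intros y [E1 E2]. now rewrite <- E1, <- Hx.
Qed.

Lemma deriv_cont {T} (io : T -> C) f x l : deriv_at io f x l -> cont_at io f x.
Proof.
  intros (phi & E & Hc & Hn).
  apply (cont_ext io (fun y => f x + (io y - io x) * phi y)).
  - refine (near_imp _ _ _ _ _ Hn). intros y Hy. now rewrite Hy.
  - apply cont_plus; [apply cont_const |]. apply cont_mult; [| exact Hc].
    apply cont_minus; [apply cont_io | apply cont_const].
Qed.

Lemma deriv_const {T} (io : T -> C) c x : deriv_at io (fun _ => c) x 0.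
Proof.
  exists (fun _ => RtoC 0). split; [reflexivity |]. split; [apply cont_const |].
  apply near_all. intros. ring.
Qed.

Lemma deriv_io {T} (io : T -> C) x : deriv_at io io x 1.
Proof.
  exists (fun _ => RtoC 1). split; [reflexivity |]. split; [apply cont_const |].
  apply near_all. intros. ring.
Qed.

Lemma deriv_id z : cderiv (fun z => z) z 1.
Proof. exact (deriv_io cid z). Qed.

Lemma deriv_plus {T} (io : T -> C) f g x l m :
  deriv_at io f x l -> deriv_at io g x m -> deriv_at io (fun y => f y + g y) x (l + m).
Proof.
  intros (p & E & Hc & Hn) (q & E' & Hc' & Hn'). exists (fun y => p y + q y).
  split; [now rewrite E, E' |]. split; [now apply cont_plus |].
  refine (near_imp _ _ _ _ _ (near_and _ _ _ _ Hn Hn')). intros y [-> ->]. ring.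
Qed.

Lemma deriv_mult {T} (io : T -> C) f g x l m :
  deriv_at io f x l -> deriv_at io g x m ->
  deriv_at io (fun y => f y * g y) x (l * g x + f x * m).
Proof.
  intros Hf Hg. pose proof (deriv_cont _ _ _ _ Hg) as Hgc.
  destruct Hf as (p & E & Hc & Hn), Hg as (q & E' & Hc' & Hn').
  exists (fun y => p y * g y + f x * q y).
  split; [now rewrite E, E' |]. split.
  - apply cont_plus; apply cont_mult; auto. apply cont_const.
  - refine (near_imp _ _ _ _ _ (near_and _ _ _ _ Hn Hn')). intros y [-> ->]. ring.
Qed.

Lemma deriv_scal {T} (io : T -> C) c f x l :
  deriv_at io f x l -> deriv_at io (fun y => c * f y) x (c * l).
Proof.
  intros Hf. eapply deriv_eq; [apply deriv_mult; [apply deriv_const | exact Hf] |]. cbv beta. ring.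
Qed.

Lemma deriv_opp {T} (io : T -> C) f x l : deriv_at io f x l -> deriv_at io (fun y => - f y) x (- l).
Proof.
  intros Hf. apply (deriv_ext io (fun y => - (1) * f y)).
  - apply near_all. intros; ring.
  - eapply deriv_eq; [apply deriv_scal, Hf |]. ring.
Qed.

Lemma deriv_minus {T} (io : T -> C) f g x l m :
  deriv_at io f x l -> deriv_at io g x m -> deriv_at io (fun y => f y - g y) x (l - m).
Proof. intros Hf Hg. apply (deriv_plus io f (fun y => - g y)); [exact Hf | now apply deriv_opp]. Qed.

(** The slope function of the composite is the product of the slope functions, so points where [g]
    takes the value [g x] again need no separate case. *)
Lemma deriv_comp {T} (io : T -> C) (f : C -> C) (g : T -> C) x l m :
  cderiv f (g x) l -> deriv_at io g x m -> deriv_at io (fun y => f (g y)) x (l * m).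
Proof.
  intros Hf Hg. pose proof (deriv_cont _ _ _ _ Hg) as Hgc.
  destruct Hf as (p & E & Hc & Hn), Hg as (q & E' & Hc' & Hn').
  exists (fun y => p (g y) * q y). split; [now rewrite E, E' |]. split.
  - apply cont_mult; [| exact Hc']. now apply cont_comp.
  - pose proof (cont_near _ _ _ _ Hgc Hn) as Hn2.
    refine (near_imp _ _ _ _ _ (near_and _ _ _ _ Hn' Hn2)). unfold cid.
    intros y [E1 E2]. rewrite E2. rewrite E1 at 1. ring.
Qed.

Lemma deriv_inv_id (z : C) : z <> 0 -> cderiv (fun w => / w) z (- / (z * z)).
Proof.
  intros Hz. exists (fun w => - / (z * w)). split; [reflexivity |]. split.
  - apply cont_opp, (cont_inv cid (fun w => z * w)).
    + apply (cont_mult cid (fun _ => z) (fun w => w)); [apply cont_const | apply cont_id].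
    + intros E. now destruct (Cmult_integral z z E).
  - refine (near_imp _ _ _ _ _ (cont_neq cid (fun w => w) z (cont_id z) Hz)).
    unfold cid. intros w Hw. field. auto.
Qed.

Lemma deriv_inv {T} (io : T -> C) f x l :
  deriv_at io f x l -> f x <> 0 -> deriv_at io (fun y => / f y) x (- l / (f x * f x)).
Proof.
  intros Hf H. eapply deriv_eq; [apply (deriv_comp io (fun w => / w)); [now apply deriv_inv_id | exact Hf] |].
  field; auto.
Qed.

Lemma deriv_div {T} (io : T -> C) f g x l m :
  deriv_at io f x l -> deriv_at io g x m -> g x <> 0 ->
  deriv_at io (fun y => f y / g y) x ((l * g x - f x * m) / (g x * g x)).
Proof.
  intros Hf Hg H. eapply deriv_eq; [apply deriv_mult; [exact Hf | apply deriv_inv; [exact Hg | exact H]] |].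
  cbv beta. field; auto.
Qed.

Lemma deriv_pow {T} (io : T -> C) f x l n :
  deriv_at io f x l -> deriv_at io (fun y => f y ^ n) x (RtoC (INR n) * f x ^ (n - 1) * l).
Proof.
  intros Hf. induction n.
  - simpl. eapply deriv_eq; [apply deriv_const |]. ring.
  - eapply deriv_eq; [apply (deriv_mult io f (fun y => f y ^ n)); [exact Hf | exact IHn] |].
    rewrite S_INR, RtoC_plus. replace (S n - 1)%nat with n by lia.
    destruct n; [simpl; ring |]. replace (S n - 1)%nat with n by lia. simpl. ring.
Qed.

Lemma deriv_unique {T} (io : T -> C) f x l m :
  (forall d, (0 < d)%R -> exists y, (0 < Cmod (io y - io x) < d)%R) ->
  deriv_at io f x l -> deriv_at io f x m -> l = m.
Proof.
  intros Hacc (p & E & Hc & Hn) (q & E' & Hc' & Hn').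
  apply Cmod_eq_sub_0, Rle_antisym; [| apply Cmod_ge_0].
  apply le_epsilon. intros eps h. rewrite Rplus_0_l.
  assert (h2 : (0 < eps / 2)%R) by lra.
  destruct (near_and _ _ _ _ (near_and _ _ _ _ Hn Hn') (near_and _ _ _ _ (Hc _ h2) (Hc' _ h2)))
    as (d & hd & H).
  destruct (Hacc d hd) as (y & hy1 & hy2). destruct (H y hy2) as ((E1 & E2) & H1 & H2).
  assert (Eq : p y = q y).
  { apply Cmod_gt_0 in hy1. replace (p y) with (((io y - io x) * p y) / (io y - io x)) by (field; auto).
    replace ((io y - io x) * p y) with (f y - f x) by (rewrite E1; ring). rewrite E2. field; auto. }
  rewrite E in H1. rewrite E', <- Eq in H2.
  pose proof (Cmod_triangle_sub l (p y) m). rewrite (Cmod_sub_comm l (p y)) in H0. lra.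
Qed.

Lemma cderiv_unique f z l m : cderiv f z l -> cderiv f z m -> l = m.
Proof.
  apply deriv_unique. unfold cid. intros d hd. exists (z + RtoC (d / 2)).
  replace (z + RtoC (d / 2) - z) with (RtoC (d / 2)) by ring.
  rewrite Cmod_R, Rabs_pos_eq; lra.
Qed.

(** The difference quotient, completed by [l] at [x], is the slope function. The first hypothesis
    keeps the denominator nonzero away from [x]. *)
Lemma deriv_intro {T} (io : T -> C) f x l :
  (forall y, io y = io x -> y = x) ->
  (forall eps, (0 < eps)%R ->
    near io x (fun y => (Cmod (f y - f x - (io y - io x) * l) <= eps * Cmod (io y - io x))%R)) ->
  deriv_at io f x l.
Proof.
  intros Hinj H.
  exists (fun y => if excluded_middle_informative (y = x) then l else (f y - f x) / (io y - io x)).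
  assert (Hne : forall y, y <> x -> io y - io x <> 0).
  { intros y Hy E. apply Hy, Hinj. replace (io y) with (io y - io x + io x) by ring. rewrite E. ring. }
  split; [destruct (excluded_middle_informative (x = x)); tauto |]. split.
  - intros eps h. refine (near_imp _ _ _ _ _ (H (eps / 2)%R _)); [| lra].
    cbv beta. intros y Hy. destruct (excluded_middle_informative (x = x)) as [_ | c]; [| tauto].
    destruct (excluded_middle_informative (y = x)) as [Ey | Ny]; [rewrite Cmod_sub_0; lra |].
    specialize (Hne y Ny). replace ((f y - f x) / (io y - io x) - l)
      with ((f y - f x - (io y - io x) * l) / (io y - io x)) by (field; auto).
    rewrite Cmod_div; [| auto]. apply Cmod_gt_0 in Hne.
    apply (Rmult_lt_reg_r (Cmod (io y - io x))); [exact Hne |].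
    unfold Rdiv. rewrite Rmult_assoc, Rinv_l, Rmult_1_r by lra. nra.
  - apply near_all. intros y. destruct (excluded_middle_informative (y = x)) as [-> | Ny]; [ring |].
    field. auto.
Qed.

Lemma deriv_elim {T} (io : T -> C) f x l eps :
  deriv_at io f x l -> (0 < eps)%R ->
  near io x (fun y => (Cmod (f y - f x - (io y - io x) * l) <= eps * Cmod (io y - io x))%R).
Proof.
  intros (p & E & Hc & Hn) h. refine (near_imp _ _ _ _ _ (near_and _ _ _ _ Hn (Hc eps h))).
  cbv beta. intros y [-> Hy]. rewrite E in Hy.
  replace (f x + (io y - io x) * p y - f x - (io y - io x) * l) with ((p y - l) * (io y - io x)) by ring.
  rewrite Cmod_mult. apply Rmult_le_compat_r; [apply Cmod_ge_0 | lra].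
Qed.

(** * Comparison with filters and [is_derive] *)

Lemma locally_near (z : C) (P : C -> Prop) : locally (T := C_UniformSpace) z P <-> near cid z P.
Proof.
  split.
  - intros [d H]. exists d. split; [apply cond_pos |]. intros y Hy. apply H.
    apply C_NormedModule_mixin_compat1. exact Hy.
  - intros (d & hd & H).
    (* Balls of [C_UniformSpace] are squares; the square of half-side [d / sqrt 2] lies in the disc
       of radius [d]. *)
    assert (h2 : (0 < d / sqrt 2)%R) by (apply Rdiv_lt_0_compat; [lra | apply sqrt_lt_R0; lra]).
    exists (mkposreal _ h2). intros y Hy. apply H.
    apply (C_NormedModule_mixin_compat2 z y) in Hy. simpl in Hy.
    replace (sqrt 2 * (d / sqrt 2))%R with d in Hy; [exact Hy |].
    field. apply Rgt_not_eq, sqrt_lt_R0. lra.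
Qed.

Lemma is_derive_cderiv (f : C -> C) (z l : C) :
  @is_derive C_AbsRing C_NormedModule f z l <-> cderiv f z l.
Proof.
  split.
  - intros [_ H]. apply deriv_intro; [unfold cid; auto |]. intros eps h.
    destruct (H z (fun P HP => HP) (mkposreal eps h)) as [d Hd].
    exists d. split; [apply cond_pos |]. intros y Hy. exact (Hd y Hy).
  - intros H. split; [apply is_linear_scal_l |]. intros x Hx eps.
    assert (E : z = x).
    { exact (is_filter_lim_locally_unique (K := C_AbsRing) (V := AbsRing_NormedModule C_AbsRing) z x Hx). }
    subst x. destruct (deriv_elim _ _ _ _ eps H (cond_pos eps)) as (d & hd & Hd).
    exists (mkposreal d hd). intros y Hy. exact (Hd y Hy).
Qed.

(** * Curves in the complex plane *)

Lemma near_R (t : R) (P : R -> Prop) : near RtoC t P <-> locally t P.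
Proof.
  split.
  - intros (d & hd & H). exists (mkposreal d hd). intros s Hs. apply H.
    rewrite Cmod_RtoC_sub. exact Hs.
  - intros [d H]. exists d. split; [apply cond_pos |]. intros s Hs. apply H.
    rewrite Cmod_RtoC_sub in Hs. exact Hs.
Qed.

Lemma cont_Re {T} (io : T -> C) f x : cont_at io f x -> cont_at io (fun y => RtoC (Re (f y))) x.
Proof.
  intros H eps h. refine (near_imp _ _ _ _ _ (H eps h)). cbv beta. intros y Hy.
  rewrite Cmod_RtoC_sub, <- Re_minus. pose proof (re_le_Cmod (f y - f x)). lra.
Qed.

Lemma cont_Im {T} (io : T -> C) f x : cont_at io f x -> cont_at io (fun y => RtoC (Im (f y))) x.
Proof.
  intros H eps h. refine (near_imp _ _ _ _ _ (H eps h)). cbv beta. intros y Hy.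
  rewrite Cmod_RtoC_sub, <- Im_minus. pose proof (Im_le_Cmod (f y - f x)). lra.
Qed.

Lemma cont_Cmod {T} (io : T -> C) f x : cont_at io f x -> cont_at io (fun y => RtoC (Cmod (f y))) x.
Proof.
  intros H eps h. refine (near_imp _ _ _ _ _ (H eps h)). cbv beta. intros y Hy.
  rewrite Cmod_RtoC_sub. pose proof (Cmod_sub_ge (f y) (f x)). pose proof (Cmod_sub_ge (f x) (f y)).
  rewrite Cmod_sub_comm in H1. apply Rabs_def1; lra.
Qed.

Lemma cont_conj {T} (io : T -> C) f x : cont_at io f x -> cont_at io (fun y => Cconj (f y)) x.
Proof.
  intros H eps h. refine (near_imp _ _ _ _ _ (H eps h)). cbv beta. intros y Hy.
  replace (Cconj (f y) - Cconj (f x)) with (Cconj (f y - f x)); [now rewrite Cmod_conj |].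
  apply C_ext; reim; ring.
Qed.

Lemma rcont_continuous (f : R -> R) t : rcont (fun s => RtoC (f s)) t <-> continuous f t.
Proof.
  split.
  - intros H P [eps HP]. apply (near_R t). refine (near_imp _ _ _ _ _ (H eps (cond_pos eps))).
    cbv beta. intros s Hs. apply HP. rewrite Cmod_RtoC_sub in Hs. exact Hs.
  - intros H eps h. apply (near_R t (fun s => (Cmod (RtoC (f s) - RtoC (f t)) < eps)%R)).
    assert (Hb : locally (f t) (fun y => (Cmod (RtoC y - RtoC (f t)) < eps)%R)).
    { exists (mkposreal eps h). intros y Hy. rewrite Cmod_RtoC_sub. exact Hy. }
    exact (H _ Hb).
Qed.

Lemma rcont_of_R (f : R -> R) t : continuous f t -> rcont (fun s => RtoC (f s)) t.
Proof. apply rcont_continuous. Qed.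

Lemma rcont_Re (f : R -> C) t : rcont f t -> continuous (fun s => Re (f s)) t.
Proof. intros H. apply rcont_continuous. now apply cont_Re. Qed.

Lemma rcont_Im (f : R -> C) t : rcont f t -> continuous (fun s => Im (f s)) t.
Proof. intros H. apply rcont_continuous. now apply cont_Im. Qed.

Lemma rcont_Cmod (f : R -> C) t : rcont f t -> continuous (fun s => Cmod (f s)) t.
Proof. intros H. apply rcont_continuous. now apply cont_Cmod. Qed.

Lemma C_split (z : C) : z = RtoC (Re z) + Ci * RtoC (Im z).
Proof. apply C_ext; reim; ring. Qed.

Lemma RtoC_inj (x y : R) : RtoC x = RtoC y -> x = y.
Proof. intros H. exact (f_equal Re H). Qed.

Lemma rderiv_is_derive (f : R -> R) t l :
  rderiv (fun s => RtoC (f s)) t (RtoC l) <-> is_derive f t l.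
Proof.
  split.
  - intros H. split; [apply is_linear_scal_l |]. intros x Hx eps.
    assert (E : t = x) by exact (is_filter_lim_locally_unique t x Hx). subst x.
    pose proof (deriv_elim _ _ _ _ eps H (cond_pos eps)) as H'. apply near_R in H'.
    refine (filter_imp _ _ _ H'). intros s Hs.
    rewrite <- !RtoC_minus, <- RtoC_mult, <- RtoC_minus, !Cmod_R in Hs. exact Hs.
  - intros [_ H]. apply deriv_intro; [intros; now apply RtoC_inj |]. intros eps h.
    apply near_R. refine (filter_imp _ _ _ (H t (fun P HP => HP) (mkposreal eps h))).
    intros s Hs. rewrite <- !RtoC_minus, <- RtoC_mult, <- RtoC_minus, !Cmod_R. exact Hs.
Qed.

Lemma rderiv_of_R (f : R -> R) t l : is_derive f t l -> rderiv (fun s => RtoC (f s)) t (RtoC l).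
Proof. apply rderiv_is_derive. Qed.

Lemma rderiv_Re (f : R -> C) t l : rderiv f t l -> is_derive (fun s => Re (f s)) t (Re l).
Proof.
  intros H. apply rderiv_is_derive, deriv_intro; [intros; now apply RtoC_inj |]. intros eps h.
  refine (near_imp _ _ _ _ _ (deriv_elim _ _ _ _ eps H h)). cbv beta. intros s Hs.
  replace (RtoC (Re (f s)) - RtoC (Re (f t)) - (RtoC s - RtoC t) * RtoC (Re l))
    with (RtoC (Re (f s - f t - (RtoC s - RtoC t) * l))) by (apply C_ext; reim; ring).
  rewrite Cmod_R. eapply Rle_trans; [apply re_le_Cmod | exact Hs].
Qed.

Lemma rderiv_Im (f : R -> C) t l : rderiv f t l -> is_derive (fun s => Im (f s)) t (Im l).
Proof.
  intros H. apply rderiv_is_derive, deriv_intro; [intros; now apply RtoC_inj |]. intros eps h.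
  refine (near_imp _ _ _ _ _ (deriv_elim _ _ _ _ eps H h)). cbv beta. intros s Hs.
  replace (RtoC (Im (f s)) - RtoC (Im (f t)) - (RtoC s - RtoC t) * RtoC (Im l))
    with (RtoC (Im (f s - f t - (RtoC s - RtoC t) * l))) by (apply C_ext; reim; ring).
  rewrite Cmod_R. eapply Rle_trans; [apply Im_le_Cmod | exact Hs].
Qed.

Lemma rderiv_pair (f : R -> C) t l :
  is_derive (fun s => Re (f s)) t (Re l) -> is_derive (fun s => Im (f s)) t (Im l) -> rderiv f t l.
Proof.
  intros H1 H2. apply (deriv_ext RtoC (fun s => RtoC (Re (f s)) + Ci * RtoC (Im (f s)))).
  - apply near_all. intros s. symmetry. apply C_split.
  - rewrite (C_split l). apply deriv_plus; [now apply rderiv_of_R |].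
    apply deriv_scal. now apply rderiv_of_R.
Qed.

(** * The mean value inequality and uniqueness for linear systems *)

(** Reduces to the real mean value theorem for [Re (e * f t)], where the unit [e] rotates the
    increment [D] onto the positive axis. *)
Lemma mean_value (f df : R -> C) (a b M : R) :
  (a <= b)%R ->
  (forall t, (a <= t <= b)%R -> rderiv f t (df t) /\ (Cmod (df t) <= M)%R) ->
  (Cmod (f b - f a) <= M * (b - a))%R.
Proof.
  intros hab H. set (D := f b - f a).
  destruct (Req_dec (Cmod D) 0) as [E | NE].
  { rewrite E. assert (0 <= M)%R by (destruct (H a); [lra |]; pose proof (Cmod_ge_0 (df a)); lra). nra. }
  assert (hD : (0 < Cmod D)%R) by (pose proof (Cmod_ge_0 D); lra).
  set (e := Cconj D / RtoC (Cmod D)).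
  assert (he : Cmod e = 1%R).
  { unfold e. rewrite Cmod_div, Cmod_conj, Cmod_R, Rabs_pos_eq; [field; lra | lra |].
    intros E. apply RtoC_inj in E. lra. }
  destruct (MVT_gen (fun t => Re (e * f t)) a b (fun t => Re (e * df t))) as (c & hc & Hc).
  - rewrite Rmin_left, Rmax_right by lra. intros t ht.
    apply (rderiv_Re (fun t => e * f t)), deriv_scal. apply H. lra.
  - rewrite Rmin_left, Rmax_right by lra. intros t ht. apply continuity_pt_filterlim.
    apply (rcont_Re (fun t => e * f t)), cont_mult; [apply cont_const |].
    eapply deriv_cont. apply H. lra.
  - rewrite Rmin_left, Rmax_right in hc by lra. rewrite <- Re_minus in Hc.
    replace (e * f b - e * f a) with (RtoC (Cmod D)) in Hc.
    + rewrite Re_RtoC in Hc. rewrite Hc. apply Rmult_le_compat_r; [lra |].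
      eapply Rle_trans; [apply Rle_abs |]. eapply Rle_trans; [apply re_le_Cmod |].
      rewrite Cmod_mult, he, Rmult_1_l. apply H. lra.
    + replace (e * f b - e * f a) with (e * D) by (unfold D; ring). unfold e.
      replace (Cconj D / RtoC (Cmod D) * D) with ((D * Cconj D) / RtoC (Cmod D)).
      * rewrite <- Cmod2_conj. rewrite <- RtoC_div by lra. f_equal. field. lra.
      * field. intros E. apply RtoC_inj in E. lra.
Qed.

Definition segm (c z : C) (t : R) : C := c + RtoC t * (z - c).

Lemma segm_0 c z : segm c z 0 = c. Proof. unfold segm. ring. Qed.
Lemma segm_1 c z : segm c z 1 = z. Proof. unfold segm. ring. Qed.

Lemma segm_rderiv c z t : rderiv (segm c z) t (z - c).
Proof.
  unfold segm. eapply deriv_eq; [apply deriv_plus; [apply deriv_const |] |].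
  - apply (deriv_mult RtoC RtoC (fun _ => z - c)); [apply deriv_io | apply deriv_const].
  - cbv beta. ring.
Qed.

Lemma segm_rcont c z t : rcont (segm c z) t.
Proof. eapply deriv_cont, segm_rderiv. Qed.

Lemma segm_comp_rderiv (f : C -> C) (c z l : C) (t : R) :
  cderiv f (segm c z t) l -> rderiv (fun s => f (segm c z s)) t (l * (z - c)).
Proof. intros H. apply deriv_comp; [exact H | apply segm_rderiv]. Qed.

Lemma mean_value_segm (f df : C -> C) (c z : C) (M : R) :
  (forall t, (0 <= t <= 1)%R -> cderiv f (segm c z t) (df (segm c z t)) /\ (Cmod (df (segm c z t)) <= M)%R) ->
  (Cmod (f z - f c) <= M * Cmod (z - c))%R.
Proof.
  intros H.
  pose proof (mean_value (fun s => f (segm c z s)) (fun s => df (segm c z s) * (z - c)) 0 1 (M * Cmod (z - c)) Rle_0_1) as Hm.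
  cbv beta in Hm. rewrite segm_0, segm_1 in Hm. rewrite Rminus_0_r, Rmult_1_r in Hm. apply Hm.
  intros t ht. destruct (H t ht) as [H1 H2]. split; [now apply segm_comp_rderiv |].
  rewrite Cmod_mult. apply Rmult_le_compat_r; [apply Cmod_ge_0 | exact H2].
Qed.

Lemma rcont_bounded (f : R -> C) (a b : R) :
  (a <= b)%R -> (forall t, (a <= t <= b)%R -> rcont f t) ->
  exists M, (0 < M)%R /\ forall t, (a <= t <= b)%R -> (Cmod (f t) <= M)%R.
Proof.
  intros hab H. destruct (continuity_ab_maj (fun t => Cmod (f t)) a b hab) as (m & Hm & _).
  - intros t ht. apply continuity_pt_filterlim. now apply rcont_Cmod, H.
  - exists (Cmod (f m) + 1)%R. split; [pose proof (Cmod_ge_0 (f m)); lra |].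
    intros t ht. specialize (Hm t ht). lra.
Qed.

Lemma rcont_Re_lower (f : R -> C) (a b : R) :
  (a <= b)%R -> (forall t, (a <= t <= b)%R -> rcont f t /\ (0 < Re (f t))%R) ->
  exists m, (0 < m)%R /\ forall t, (a <= t <= b)%R -> (m <= Re (f t))%R.
Proof.
  intros hab H. destruct (continuity_ab_min (fun t => Re (f t)) a b hab) as (m & Hm & h).
  - intros t ht. apply continuity_pt_filterlim. now apply rcont_Re, H.
  - exists (Re (f m)). split; [now apply H | exact Hm].
Qed.

(** [N t * exp (- M t)] is nonincreasing, nonnegative, and [0] at the left end. *)
Lemma gronwall_zero (N N' : R -> R) (M : R) :
  (forall t, (0 <= t <= 1)%R -> is_derive N t (N' t) /\ (0 <= N t)%R /\ (N' t <= M * N t)%R) ->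
  N 0%R = 0%R -> N 1%R = 0%R.
Proof.
  intros H H0.
  destruct (MVT_gen (fun t => N t * exp (- (M * t)))%R 0 1
    (fun t => (N' t - M * N t) * exp (- (M * t)))%R) as (c & hc & Hc).
  - rewrite Rmin_left, Rmax_right by lra. intros t ht.
    destruct (H t ltac:(lra)) as (Hd & _ & _).
    evar_last; [apply (is_derive_mult N (fun t => exp (- (M * t))) t (N' t) (- M * exp (- (M * t))))%R |].
    + exact Hd.
    + auto_derive; [trivial | ring].
    + intros; apply Rmult_comm.
    + unfold plus, mult; simpl. ring.
  - rewrite Rmin_left, Rmax_right by lra. intros t ht.
    destruct (H t ltac:(lra)) as (Hd & _ & _). apply continuity_pt_filterlim.
    apply (continuous_mult N (fun t => exp (- (M * t)))%R).
    + apply (ex_derive_continuous N). eexists; exact Hd.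
    + apply (ex_derive_continuous (fun t => exp (- (M * t)))%R). auto_derive. trivial.
  - rewrite Rmin_left, Rmax_right in hc by lra.
    destruct (H c hc) as (_ & _ & h3). destruct (H 1%R ltac:(lra)) as (_ & h1 & _).
    rewrite H0 in Hc. pose proof (exp_pos (- (M * c))). pose proof (exp_pos (- (M * 1))). nra.
Qed.

(* The energy [|u|^2 + |v|^2] satisfies Gronwall's inequality along the segment. *)
Lemma ode_unique_segm (u v r : C -> C) (c z : C) :
  (forall t, (0 <= t <= 1)%R ->
     let w := segm c z t in
     ccont r w /\ cderiv u w (r w * v w) /\ cderiv v w (u w / 4)) ->
  u c = 0 -> v c = 0 -> u z = 0 /\ v z = 0.
Proof.
  intros H Hu Hv.
  destruct (rcont_bounded (fun t => r (segm c z t)) 0 1 Rle_0_1) as (M & hM & HM).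
  { intros t ht. apply cont_comp; [apply H; exact ht | apply segm_rcont]. }
  set (A := fun t => u (segm c z t)). set (B := fun t => v (segm c z t)).
  set (A' := fun t => r (segm c z t) * v (segm c z t) * (z - c)).
  set (B' := fun t => u (segm c z t) / 4 * (z - c)).
  assert (HA : forall t, (0 <= t <= 1)%R -> rderiv A t (A' t)).
  { intros t ht. apply segm_comp_rderiv. apply H. exact ht. }
  assert (HB : forall t, (0 <= t <= 1)%R -> rderiv B t (B' t)).
  { intros t ht. apply segm_comp_rderiv. apply H. exact ht. }
  set (l := Cmod (z - c)).
  pose proof (gronwall_zero
    (fun t => Re (A t) * Re (A t) + Im (A t) * Im (A t) + (Re (B t) * Re (B t) + Im (B t) * Im (B t)))%R
    (fun t => 2 * (Re (A t) * Re (A' t) + Im (A t) * Im (A' t)) + 2 * (Re (B t) * Re (B' t) + Im (B t) * Im (B' t)))%R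
    (2 * (2 * (M * l) + 2 * l))%R) as G.
  cbv beta in G.
  assert (E : (Cmod (A 1) * Cmod (A 1) + Cmod (B 1) * Cmod (B 1) = 0)%R).
  { rewrite !Cmod_sqr. apply G.
    - intros t ht. split; [| split].
      + pose proof (HA t ht) as h1. pose proof (HB t ht) as h2.
        pose proof (rderiv_Re _ _ _ h1) as a1. pose proof (rderiv_Im _ _ _ h1) as a2.
        pose proof (rderiv_Re _ _ _ h2) as b1. pose proof (rderiv_Im _ _ _ h2) as b2.
        evar_last.
        * apply (is_derive_plus (V := R_NormedModule)); apply (is_derive_plus (V := R_NormedModule)).
          -- apply (is_derive_mult (fun t => Re (A t)) (fun t => Re (A t))); [exact a1 | exact a1 | intros; apply Rmult_comm].
          -- apply (is_derive_mult (fun t => Im (A t)) (fun t => Im (A t))); [exact a2 | exact a2 | intros; apply Rmult_comm].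
          -- apply (is_derive_mult (fun t => Re (B t)) (fun t => Re (B t))); [exact b1 | exact b1 | intros; apply Rmult_comm].
          -- apply (is_derive_mult (fun t => Im (B t)) (fun t => Im (B t))); [exact b2 | exact b2 | intros; apply Rmult_comm].
        * unfold plus, mult; simpl. ring.
      + nra.
      (* Cauchy-Schwarz in the plane; it bounds the derivative of the energy by
         [2 (M l + l) |A| |B|]. *)
      + assert (dot : forall x y : C, (Re x * Re y + Im x * Im y <= Cmod x * Cmod y)%R).
        { intros x y. replace (Re x * Re y + Im x * Im y)%R with (Re (Cconj x * y)) by (reim; ring).
          eapply Rle_trans; [apply Rle_abs |]. eapply Rle_trans; [apply re_le_Cmod |].
          rewrite Cmod_mult, Cmod_conj. lra. }
        pose proof (dot (A t) (A' t)) as d1. pose proof (dot (B t) (B' t)) as d2.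
        pose proof (Cmod_sqr (A t)) as s1. pose proof (Cmod_sqr (B t)) as s2.
        assert (e1 : (Cmod (A' t) <= M * l * Cmod (B t))%R).
        { unfold A'. rewrite !Cmod_mult. fold l. specialize (HM t ht). cbv beta in HM. fold (B t).
          pose proof (Cmod_ge_0 (B t)). assert (0 <= l)%R by apply Cmod_ge_0.
          replace (M * l * Cmod (B t))%R with (M * (Cmod (B t) * l))%R by ring.
          replace (Cmod (r (segm c z t)) * Cmod (B t) * l)%R with (Cmod (r (segm c z t)) * (Cmod (B t) * l))%R by ring.
          apply Rmult_le_compat_r; [nra | exact HM]. }
        assert (e2 : (Cmod (B' t) <= l * Cmod (A t))%R).
        { unfold B'. unfold Cdiv. rewrite !Cmod_mult. fold l. fold (A t). rewrite Cmod_inv.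
          2: intros E; apply RtoC_inj in E; lra.
          rewrite Cmod_R, Rabs_pos_eq by lra.
          pose proof (Cmod_ge_0 (A t)). assert (0 <= l)%R by apply Cmod_ge_0. nra. }
        pose proof (Cmod_ge_0 (A t)) as p1. pose proof (Cmod_ge_0 (B t)) as p2.
        assert (p3 : (0 <= l)%R) by apply Cmod_ge_0.
        set (a := Cmod (A t)) in *. set (b := Cmod (B t)) in *.
        rewrite <- s1, <- s2.
        assert (q1 : (a * Cmod (A' t) <= a * (M * l * b))%R) by (apply Rmult_le_compat_l; assumption).
        assert (q2 : (b * Cmod (B' t) <= b * (l * a))%R) by (apply Rmult_le_compat_l; assumption).
        assert (q3 : (0 <= M * l)%R) by nra.
        assert (q4 : (2 * (a * b) <= a * a + b * b)%R) by (pose proof (pow2_ge_0 (a - b)); nra).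
        assert (q5 : (2 * (M * l * (a * b)) <= M * l * (a * a + b * b))%R) by nra.
        assert (q6 : (2 * (l * (a * b)) <= l * (a * a + b * b))%R) by nra.
        nra.
    - unfold A, B. rewrite segm_0, Hu, Hv. simpl. ring. }
  unfold A, B in E. rewrite segm_1 in E.
  pose proof (Cmod_ge_0 (u z)). pose proof (Cmod_ge_0 (v z)).
  split; apply Cmod_eq_0; nra.
Qed.

(** * Integrals of complex-valued functions of a real variable *)

Definition cint (f : R -> C) (a b : R) : C :=
  (RInt (fun t => Re (f t)) a b, RInt (fun t => Im (f t)) a b).

Definition rcont_on (a b : R) (f : R -> C) : Prop := forall t, (a <= t <= b)%R -> rcont f t.

Lemma ex_RInt_cont_on (f : R -> R) (a b : R) :
  (a <= b)%R -> (forall t, (a <= t <= b)%R -> continuous f t) -> ex_RInt f a b.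
Proof.
  intros hab H. apply (ex_RInt_continuous (V := R_CompleteNormedModule)).
  rewrite Rmin_left, Rmax_right by lra. exact H.
Qed.

Lemma cint_ex_Re f a b : (a <= b)%R -> rcont_on a b f -> ex_RInt (fun t => Re (f t)) a b.
Proof. intros hab H. apply ex_RInt_cont_on; [exact hab |]. intros; now apply rcont_Re, H. Qed.

Lemma cint_ex_Im f a b : (a <= b)%R -> rcont_on a b f -> ex_RInt (fun t => Im (f t)) a b.
Proof. intros hab H. apply ex_RInt_cont_on; [exact hab |]. intros; now apply rcont_Im, H. Qed.

Lemma cint_ext f g a b :
  (a <= b)%R -> (forall t, (a <= t <= b)%R -> f t = g t) -> cint f a b = cint g a b.
Proof.
  intros hab H. unfold cint. f_equal; apply RInt_ext; rewrite Rmin_left, Rmax_right by lra;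
    intros; rewrite H by lra; reflexivity.
Qed.

Lemma cint_plus f g a b :
  (a <= b)%R -> rcont_on a b f -> rcont_on a b g ->
  cint (fun t => f t + g t) a b = cint f a b + cint g a b.
Proof.
  intros hab Hf Hg. apply C_ext; reim; simpl.
  - apply (RInt_plus (V := R_CompleteNormedModule)); now apply cint_ex_Re.
  - apply (RInt_plus (V := R_CompleteNormedModule)); now apply cint_ex_Im.
Qed.

Lemma cint_scal (c : C) f a b :
  (a <= b)%R -> rcont_on a b f -> cint (fun t => c * f t) a b = c * cint f a b.
Proof.
  intros hab Hf. pose proof (cint_ex_Re f a b hab Hf) as h1. pose proof (cint_ex_Im f a b hab Hf) as h2.
  assert (hs : forall (k : R) (g : R -> R), ex_RInt g a b -> ex_RInt (fun t => k * g t)%R a b).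
  { intros k g hg. exact (ex_RInt_scal (V := R_NormedModule) g a b k hg). }
  assert (hi : forall (k : R) (g : R -> R), ex_RInt g a b -> RInt (fun t => k * g t)%R a b = (k * RInt g a b)%R).
  { intros k g hg. exact (RInt_scal (V := R_CompleteNormedModule) g a b k hg). }
  apply C_ext; simpl; rewrite <- !hi by assumption.
  - apply (RInt_minus (V := R_CompleteNormedModule) (fun t => Re c * Re (f t))%R (fun t => Im c * Im (f t))%R);
      now apply hs.
  - apply (RInt_plus (V := R_CompleteNormedModule) (fun t => Re c * Im (f t))%R (fun t => Im c * Re (f t))%R);
      now apply hs.
Qed.

Lemma cint_opp f a b : (a <= b)%R -> rcont_on a b f -> cint (fun t => - f t) a b = - cint f a b.
Proof.
  intros hab Hf. rewrite (cint_ext _ (fun t => - (1) * f t)) by (auto; intros; ring).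
  rewrite cint_scal by assumption. ring.
Qed.

Lemma cint_minus f g a b :
  (a <= b)%R -> rcont_on a b f -> rcont_on a b g ->
  cint (fun t => f t - g t) a b = cint f a b - cint g a b.
Proof.
  intros hab Hf Hg. unfold Cminus. rewrite cint_plus by (auto; intros t ht; apply cont_opp, Hg, ht).
  now rewrite cint_opp.
Qed.

Lemma cint_chasles f a b c :
  (a <= b)%R -> (b <= c)%R -> rcont_on a c f -> cint f a c = cint f a b + cint f b c.
Proof.
  intros h1 h2 Hf.
  assert (F1 : rcont_on a b f) by (intros t ht; apply Hf; lra).
  assert (F2 : rcont_on b c f) by (intros t ht; apply Hf; lra).
  apply C_ext; reim; simpl; symmetry.
  - apply (RInt_Chasles (V := R_CompleteNormedModule) (fun t => Re (f t))); apply cint_ex_Re; assumption.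
  - apply (RInt_Chasles (V := R_CompleteNormedModule) (fun t => Im (f t))); apply cint_ex_Im; assumption.
Qed.

Lemma cint_FTC (F f : R -> C) a b :
  (a <= b)%R -> (forall t, (a <= t <= b)%R -> rderiv F t (f t)) -> rcont_on a b f ->
  cint f a b = F b - F a.
Proof.
  intros hab H Hc. apply C_ext; reim; simpl; apply is_RInt_unique.
  - apply (is_RInt_derive (fun t => Re (F t)) (fun t => Re (f t))); rewrite Rmin_left, Rmax_right by lra.
    + intros; now apply rderiv_Re, H.
    + intros; now apply rcont_Re, Hc.
  - apply (is_RInt_derive (fun t => Im (F t)) (fun t => Im (f t))); rewrite Rmin_left, Rmax_right by lra.
    + intros; now apply rderiv_Im, H.
    + intros; now apply rcont_Im, Hc.
Qed.

(** The same rotation as for [mean_value]: the modulus of the integral is the integral of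
    [Re (e * f t)] for a suitable unit [e]. *)
Lemma cint_norm f a b M :
  (a <= b)%R -> rcont_on a b f -> (forall t, (a <= t <= b)%R -> (Cmod (f t) <= M)%R) ->
  (Cmod (cint f a b) <= M * (b - a))%R.
Proof.
  intros hab Hf HM. set (D := cint f a b).
  destruct (Req_dec (Cmod D) 0) as [E | NE].
  { rewrite E. specialize (HM a ltac:(lra)). pose proof (Cmod_ge_0 (f a)). nra. }
  assert (hD : (0 < Cmod D)%R) by (pose proof (Cmod_ge_0 D); lra).
  assert (hD' : RtoC (Cmod D) <> 0) by (intros E; apply RtoC_inj in E; lra).
  set (e := Cconj D / RtoC (Cmod D)).
  assert (he : Cmod e = 1%R).
  { unfold e. rewrite Cmod_div, Cmod_conj, Cmod_R, Rabs_pos_eq; [field; lra | lra | exact hD']. }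
  assert (E : e * D = RtoC (Cmod D)).
  { unfold e. replace (Cconj D / RtoC (Cmod D) * D) with ((D * Cconj D) / RtoC (Cmod D)) by now field.
    rewrite <- Cmod2_conj. rewrite <- RtoC_div by lra. f_equal. field. lra. }
  assert (He : rcont_on a b (fun t => e * f t)).
  { intros t ht. apply cont_mult; [apply cont_const | now apply Hf]. }
  unfold D in E at 1. rewrite <- cint_scal in E by assumption.
  replace (Cmod D) with (RInt (fun t => Re (e * f t)) a b) by exact (f_equal Re E).
  eapply Rle_trans.
  - apply (RInt_le _ (fun _ => M) a b hab); [now apply (cint_ex_Re (fun t => e * f t)) | apply ex_RInt_const |].
    intros t ht. eapply Rle_trans; [apply Rle_abs |]. eapply Rle_trans; [apply re_le_Cmod |].
    rewrite Cmod_mult, he, Rmult_1_l. apply HM. lra.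
  - rewrite RInt_const. simpl. unfold scal; simpl. unfold mult; simpl. lra.
Qed.

Lemma cint_const (c : C) a b : cint (fun _ => c) a b = RtoC (b - a) * c.
Proof. unfold cint. rewrite !RInt_const. apply C_ext; reim; simpl; unfold scal; simpl; unfold mult; simpl; ring. Qed.

Lemma cint_RtoC (f : R -> R) a b : cint (fun t => RtoC (f t)) a b = RtoC (RInt f a b).
Proof.
  apply C_ext; simpl; [reflexivity |]. rewrite RInt_const. unfold scal; simpl. unfold mult; simpl. ring.
Qed.

(** * The exponential *)

Definition Cexp (z : C) : C := ((exp (Re z) * cos (Im z))%R, (exp (Re z) * sin (Im z))%R).

Lemma Cexp_plus z w : Cexp (z + w) = Cexp z * Cexp w.
Proof.
  unfold Cexp. apply C_ext; reim; simpl; rewrite exp_plus, ?cos_plus, ?sin_plus; ring.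
Qed.

Lemma Cexp_0 : Cexp 0 = 1.
Proof. unfold Cexp. apply C_ext; simpl; rewrite exp_0, ?cos_0, ?sin_0; ring. Qed.

Lemma Cmod_Cexp z : Cmod (Cexp z) = exp (Re z).
Proof.
  pose proof (Cmod_sqr (Cexp z)) as H. unfold Cexp in H at 3 4 5 6. simpl in H.
  pose proof (sin2_cos2 (Im z)) as h. unfold Rsqr in h. pose proof (exp_pos (Re z)).
  pose proof (Cmod_ge_0 (Cexp z)).
  assert (Cmod (Cexp z) * Cmod (Cexp z) = exp (Re z) * exp (Re z))%R by (rewrite H; nra). nra.
Qed.

Lemma Cexp_deriv_0 : cderiv Cexp 0 1.
Proof.
  apply deriv_intro; [unfold cid; auto |]. intros eps h.
  set (e := Rmin (eps / 9) 1). assert (he : (0 < e)%R) by (apply Rmin_glb_lt; lra).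
  pose proof (Rmin_l (eps / 9) 1) as he1. pose proof (Rmin_r (eps / 9) 1) as he2. fold e in he1, he2.
  assert (D1 : rderiv (fun t => RtoC (exp t)) 0 (RtoC 1)) by (apply rderiv_of_R; auto_derive; [trivial | rewrite exp_0; ring]).
  assert (D2 : rderiv (fun t => RtoC (cos t)) 0 (RtoC 0)) by (apply rderiv_of_R; auto_derive; [trivial | rewrite sin_0; ring]).
  assert (D3 : rderiv (fun t => RtoC (sin t)) 0 (RtoC 1)) by (apply rderiv_of_R; auto_derive; [trivial | rewrite cos_0; ring]).
  pose proof (deriv_elim _ _ _ _ e D1 he) as N1. pose proof (deriv_elim _ _ _ _ e D2 he) as N2.
  pose proof (deriv_elim _ _ _ _ e D3 he) as N3.
  destruct (near_and _ _ _ _ N1 (near_and _ _ _ _ N2 N3)) as (d & hd & H). clear N1 N2 N3.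
  exists (Rmin d e). split; [now apply Rmin_glb_lt |]. unfold cid. intros y Hy.
  pose proof (Rmin_l d e). pose proof (Rmin_r d e).
  replace (y - 0) with y in * by ring.
  pose proof (re_le_Cmod y) as ha. pose proof (Im_le_Cmod y) as hb.
  set (a := Re y) in *. set (b := Im y) in *. set (m := Cmod y) in *.
  assert (Ha : (Rabs (exp a - 1 - a) <= e * Rabs a)%R).
  { destruct (H a) as (h1 & _); [rewrite Cmod_RtoC_sub, Rminus_0_r; lra |].
    rewrite <- !RtoC_minus, <- RtoC_mult, <- RtoC_minus, !Cmod_R, exp_0, Rminus_0_r, Rmult_1_r in h1. exact h1. }
  assert (Hb : (Rabs (cos b - 1) <= e * Rabs b)%R /\ (Rabs (sin b - b) <= e * Rabs b)%R).
  { destruct (H b) as (_ & h1 & h2); [rewrite Cmod_RtoC_sub, Rminus_0_r; lra |].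
    rewrite <- !RtoC_minus, <- RtoC_mult, <- RtoC_minus, !Cmod_R, cos_0, Rminus_0_r, Rmult_0_r, Rminus_0_r in h1.
    rewrite <- !RtoC_minus, <- RtoC_mult, <- RtoC_minus, !Cmod_R, sin_0, !Rminus_0_r, Rmult_1_r in h2. auto. }
  destruct Hb as [Hb Hc]. rewrite Cexp_0.
  eapply Rle_trans; [apply Cmod_le_Re_Im |].
  replace (Re (Cexp y - 1 - y * 1)) with ((exp a - 1 - a) + exp a * (cos b - 1))%R
    by (unfold Cexp; reim; simpl; fold a b; ring).
  replace (Im (Cexp y - 1 - y * 1)) with ((exp a - 1) * sin b + (sin b - b))%R
    by (unfold Cexp; reim; simpl; fold a b; ring).
  assert (k1 : (Rabs (exp a - 1) <= 2 * Rabs a)%R).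
  { replace (exp a - 1)%R with ((exp a - 1 - a) + a)%R by ring.
    eapply Rle_trans; [apply Rabs_triang |]. pose proof (Rabs_pos a). nra. }
  assert (k2 : (Rabs (exp a) <= 3)%R).
  { replace (exp a) with ((exp a - 1) + 1)%R by ring. eapply Rle_trans; [apply Rabs_triang |].
    rewrite Rabs_R1. lra. }
  assert (k3 : (Rabs (sin b) <= 2 * Rabs b)%R).
  { replace (sin b) with ((sin b - b) + b)%R by ring. eapply Rle_trans; [apply Rabs_triang |].
    pose proof (Rabs_pos b). nra. }
  pose proof (Rabs_triang (exp a - 1 - a) (exp a * (cos b - 1))) as t1.
  pose proof (Rabs_triang ((exp a - 1) * sin b) (sin b - b)) as t2.
  rewrite Rabs_mult in t1, t2.
  assert (k4 : (Rabs (exp a) * Rabs (cos b - 1) <= 3 * (e * Rabs b))%R) by (apply Rmult_le_compat; auto using Rabs_pos).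
  assert (k5 : (Rabs (exp a - 1) * Rabs (sin b) <= 2 * Rabs a * (2 * Rabs b))%R) by (apply Rmult_le_compat; auto using Rabs_pos).
  assert (k6 : (0 <= m)%R) by apply Cmod_ge_0.
  assert (k7 : (e * Rabs a <= e * m)%R) by nra. assert (k8 : (e * Rabs b <= e * m)%R) by nra.
  assert (k9 : (Rabs a * Rabs b <= e * m)%R) by (apply Rmult_le_compat; auto using Rabs_pos; lra).
  (* the four error terms add up to at most [9 e m] *)
  assert (k10 : (9 * (e * m) <= eps * m)%R) by nra.
  assert (k11 : (Rabs (exp a - 1 - a + exp a * (cos b - 1)) <= 4 * (e * m))%R) by lra.
  assert (k12 : (Rabs ((exp a - 1) * sin b + (sin b - b)) <= 5 * (e * m))%R) by lra.
  lra.
Qed.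

Lemma Cexp_deriv z : cderiv Cexp z (Cexp z).
Proof.
  apply (deriv_ext cid (fun w => Cexp z * Cexp (w - z))).
  - apply near_all. intros w. rewrite <- Cexp_plus. f_equal. ring.
  - eapply deriv_eq; [apply deriv_scal, (deriv_comp cid Cexp (fun w => w - z)) |].
    + replace (z - z) with (RtoC 0) by ring. apply Cexp_deriv_0.
    + apply deriv_minus; [apply deriv_id | apply deriv_const].
    + ring.
Qed.

(** * Goursat's theorem *)

Definition hline (y t : R) : C := (t, y).
Definition vline (x t : R) : C := (x, t).

Lemma hline_rderiv y t : rderiv (hline y) t 1.
Proof.
  apply rderiv_pair; simpl; [apply (is_derive_id (K := R_AbsRing)) | apply (is_derive_const (V := R_NormedModule))].
Qed.

Lemma vline_rderiv x t : rderiv (vline x) t Ci.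
Proof.
  apply rderiv_pair; simpl; [apply (is_derive_const (V := R_NormedModule)) | apply (is_derive_id (K := R_AbsRing))].
Qed.

(** Lower left corner [(a, c)], width [w], height [h]: under bisection the two side lengths are
    simply halved. *)
Definition in_rect (a c w h : R) (z : C) : Prop := (a <= Re z <= a + w)%R /\ (c <= Im z <= c + h)%R.

(** The contour integral over the boundary, anticlockwise; the factor [Ci] is the derivative of
    [vline]. *)
Definition rect_int (f : C -> C) (a c w h : R) : C :=
  cint (fun t => f (hline c t)) a (a + w) + Ci * cint (fun t => f (vline (a + w) t)) c (c + h)
  - cint (fun t => f (hline (c + h) t)) a (a + w) - Ci * cint (fun t => f (vline a t)) c (c + h).

Lemma hline_rcont_on f a c w h y :
  (c <= y <= c + h)%R -> (forall z, in_rect a c w h z -> ccont f z) ->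
  rcont_on a (a + w) (fun t => f (hline y t)).
Proof.
  intros hy H t ht. apply cont_comp; [apply H; split; assumption |].
  eapply deriv_cont, hline_rderiv.
Qed.

Lemma vline_rcont_on f a c w h x :
  (a <= x <= a + w)%R -> (forall z, in_rect a c w h z -> ccont f z) ->
  rcont_on c (c + h) (fun t => f (vline x t)).
Proof.
  intros hx H t ht. apply cont_comp; [apply H; split; assumption |].
  eapply deriv_cont, vline_rderiv.
Qed.

(** Each side contributes the difference of [F] at its ends, and these cancel around the
    boundary. *)
Lemma rect_int_primitive (F f : C -> C) a c w h :
  (0 <= w)%R -> (0 <= h)%R ->
  (forall z, in_rect a c w h z -> cderiv F z (f z) /\ ccont f z) -> rect_int f a c w h = 0.
Proof.
  intros hw hh H.
  assert (Hc : forall z, in_rect a c w h z -> ccont f z) by (intros; now apply H).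
  assert (Hh : forall y, (c <= y <= c + h)%R ->
     cint (fun t => f (hline y t)) a (a + w) = F (a + w, y)%R - F (a, y)).
  { intros y hy. apply (cint_FTC (fun t => F (hline y t))); [lra | | now apply (hline_rcont_on f a c w h)].
    intros t ht. eapply deriv_eq; [apply deriv_comp; [apply H; split; assumption | apply hline_rderiv] |]. ring. }
  assert (Hv : forall x, (a <= x <= a + w)%R ->
     Ci * cint (fun t => f (vline x t)) c (c + h) = F (x, c + h)%R - F (x, c)).
  { intros x hx. rewrite <- cint_scal by (try lra; now apply (vline_rcont_on f a c w h)).
    apply (cint_FTC (fun t => F (vline x t))); [lra | |].
    - intros t ht. eapply deriv_eq; [apply deriv_comp; [apply H; split; assumption | apply vline_rderiv] |]. ring.
    - intros t ht. apply cont_mult; [apply cont_const |]. now apply (vline_rcont_on f a c w h x hx Hc). }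
  unfold rect_int. rewrite !Hh, !Hv by lra. ring.
Qed.

Lemma rect_int_norm f a c w h M :
  (0 <= w)%R -> (0 <= h)%R ->
  (forall z, in_rect a c w h z -> ccont f z /\ (Cmod (f z) <= M)%R) ->
  (Cmod (rect_int f a c w h) <= 2 * M * (w + h))%R.
Proof.
  intros hw hh H.
  assert (Hc : forall z, in_rect a c w h z -> ccont f z) by (intros; now apply H).
  assert (Hh : forall y, (c <= y <= c + h)%R -> (Cmod (cint (fun t => f (hline y t)) a (a + w)) <= M * w)%R).
  { intros y hy. replace w with (a + w - a)%R at 2 by ring.
    apply cint_norm; [lra | now apply (hline_rcont_on f a c w h) |]. intros t ht. apply H. now split. }
  assert (Hv : forall x, (a <= x <= a + w)%R -> (Cmod (Ci * cint (fun t => f (vline x t)) c (c + h)) <= M * h)%R).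
  { intros x hx. rewrite Cmod_mult, Cmod_Ci, Rmult_1_l. replace h with (c + h - c)%R at 2 by ring.
    apply cint_norm; [lra | now apply (vline_rcont_on f a c w h) |]. intros t ht. apply H. now split. }
  unfold rect_int. eapply Rle_trans; [apply Cmod_sub_le |].
  pose proof (Hh c ltac:(lra)). pose proof (Hh (c + h)%R ltac:(lra)).
  pose proof (Hv a ltac:(lra)). pose proof (Hv (a + w)%R ltac:(lra)).
  match goal with |- (Cmod (?x - ?y) + ?z <= _)%R => pose proof (Cmod_sub_le x y) end.
  match goal with h : (Cmod (?x + ?y - ?z) <= _)%R |- _ => pose proof (Cmod_triangle x y) end.
  lra.
Qed.

Lemma rect_int_plus f g a c w h :
  (0 <= w)%R -> (0 <= h)%R -> (forall z, in_rect a c w h z -> ccont f z) ->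
  (forall z, in_rect a c w h z -> ccont g z) ->
  rect_int (fun z => f z + g z) a c w h = rect_int f a c w h + rect_int g a c w h.
Proof.
  intros hw hh Hf Hg. unfold rect_int. rewrite !cint_plus; try lra;
    try (apply (hline_rcont_on _ a c w h); [lra | assumption]);
    try (apply (vline_rcont_on _ a c w h); [lra | assumption]).
  ring.
Qed.

Lemma rect_int_quarters f a c w h :
  (0 <= w)%R -> (0 <= h)%R -> (forall z, in_rect a c w h z -> ccont f z) ->
  rect_int f a c w h =
    rect_int f a c (w / 2) (h / 2) + rect_int f (a + w / 2) c (w / 2) (h / 2)
    + (rect_int f a (c + h / 2) (w / 2) (h / 2) + rect_int f (a + w / 2) (c + h / 2) (w / 2) (h / 2)).
Proof.
  intros hw hh Hf. unfold rect_int.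
  replace (a + w / 2 + w / 2)%R with (a + w)%R by field.
  replace (c + h / 2 + h / 2)%R with (c + h)%R by field.
  rewrite (cint_chasles (fun t => f (hline c t)) a (a + w / 2) (a + w)); try lra;
    [| apply (hline_rcont_on _ a c w h); [lra | assumption]].
  rewrite (cint_chasles (fun t => f (hline (c + h) t)) a (a + w / 2) (a + w)); try lra;
    [| apply (hline_rcont_on _ a c w h); [lra | assumption]].
  rewrite (cint_chasles (fun t => f (vline a t)) c (c + h / 2) (c + h)); try lra;
    [| apply (vline_rcont_on _ a c w h); [lra | assumption]].
  rewrite (cint_chasles (fun t => f (vline (a + w) t)) c (c + h / 2) (c + h)); try lra;
    [| apply (vline_rcont_on _ a c w h); [lra | assumption]].
  ring.
Qed.

(** Of four numbers with sum [I], one has modulus at least [Cmod I / 4]. *)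
Lemma rect_int_large_quarter f a c w h :
  (0 <= w)%R -> (0 <= h)%R -> (forall z, in_rect a c w h z -> ccont f z) ->
  exists p : R * R, (a <= fst p <= a + w / 2)%R /\ (c <= snd p <= c + h / 2)%R /\
    (Cmod (rect_int f a c w h) <= 4 * Cmod (rect_int f (fst p) (snd p) (w / 2) (h / 2)))%R.
Proof.
  intros hw hh Hf. pose proof (rect_int_quarters f a c w h hw hh Hf) as E.
  set (I1 := rect_int f a c (w / 2) (h / 2)) in *.
  set (I2 := rect_int f (a + w / 2) c (w / 2) (h / 2)) in *.
  set (I3 := rect_int f a (c + h / 2) (w / 2) (h / 2)) in *.
  set (I4 := rect_int f (a + w / 2) (c + h / 2) (w / 2) (h / 2)) in *.
  rewrite E. set (I := I1 + I2 + (I3 + I4)).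
  pose proof (Cmod_triangle (I1 + I2) (I3 + I4)). pose proof (Cmod_triangle I1 I2). pose proof (Cmod_triangle I3 I4).
  destruct (Rle_dec (Cmod I) (4 * Cmod I1)).
  { exists (a, c). simpl. repeat split; try lra. exact r. }
  destruct (Rle_dec (Cmod I) (4 * Cmod I2)).
  { exists (a + w / 2, c)%R. simpl. repeat split; try lra. exact r. }
  destruct (Rle_dec (Cmod I) (4 * Cmod I3)).
  { exists (a, c + h / 2)%R. simpl. repeat split; try lra. exact r. }
  exists (a + w / 2, c + h / 2)%R. simpl. repeat split; try lra. fold I4. unfold I in *. lra.
Qed.

Lemma nested_intervals (a : nat -> R) (w : R) :
  (0 <= w)%R -> (forall n, (a n <= a (S n) <= a n + w / 2 ^ n / 2)%R) ->
  exists x, forall n, (a n <= x <= a n + w / 2 ^ n)%R.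
Proof.
  intros hw H.
  assert (P : forall n, (0 < 2 ^ n)%R) by (intros; apply pow_lt; lra).
  assert (W : forall n, (w / 2 ^ S n = w / 2 ^ n / 2)%R).
  { intros n. pose proof (P n). simpl. field. lra. }
  assert (W0 : forall n, (0 <= w / 2 ^ n)%R).
  { intros n. apply Rmult_le_pos; [exact hw |]. left. apply Rinv_0_lt_compat, P. }
  assert (Hup : forall n k, (a n <= a (n + k)%nat)%R /\ (a (n + k)%nat + w / 2 ^ (n + k) <= a n + w / 2 ^ n)%R).
  { intros n k. induction k.
    - rewrite Nat.add_0_r. lra.
    - rewrite Nat.add_succ_r, W. specialize (H (n + k)%nat). lra. }
  assert (Hall : forall n m, (a m <= a n + w / 2 ^ n)%R).
  { intros n m. destruct (Nat.le_ge_cases n m) as [h | h].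
    - replace m with (n + (m - n))%nat by lia. destruct (Hup n (m - n)%nat) as [_ h2].
      specialize (W0 (n + (m - n))%nat). lra.
    - replace n with (m + (n - m))%nat by lia. destruct (Hup m (n - m)%nat) as [h2 _].
      specialize (W0 (m + (n - m))%nat). lra. }
  destruct (completeness (fun x => exists n, x = a n)) as (x & ub & lub).
  - exists (a 0%nat + w / 2 ^ 0)%R. intros y (n & ->). apply Hall.
  - exists (a 0%nat). now exists 0%nat.
  - exists x. intros n. split; [apply ub; now exists n |]. apply lub. intros y (m & ->). apply Hall.
Qed.

(** Goursat's bisection, which asks nothing of the derivative but existence. The chosen quarters
    shrink to a point [z], where [f] is affine up to [e |u - z|]. The affine part has a primitive;
    the remainder contributes at most a multiple of [e (w + h)^2 / 4^n], which balances the factor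
    [4^n] lost in the selection. *)
Lemma goursat (f : C -> C) a c w h :
  (0 <= w)%R -> (0 <= h)%R ->
  (forall z, in_rect a c w h z -> exists l, cderiv f z l) -> rect_int f a c w h = 0.
Proof.
  intros hw hh Hd.
  assert (Hc : forall z, in_rect a c w h z -> ccont f z).
  { intros z hz. destruct (Hd z hz) as (l & hl). eapply deriv_cont, hl. }
  assert (W0 : forall x n, (0 <= x)%R -> (0 <= x / 2 ^ n)%R).
  { intros x n hx. apply Rmult_le_pos; [exact hx |]. left. apply Rinv_0_lt_compat, pow_lt. lra. }
  assert (W1 : forall x n, (0 <= x)%R -> (x / 2 ^ n <= x)%R).
  { intros x n hx. assert (1 <= 2 ^ n)%R by (apply pow_R1_Rle; lra).
    apply (Rmult_le_reg_r (2 ^ n)); [lra |]. unfold Rdiv. rewrite Rmult_assoc, Rinv_l by lra. nra. }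
  assert (WS : forall x n, (x / 2 ^ S n = x / 2 ^ n / 2)%R).
  { intros x n. assert (0 < 2 ^ n)%R by (apply pow_lt; lra). simpl. field. lra. }
  (* A rectangle of generation [n] is encoded by its corner; [good] places it inside the original
     one, where [f] is known to be differentiable. *)
  set (good := fun (n : nat) (p : R * R) => forall z, in_rect (fst p) (snd p) (w / 2 ^ n) (h / 2 ^ n) z -> in_rect a c w h z).
  (* The implication stands under the existential, so that choice gives a total function [nxt]. *)
  assert (St : forall n (p : R * R), exists q : R * R, good n p ->
     (fst p <= fst q <= fst p + w / 2 ^ n / 2)%R /\ (snd p <= snd q <= snd p + h / 2 ^ n / 2)%R /\
     (Cmod (rect_int f (fst p) (snd p) (w / 2 ^ n) (h / 2 ^ n)) <=
        4 * Cmod (rect_int f (fst q) (snd q) (w / 2 ^ n / 2) (h / 2 ^ n / 2)))%R).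
  { intros n p. destruct (classic (good n p)) as [g | ng]; [| exists p; tauto].
    destruct (rect_int_large_quarter f (fst p) (snd p) (w / 2 ^ n) (h / 2 ^ n)) as (q & hq); auto.
    exists q. auto. }
  set (nxt := fun n p => proj1_sig (constructive_indefinite_description _ (St n p))).
  assert (Hn : forall n p, _) by (intros n p; exact (proj2_sig (constructive_indefinite_description _ (St n p)))).
  set (s := fix s n := match n with O => (a, c) | S k => nxt k (s k) end).
  assert (Hg : forall n, good n (s n) /\ (Cmod (rect_int f a c w h) <= 4 ^ n *
     Cmod (rect_int f (fst (s n)) (snd (s n)) (w / 2 ^ n) (h / 2 ^ n)))%R).
  { induction n as [| n [IH1 IH2]].
    - split; simpl; rewrite ?Rdiv_1_r.
      + intros z hz. simpl in hz. rewrite !Rdiv_1_r in hz. exact hz.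
      + lra.
    - destruct (Hn n (s n) IH1) as (q1 & q2 & q3). fold (nxt n (s n)) in q1, q2, q3.
      change (nxt n (s n)) with (s (S n)) in q1, q2, q3. split.
      + intros z [z1 z2]. apply IH1. rewrite WS in z1, z2. split; lra.
      + rewrite !WS. eapply Rle_trans; [exact IH2 |]. change (4 ^ S n)%R with (4 * 4 ^ n)%R.
        assert (0 < 4 ^ n)%R by (apply pow_lt; lra). nra. }
  destruct (nested_intervals (fun n => fst (s n)) w hw) as (x & hx).
  { intros n. destruct (Hn n (s n) (proj1 (Hg n))) as (q1 & _ & _). exact q1. }
  destruct (nested_intervals (fun n => snd (s n)) h hh) as (y & hy).
  { intros n. destruct (Hn n (s n) (proj1 (Hg n))) as (_ & q2 & _). exact q2. }
  assert (hz : in_rect a c w h (x, y)).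
  { apply (proj1 (Hg 0%nat)). split; [apply hx | apply hy]. }
  destruct (Hd _ hz) as (l & hl). set (z := (x, y)) in *.
  apply Cmod_eq_0, Rle_antisym; [| apply Cmod_ge_0]. apply le_epsilon. intros eps he. rewrite Rplus_0_l.
  (* [2 (w + h)^2] is the constant of the final estimate; the [1] keeps [B] positive for a
     degenerate rectangle. *)
  set (B := (2 * ((w + h) * (w + h)) + 1)%R). assert (hB : (0 < B)%R) by (unfold B; nra).
  set (e := (eps / B)%R). assert (he' : (0 < e)%R) by (apply Rdiv_lt_0_compat; lra).
  destruct (deriv_elim _ _ _ _ e hl he') as (d & hd & H). unfold cid in H.
  assert (Hbig : exists n, ((w + h) / 2 ^ n < d)%R).
  { destruct (Pow_x_infinity 2 ltac:(rewrite Rabs_pos_eq; lra) ((w + h + 1) / d)%R) as (n & hn).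
    exists n. specialize (hn n (Nat.le_refl _)). assert (0 < 2 ^ n)%R by (apply pow_lt; lra).
    rewrite Rabs_pos_eq in hn by lra. apply Rge_le in hn.
    apply (Rmult_lt_reg_r (2 ^ n)); [assumption |]. unfold Rdiv at 1. rewrite Rmult_assoc, Rinv_l by lra.
    apply (Rmult_le_compat_r d) in hn; [| lra]. unfold Rdiv in hn. rewrite Rmult_assoc, Rinv_l in hn by lra. lra. }
  destruct Hbig as (n & hn). destruct (Hg n) as [gn Hn']. specialize (hx n). specialize (hy n). cbv beta in hx, hy.
  set (an := fst (s n)) in *. set (cn := snd (s n)) in *.
  pose proof (W0 w n hw) as w0. pose proof (W0 h n hh) as h0.
  assert (Hs : ((w + h) / 2 ^ n = w / 2 ^ n + h / 2 ^ n)%R) by (unfold Rdiv; ring). rewrite Hs in hn.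
  set (wn := (w / 2 ^ n)%R) in *. set (hn' := (h / 2 ^ n)%R) in *.
  assert (Hlin : rect_int (fun u => f z + (u - z) * l) an cn wn hn' = 0).
  { apply (rect_int_primitive (fun u => f z * u + (u - z) ^ 2 * (l / 2))); auto. intros u _.
    assert (C1 : cderiv (fun u => u - z) u 1).
    { eapply deriv_eq; [apply deriv_minus; [apply deriv_id | apply deriv_const] | ring]. }
    split.
    - eapply deriv_eq.
      + apply deriv_plus; [apply deriv_scal, deriv_id |].
        apply (deriv_mult cid (fun u => (u - z) ^ 2) (fun _ => l / 2)); [| apply deriv_const].
        apply (deriv_pow cid (fun u => u - z) u 1 2 C1).
      + cbv beta. replace (INR 2) with 2%R by (simpl; ring). change (2 - 1)%nat with 1%nat. simpl. field.
    - apply cont_plus; [apply cont_const |]. apply cont_mult; [eapply deriv_cont, C1 | apply cont_const]. }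
  set (g := fun u => f u - f z - (u - z) * l).
  assert (C1 : forall u, ccont (fun u => (u - z) * l) u).
  { intros u. apply cont_mult; [apply cont_minus; [apply cont_id | apply cont_const] | apply cont_const]. }
  assert (Cg : forall u, in_rect an cn wn hn' u -> ccont g u).
  { intros u hu. apply cont_minus; [apply cont_minus; [now apply Hc, gn | apply cont_const] | apply C1]. }
  assert (E : rect_int f an cn wn hn' = rect_int g an cn wn hn').
  { replace (rect_int f an cn wn hn') with (rect_int (fun u => g u + (f z + (u - z) * l)) an cn wn hn').
    - rewrite rect_int_plus; auto; [rewrite Hlin; ring |]. intros u _. apply cont_plus; [apply cont_const | apply C1].
    - f_equal. apply functional_extensionality. intros u. unfold g. ring. }
  assert (Hbd : (Cmod (rect_int g an cn wn hn') <= 2 * (e * (wn + hn')) * (wn + hn'))%R).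
  { apply rect_int_norm; auto. intros u hu. split; [now apply Cg |].
    assert (hu' : (Cmod (u - z) <= wn + hn')%R).
    { eapply Rle_trans; [apply Cmod_le_Re_Im |]. reim. destruct hu as [u1 u2].
      apply Rplus_le_compat; apply Rabs_le; unfold z; simpl; lra. }
    unfold g. eapply Rle_trans; [apply H; lra |]. apply Rmult_le_compat_l; lra. }
  rewrite E in Hn'. eapply Rle_trans; [exact Hn' |].
  assert (P2 : (0 < 2 ^ n)%R) by (apply pow_lt; lra).
  replace (4 ^ n)%R with (2 ^ n * 2 ^ n)%R by (rewrite <- Rpow_mult_distr; f_equal; lra).
  eapply Rle_trans; [apply Rmult_le_compat_l; [nra | exact Hbd] |].
  rewrite <- Hs. replace (2 ^ n * 2 ^ n * (2 * (e * ((w + h) / 2 ^ n)) * ((w + h) / 2 ^ n)))%R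
    with (e * (2 * ((w + h) * (w + h))))%R by (field; lra).
  replace eps with (e * B)%R by (unfold e; field; lra). apply Rmult_le_compat_l; [lra |]. unfold B. lra.
Qed.

(** * The mean value property and the identity theorem *)

(** [A] is the logarithm of the radius, so that an annulus becomes a rectangle in the exponent. *)
Definition circ (z : C) (A t : R) : C := z + Cexp (A, t).

Lemma Cmod_circ z A t : Cmod (circ z A t - z) = exp A.
Proof. unfold circ. replace (z + Cexp (A, t) - z) with (Cexp (A, t)) by ring. now rewrite Cmod_Cexp. Qed.

Lemma circ_rcont z A t : rcont (circ z A) t.
Proof.
  apply cont_plus; [apply cont_const |]. apply (cont_comp RtoC Cexp (vline A)).
  - eapply deriv_cont, Cexp_deriv.
  - eapply deriv_cont, vline_rderiv.
Qed.

(* Goursat's theorem for [zeta |-> f (z + exp zeta)] on [A0, A] x [0, 2 PI]: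
   the horizontal sides cancel by periodicity. *)
Lemma circle_mean (f : C -> C) (z : C) (A : R) :
  (forall u, (Cmod (u - z) <= exp A)%R -> exists l, cderiv f u l) ->
  cint (fun t => f (circ z A t)) 0 (2 * PI) = RtoC (2 * PI) * f z.
Proof.
  intros H. pose proof PI_RGT_0 as hpi.
  set (k := fun u => f (z + Cexp u)).
  assert (Hinv : forall w, (0 <= w)%R ->
     cint (fun t => f (circ z A t)) 0 (2 * PI) = cint (fun t => f (circ z (A - w) t)) 0 (2 * PI)).
  { intros w hw.
    assert (G : rect_int k (A - w) 0 w (2 * PI) = 0).
    { apply goursat; [exact hw | lra |]. intros u [hu _].
      destruct (H (z + Cexp u)) as (l & hl).
      - replace (z + Cexp u - z) with (Cexp u) by ring. rewrite Cmod_Cexp.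
        destruct (Req_dec (Re u) A) as [-> |]; [lra |]. left. apply exp_increasing. lra.
      - exists (l * (0 + Cexp u)). apply (deriv_comp cid f (fun u => z + Cexp u)); [exact hl |].
        apply deriv_plus; [apply deriv_const | apply Cexp_deriv]. }
    unfold rect_int in G. replace (A - w + w)%R with A in G by ring. rewrite Rplus_0_l in G.
    replace (cint (fun t => k (hline (2 * PI) t)) (A - w) A) with (cint (fun t => k (hline 0 t)) (A - w) A) in G.
    2:{ apply cint_ext; [lra |]. intros t _. unfold k, hline, Cexp. simpl. now rewrite cos_2PI, sin_2PI, cos_0, sin_0. }
    unfold k, vline in G. fold (circ z A) in G.
    assert (G2 : Ci * (cint (fun t => f (circ z A t)) 0 (2 * PI) - cint (fun t => f (circ z (A - w) t)) 0 (2 * PI)) = 0).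
    { rewrite <- G. unfold circ. ring. }
    apply Cmult_integral in G2 as [G2 | G2].
    - exfalso. apply (f_equal Im) in G2. simpl in G2. lra.
    - apply Cmod_eq_sub_0. now rewrite G2, Cmod_0. }
  apply Cmod_eq_sub_0, Rle_antisym; [| apply Cmod_ge_0]. apply le_epsilon. intros eps he. rewrite Rplus_0_l.
  assert (Cf : forall u, (Cmod (u - z) <= exp A)%R -> ccont f u).
  { intros u hu. destruct (H u hu) as (l & hl). eapply deriv_cont, hl. }
  pose proof (exp_pos A) as hA.
  destruct (Cf z ltac:(rewrite Cmod_sub_0; lra) (eps / (2 * PI))%R) as (d & hd & Hd).
  { apply Rdiv_lt_0_compat; lra. }
  (* Makes the radius [exp (A - w)] at most [d / 2] without exceeding the original radius. *)
  set (w := Rmax 0 (A - ln (d / 2))). assert (hw : (0 <= w)%R) by apply Rmax_l.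
  assert (hw2 : (exp (A - w) <= d / 2)%R).
  { assert (hh : (A - w <= ln (d / 2))%R) by (pose proof (Rmax_r 0 (A - ln (d / 2))); unfold w; lra).
    rewrite <- (exp_ln (d / 2)) by lra. destruct hh as [hh | ->]; [left; now apply exp_increasing | lra]. }
  assert (hw3 : (exp (A - w) <= exp A)%R).
  { destruct hw as [hw | hw]; [left; apply exp_increasing; lra | rewrite <- hw, Rminus_0_r; lra]. }
  rewrite (Hinv w hw). replace (2 * PI)%R with (2 * PI - 0)%R at 2 by ring. rewrite <- cint_const.
  assert (R1 : rcont_on 0 (2 * PI) (fun t => f (circ z (A - w) t))).
  { intros t _. apply cont_comp; [apply Cf; rewrite Cmod_circ; exact hw3 | apply circ_rcont]. }
  assert (R2 : rcont_on 0 (2 * PI) (fun _ => f z)) by (intros t _; apply cont_const).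
  rewrite <- cint_minus by (auto; lra).
  replace eps with (eps / (2 * PI) * (2 * PI - 0))%R by (field; lra).
  apply cint_norm; [lra | intros t ht; apply cont_minus; [now apply R1 | apply cont_const] |].
  intros t _. left. apply Hd. unfold cid. rewrite Cmod_circ. lra.
Qed.

Lemma circle_bound (f : C -> C) (z : C) (A M : R) :
  (forall u, (Cmod (u - z) <= exp A)%R -> exists l, cderiv f u l) ->
  (forall t, (0 <= t <= 2 * PI)%R -> (Cmod (f (circ z A t)) <= M)%R) ->
  (Cmod (f z) <= M)%R.
Proof.
  intros H HM. pose proof PI_RGT_0 as hpi.
  assert (B : (Cmod (RtoC (2 * PI) * f z) <= M * (2 * PI - 0))%R).
  { rewrite <- (circle_mean f z A H). apply cint_norm; [lra | | exact HM].
    intros t _. apply cont_comp; [| apply circ_rcont].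
    destruct (H (circ z A t)) as (l & hl); [rewrite Cmod_circ; lra |]. eapply deriv_cont, hl. }
  rewrite Cmod_mult, Cmod_R, Rabs_pos_eq in B by lra. nra.
Qed.

(** The quotient [f u / (u - p)^n] stays differentiable at [p], as it vanishes near there. On the
    circle of radius [R / 2] about [z] one has [|u - p| >= R/2 - R/10 = 2R/5], whereas
    [|z - p| < R / 10]; the mean value property thus bounds [|f z|] by [M (1/4)^n] for every [n]. *)
Lemma vanishing_spreads (f : C -> C) (p : C) (R : R) :
  (forall u, (Cmod (u - p) < R)%R -> exists l, cderiv f u l) ->
  near cid p (fun u => f u = 0) ->
  forall z, (Cmod (z - p) < R / 10)%R -> f z = 0.
Proof.
  intros H H0 z hz.
  assert (hR : (0 < R)%R) by (pose proof (Cmod_ge_0 (z - p)); lra).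
  destruct (classic (z = p)) as [-> | hzp]; [exact (near_at _ _ _ H0) |].
  set (A := ln (R / 2)). assert (eA : exp A = (R / 2)%R) by (apply exp_ln; lra).
  assert (In : forall u, (Cmod (u - z) <= exp A)%R -> (Cmod (u - p) < R)%R).
  { intros u hu. pose proof (Cmod_triangle_sub u z p). lra. }
  assert (Far : forall t, (2 * R / 5 <= Cmod (circ z A t - p))%R).
  { intros t. pose proof (Cmod_circ z A t) as E. pose proof (Cmod_triangle_sub (circ z A t) p z).
    rewrite (Cmod_sub_comm p z) in H1. lra. }
  destruct (rcont_bounded (fun t => f (circ z A t)) 0 (2 * PI)) as (M & hM & HM).
  { pose proof PI_RGT_0; lra. }
  { intros t _. apply cont_comp; [| apply circ_rcont].
    destruct (H (circ z A t)) as (l & hl); [apply In; rewrite Cmod_circ; lra |]. eapply deriv_cont, hl. }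
  assert (B : forall n, (Cmod (f z / (z - p) ^ n) <= M / (2 * R / 5) ^ n)%R).
  { intros n. apply (circle_bound (fun u => f u / (u - p) ^ n) z A).
    - intros u hu. destruct (classic (u = p)) as [-> | hup].
      + exists 0. apply (deriv_ext cid (fun _ => RtoC 0)); [| apply deriv_const].
        refine (near_imp _ _ _ _ _ H0). intros v ->. unfold Cdiv. ring.
      + destruct (H u (In u hu)) as (l & hl). eexists.
        apply deriv_div; [exact hl | apply deriv_pow, deriv_minus; [apply deriv_id | apply deriv_const] |].
        apply Cpow_nz. intros E. apply hup, Cmod_eq_sub_0. now rewrite E, Cmod_0.
    - intros t ht. specialize (Far t). rewrite Cmod_div.
      2:{ apply Cpow_nz, Cmod_gt_0. lra. }
      rewrite Cmod_pow. apply Rmult_le_compat; [apply Cmod_ge_0 | | now apply HM |].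
      + left. apply Rinv_0_lt_compat, pow_lt. lra.
      + apply Rinv_le_contravar; [apply pow_lt; lra |]. apply pow_incr. lra. }
  assert (B2 : forall n, (Cmod (f z) <= M * (1 / 4) ^ n)%R).
  { intros n. specialize (B n).
    assert (hm : (0 < Cmod (z - p))%R).
    { apply Cmod_gt_0. intros E. apply hzp, Cmod_eq_sub_0. now rewrite E, Cmod_0. }
    rewrite Cmod_div, Cmod_pow in B by (apply Cpow_nz, Cmod_gt_0, hm).
    assert (q : (0 < Cmod (z - p) ^ n)%R) by (apply pow_lt, hm).
    apply (Rmult_le_compat_r (Cmod (z - p) ^ n)) in B; [| lra].
    unfold Rdiv in B at 1. rewrite Rmult_assoc, Rinv_l, Rmult_1_r in B by lra.
    eapply Rle_trans; [exact B |]. unfold Rdiv at 1. rewrite Rmult_assoc. apply Rmult_le_compat_l; [lra |].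
    rewrite <- pow_inv, <- Rpow_mult_distr. apply pow_incr. split.
    - apply Rmult_le_pos; [left; apply Rinv_0_lt_compat |]; lra.
    - apply (Rmult_le_reg_l (2 * R / 5)); [lra |]. rewrite <- Rmult_assoc, Rinv_r by lra. lra. }
  apply Cmod_eq_0, Rle_antisym; [| apply Cmod_ge_0]. apply le_epsilon. intros eps he. rewrite Rplus_0_l.
  destruct (pow_lt_1_zero (1 / 4) ltac:(rewrite Rabs_pos_eq; lra) (eps / M)) as (N & hN).
  { apply Rdiv_lt_0_compat; lra. }
  specialize (hN N (Nat.le_refl _)). rewrite Rabs_pos_eq in hN by (apply pow_le; lra).
  eapply Rle_trans; [apply (B2 N) |]. apply (Rmult_lt_compat_l M) in hN; [| lra].
  replace (M * (eps / M))%R with eps in hN by (field; lra). lra.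
Qed.

(** * Unordered sums *)

Fixpoint lsum {I} (a : I -> C) (l : list I) : C :=
  match l with nil => 0 | i :: l' => a i + lsum a l' end.

Fixpoint rsum {I} (a : I -> R) (l : list I) : R :=
  match l with nil => 0%R | i :: l' => (a i + rsum a l')%R end.

(** Summation along finite subsets, represented by duplicate-free lists. Such sums are invariant
    under bijections of the index set, which is what a change of lattice basis requires. *)
Definition has_sum {I} (a : I -> C) (s : C) : Prop :=
  forall eps, (0 < eps)%R -> exists l0, forall l, NoDup l -> incl l0 l -> (Cmod (lsum a l - s) < eps)%R.

Definition sum_bounded {I} (M : I -> R) (S : R) : Prop :=
  (forall i, (0 <= M i)%R) /\ forall l, NoDup l -> (rsum M l <= S)%R.

Definition summable {I} (M : I -> R) : Prop := exists S, sum_bounded M S.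

Definition memb {I} (l : list I) (i : I) : bool :=
  if excluded_middle_informative (In i l) then true else false.

Lemma memb_true {I} (l : list I) i : memb l i = true <-> In i l.
Proof. unfold memb. destruct (excluded_middle_informative (In i l)); split; auto; discriminate. Qed.

Lemma memb_false {I} (l : list I) i : memb l i = false <-> ~ In i l.
Proof. unfold memb. destruct (excluded_middle_informative (In i l)); split; auto; try discriminate; tauto. Qed.

Definition outside {I} (l0 l : list I) : list I := filter (fun i => negb (memb l0 i)) l.

Lemma outside_In {I} (l0 l : list I) i : In i (outside l0 l) <-> In i l /\ ~ In i l0.
Proof.
  unfold outside. rewrite filter_In. split; intros [h1 h2]; split; auto.
  - apply memb_false. now destruct (memb l0 i).
  - apply memb_false in h2. now rewrite h2.
Qed.

Lemma outside_NoDup {I} (l0 l : list I) : NoDup l -> NoDup (outside l0 l).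
Proof. apply NoDup_filter. Qed.

Lemma outside_perm {I} (l0 l : list I) :
  NoDup l0 -> NoDup l -> incl l0 l -> Permutation l (l0 ++ outside l0 l).
Proof.
  intros h0 h hi. apply NoDup_Permutation; [exact h | |].
  - apply NoDup_app; [exact h0 | now apply outside_NoDup |]. intros i hi0 hi1. apply outside_In in hi1. tauto.
  - intros i. rewrite in_app_iff, outside_In. split; [| intros [H | [H _]]; auto].
    intros H. destruct (classic (In i l0)); tauto.
Qed.

Definition dedup {I} (l : list I) : list I := nodup (fun x y => excluded_middle_informative (x = y)) l.

Lemma dedup_NoDup {I} (l : list I) : NoDup (dedup l).
Proof. apply NoDup_nodup. Qed.

Lemma dedup_In {I} (l : list I) i : In i (dedup l) <-> In i l.
Proof. apply nodup_In. Qed.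

Lemma lsum_perm {I} (a : I -> C) l l' : Permutation l l' -> lsum a l = lsum a l'.
Proof. induction 1; simpl; try congruence. ring. Qed.

Lemma rsum_perm {I} (a : I -> R) l l' : Permutation l l' -> rsum a l = rsum a l'.
Proof. induction 1; simpl; try congruence. ring. Qed.

Lemma lsum_app {I} (a : I -> C) l l' : lsum a (l ++ l') = lsum a l + lsum a l'.
Proof. induction l; simpl; [ring |]. rewrite IHl. ring. Qed.

Lemma rsum_app {I} (a : I -> R) l l' : rsum a (l ++ l') = (rsum a l + rsum a l')%R.
Proof. induction l; simpl; [ring |]. rewrite IHl. ring. Qed.

Lemma lsum_plus {I} (a b : I -> C) l : lsum (fun i => a i + b i) l = lsum a l + lsum b l.
Proof. induction l; simpl; [ring |]. rewrite IHl. ring. Qed.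

Lemma lsum_scal {I} (c : C) (a : I -> C) l : lsum (fun i => c * a i) l = c * lsum a l.
Proof. induction l; simpl; [ring |]. rewrite IHl. ring. Qed.

Lemma rsum_scal {I} (c : R) (a : I -> R) l : rsum (fun i => c * a i)%R l = (c * rsum a l)%R.
Proof. induction l; simpl; [ring |]. rewrite IHl. ring. Qed.

Lemma lsum_ext {I} (a b : I -> C) l : (forall i, In i l -> a i = b i) -> lsum a l = lsum b l.
Proof. induction l; simpl; [auto |]. intros H. rewrite IHl by auto. now rewrite H by auto. Qed.

Lemma lsum_map {I J} (f : I -> J) (a : J -> C) l : lsum a (map f l) = lsum (fun i => a (f i)) l.
Proof. induction l; simpl; congruence. Qed.

Lemma lsum_zero {I} (a : I -> C) l : (forall i, In i l -> a i = 0) -> lsum a l = 0.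
Proof. induction l; simpl; [auto |]. intros H. rewrite IHl, H by auto. ring. Qed.

Lemma lsum_norm {I} (a : I -> C) (M : I -> R) l :
  (forall i, In i l -> (Cmod (a i) <= M i)%R) -> (Cmod (lsum a l) <= rsum M l)%R.
Proof.
  induction l; simpl; intros H; [rewrite Cmod_0; lra |].
  eapply Rle_trans; [apply Cmod_triangle |]. apply Rplus_le_compat; auto.
Qed.

Lemma rsum_le {I} (a b : I -> R) l : (forall i, In i l -> (a i <= b i)%R) -> (rsum a l <= rsum b l)%R.
Proof. induction l; simpl; intros H; [lra |]. apply Rplus_le_compat; auto. Qed.

Lemma rsum_nonneg {I} (a : I -> R) l : (forall i, (0 <= a i)%R) -> (0 <= rsum a l)%R.
Proof. intros H. induction l; simpl; [lra |]. specialize (H a0). lra. Qed.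

Lemma rsum_incl {I} (a : I -> R) l l' :
  (forall i, (0 <= a i)%R) -> NoDup l -> NoDup l' -> incl l l' -> (rsum a l <= rsum a l')%R.
Proof.
  intros H h h' hi. rewrite (rsum_perm a _ _ (outside_perm l l' h h' hi)), rsum_app.
  pose proof (rsum_nonneg a (outside l l') H). lra.
Qed.

Lemma sum_bounded_le {I} (M M' : I -> R) S :
  (forall i, (0 <= M i <= M' i)%R) -> sum_bounded M' S -> sum_bounded M S.
Proof.
  intros H [h1 h2]. split; [apply H |]. intros l hl. eapply Rle_trans; [| now apply (h2 l)].
  apply rsum_le. intros i _. apply H.
Qed.

Lemma summable_le {I} (M M' : I -> R) :
  (forall i, (0 <= M i <= M' i)%R) -> summable M' -> summable M.
Proof. intros H [S hS]. exists S. now apply (sum_bounded_le M M'). Qed.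

Lemma summable_scal {I} (c : R) (M : I -> R) : (0 <= c)%R -> summable M -> summable (fun i => c * M i)%R.
Proof.
  intros hc (S & h1 & h2). exists (c * S)%R. split; [intros i; apply Rmult_le_pos; auto |].
  intros l hl. rewrite rsum_scal. apply Rmult_le_compat_l; auto.
Qed.

(** Take [l0] whose sum is within [eps] of the supremum of all finite sums; what is disjoint from it
    can add at most [eps]. *)
Lemma summable_tail {I} (M : I -> R) eps :
  summable M -> (0 < eps)%R ->
  exists l0, NoDup l0 /\ forall l, NoDup l -> (forall i, In i l -> ~ In i l0) -> (rsum M l <= eps)%R.
Proof.
  intros (S & h1 & h2) he.
  destruct (completeness (fun x => exists l, NoDup l /\ x = rsum M l)) as (s & ub & lub).
  { exists S. intros x (l & hl & ->). now apply h2. }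
  { exists 0%R, nil. split; [constructor | reflexivity]. }
  assert (H : exists l0, NoDup l0 /\ (s - eps < rsum M l0)%R).
  { apply NNPP. intros N. assert (s <= s - eps)%R; [| lra]. apply lub. intros x (l & hl & ->).
    apply Rnot_lt_le. intros h. apply N. now exists l. }
  destruct H as (l0 & hl0 & Hl0). exists l0. split; [exact hl0 |]. intros l hl hd.
  assert (hA : (rsum M (l0 ++ l) <= s)%R).
  { apply ub. exists (l0 ++ l). split; [| reflexivity]. apply NoDup_app; auto. intros i i0 i1. apply (hd i i1 i0). }
  rewrite rsum_app in hA. lra.
Qed.

Lemma lsum_tail {I} (a : I -> C) (M : I -> R) l0 l eps :
  (forall i, (Cmod (a i) <= M i)%R) -> NoDup l0 -> NoDup l -> incl l0 l ->
  (forall l, NoDup l -> (forall i, In i l -> ~ In i l0) -> (rsum M l <= eps)%R) ->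
  (Cmod (lsum a l - lsum a l0) <= eps)%R.
Proof.
  intros HM h0 h hi Ht. rewrite (lsum_perm a _ _ (outside_perm l0 l h0 h hi)), lsum_app.
  replace (lsum a l0 + lsum a (outside l0 l) - lsum a l0) with (lsum a (outside l0 l)) by ring.
  eapply Rle_trans; [apply lsum_norm; intros; apply HM |]. apply Ht; [now apply outside_NoDup |].
  intros i hi0. now apply outside_In in hi0.
Qed.

(** Finite subsets directed by inclusion, as a filter: the completeness of the plane then provides
    the sum of a dominated family. *)
Definition list_filter (I : Type) : (list I -> Prop) -> Prop :=
  fun P => exists l0, forall l, NoDup l -> incl l0 l -> P l.

Lemma list_filter_proper (I : Type) : ProperFilter (list_filter I).
Proof.
  constructor.
  - intros P (l0 & H). exists (dedup l0). apply H; [apply dedup_NoDup |]. intros i hi. now apply dedup_In.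
  - constructor.
    + exists nil. auto.
    + intros P Q (l1 & H1) (l2 & H2). exists (l1 ++ l2). intros l hl hi. split.
      * apply H1; auto. intros i h. apply hi, in_or_app. now left.
      * apply H2; auto. intros i h. apply hi, in_or_app. now right.
    + intros P Q H (l0 & H0). exists l0. auto.
Qed.

Lemma has_sum_exists {I} (a : I -> C) (M : I -> R) :
  (forall i, (Cmod (a i) <= M i)%R) -> summable M -> exists s, has_sum a s.
Proof.
  intros HM HS. pose proof (list_filter_proper I) as PF.
  destruct (proj1 (filterlim_locally_cauchy (U := C_R_CompleteNormedModule) (F := list_filter I) (lsum a))) as (s & Hs).
  - intros eps. destruct (summable_tail M (eps / 4) HS) as (l0 & hl0 & H0).
    { pose proof (cond_pos eps); lra. }
    exists (fun l => NoDup l /\ incl l0 l). split; [exists l0; auto |].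
    intros l l' [h1 h2] [h3 h4]. apply C_NormedModule_mixin_compat1.
    pose proof (lsum_tail a M l0 l _ HM hl0 h1 h2 H0) as t1.
    pose proof (lsum_tail a M l0 l' _ HM hl0 h3 h4 H0) as t2.
    pose proof (Cmod_triangle_sub (lsum a l') (lsum a l0) (lsum a l)) as t3.
    rewrite (Cmod_sub_comm (lsum a l0)) in t3. pose proof (cond_pos eps).
    change (Cmod (lsum a l' - lsum a l) < eps)%R. lra.
  - exists s. intros eps he.
    assert (N : near cid s (fun y => (Cmod (y - s) < eps)%R)) by (exists eps; auto).
    apply (locally_near s) in N. destruct (Hs _ N) as (l0 & H0). exists l0. exact H0.
Qed.

Lemma has_sum_near {I} (a b : I -> C) s t :
  has_sum a s -> has_sum b t ->
  forall eps, (0 < eps)%R -> exists l0, forall l, NoDup l -> incl l0 l ->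
    (Cmod (lsum a l - s) < eps /\ Cmod (lsum b l - t) < eps)%R.
Proof.
  intros Ha Hb eps he. destruct (Ha eps he) as (l1 & H1), (Hb eps he) as (l2 & H2).
  exists (l1 ++ l2). intros l hl hi. split.
  - apply H1; auto. intros i h. apply hi, in_or_app. now left.
  - apply H2; auto. intros i h. apply hi, in_or_app. now right.
Qed.

Lemma has_sum_unique {I} (a : I -> C) s t : has_sum a s -> has_sum a t -> s = t.
Proof.
  intros Hs Ht. apply Cmod_eq_sub_0, Rle_antisym; [| apply Cmod_ge_0].
  apply le_epsilon. intros eps he. rewrite Rplus_0_l.
  destruct (has_sum_near a a s t Hs Ht (eps / 2)%R ltac:(lra)) as (l0 & H0).
  destruct (H0 (dedup l0) (dedup_NoDup l0)) as [h1 h2]; [intros i hi; now apply dedup_In |].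
  pose proof (Cmod_triangle_sub s (lsum a (dedup l0)) t). rewrite (Cmod_sub_comm s (lsum a (dedup l0))) in H. lra.
Qed.

Lemma has_sum_ext {I} (a b : I -> C) s : (forall i, a i = b i) -> has_sum a s -> has_sum b s.
Proof. intros H. replace b with a; [auto | now apply functional_extensionality]. Qed.

Lemma has_sum_plus {I} (a b : I -> C) s t :
  has_sum a s -> has_sum b t -> has_sum (fun i => a i + b i) (s + t).
Proof.
  intros Ha Hb eps he. destruct (has_sum_near a b s t Ha Hb (eps / 2)%R ltac:(lra)) as (l0 & H0).
  exists l0. intros l hl hi. destruct (H0 l hl hi) as [h1 h2]. rewrite lsum_plus.
  replace (lsum a l + lsum b l - (s + t)) with ((lsum a l - s) + (lsum b l - t)) by ring.
  pose proof (Cmod_triangle (lsum a l - s) (lsum b l - t)). lra.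
Qed.

Lemma has_sum_scal {I} (c : C) (a : I -> C) s : has_sum a s -> has_sum (fun i => c * a i) (c * s).
Proof.
  intros Ha eps he. pose proof (Cmod_ge_0 c).
  destruct (Ha (eps / (Cmod c + 1))%R) as (l0 & H0); [apply Rdiv_lt_0_compat; lra |].
  exists l0. intros l hl hi. specialize (H0 l hl hi). rewrite lsum_scal.
  replace (c * lsum a l - c * s) with (c * (lsum a l - s)) by ring. rewrite Cmod_mult.
  pose proof (Cmod_ge_0 (lsum a l - s)).
  apply (Rmult_lt_compat_r (Cmod c + 1)) in H0; [| lra].
  unfold Rdiv in H0. rewrite Rmult_assoc, Rinv_l in H0 by lra. nra.
Qed.

Lemma has_sum_norm {I} (a : I -> C) s B :
  has_sum a s -> (exists l0, forall l, NoDup l -> incl l0 l -> (Cmod (lsum a l) <= B)%R) -> (Cmod s <= B)%R.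
Proof.
  intros Ha (l1 & H1). apply le_epsilon. intros eps he. destruct (Ha eps he) as (l0 & H0).
  set (l := dedup (l0 ++ l1)).
  assert (hl : NoDup l) by apply dedup_NoDup.
  specialize (H0 l hl). specialize (H1 l hl).
  assert (h0 : incl l0 l) by (intros i hi; apply dedup_In, in_or_app; now left).
  assert (h1 : incl l1 l) by (intros i hi; apply dedup_In, in_or_app; now right).
  specialize (H0 h0). specialize (H1 h1).
  pose proof (Cmod_sub_ge s (lsum a l)). rewrite Cmod_sub_comm in H. lra.
Qed.

Lemma has_sum_single {I} (i0 : I) (c : C) :
  has_sum (fun i => if excluded_middle_informative (i = i0) then c else 0) c.
Proof.
  intros eps he. exists (i0 :: nil). intros l hl hi.
  assert (h0 : In i0 l) by (apply hi; now left).
  apply in_split in h0. destruct h0 as (l1 & l2 & ->). apply NoDup_remove_2 in hl.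
  rewrite lsum_app. simpl. destruct (excluded_middle_informative (i0 = i0)) as [_ | n]; [| tauto].
  assert (Z : forall l', incl l' (l1 ++ l2) ->
     lsum (fun i => if excluded_middle_informative (i = i0) then c else 0) l' = 0).
  { intros l' h. apply lsum_zero. intros i hi'. destruct (excluded_middle_informative (i = i0)) as [-> |]; auto.
    exfalso. apply hl, h, hi'. }
  rewrite !Z by (intros i h; apply in_or_app; auto).
  replace (0 + (c + 0) - c) with (RtoC 0) by ring. now rewrite Cmod_0.
Qed.

Lemma has_sum_reindex {I J} (f : I -> J) (g : J -> I) (a : J -> C) s :
  (forall i, g (f i) = i) -> (forall j, f (g j) = j) ->
  has_sum a s -> has_sum (fun i => a (f i)) s.
Proof.
  intros gf fg Ha eps he. destruct (Ha eps he) as (l0 & H0). exists (map g l0). intros l hl hi.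
  rewrite <- lsum_map. apply H0.
  - apply FinFun.Injective_map_NoDup; [| exact hl]. intros x y E. now rewrite <- (gf x), E, gf.
  - intros j hj. rewrite <- (fg j). apply in_map, hi, in_map, hj.
Qed.

(** The passage from unordered sums to the limits over squares and initial segments by which [wp]
    and [CSeries] are defined. *)
Lemma has_sum_exhaustion {I} (a : I -> C) s (L : nat -> list I) :
  (forall n, NoDup (L n)) -> (forall i, exists N, forall n, (N <= n)%nat -> In i (L n)) ->
  has_sum a s -> filterlim (fun n => lsum a (L n)) eventually (locally (T := C_UniformSpace) s).
Proof.
  intros hL hex Ha P HP. apply locally_near in HP. destruct HP as (eps & he & HP).
  destruct (Ha eps he) as (l0 & H0).
  assert (HN : exists N, forall n, (N <= n)%nat -> incl l0 (L n)).
  { clear H0. induction l0 as [| i l0 (N & IH)]; [exists 0%nat; intros n _ x [] |].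
    destruct (hex i) as (N' & H'). exists (Nat.max N N'). intros n hn x [<- | hx].
    - apply H'. lia.
    - apply (IH n); [lia | exact hx]. }
  destruct HN as (N & HN). exists N. intros n hn. apply HP. unfold cid. apply H0; auto.
Qed.

Lemma has_sum_split {I} (a : I -> C) s l0 :
  NoDup l0 -> has_sum a s <-> has_sum (fun i => if memb l0 i then 0 else a i) (s - lsum a l0).
Proof.
  intros h0. set (b := fun i => if memb l0 i then RtoC 0 else a i).
  assert (E : forall l, NoDup l -> incl l0 l -> lsum b l - (s - lsum a l0) = lsum a l - s).
  { intros l hl hi. rewrite !(lsum_perm _ _ _ (outside_perm l0 l h0 hl hi)), !lsum_app.
    rewrite (lsum_zero b l0), (lsum_ext b a (outside l0 l)); [ring | |]; unfold b; intros i h.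
    - apply outside_In in h. destruct h as [_ h]. apply memb_false in h. now rewrite h.
    - apply memb_true in h. now rewrite h. }
  split; intros Ha eps he; destruct (Ha eps he) as (l1 & H1); exists (l0 ++ l1); intros l hl hi;
    specialize (H1 l hl (fun i h => hi i (in_or_app _ _ _ (or_intror h))));
    specialize (E l hl (fun i h => hi i (in_or_app _ _ _ (or_introl h)))).
  - now rewrite E.
  - now rewrite <- E.
Qed.

Lemma lsum_deriv {I} (T T' : I -> C -> C) l p :
  (forall i, In i l -> cderiv (T i) p (T' i p)) ->
  cderiv (fun z => lsum (fun i => T i z) l) p (lsum (fun i => T' i p) l).
Proof.
  induction l; simpl; intros H; [apply deriv_const |]. apply deriv_plus; auto.
Qed.

(** Termwise differentiation. The first order remainders of finitely many terms are small by
    differentiability; the others are at most [2 |z - p| M i] by the mean value inequality, with a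
    small total. *)
Lemma has_sum_deriv {I} (T T' : I -> C -> C) (M : I -> R) (p : C) (R : R) (s : C -> C) (s' : C) :
  (0 < R)%R -> summable M ->
  (forall i z, (Cmod (z - p) < R)%R -> cderiv (T i) z (T' i z) /\ (Cmod (T' i z) <= M i)%R) ->
  (forall z, (Cmod (z - p) < R)%R -> has_sum (fun i => T i z) (s z)) ->
  has_sum (fun i => T' i p) s' -> cderiv s p s'.
Proof.
  intros hR HM HT Hs Hs'. apply deriv_intro; [auto |]. unfold cid. intros eps he.
  destruct (summable_tail M (eps / 4) HM) as (l0 & hl0 & H0); [lra |].
  assert (Pp : (Cmod (p - p) < R)%R) by (rewrite Cmod_sub_0; exact hR).
  pose proof (lsum_deriv T T' l0 p (fun i _ => proj1 (HT i p Pp))) as Hd.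
  destruct (deriv_elim _ _ _ _ (eps / 2) Hd) as (d & hd & H); [lra |].
  exists (Rmin d R). split; [now apply Rmin_glb_lt |]. unfold cid in *. intros z hz.
  pose proof (Rmin_l d R). pose proof (Rmin_r d R). specialize (H z ltac:(lra)). cbv beta in H.
  set (r := fun i => T i z - T i p - (z - p) * T' i p).
  assert (Hr : has_sum r (s z - s p - (z - p) * s')).
  { apply (has_sum_ext (fun i => T i z + (- (1) * T i p + - (z - p) * T' i p))); [intros i; unfold r; ring |].
    replace (s z - s p - (z - p) * s') with (s z + (- (1) * s p + - (z - p) * s')) by ring.
    apply has_sum_plus; [apply Hs; lra |]. apply has_sum_plus; apply has_sum_scal; [apply Hs, Pp | exact Hs']. }
  assert (Hrb : forall i, (Cmod (r i) <= (2 * Cmod (z - p)) * M i)%R).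
  { intros i. unfold r. eapply Rle_trans; [apply Cmod_sub_le |]. rewrite Cmod_mult.
    pose proof (proj2 (HT i p Pp)). pose proof (Cmod_ge_0 (z - p)).
    assert (Cmod (T i z - T i p) <= M i * Cmod (z - p))%R.
    { apply (mean_value_segm (T i) (T' i)). intros t ht. apply HT.
      unfold segm. replace (p + RtoC t * (z - p) - p) with (RtoC t * (z - p)) by ring.
      rewrite Cmod_mult, Cmod_R, Rabs_pos_eq by lra. nra. }
    nra. }
  apply (has_sum_norm r _ _ Hr). exists l0. intros l hl hi.
  assert (t1 : (Cmod (lsum r l - lsum r l0) <= (2 * Cmod (z - p)) * (eps / 4))%R).
  { apply (lsum_tail r (fun i => (2 * Cmod (z - p)) * M i)%R); auto.
    intros l' hl' hd'. rewrite rsum_scal. apply Rmult_le_compat_l; [pose proof (Cmod_ge_0 (z - p)); lra | auto]. }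
  assert (t2 : lsum r l0 = lsum (fun i => T i z) l0 - lsum (fun i => T i p) l0 - (z - p) * lsum (fun i => T' i p) l0).
  (* A finite sum of remainders is the remainder of the finite sum, to which the estimate [H]
     applies. *)
  { unfold r. clear. induction l0; simpl; [ring |]. rewrite IHl0. ring. }
  rewrite <- t2 in H.
  pose proof (Cmod_triangle (lsum r l - lsum r l0) (lsum r l0)) as t3.
  replace (lsum r l - lsum r l0 + lsum r l0) with (lsum r l) in t3 by ring. lra.
Qed.

(** * Lattice sums *)

Definition zrange (N : nat) : list Z := map (fun i => Z.of_nat i - Z.of_nat N)%Z (seq 0 (S (2 * N))).
Definition zsquare (N : nat) : list (Z * Z) := list_prod (zrange N) (zrange N).

Lemma zrange_In N z : In z (zrange N) <-> (- Z.of_nat N <= z <= Z.of_nat N)%Z.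
Proof.
  unfold zrange. rewrite in_map_iff. split.
  - intros (i & <- & hi). apply in_seq in hi. lia.
  - intros h. exists (Z.to_nat (z + Z.of_nat N)). split; [lia | apply in_seq; lia].
Qed.

Lemma zrange_NoDup N : NoDup (zrange N).
Proof. apply FinFun.Injective_map_NoDup; [| apply seq_NoDup]. intros x y h. lia. Qed.

Lemma zsquare_In N p :
  In p (zsquare N) <-> (Z.abs (fst p) <= Z.of_nat N /\ Z.abs (snd p) <= Z.of_nat N)%Z.
Proof.
  destruct p as [m n]. unfold zsquare. rewrite in_prod_iff, !zrange_In. simpl. lia.
Qed.

Lemma NoDup_list_prod {I J} (l : list I) (l' : list J) : NoDup l -> NoDup l' -> NoDup (list_prod l l').
Proof.
  intros h h'. induction h; simpl; [constructor |]. apply NoDup_app; auto.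
  - apply FinFun.Injective_map_NoDup; [intros a b E; congruence | exact h'].
  - intros [a b] h1 h2. apply in_map_iff in h1. destruct h1 as (b' & E & _). apply in_prod_iff in h2.
    injection E as <- <-. tauto.
Qed.

Lemma zsquare_NoDup N : NoDup (zsquare N).
Proof. apply NoDup_list_prod; apply zrange_NoDup. Qed.

Lemma zsquare_exhausts (p : Z * Z) : exists N, forall n, (N <= n)%nat -> In p (zsquare n).
Proof.
  exists (Z.to_nat (Z.max (Z.abs (fst p)) (Z.abs (snd p)))). intros n hn. apply zsquare_In. lia.
Qed.

Lemma lsum_seq (a : nat -> C) n : lsum a (seq 0 (S n)) = sum_n a n.
Proof.
  induction n.
  - rewrite sum_O. simpl. ring.
  - rewrite seq_S, lsum_app, IHn, sum_Sn. simpl. change plus with Cplus. ring.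
Qed.

Lemma lsum_prod {I J} (a : I * J -> C) l l' :
  lsum a (list_prod l l') = lsum (fun i => lsum (fun j => a (i, j)) l') l.
Proof.
  induction l; simpl; [reflexivity |]. now rewrite lsum_app, IHl, lsum_map.
Qed.

Lemma rsum_prod_mult {I J} (a : I -> R) (b : J -> R) l l' :
  rsum (fun p => a (fst p) * b (snd p))%R (list_prod l l') = (rsum a l * rsum b l')%R.
Proof.
  induction l; simpl; [ring |]. rewrite rsum_app, IHl.
  assert (E : rsum (fun p : I * J => a (fst p) * b (snd p))%R (map (fun y => (a0, y)) l') = (a a0 * rsum b l')%R).
  { clear. induction l'; simpl; [ring |]. rewrite IHl'. ring. }
  rewrite E. ring.
Qed.

Lemma rsum_map {I J} (f : I -> J) (a : J -> R) l : rsum a (map f l) = rsum (fun i => a (f i)) l.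
Proof. induction l; simpl; congruence. Qed.

(** [(1 + |m|)^(-3/2)]: still summable over the integers, while by AM-GM the product of two weights
    dominates [(|m| + |n|)^(-3)] up to a constant. The double lattice sum is thereby controlled by a
    product of simple ones. *)
Definition zweight (m : Z) : R := (/ ((1 + IZR (Z.abs m)) * sqrt (1 + IZR (Z.abs m))))%R.

Lemma zweight_pos m : (0 < zweight m)%R.
Proof.
  assert (0 <= IZR (Z.abs m))%R by (apply IZR_le; lia).
  apply Rinv_0_lt_compat, Rmult_lt_0_compat; [lra | apply sqrt_lt_R0; lra].
Qed.

(** With [a = sqrt x] and [b = sqrt (x + 1)] the difference is [/ (a b (a + b))], and [b <= 3/2 a]
    gives [a b (a + b) <= 15/4 a^3]. *)
Lemma inv_sqrt_telescope (x : R) :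
  (1 <= x)%R -> (/ (x * sqrt x) <= 4 * (/ sqrt x - / sqrt (x + 1)))%R.
Proof.
  intros hx. pose proof (sqrt_lt_R0 x ltac:(lra)) as h1. pose proof (sqrt_lt_R0 (x + 1) ltac:(lra)) as h2.
  pose proof (sqrt_sqrt x ltac:(lra)) as s1. pose proof (sqrt_sqrt (x + 1) ltac:(lra)) as s2.
  set (a := sqrt x) in *. set (b := sqrt (x + 1)) in *.
  assert (E : (/ a - / b = / (a * b * (a + b)))%R).
  { replace (/ a - / b)%R with ((b * b - a * a) / (a * b * (a + b)))%R by (field; repeat split; nra).
    rewrite s1, s2. field. repeat split; nra. }
  rewrite E, <- s1. apply (Rmult_le_reg_l (a * a * a)); [nra |].
  replace (a * a * a * / (a * a * a))%R with 1%R by (field; lra).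
  apply (Rmult_le_reg_r (a * b * (a + b))); [apply Rmult_lt_0_compat; nra |].
  replace (a * a * a * (4 * / (a * b * (a + b))) * (a * b * (a + b)))%R with (4 * (a * a * a))%R by (field; nra).
  rewrite Rmult_1_l. assert (hb : (b <= 3 / 2 * a)%R) by nra.
  assert (a * b * (a + b) <= a * (3 / 2 * a) * (a + 3 / 2 * a))%R.
  { apply Rmult_le_compat; nra. }
  nra.
Qed.

Lemma zweight_nat_sum n : (rsum (fun i => zweight (Z.of_nat i)) (seq 0 n) <= 4 - 4 / sqrt (INR n + 1))%R.
Proof.
  induction n.
  - simpl. rewrite Rplus_0_l, sqrt_1. lra.
  - rewrite seq_S, rsum_app. simpl rsum at 2. rewrite S_INR.
    assert (h : (zweight (Z.of_nat n) <= 4 * (/ sqrt (INR n + 1) - / sqrt (INR n + 1 + 1)))%R).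
    { unfold zweight. rewrite Z.abs_eq, <- INR_IZR_INZ, (Rplus_comm 1) by lia. apply inv_sqrt_telescope.
      pose proof (pos_INR n). lra. }
    simpl Nat.add. lra.
Qed.

Lemma zweight_range_sum N : (rsum zweight (zrange N) <= 8)%R.
Proof.
  assert (Hn : forall n, (rsum (fun i => zweight (Z.of_nat i)) (seq 0 n) <= 4)%R).
  { intros n. pose proof (zweight_nat_sum n). assert (0 < / sqrt (INR n + 1))%R.
    { apply Rinv_0_lt_compat, sqrt_lt_R0. pose proof (pos_INR n). lra. }
    lra. }
  set (l := map (fun i => - Z.of_nat i)%Z (seq 1 N) ++ map Z.of_nat (seq 0 (S N))).
  rewrite (rsum_perm _ (zrange N) l).
  - unfold l. rewrite rsum_app, !rsum_map.
    assert (E : rsum (fun i => zweight (- Z.of_nat i)) (seq 1 N) = rsum (fun i => zweight (Z.of_nat i)) (seq 1 N)).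
    { generalize (seq 1 N). induction l0; simpl; [reflexivity |]. rewrite IHl0. unfold zweight. now rewrite Z.abs_opp. }
    rewrite E. pose proof (Hn (S N)) as h. assert (h' : (rsum (fun i => zweight (Z.of_nat i)) (seq 1 N) <= 4)%R).
    { simpl in h. pose proof (zweight_pos 0). simpl in *. lra. }
    lra.
  - apply NoDup_Permutation; [apply zrange_NoDup | |].
    + apply NoDup_app.
      * apply FinFun.Injective_map_NoDup; [intros x y h; lia | apply seq_NoDup].
      * apply FinFun.Injective_map_NoDup; [intros x y h; lia | apply seq_NoDup].
      * intros z h1 h2. apply in_map_iff in h1, h2. destruct h1 as (i & <- & hi), h2 as (j & E & hj).
        apply in_seq in hi, hj. lia.
    + intros z. rewrite zrange_In. unfold l. rewrite in_app_iff, !in_map_iff. split.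
      * intros h. destruct (Z_lt_le_dec z 0).
        -- left. exists (Z.to_nat (- z)). rewrite in_seq. lia.
        -- right. exists (Z.to_nat z). rewrite in_seq. lia.
      * intros [(i & <- & hi) | (i & <- & hi)]; apply in_seq in hi; lia.
Qed.

Lemma zweight_summable : summable (fun p : Z * Z => zweight (fst p) * zweight (snd p))%R.
Proof.
  (* The square of the bound [8] for one factor. *)
  exists 64%R. split.
  - intros p. left. apply Rmult_lt_0_compat; apply zweight_pos.
  - intros l hl.
    assert (HN : exists N, incl l (zsquare N)).
    { clear hl. induction l as [| p l (N & IH)]; [exists 0%nat; intros x [] |].
      destruct (zsquare_exhausts p) as (N' & H'). exists (Nat.max N N'). intros x [<- | hx].
      - apply H'. lia.
      - apply IH, zsquare_In in hx. apply zsquare_In. lia. }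
    destruct HN as (N & HN). eapply Rle_trans.
    + apply (rsum_incl _ l (zsquare N)); auto using zsquare_NoDup.
      intros p. left. apply Rmult_lt_0_compat; apply zweight_pos.
    + unfold zsquare. rewrite rsum_prod_mult. pose proof (zweight_range_sum N).
      assert (0 <= rsum zweight (zrange N))%R by (apply rsum_nonneg; intros; left; apply zweight_pos). nra.
Qed.

Definition znorm (p : Z * Z) : R := (IZR (Z.abs (fst p)) + IZR (Z.abs (snd p)))%R.

Lemma znorm_ge_1 p : p <> (0, 0)%Z -> (1 <= znorm p)%R.
Proof.
  intros h. unfold znorm. rewrite <- plus_IZR. apply IZR_le. destruct p as [m n]. simpl.
  destruct (Z.eq_dec m 0) as [-> |]; [destruct (Z.eq_dec n 0) as [-> |]; [congruence | lia] | lia].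
Qed.

Lemma inv_cube_le_zweight p :
  p <> (0, 0)%Z -> (/ znorm p ^ 3 <= 4 * (zweight (fst p) * zweight (snd p)))%R.
Proof.
  intros hp. pose proof (znorm_ge_1 p hp) as h1. destruct p as [m n]. unfold zweight, znorm in *. simpl fst in *. simpl snd in *.
  assert (ha : (0 <= IZR (Z.abs m))%R) by (apply IZR_le; lia).
  assert (hb : (0 <= IZR (Z.abs n))%R) by (apply IZR_le; lia).
  set (a := IZR (Z.abs m)) in *. set (b := IZR (Z.abs n)) in *.
  pose proof (sqrt_lt_R0 (1 + a) ltac:(lra)) as s1. pose proof (sqrt_lt_R0 (1 + b) ltac:(lra)) as s2.
  pose proof (sqrt_sqrt (1 + a) ltac:(lra)) as q1. pose proof (sqrt_sqrt (1 + b) ltac:(lra)) as q2.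
  set (x := sqrt (1 + a)) in *. set (y := sqrt (1 + b)) in *.
  rewrite <- Rinv_mult.
  (* AM-GM: [2 x y <= x^2 + y^2 = 2 + a + b <= 3 (a + b)] *)
  assert (hxy : (x * y <= 3 / 2 * (a + b))%R) by (pose proof (pow2_ge_0 (x - y)); nra).
  assert (hxy0 : (0 < x * y)%R) by nra.
  rewrite <- q1, <- q2. replace (x * x * x * (y * y * y))%R with ((x * y) ^ 3)%R by ring.
  assert (h3 : ((x * y) ^ 3 <= (3 / 2 * (a + b)) ^ 3)%R) by (apply pow_incr; lra).
  assert (h4 : (0 < (x * y) ^ 3)%R) by (apply pow_lt; lra).
  assert (h5 : (0 < (a + b) ^ 3)%R) by (apply pow_lt; lra).
  apply (Rmult_le_reg_l ((a + b) ^ 3)); [exact h5 |]. rewrite Rinv_r by lra.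
  apply (Rmult_le_reg_r ((x * y) ^ 3)); [exact h4 |].
  rewrite Rmult_1_l. replace ((a + b) ^ 3 * (4 * / (x * y) ^ 3) * (x * y) ^ 3)%R with (4 * (a + b) ^ 3)%R by (field; nra).
  eapply Rle_trans; [exact h3 |]. rewrite Rpow_mult_distr. nra.
Qed.

Definition inv_cube (p : Z * Z) : R := if excluded_middle_informative (p = (0, 0)%Z) then 0%R else (/ znorm p ^ 3)%R.

Lemma inv_cube_summable : summable inv_cube.
Proof.
  apply (summable_le _ (fun p => 4 * (zweight (fst p) * zweight (snd p)))%R).
  - intros p. unfold inv_cube. destruct (excluded_middle_informative (p = (0, 0)%Z)) as [_ | h].
    + split; [lra |]. pose proof (zweight_pos (fst p)). pose proof (zweight_pos (snd p)). nra.
    + split; [| now apply inv_cube_le_zweight]. left. apply Rinv_0_lt_compat, pow_lt.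
      pose proof (znorm_ge_1 p h). lra.
  - apply summable_scal; [lra | apply zweight_summable].
Qed.

(** * The Weierstrass function *)

Notation lat w1 w2 q := (lattice_point w1 w2 (fst q) (snd q)).

(** In contrast to [wp_term], the origin carries the term [/ u ^ 2], so that the whole function is a
    single sum over the lattice and can be reindexed at once. *)
Definition wpt (u w1 w2 : C) (q : Z * Z) : C :=
  if excluded_middle_informative (q = (0, 0)%Z) then / u ^ 2
  else / (u - lat w1 w2 q) ^ 2 - / (lat w1 w2 q) ^ 2.

(** The oriented area of the parallelogram on [w1], [w2]: nonzero exactly when they are linearly
    independent over the reals. *)
Definition indep (w1 w2 : C) : Prop := Im (Cconj w1 * w2) <> 0%R.

Lemma wp_term_wpt u w1 w2 q :
  wp_term u w1 w2 (fst q) (snd q) =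
  wpt u w1 w2 q + (if excluded_middle_informative (q = (0, 0)%Z) then - / u ^ 2 else 0).
Proof.
  destruct q as [m n]. unfold wp_term, wpt. simpl fst. simpl snd.
  destruct (excluded_middle_informative ((m, n) = (0, 0)%Z)) as [E | N].
  - injection E as -> ->. simpl. ring.
  - destruct (Z.eqb_spec m 0) as [-> |]; [destruct (Z.eqb_spec n 0) as [-> |] |]; simpl; try ring. congruence.
Qed.

(** The imaginary part of [conj w1 * L] isolates [n], that of [conj w2 * L] isolates [m]. The bound
    uses [I0] and [B] instead of the half-periods so as to hold uniformly while these vary. *)
Lemma lattice_lower (w1 w2 : C) (I0 B : R) q :
  (0 <= I0 <= Rabs (Im (Cconj w1 * w2)))%R -> (0 < B)%R -> (Cmod w1 + Cmod w2 <= B)%R ->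
  (2 * I0 / B * znorm q <= Cmod (lat w1 w2 q))%R.
Proof.
  intros [hI0 hI] hB Hw. destruct q as [m n]. unfold znorm, lattice_point. simpl fst. simpl snd.
  set (L := 2 * RtoC (IZR m) * w1 + 2 * RtoC (IZR n) * w2).
  rewrite !abs_IZR. set (D := Im (Cconj w1 * w2)) in *.
  assert (h1 : (2 * Rabs (IZR n) * Rabs D <= Cmod w1 * Cmod L)%R).
  { rewrite <- (Cmod_conj w1), <- Cmod_mult. eapply Rle_trans; [| apply Im_le_Cmod].
    replace (Im (Cconj w1 * L)) with (2 * IZR n * D)%R by (unfold L, D; reim; ring).
    rewrite !Rabs_mult, (Rabs_pos_eq 2) by lra. lra. }
  assert (h2 : (2 * Rabs (IZR m) * Rabs D <= Cmod w2 * Cmod L)%R).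
  { rewrite <- (Cmod_conj w2), <- Cmod_mult. eapply Rle_trans; [| apply Im_le_Cmod].
    replace (Im (Cconj w2 * L)) with (- (2 * IZR m * D))%R by (unfold L, D; reim; ring).
    rewrite Rabs_Ropp, !Rabs_mult, (Rabs_pos_eq 2) by lra. lra. }
  pose proof (Cmod_ge_0 L). pose proof (Rabs_pos (IZR m)). pose proof (Rabs_pos (IZR n)).
  apply (Rmult_le_reg_l B); [exact hB |].
  replace (B * (2 * I0 / B * (Rabs (IZR m) + Rabs (IZR n))))%R with (2 * I0 * (Rabs (IZR m) + Rabs (IZR n)))%R by (field; lra).
  nra.
Qed.

(** Put [a = 1/L], [b = 1/(u - L)]; then [a + b = u a b], hence [b^2 - a^2 = u a b (b - a)] and
    [a^3 + b^3 = u a b (a^2 - a b + b^2)]. Each factor [u] gained brings one more power of decay,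
    which in the derivative compensates the growth of [L']. *)
Lemma term_bounds (u L u' L' : C) (x U W : R) :
  (0 < x)%R -> (x <= Cmod L)%R -> (2 * Cmod u <= x)%R -> (Cmod u <= U)%R -> (Cmod u' <= U)%R -> (Cmod L' <= W)%R ->
  L <> 0 /\ u - L <> 0 /\
  (Cmod (/ (u - L) ^ 2 - / L ^ 2) <= 6 * U / x ^ 3)%R /\
  (Cmod (- (2) * (u' - L') / (u - L) ^ 3 + 2 * L' / L ^ 3) <= 16 * U / x ^ 3 + 28 * W * U / x ^ 4)%R.
Proof.
  intros hx hL hu hU hu' hL'.
  assert (nL : L <> 0) by (apply Cmod_gt_0; lra).
  assert (h2 : (x / 2 <= Cmod (u - L))%R) by (pose proof (Cmod_sub_ge L u); rewrite Cmod_sub_comm; lra).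
  assert (nuL : u - L <> 0) by (apply Cmod_gt_0; lra).
  split; [exact nL |]. split; [exact nuL |].
  set (a := / L). set (b := / (u - L)). set (y := (/ x)%R).
  assert (hy : (0 < y)%R) by (apply Rinv_0_lt_compat, hx).
  assert (ha : (Cmod a <= y)%R) by (unfold a; rewrite Cmod_inv by exact nL; now apply Rinv_le_contravar).
  assert (hb : (Cmod b <= 2 * y)%R).
  { unfold b. rewrite Cmod_inv by exact nuL. replace (2 * y)%R with (/ (x / 2))%R by (unfold y; field; lra).
    apply Rinv_le_contravar; lra. }
  pose proof (Cmod_ge_0 a) as a0. pose proof (Cmod_ge_0 b) as b0. pose proof (Cmod_ge_0 u) as u0.
  pose proof (Cmod_ge_0 L') as L0.
  assert (yy : (0 < y * y)%R) by nra.
  split.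
  - replace (/ (u - L) ^ 2 - / L ^ 2) with (u * (a * b * b - a * a * b)) by (unfold a, b; field; auto).
    replace (6 * U / x ^ 3)%R with (U * (y * (2 * y) * (2 * y) + y * y * (2 * y)))%R by (unfold y; field; lra).
    rewrite Cmod_mult. apply Rmult_le_compat; try apply Cmod_ge_0; [exact hU |].
    eapply Rle_trans; [apply Cmod_sub_le |]. rewrite !Cmod_mult.
    apply Rplus_le_compat; repeat apply Rmult_le_compat; auto; nra.
  - replace (- (2) * (u' - L') / (u - L) ^ 3 + 2 * L' / L ^ 3)
      with (- (2) * (u' * (b * b * b)) + 2 * (L' * (u * (a * b * (a * a - a * b + b * b))))) by (unfold a, b; field; auto).
    replace (16 * U / x ^ 3 + 28 * W * U / x ^ 4)%R
      with (2 * (U * (2 * y * (2 * y) * (2 * y))) + 2 * (W * (U * (y * (2 * y) * (y * y + y * (2 * y) + 2 * y * (2 * y))))))%R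
      by (unfold y; field; lra).
    eapply Rle_trans; [apply Cmod_triangle |]. rewrite !Cmod_mult, Cmod_opp, Cmod_R, Rabs_pos_eq by lra.
    assert (hab : (Cmod (a * a - a * b + b * b) <= y * y + y * (2 * y) + 2 * y * (2 * y))%R).
    { eapply Rle_trans; [apply Cmod_triangle |]. rewrite (Cmod_mult b b).
      apply Rplus_le_compat; [| apply Rmult_le_compat; auto].
      eapply Rle_trans; [apply Cmod_sub_le |]. rewrite !Cmod_mult.
      apply Rplus_le_compat; apply Rmult_le_compat; auto. }
    pose proof (Cmod_ge_0 (a * a - a * b + b * b)). pose proof (Cmod_ge_0 u').
    apply Rplus_le_compat; (apply Rmult_le_compat_l; [lra |]).
    + apply Rmult_le_compat; auto; [apply Rmult_le_pos; nra |]. repeat apply Rmult_le_compat; auto; nra.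
    + apply Rmult_le_compat; auto; [repeat apply Rmult_le_pos; auto |].
      apply Rmult_le_compat; auto; [repeat apply Rmult_le_pos; auto |].
      apply Rmult_le_compat; auto; [nra |]. apply Rmult_le_compat; auto.
Qed.

Lemma wpt_deriv (u w1 w2 : C -> C) (u' w1' w2' z : C) q :
  cderiv u z u' -> cderiv w1 z w1' -> cderiv w2 z w2' -> q <> (0, 0)%Z ->
  lat (w1 z) (w2 z) q <> 0 -> u z - lat (w1 z) (w2 z) q <> 0 ->
  cderiv (fun z => wpt (u z) (w1 z) (w2 z) q) z
    (- (2) * (u' - lat w1' w2' q) / (u z - lat (w1 z) (w2 z) q) ^ 3 + 2 * lat w1' w2' q / lat (w1 z) (w2 z) q ^ 3).
Proof.
  intros Hu H1 H2 hq nL nuL.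
  assert (HL : cderiv (fun z => lat (w1 z) (w2 z) q) z (lat w1' w2' q)).
  { apply deriv_plus; apply deriv_scal; assumption. }
  unfold wpt. destruct (excluded_middle_informative (q = (0, 0)%Z)); [tauto |].
  eapply deriv_eq.
  - apply deriv_minus; apply deriv_inv; try (now apply Cpow_nz); apply deriv_pow;
      [apply deriv_minus; [exact Hu | exact HL] | exact HL].
  - cbv beta. replace (INR 2) with 2%R by (simpl; ring). change (2 - 1)%nat with 1%nat. field. auto.
Qed.

Lemma zsquare_outside_norm (x : R) : exists N, forall q, ~ In q (zsquare N) -> (x <= znorm q)%R /\ q <> (0, 0)%Z.
Proof.
  exists (Z.to_nat (up x)). intros q hq. destruct (archimed x) as [h _]. split.
  - rewrite zsquare_In in hq. unfold znorm. rewrite <- plus_IZR.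
    assert (up x <= Z.abs (fst q) + Z.abs (snd q))%Z by lia.
    apply IZR_le in H. lra.
  - intros ->. apply hq, zsquare_In. simpl. lia.
Qed.

Lemma inv_cube_neq q : q <> (0, 0)%Z -> inv_cube q = (/ znorm q ^ 3)%R.
Proof. intros h. unfold inv_cube. destruct (excluded_middle_informative (q = (0, 0)%Z)); tauto. Qed.

Lemma inv_cube_nonneg q : (0 <= inv_cube q)%R.
Proof.
  unfold inv_cube. destruct (excluded_middle_informative (q = (0, 0)%Z)) as [|h]; [lra |].
  left. apply Rinv_0_lt_compat, pow_lt. pose proof (znorm_ge_1 q h). lra.
Qed.

(* Outside the finite set [l0] all terms, and their derivatives along
   variations [u'], [w1'], [w2'], are dominated by [1/(|m|+|n|)^3]. *)
Lemma wpt_tail_bounds (u w1 w2 u' w1' w2' : C) (c U W : R) q :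
  (0 < c)%R -> (0 <= W)%R -> q <> (0, 0)%Z -> (2 * U <= c * znorm q)%R ->
  (c * znorm q <= Cmod (lat w1 w2 q))%R ->
  (Cmod u <= U)%R -> (Cmod u' <= U)%R -> (Cmod w1' <= W)%R -> (Cmod w2' <= W)%R ->
  let K := (16 * U / c ^ 3 + 56 * W * U / c ^ 4)%R in
  lat w1 w2 q <> 0 /\ u - lat w1 w2 q <> 0 /\
  (Cmod (wpt u w1 w2 q) <= K * inv_cube q)%R /\
  (Cmod (- (2) * (u' - lat w1' w2' q) / (u - lat w1 w2 q) ^ 3 + 2 * lat w1' w2' q / lat w1 w2 q ^ 3) <= K * inv_cube q)%R.
Proof.
  intros hc hW hq hU hL hu hu' h1 h2 K. pose proof (znorm_ge_1 q hq) as hk. rewrite inv_cube_neq by exact hq.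
  assert (U0 : (0 <= U)%R) by (pose proof (Cmod_ge_0 u); lra).
  assert (hL' : (Cmod (lat w1' w2' q) <= 2 * W * znorm q)%R).
  { destruct q as [m n]. unfold lattice_point, znorm. simpl fst. simpl snd. eapply Rle_trans; [apply Cmod_triangle |].
    rewrite !Cmod_mult, !Cmod_R, (Rabs_pos_eq 2), !abs_IZR by lra.
    pose proof (Rabs_pos (IZR m)). pose proof (Rabs_pos (IZR n)). nra. }
  destruct (term_bounds u (lat w1 w2 q) u' (lat w1' w2' q) (c * znorm q) U (2 * W * znorm q)) as (a1 & a2 & a3 & a4); auto; try nra.
  set (k := znorm q) in *.
  assert (k3 : (0 < / k ^ 3)%R) by (apply Rinv_0_lt_compat, pow_lt; lra).
  assert (c3 : (0 < / c ^ 3)%R) by (apply Rinv_0_lt_compat, pow_lt; lra).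
  assert (c4 : (0 < / c ^ 4)%R) by (apply Rinv_0_lt_compat, pow_lt; lra).
  split; [exact a1 |]. split; [exact a2 |]. split.
  - unfold wpt. destruct (excluded_middle_informative (q = (0, 0)%Z)); [tauto |].
    eapply Rle_trans; [exact a3 |]. replace (6 * U / (c * k) ^ 3)%R with (6 * U * / c ^ 3 * / k ^ 3)%R by (field; lra).
    apply Rmult_le_compat_r; [lra |]. unfold K, Rdiv.
    assert (0 <= U * / c ^ 3)%R by nra. assert (0 <= W * U * / c ^ 4)%R by (apply Rmult_le_pos; nra). lra.
  - eapply Rle_trans; [exact a4 |].
    replace (16 * U / (c * k) ^ 3 + 28 * (2 * W * k) * U / (c * k) ^ 4)%R with (K * / k ^ 3)%R by (unfold K; field; lra).
    lra.
Qed.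

Lemma indep_lower w1 w2 : indep w1 w2 ->
  exists c, (0 < c)%R /\ forall q, (c * znorm q <= Cmod (lat w1 w2 q))%R.
Proof.
  intros h. apply Rabs_pos_lt in h as h'. pose proof (Cmod_ge_0 w1). pose proof (Cmod_ge_0 w2).
  exists (2 * Rabs (Im (Cconj w1 * w2)) / (Cmod w1 + Cmod w2 + 1))%R. split.
  - apply Rdiv_lt_0_compat; lra.
  - intros q. apply lattice_lower; lra.
Qed.

Lemma wpt_has_sum_exists u w1 w2 : indep w1 w2 -> exists s, has_sum (wpt u w1 w2) s.
Proof.
  intros h. destruct (indep_lower w1 w2 h) as (c & hc & Hc). pose proof (Cmod_ge_0 u) as hu.
  destruct (zsquare_outside_norm (2 * Cmod u / c)) as (N & HN).
  destruct (has_sum_exists (fun q => if memb (zsquare N) q then 0 else wpt u w1 w2 q)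
    (fun q => (16 * Cmod u / c ^ 3 + 56 * 0 * Cmod u / c ^ 4) * inv_cube q)%R) as (s & Hs).
  - intros q. destruct (memb (zsquare N) q) eqn:E.
    + rewrite Cmod_0. apply Rmult_le_pos; [| apply inv_cube_nonneg].
      rewrite Rmult_0_r, Rmult_0_l. unfold Rdiv. rewrite Rmult_0_l, Rplus_0_r.
      apply Rmult_le_pos; [lra |]. left. apply Rinv_0_lt_compat, pow_lt, hc.
    + apply memb_false in E. destruct (HN q E) as [h1 h2].
      apply (wpt_tail_bounds u w1 w2 0 0 0 c (Cmod u) 0 q); auto; try (rewrite Cmod_0; lra); try lra.
      apply (Rmult_le_compat_l c) in h1; [| lra]. replace (c * (2 * Cmod u / c))%R with (2 * Cmod u)%R in h1 by (field; lra). exact h1.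
  - apply summable_scal; [| exact inv_cube_summable].
    rewrite Rmult_0_r, Rmult_0_l. unfold Rdiv. rewrite Rmult_0_l, Rplus_0_r.
    apply Rmult_le_pos; [lra |]. left. apply Rinv_0_lt_compat, pow_lt, hc.
  - exists (s + lsum (wpt u w1 w2) (zsquare N)). apply (has_sum_split _ _ _ (zsquare_NoDup N)).
    replace (s + _ - _) with s by ring. exact Hs.
Qed.

(** Also when [u] is a lattice point: one term is then an inverse of [0] with its default value, and
    the others still converge. *)
Lemma wp_has_sum u w1 w2 : indep w1 w2 -> has_sum (wpt u w1 w2) (wp u w1 w2).
Proof.
  intros h. destruct (wpt_has_sum_exists u w1 w2 h) as (s & Hs).
  assert (Ht : has_sum (fun q => wp_term u w1 w2 (fst q) (snd q)) (s + - / u ^ 2)).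
  { eapply has_sum_ext; [intros q; symmetry; apply wp_term_wpt |].
    apply has_sum_plus; [exact Hs | apply has_sum_single]. }
  replace (wp u w1 w2) with s; [exact Hs |].
  unfold wp. replace (CLim_seq _) with (s + - / u ^ 2); [ring |]. symmetry. unfold CLim_seq.
  apply (iota_filterlim_locally (V := C_CompleteNormedModule)).
  pose proof (has_sum_exhaustion _ _ zsquare zsquare_NoDup zsquare_exhausts Ht) as H.
  eapply filterlim_ext; [| exact H]. intros N. cbv beta. unfold zsquare.
  rewrite lsum_prod. unfold zrange. rewrite lsum_map, lsum_seq. apply sum_n_ext. intros i.
  rewrite lsum_map, lsum_seq. apply sum_n_ext. intros j. reflexivity.
Qed.

(** Both bases span the same lattice, and the bijection of the indices fixes the origin, hence
    matches the exceptional term. *)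
Lemma wp_change_basis u w1 w2 (a b c d : Z) :
  (a * d - b * c = 1)%Z -> indep w1 w2 ->
  wp u (RtoC (IZR a) * w1 + RtoC (IZR b) * w2) (RtoC (IZR c) * w1 + RtoC (IZR d) * w2) = wp u w1 w2.
Proof.
  intros hdet hi. set (v1 := RtoC (IZR a) * w1 + RtoC (IZR b) * w2). set (v2 := RtoC (IZR c) * w1 + RtoC (IZR d) * w2).
  assert (hR : (IZR a * IZR d - IZR b * IZR c = 1)%R) by (rewrite <- !mult_IZR, <- minus_IZR, hdet; reflexivity).
  assert (hv : indep v1 v2).
  { unfold indep in *. replace (Im (Cconj v1 * v2)) with ((IZR a * IZR d - IZR b * IZR c) * Im (Cconj w1 * w2))%R.
    - now rewrite hR, Rmult_1_l.
    - unfold v1, v2. reim. ring. }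
  eapply has_sum_unique; [apply wp_has_sum, hv |].
  (* The row vector [q] times the matrix; [g] is the inverse by the determinant condition. *)
  set (f := fun q : Z * Z => (fst q * a + snd q * c, fst q * b + snd q * d)%Z).
  set (g := fun q : Z * Z => (d * fst q - c * snd q, - b * fst q + a * snd q)%Z).
  assert (gf : forall q, g (f q) = q).
  { intros [m n]. unfold f, g. simpl. f_equal.
    - replace (d * (m * a + n * c) - c * (m * b + n * d))%Z with ((a * d - b * c) * m)%Z by ring. rewrite hdet. ring.
    - replace (- b * (m * a + n * c) + a * (m * b + n * d))%Z with ((a * d - b * c) * n)%Z by ring. rewrite hdet. ring. }
  assert (fg : forall q, f (g q) = q).
  { intros [m n]. unfold f, g. simpl. f_equal.
    - replace ((d * m - c * n) * a + (- b * m + a * n) * c)%Z with ((a * d - b * c) * m)%Z by ring. rewrite hdet. ring.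
    - replace ((d * m - c * n) * b + (- b * m + a * n) * d)%Z with ((a * d - b * c) * n)%Z by ring. rewrite hdet. ring. }
  eapply has_sum_ext; [| exact (has_sum_reindex f g _ _ gf fg (wp_has_sum u w1 w2 hi))].
  intros q. cbv beta. unfold wpt.
  assert (E : lat v1 v2 q = lat w1 w2 (f q)).
  { unfold lattice_point, f, v1, v2. simpl. rewrite !plus_IZR, !mult_IZR, !RtoC_plus, !RtoC_mult. ring. }
  rewrite <- E.
  destruct (excluded_middle_informative (q = (0, 0)%Z)) as [-> | N1];
  destruct (excluded_middle_informative (f _ = (0, 0)%Z)) as [E2 | N2]; try reflexivity.
  - exfalso. now apply N2.
  - exfalso. apply N1. rewrite <- (gf q), E2. unfold g. simpl. f_equal; ring.
Qed.

(** Reindexing by the symmetry [q -> - q] of the lattice. *)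
Lemma wp_even u w1 w2 : indep w1 w2 -> wp (- u) w1 w2 = wp u w1 w2.
Proof.
  intros hi. eapply has_sum_unique; [apply wp_has_sum, hi |].
  set (f := fun q : Z * Z => (- fst q, - snd q)%Z).
  assert (ff : forall q, f (f q) = q) by (intros [m n]; unfold f; simpl; f_equal; ring).
  eapply has_sum_ext; [| exact (has_sum_reindex f f _ _ ff ff (wp_has_sum u w1 w2 hi))].
  intros q. cbv beta. unfold wpt.
  assert (E : lat w1 w2 (f q) = - lat w1 w2 q).
  { unfold lattice_point, f. simpl. rewrite !opp_IZR, !RtoC_opp. ring. }
  rewrite E.
  destruct (excluded_middle_informative (q = (0, 0)%Z)) as [-> | N1];
  destruct (excluded_middle_informative (f _ = (0, 0)%Z)) as [E2 | N2].
  - now replace ((- u) ^ 2) with (u ^ 2) by ring.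
  - exfalso. now apply N2.
  - exfalso. apply N1. rewrite <- (ff q), E2. reflexivity.
  - replace ((- u - lat w1 w2 q) ^ 2) with ((u - - lat w1 w2 q) ^ 2) by ring.
    now replace ((- lat w1 w2 q) ^ 2) with (lat w1 w2 q ^ 2) by ring.
Qed.

(** * Meromorphic functions *)

Definition holo_at (p : C) (f : C -> C) : Prop := near cid p (fun z => exists l, cderiv f z l).

Definition pnear (p : C) (P : C -> Prop) : Prop := near cid p (fun z => z <> p -> P z).

Lemma germ_eq_pnear p f g : germ_eq p f g <-> pnear p (fun z => f z = g z).
Proof. unfold germ_eq, locally', within. apply (locally_near p). Qed.

Lemma meromorphic_at_iff p f :
  meromorphic_at p f <-> exists n g, holo_at p g /\ pnear p (fun z => (z - p) ^ n * f z = g z).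
Proof.
  split.
  - intros (n & g & H1 & H2). exists n, g. split.
    + apply locally_near in H1. refine (near_imp _ _ _ _ _ H1). intros z [l hl]. exists l.
      now apply is_derive_cderiv.
    + apply (locally_near p) in H2. exact H2.
  - intros (n & g & H1 & H2). exists n, g. split.
    + apply locally_near. refine (near_imp _ _ _ _ _ H1). intros z [l hl]. exists l.
      now apply is_derive_cderiv.
    + apply (locally_near p). exact H2.
Qed.

Lemma pnear_and p P Q : pnear p P -> pnear p Q -> pnear p (fun z => P z /\ Q z).
Proof. intros H1 H2. refine (near_imp _ _ _ _ _ (near_and _ _ _ _ H1 H2)). intros z [a b] h. auto. Qed.

Lemma pnear_imp p (P Q : C -> Prop) : (forall z, P z -> Q z) -> pnear p P -> pnear p Q.
Proof. intros H H1. refine (near_imp _ _ _ _ _ H1). intros z a h. auto. Qed.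

Lemma pnear_near p (P : C -> Prop) : near cid p P -> pnear p P.
Proof. intros H. refine (near_imp _ _ _ _ _ H). auto. Qed.

Lemma holo_plus p f g : holo_at p f -> holo_at p g -> holo_at p (fun z => f z + g z).
Proof.
  intros H1 H2. refine (near_imp _ _ _ _ _ (near_and _ _ _ _ H1 H2)). intros z [[l hl] [m hm]].
  eexists. apply deriv_plus; eassumption.
Qed.

Lemma holo_mult p f g : holo_at p f -> holo_at p g -> holo_at p (fun z => f z * g z).
Proof.
  intros H1 H2. refine (near_imp _ _ _ _ _ (near_and _ _ _ _ H1 H2)). intros z [[l hl] [m hm]].
  eexists. apply deriv_mult; eassumption.
Qed.

Lemma holo_cont p f : holo_at p f -> ccont f p.
Proof. intros H. destruct (near_at _ _ _ H) as [l hl]. eapply deriv_cont, hl. Qed.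

Lemma holo_inv p f : holo_at p f -> f p <> 0 -> holo_at p (fun z => / f z).
Proof.
  intros H h. pose proof (cont_neq _ _ _ (holo_cont p f H) h) as Hn.
  refine (near_imp _ _ _ _ _ (near_and _ _ _ _ H Hn)). intros z [[l hl] hz].
  eexists. apply deriv_inv; eassumption.
Qed.

Lemma holo_const p c : holo_at p (fun _ => c).
Proof. apply near_all. intros z. exists 0. apply deriv_const. Qed.

Lemma holo_id p : holo_at p (fun z => z).
Proof. apply near_all. intros z. exists 1. apply deriv_id. Qed.

Lemma holo_pow p f n : holo_at p f -> holo_at p (fun z => f z ^ n).
Proof. intros H. induction n; simpl; [apply holo_const | now apply holo_mult]. Qed.

Lemma holo_opp p f : holo_at p f -> holo_at p (fun z => - f z).
Proof. intros H. refine (near_imp _ _ _ _ _ H). intros z [l hl]. eexists. apply deriv_opp, hl. Qed.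

Lemma holo_minus p f g : holo_at p f -> holo_at p g -> holo_at p (fun z => f z - g z).
Proof. intros H1 H2. apply holo_plus; [exact H1 | now apply holo_opp]. Qed.

Lemma holo_mero p f : holo_at p f -> meromorphic_at p f.
Proof.
  intros H. apply meromorphic_at_iff. exists 0%nat, f. split; [exact H |].
  apply near_all. intros z _. simpl. ring.
Qed.

Lemma mero_plus p f g : meromorphic_at p f -> meromorphic_at p g -> meromorphic_at p (fun z => f z + g z).
Proof.
  rewrite !meromorphic_at_iff. intros (n & F & h1 & h2) (m & G & h3 & h4).
  exists (n + m)%nat, (fun z => (z - p) ^ m * F z + (z - p) ^ n * G z). split.
  - assert (Hp : forall k, holo_at p (fun z => (z - p) ^ k)).
    { intros k. apply holo_pow, holo_minus; [apply holo_id | apply holo_const]. }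
    apply holo_plus; apply holo_mult; auto.
  - refine (pnear_imp _ _ _ _ (pnear_and _ _ _ h2 h4)). intros z [<- <-]. rewrite Cpow_add_r. ring.
Qed.

Lemma mero_ext p f g : pnear p (fun z => f z = g z) -> meromorphic_at p f -> meromorphic_at p g.
Proof.
  rewrite !meromorphic_at_iff. intros H (n & F & h1 & h2). exists n, F. split; [exact h1 |].
  refine (pnear_imp _ _ _ _ (pnear_and _ _ _ H h2)). intros z [<- h]. exact h.
Qed.

Lemma mero_lsum {I} p (T : I -> C -> C) l :
  (forall i, In i l -> meromorphic_at p (T i)) -> meromorphic_at p (fun z => lsum (fun i => T i z) l).
Proof.
  induction l; simpl; intros H; [apply holo_mero, holo_const |]. apply mero_plus; auto.
Qed.

(* Near a simple zero, [(z-p)^4/f^2] is holomorphic: at [p] it is [O((z-p)^2)]. *)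
Lemma mero_inv_sqr p f l :
  holo_at p f -> cderiv f p l -> (f p = 0 -> l <> 0) -> meromorphic_at p (fun z => / f z ^ 2).
Proof.
  intros Hf Hl hz. destruct (classic (f p = 0)) as [E | N].
  2:{ apply holo_mero, holo_inv; [now apply holo_pow | now apply Cpow_nz]. }
  specialize (hz E). apply meromorphic_at_iff.
  destruct Hl as (phi & Ep & Hc & Hn).
  assert (Hphi : near cid p (fun z => phi z <> 0)) by (apply cont_neq; [exact Hc | now rewrite Ep]).
  exists 4%nat, (fun z => if excluded_middle_informative (z = p) then RtoC 0 else (z - p) ^ 4 * / f z ^ 2). split.
  - destruct (near_and _ _ _ _ Hn (near_and _ _ _ _ Hphi Hf)) as (d & hd & H). unfold cid in H.
    exists d. split; [exact hd |]. unfold cid. intros z hzd. destruct (classic (z = p)) as [-> | hzp].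
    + exists 0. exists (fun z => if excluded_middle_informative (z = p) then RtoC 0 else (z - p) * / phi z ^ 2).
      destruct (excluded_middle_informative (p = p)) as [_ | c]; [| tauto]. split; [reflexivity |]. split.
      * apply (cont_ext cid (fun z => (z - p) * / phi z ^ 2)).
        -- apply near_all. intros z. destruct (excluded_middle_informative (z = p)) as [-> |]; [ring | reflexivity].
        -- apply cont_mult; [apply cont_minus; [apply cont_id | apply cont_const] |].
           apply cont_inv; [now apply cont_pow | apply Cpow_nz; now rewrite Ep].
      * exists d. split; [exact hd |]. unfold cid. intros z hz'. destruct (H z hz') as (h1 & h2 & _).
        destruct (excluded_middle_informative (z = p)) as [-> | hzp]; [ring |].
        rewrite h1, E. field. split; [exact h2 |].
        intros E'. apply hzp, Cmod_eq_sub_0. now rewrite E', Cmod_0.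
    + destruct (H z hzd) as (h1 & h2 & [m hm]).
      assert (hzp' : z - p <> 0) by (intros E'; apply hzp, Cmod_eq_sub_0; now rewrite E', Cmod_0).
      assert (fz : f z <> 0).
      { rewrite h1, E. intros E'. replace (0 + (z - p) * phi z) with ((z - p) * phi z) in E' by ring.
        destruct (Cmult_integral _ _ E'); tauto. }
      eexists. eapply (deriv_ext cid (fun z => (z - p) ^ 4 * / f z ^ 2)).
      * refine (near_imp _ _ _ _ _ (cont_neq cid (fun z => z - p) z _ hzp')).
        -- intros y hy. destruct (excluded_middle_informative (y = p)) as [-> |]; [| reflexivity].
           exfalso. apply hy. ring.
        -- apply cont_minus; [apply cont_id | apply cont_const].
      * apply deriv_mult; [apply deriv_pow, deriv_minus; [apply deriv_id | apply deriv_const] |].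
        apply deriv_inv; [apply deriv_pow, hm | now apply Cpow_nz].
  - apply near_all. intros z hzp. destruct (excluded_middle_informative (z = p)); tauto.
Qed.

Lemma sub_neq_0 (x y : C) : x <> y -> x - y <> 0.
Proof. intros h E. apply h, Cmod_eq_sub_0. now rewrite E, Cmod_0. Qed.

Lemma near_neq (p q : C) : p <> q -> near cid p (fun z => z <> q).
Proof.
  intros h. apply sub_neq_0, Cmod_gt_0 in h. exists (Cmod (p - q)). split; [exact h |].
  unfold cid. intros z hz ->. rewrite Cmod_sub_comm in hz. lra.
Qed.

(** Off [p], a small disc about [q] misses [p], so the puncture may be moved. *)
Lemma pnear_open p (P : C -> Prop) : pnear p P -> near cid p (fun q => pnear q P).
Proof.
  intros H. pose proof (near_near _ _ _ H) as H2.
  refine (near_imp _ _ _ _ _ H2). cbv beta. intros q hq. destruct (classic (q = p)) as [-> | N]; [exact H |].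
  refine (near_imp _ _ _ _ _ (near_and _ _ _ _ hq (near_neq q p N))). intros z [h1 h2] _. auto.
Qed.

Lemma cont_pnear_zero p f : ccont f p -> pnear p (fun z => f z = 0) -> near cid p (fun z => f z = 0).
Proof.
  intros Hc H. assert (E : f p = 0).
  { apply Cmod_eq_0, Rle_antisym; [| apply Cmod_ge_0]. apply le_epsilon. intros eps he. rewrite Rplus_0_l.
    destruct (near_and _ _ _ _ H (Hc eps he)) as (d & hd & Hd). unfold cid in Hd.
    destruct (Hd (p + RtoC (d / 2))) as [h1 h2].
    - replace (p + RtoC (d / 2) - p) with (RtoC (d / 2)) by ring. rewrite Cmod_R, Rabs_pos_eq; lra.
    - rewrite h1 in h2.
      + rewrite Cmod_sub_comm in h2. replace (f p - 0) with (f p) in h2 by ring. lra.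
      + intros E. apply (f_equal Re) in E. revert E. reim. lra. }
  refine (near_imp _ _ _ _ _ H). cbv beta. intros z hz. destruct (classic (z = p)) as [-> |]; auto.
Qed.

(** The closedness half of the identity theorem for meromorphic germs. The difference [H], cleared
    of denominators, is holomorphic on a disc about [p] of radius independent of [q]; if it vanishes
    near a close enough [q], then the zeros spread over [p]. *)
Lemma mero_agree_limit p f g :
  meromorphic_at p f -> meromorphic_at p g ->
  near cid p (fun q => pnear q (fun z => f z = g z) -> pnear p (fun z => f z = g z)).
Proof.
  rewrite !meromorphic_at_iff. intros (n & F & h1 & h2) (m & G & h3 & h4).
  set (H := fun z => (z - p) ^ m * F z - (z - p) ^ n * G z).
  assert (Hp : forall k, holo_at p (fun z => (z - p) ^ k)).
  { intros k. apply holo_pow, holo_minus; [apply holo_id | apply holo_const]. }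
  assert (HH : holo_at p H) by (apply holo_minus; apply holo_mult; auto).
  destruct (near_and _ _ _ _ HH (near_and _ _ _ _ h2 h4)) as (R & hR & HR). unfold cid in HR.
  (* A disc of radius [R / 2] about [q] stays in the domain of [H]; a tenth of it, [R / 20], covers
     the disc of radius [R / 40] about [p]. *)
  exists (R / 40)%R. split; [lra |]. unfold cid. intros q hq Hq.
  destruct (classic (q = p)) as [-> | N]; [exact Hq |].
  assert (Zq : near cid q (fun z => H z = 0)).
  { apply cont_pnear_zero.
    - destruct (HR q) as [[l hl] _]; [lra |]. eapply deriv_cont, hl.
    - assert (B : near cid q (fun z => (Cmod (z - p) < R)%R)).
      { exists (R / 2)%R. split; [lra |]. unfold cid. intros z hz. pose proof (Cmod_triangle_sub z q p). lra. }
      refine (near_imp _ _ _ _ _ (near_and _ _ _ _ Hq (near_and _ _ _ _ B (near_neq q p N)))).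
      cbv beta. intros z [a [b c]] d. destruct (HR z b) as (_ & e1 & e2).
      unfold H. rewrite <- e1, <- e2, a by assumption. ring. }
  assert (Zp : forall z, (Cmod (z - p) < R / 40)%R -> H z = 0).
  { intros z hz. apply (vanishing_spreads H q (R / 2)).
    - intros u hu. apply HR. pose proof (Cmod_triangle_sub u q p). lra.
    - exact Zq.
    - pose proof (Cmod_triangle_sub z p q). rewrite (Cmod_sub_comm p q) in H0. lra. }
  exists (R / 40)%R. split; [lra |]. unfold cid. intros z hz hzp.
  destruct (HR z) as (_ & e1 & e2); [lra |]. specialize (Zp z hz). unfold H in Zp.
  rewrite <- e1, <- e2 in Zp by assumption. apply Cmod_eq_sub_0.
  replace ((z - p) ^ m * ((z - p) ^ n * f z) - (z - p) ^ n * ((z - p) ^ m * g z))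
    with ((z - p) ^ m * (z - p) ^ n * (f z - g z)) in Zp by ring.
  apply sub_neq_0 in hzp.
  destruct (Cmult_integral _ _ Zp) as [E | E]; [| now rewrite E, Cmod_0].
  destruct (Cmult_integral _ _ E) as [E' | E']; exfalso; revert E'; now apply Cpow_nz.
Qed.

(** Openness and closedness of [Q] are packed into [Q s <-> Q t] for [s] near [t]; every propagation
    of germs along a curve goes through this. *)
Lemma unit_connected (Q : R -> Prop) :
  (forall t, unit_interval t -> exists d, (0 < d)%R /\
     forall s, unit_interval s -> (Rabs (s - t) < d)%R -> (Q s <-> Q t)) ->
  Q 0%R -> Q 1%R.
Proof.
  intros H H0. unfold unit_interval in H.
  set (E := fun x => (0 <= x <= 1)%R /\ forall y, (0 <= y <= x)%R -> Q y).
  destruct (completeness E) as (s & ub & lub).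
  - exists 1%R. intros x [h _]. lra.
  - exists 0%R. split; [lra |]. intros y hy. replace y with 0%R by lra. exact H0.
  - assert (hs0 : (0 <= s)%R). { apply ub. split; [lra |]. intros y hy. replace y with 0%R by lra. exact H0. }
    assert (hs1 : (s <= 1)%R) by (apply lub; intros x [h _]; lra).
    destruct (H s (conj hs0 hs1)) as (d & hd & Hd).
    assert (below : forall y, (0 <= y < s)%R -> Q y).
    { intros y hy. apply NNPP. intros N. assert (s <= y)%R; [| lra]. apply lub. intros x [hx1 hx2].
      apply Rnot_lt_le. intros h. apply N, hx2. lra. }
    assert (Qs : Q s).
    { destruct (Req_dec s 0) as [-> | n0]; [exact H0 |]. set (y := Rmax 0 (s - d / 2)).
      assert (hy : (0 <= y < s)%R /\ (s - y < d)%R).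
      { unfold y. split; [split; [apply Rmax_l |] |].
        - apply Rmax_lub_lt; lra.
        - pose proof (Rmax_r 0 (s - d / 2)). lra. }
      apply (Hd y); [lra | rewrite Rabs_left; lra | apply below; lra]. }
    destruct (Rlt_dec s 1) as [h | h]; [| now replace 1%R with s by lra].
    exfalso. set (x := Rmin 1 (s + d / 2)).
    assert (hx : (s < x <= 1)%R /\ (x - s < d)%R).
    { unfold x. split; [split; [apply Rmin_glb_lt; lra | apply Rmin_l] |].
      pose proof (Rmin_r 1 (s + d / 2)). lra. }
    assert (Ex : E x).
    { split; [lra |]. intros y hy. destruct (Rlt_dec y s); [apply below; lra |].
      apply Hd; [lra | rewrite Rabs_pos_eq; lra | exact Qs]. }
    apply ub in Ex. lra.
Qed.

(** Along the segment, agreement of the germs is open by [pnear_open] and closed by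
    [mero_agree_limit]. *)
Lemma identity_segm (f g : C -> C) (c z : C) :
  (forall t, unit_interval t -> meromorphic_at (segm c z t) f /\ meromorphic_at (segm c z t) g) ->
  pnear c (fun w => f w = g w) -> pnear z (fun w => f w = g w).
Proof.
  intros H H0. rewrite <- (segm_1 c z). rewrite <- (segm_0 c z) in H0.
  revert H0. apply (unit_connected (fun t => pnear (segm c z t) (fun w => f w = g w))).
  intros t ht. destruct (H t ht) as [h1 h2].
  pose proof (cont_near _ _ _ _ (segm_rcont c z t) (mero_agree_limit _ _ _ h1 h2)) as N1.
  assert (N : near RtoC t (fun s => pnear (segm c z s) (fun w => f w = g w) <-> pnear (segm c z t) (fun w => f w = g w))).
  { destruct (classic (pnear (segm c z t) (fun w => f w = g w))) as [Y | Y].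
    - pose proof (cont_near _ _ _ _ (segm_rcont c z t) (pnear_open _ _ Y)) as N2.
      refine (near_imp _ _ _ _ _ N2). cbv beta. tauto.
    - refine (near_imp _ _ _ _ _ N1). cbv beta. tauto. }
  destruct N as (d & hd & N). exists d. split; [exact hd |]. intros s _ hs. apply N.
  rewrite Cmod_RtoC_sub. exact hs.
Qed.

(** * Meromorphy of the Weierstrass function along a holomorphic family *)

(** Only the finitely many terms indexed by [l0] can have poles near [p], and they are treated one
    by one; the rest converges to a holomorphic function by termwise differentiation. The last
    hypothesis says that [u] and a lattice point agree at most to first order, so each pole comes
    from the inverse square of a simple zero. *)
Lemma wp_family_mero (u w1 w2 u' w1' w2' : C -> C) (p : C) :
  near cid p (fun z => cderiv u z (u' z) /\ cderiv w1 z (w1' z) /\ cderiv w2 z (w2' z)) ->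
  ccont u' p -> ccont w1' p -> ccont w2' p ->
  indep (w1 p) (w2 p) ->
  (forall q, u p = lat (w1 p) (w2 p) q -> u' p <> lat (w1' p) (w2' p) q) ->
  meromorphic_at p (fun z => wp (u z) (w1 z) (w2 z)).
Proof.
  intros HD Cu C1 C2 Hi Hz.
  pose proof (near_at _ _ _ HD) as (Du & D1 & D2).
  pose proof (deriv_cont _ _ _ _ Du) as cu. pose proof (deriv_cont _ _ _ _ D1) as c1. pose proof (deriv_cont _ _ _ _ D2) as c2.
  (* Half of the area at [p]: a lower bound which persists nearby. *)
  set (I0 := (Rabs (Im (Cconj (w1 p) * w2 p)) / 2)%R).
  assert (hI0 : (0 < I0)%R) by (apply Rabs_pos_lt in Hi; unfold I0; lra).
  set (B := (Cmod (w1 p) + Cmod (w2 p) + 2)%R).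
  pose proof (Cmod_ge_0 (w1 p)). pose proof (Cmod_ge_0 (w2 p)). assert (hB : (0 < B)%R) by (unfold B; lra).
  set (U := (Cmod (u p) + Cmod (u' p) + 1)%R). set (W := (Cmod (w1' p) + Cmod (w2' p) + 1)%R).
  pose proof (Cmod_ge_0 (u p)). pose proof (Cmod_ge_0 (u' p)). pose proof (Cmod_ge_0 (w1' p)). pose proof (Cmod_ge_0 (w2' p)).
  assert (hU : (0 < U)%R) by (unfold U; lra). assert (hW : (0 < W)%R) by (unfold W; lra).
  assert (NI : near cid p (fun z => (I0 <= Rabs (Im (Cconj (w1 z) * w2 z)))%R)).
  { pose proof (cont_Im _ _ _ (cont_mult cid _ _ p (cont_conj _ _ _ c1) c2)) as K.
    refine (near_imp _ _ _ _ _ (K I0 hI0)). cbv beta. intros z hz. rewrite Cmod_RtoC_sub in hz.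
    unfold I0 in *. pose proof (Rabs_triang_inv (Im (Cconj (w1 p) * w2 p)) (Im (Cconj (w1 z) * w2 z))) as T.
    rewrite Rabs_minus_sym in T. lra. }
  assert (Nb : forall f : C -> C, ccont f p -> near cid p (fun z => (Cmod (f z) <= Cmod (f p) + 1)%R)).
  { intros f Hf. refine (near_imp _ _ _ _ _ (Hf 1%R Rlt_0_1)). cbv beta. intros z hz.
    pose proof (Cmod_sub_ge (f z) (f p)). lra. }
  destruct (near_and _ _ _ _ HD (near_and _ _ _ _ NI (near_and _ _ _ _ (near_and _ _ _ _ (Nb _ cu) (Nb _ Cu))
     (near_and _ _ _ _ (near_and _ _ _ _ (Nb _ c1) (Nb _ c2)) (near_and _ _ _ _ (Nb _ C1) (Nb _ C2)))))) as (R & hR & HR).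
  unfold cid in HR.
  set (c := (2 * I0 / B)%R). assert (hc : (0 < c)%R) by (apply Rdiv_lt_0_compat; lra).
  (* Outside this square the lattice points have modulus at least [2 U], out of reach of [u z]. *)
  destruct (zsquare_outside_norm (2 * U / c)) as (N & HN).
  set (l0 := zsquare N) in *.
  set (K := (16 * U / c ^ 3 + 56 * W * U / c ^ 4)%R).
  assert (hK : (0 <= K)%R).
  { unfold K, Rdiv. assert (0 < / c ^ 3)%R by (apply Rinv_0_lt_compat, pow_lt, hc).
    assert (0 < / c ^ 4)%R by (apply Rinv_0_lt_compat, pow_lt, hc).
    apply Rplus_le_le_0_compat; repeat apply Rmult_le_pos; lra. }
  set (dT := fun q z => - (2) * (u' z - lat (w1' z) (w2' z) q) / (u z - lat (w1 z) (w2 z) q) ^ 3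
     + 2 * lat (w1' z) (w2' z) q / lat (w1 z) (w2 z) q ^ 3).
  assert (Key : forall z q, (Cmod (z - p) < R)%R -> ~ In q l0 ->
     indep (w1 z) (w2 z) /\
     cderiv (fun z => wpt (u z) (w1 z) (w2 z) q) z (dT q z) /\
     (Cmod (wpt (u z) (w1 z) (w2 z) q) <= K * inv_cube q)%R /\ (Cmod (dT q z) <= K * inv_cube q)%R).
  { intros z q hz hq. destruct (HR z hz) as ((du & d1 & d2) & b0 & (b1 & b2) & (b3 & b4) & b5 & b6).
    destruct (HN q hq) as [k1 k2].
    assert (k3 : (2 * U <= c * znorm q)%R).
    { apply (Rmult_le_compat_l c) in k1; [| lra]. replace (c * (2 * U / c))%R with (2 * U)%R in k1 by (field; lra). exact k1. }
    assert (k4 : (c * znorm q <= Cmod (lat (w1 z) (w2 z) q))%R) by (apply lattice_lower; unfold B in *; lra).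
    destruct (wpt_tail_bounds (u z) (w1 z) (w2 z) (u' z) (w1' z) (w2' z) c U W q) as (e1 & e2 & e3 & e4);
      auto; try (unfold U in *; lra); try (unfold W in *; lra).
    split; [| split; [| split]]; auto.
    - intros E. rewrite E, Rabs_R0 in b0. lra.
    - now apply wpt_deriv. }
  assert (Hind : forall z, (Cmod (z - p) < R)%R -> indep (w1 z) (w2 z)).
  { intros z hz E. destruct (HR z hz) as (_ & b0 & _). rewrite E, Rabs_R0 in b0. lra. }
  set (rest := fun z => wp (u z) (w1 z) (w2 z) - lsum (wpt (u z) (w1 z) (w2 z)) l0).
  set (T := fun q z => if memb l0 q then RtoC 0 else wpt (u z) (w1 z) (w2 z) q).
  set (T' := fun q z => if memb l0 q then RtoC 0 else dT q z).
  assert (HM : summable (fun q => K * inv_cube q)%R) by (apply summable_scal; [exact hK | apply inv_cube_summable]).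
  assert (KT : forall q z, (Cmod (z - p) < R)%R -> cderiv (T q) z (T' q z) /\ (Cmod (T' q z) <= K * inv_cube q)%R).
  { intros q z hz. unfold T, T'. destruct (memb l0 q) eqn:E.
    - split; [apply deriv_const |]. rewrite Cmod_0. apply Rmult_le_pos; [exact hK | apply inv_cube_nonneg].
    - apply memb_false in E. destruct (Key z q hz E) as (_ & e1 & _ & e2). auto. }
  assert (KS : forall z, (Cmod (z - p) < R)%R -> has_sum (fun q => T q z) (rest z)).
  { intros z hz. unfold T, rest. apply (has_sum_split (wpt (u z) (w1 z) (w2 z))).
    - apply zsquare_NoDup.
    - now apply wp_has_sum, Hind. }
  assert (Hrest : holo_at p rest).
  { exists R. split; [exact hR |]. unfold cid. intros z hz.
    destruct (has_sum_exists (fun q => T' q z) (fun q => K * inv_cube q)%R) as (s' & Hs'); auto.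
    { intros q. now apply KT. }
    exists s'. apply (has_sum_deriv T T' (fun q => K * inv_cube q)%R z (R - Cmod (z - p))); auto; try lra.
    - intros q y hy. apply KT. pose proof (Cmod_triangle_sub y z p). lra.
    - intros y hy. apply KS. pose proof (Cmod_triangle_sub y z p). lra. }
  assert (hol : holo_at p u /\ holo_at p w1 /\ holo_at p w2).
  { split; [| split]; refine (near_imp _ _ _ _ _ HD); intros z (e1 & e2 & e3); eexists; eassumption. }
  destruct hol as (hu & h1 & h2).
  assert (hL : forall q, holo_at p (fun z => lat (w1 z) (w2 z) q)).
  { intros q. apply holo_plus; apply holo_mult; auto; apply holo_const. }
  assert (dL : forall q, cderiv (fun z => lat (w1 z) (w2 z) q) p (lat (w1' p) (w2' p) q)).
  { intros q. apply deriv_plus; apply deriv_scal; assumption. }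
  apply (mero_ext p (fun z => rest z + lsum (fun q => wpt (u z) (w1 z) (w2 z) q) l0)).
  { apply near_all. intros z _. unfold rest.
    change (fun q => wpt (u z) (w1 z) (w2 z) q) with (wpt (u z) (w1 z) (w2 z)). ring. }
  apply mero_plus; [now apply holo_mero |].
  apply (mero_lsum p (fun q z => wpt (u z) (w1 z) (w2 z) q)). intros q _. unfold wpt.
  destruct (excluded_middle_informative (q = (0, 0)%Z)) as [-> | hq].
  - apply (mero_inv_sqr p u (u' p)); auto. intros E E'.
    apply (Hz (0, 0)%Z); unfold lattice_point; cbn [fst snd]; [rewrite E | rewrite E']; ring.
  - apply mero_plus.
    + apply (mero_inv_sqr p (fun z => u z - lat (w1 z) (w2 z) q) (u' p - lat (w1' p) (w2' p) q)).
      * now apply holo_minus.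
      * apply deriv_minus; auto.
      * intros E. apply sub_neq_0, Hz, Cmod_eq_sub_0. now rewrite E, Cmod_0.
    + apply holo_mero, holo_opp, holo_inv; [apply holo_pow, hL |]. apply Cpow_nz.
      destruct (indep_lower _ _ Hi) as (c' & hc' & Hc'). specialize (Hc' q). apply Cmod_gt_0.
      pose proof (znorm_ge_1 q hq). nra.
Qed.

(** * The principal square root *)

Definition slit (z : C) : Prop := ~ (Im z = 0 /\ Re z <= 0)%R.

Definition csqrt (z : C) : C :=
  (sqrt ((Cmod z + Re z) / 2),
   if Rle_dec 0 (Im z) then sqrt ((Cmod z - Re z) / 2) else (- sqrt ((Cmod z - Re z) / 2))%R).

Lemma csqrt_sqr z : csqrt z * csqrt z = z.
Proof.
  pose proof (re_le_Cmod z) as h. pose proof (Rle_abs (Re z)). pose proof (Rle_abs (- Re z)) as h2. rewrite Rabs_Ropp in h2.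
  set (p := ((Cmod z + Re z) / 2)%R). set (q := ((Cmod z - Re z) / 2)%R).
  assert (hp : (0 <= p)%R) by (unfold p; lra). assert (hq : (0 <= q)%R) by (unfold q; lra).
  assert (E : (sqrt p * sqrt q = Rabs (Im z) / 2)%R).
  { rewrite <- sqrt_mult by assumption. replace (p * q)%R with ((Im z / 2) * (Im z / 2))%R.
    - change (sqrt (Rsqr (Im z / 2)) = Rabs (Im z) / 2)%R. rewrite sqrt_Rsqr_abs. unfold Rdiv.
      rewrite Rabs_mult, (Rabs_pos_eq (/ 2)) by lra. reflexivity.
    - unfold p, q. pose proof (Cmod_sqr z). nra. }
  pose proof (sqrt_sqrt p hp) as sp. pose proof (sqrt_sqrt q hq) as sq.
  unfold csqrt. fold p q.
  apply C_ext; reim; simpl; destruct (Rle_dec 0 (Im z)) as [r | r].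
  - rewrite sp, sq. unfold p, q. lra.
  - replace (sqrt p * sqrt p - - sqrt q * - sqrt q)%R with (sqrt p * sqrt p - sqrt q * sqrt q)%R by ring.
    rewrite sp, sq. unfold p, q. lra.
  - rewrite (Rmult_comm (sqrt q)), E, Rabs_pos_eq by lra. lra.
  - replace (sqrt p * - sqrt q + - sqrt q * sqrt p)%R with (- 2 * (sqrt p * sqrt q))%R by ring.
    rewrite E, Rabs_left by lra. lra.
Qed.

Lemma csqrt_Re_nonneg z : (0 <= Re (csqrt z))%R.
Proof. unfold csqrt. simpl. apply sqrt_pos. Qed.

Lemma csqrt_Re_pos z : slit z -> (0 < Re (csqrt z))%R.
Proof.
  intros hz. unfold csqrt. simpl. apply sqrt_lt_R0.
  pose proof (Cmod_sqr z). pose proof (Cmod_ge_0 z).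
  destruct (Rlt_dec (Re z) 0) as [h | h].
  - assert (Im z <> 0)%R by (intros E; apply hz; lra). nra.
  - destruct (Req_dec (Re z) 0) as [E | E]; [| nra].
    assert (Im z <> 0)%R by (intros E'; apply hz; lra). nra.
Qed.

Lemma csqrt_neq_0 z : slit z -> csqrt z <> 0.
Proof. intros h E. pose proof (csqrt_Re_pos z h) as H. rewrite E in H. simpl in H. lra. Qed.

Lemma csqrt_RtoC (x : R) : (0 <= x)%R -> csqrt (RtoC x) = RtoC (sqrt x).
Proof.
  intros h. unfold csqrt. rewrite Cmod_R, Rabs_pos_eq, Re_RtoC, Im_RtoC by exact h.
  replace ((x + x) / 2)%R with x by field. replace ((x - x) / 2)%R with 0%R by field. rewrite sqrt_0.
  destruct (Rle_dec 0 0); [reflexivity | lra].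
Qed.

Lemma csqrt_sub_bound z w :
  slit z -> (Cmod (csqrt w - csqrt z) * Re (csqrt z) <= Cmod (w - z))%R.
Proof.
  intros hz. replace (w - z) with ((csqrt w - csqrt z) * (csqrt w + csqrt z)).
  - rewrite Cmod_mult. apply Rmult_le_compat_l; [apply Cmod_ge_0 |].
    eapply Rle_trans; [| apply re_le_Cmod]. eapply Rle_trans; [| apply Rle_abs].
    reim. pose proof (csqrt_Re_nonneg w). lra.
  - rewrite <- (csqrt_sqr w) at 3. rewrite <- (csqrt_sqr z) at 3. ring.
Qed.

Lemma csqrt_cont z : slit z -> ccont csqrt z.
Proof.
  intros hz eps he. pose proof (csqrt_Re_pos z hz) as hp.
  exists (eps * Re (csqrt z))%R. split; [nra |]. unfold cid. intros w hw.
  pose proof (csqrt_sub_bound z w hz). nra.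
Qed.

(** From [w - z = (csqrt w - csqrt z) (csqrt w + csqrt z)], whose second factor has positive real
    part for every [w]. *)
Lemma csqrt_deriv z : slit z -> cderiv csqrt z (/ (2 * csqrt z)).
Proof.
  intros hz. pose proof (csqrt_Re_pos z hz) as hp.
  exists (fun w => / (csqrt w + csqrt z)).
  assert (N : forall w, csqrt w + csqrt z <> 0).
  { intros w E. apply (f_equal Re) in E. revert E. reim. pose proof (csqrt_Re_nonneg w). lra. }
  split; [f_equal; ring |]. split.
  - apply cont_inv; [| apply N]. apply cont_plus; [now apply csqrt_cont | apply cont_const].
  - apply near_all. unfold cid. intros w.
    replace (w - z) with ((csqrt w - csqrt z) * (csqrt w + csqrt z)).
    + field. apply N.
    + rewrite <- (csqrt_sqr w) at 3. rewrite <- (csqrt_sqr z) at 3. ring.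
Qed.

Lemma Cmod_csqrt z : (Cmod (csqrt z) * Cmod (csqrt z) = Cmod z)%R.
Proof. rewrite <- Cmod_mult, csqrt_sqr. reflexivity. Qed.

(* A point [s^2] is at distance at least [(Re s)^2] from the negative axis. *)
Lemma slit_perturb z w m :
  slit z -> (0 < m)%R -> (m <= Re (csqrt z))%R -> (Cmod (w - z) <= m * m / 2)%R ->
  slit w /\ (m / 2 <= Cmod (csqrt w))%R.
Proof.
  intros hz hm hs hw. set (s := csqrt z) in *.
  assert (D : forall y : R, (m * m <= Cmod (z + RtoC (y * y)))%R).
  { intros y. replace (z + RtoC (y * y)) with ((s - Ci * RtoC y) * (s + Ci * RtoC y)).
    - rewrite Cmod_mult. apply Rmult_le_compat; try lra.
      + eapply Rle_trans; [| apply re_le_Cmod]. eapply Rle_trans; [| apply Rle_abs]. reim. lra.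
      + eapply Rle_trans; [| apply re_le_Cmod]. eapply Rle_trans; [| apply Rle_abs]. reim. lra.
    - rewrite <- (csqrt_sqr z). fold s. apply C_ext; reim; ring. }
  assert (D2 : forall y : R, (m * m / 2 <= Cmod (w + RtoC (y * y)))%R).
  { intros y. pose proof (Cmod_sub_ge (z + RtoC (y * y)) (w + RtoC (y * y))) as h.
    replace (z + RtoC (y * y) - (w + RtoC (y * y))) with (- (w - z)) in h by ring. rewrite Cmod_opp in h.
    specialize (D y). lra. }
  split.
  - intros [h1 h2]. specialize (D2 (sqrt (- Re w))). rewrite sqrt_sqrt in D2 by lra.
    replace (w + RtoC (- Re w)) with (RtoC 0) in D2 by (apply C_ext; reim; lra). rewrite Cmod_0 in D2. nra.
  - specialize (D2 0%R). replace (w + RtoC (0 * 0)) with w in D2 by (apply C_ext; reim; ring).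
    rewrite <- Cmod_csqrt in D2. pose proof (Cmod_ge_0 (csqrt w)). nra.
Qed.

(** * Integrals depending on a complex parameter *)

(** Two applications of the mean value inequality, hence [M] instead of [M / 2]. *)
Lemma taylor2_bound (f f' f'' : C -> C) (x y : C) (r M : R) :
  (forall z, (Cmod (z - x) < r)%R -> cderiv f z (f' z) /\ cderiv f' z (f'' z) /\ (Cmod (f'' z) <= M)%R) ->
  (Cmod (y - x) < r)%R ->
  (Cmod (f y - f x - (y - x) * f' x) <= M * Cmod (y - x) * Cmod (y - x))%R.
Proof.
  intros H hy.
  assert (Seg : forall z t, (0 <= t <= 1)%R -> (Cmod (segm x z t - x) <= Cmod (z - x))%R).
  { intros z t ht. unfold segm. replace (x + RtoC t * (z - x) - x) with (RtoC t * (z - x)) by ring.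
    rewrite Cmod_mult, Cmod_R, Rabs_pos_eq by lra. pose proof (Cmod_ge_0 (z - x)). nra. }
  replace (f y - f x - (y - x) * f' x) with ((f y - y * f' x) - (f x - x * f' x)) by ring.
  apply (mean_value_segm (fun z => f z - z * f' x) (fun z => f' z - f' x)). intros t ht.
  pose proof (Seg y t ht) as h1. destruct (H (segm x y t) ltac:(lra)) as (d1 & _ & _). split.
  - eapply deriv_eq; [apply deriv_minus; [exact d1 | apply (deriv_mult cid (fun z => z) (fun _ => f' x)); [apply deriv_id | apply deriv_const]] |].
    cbv beta. ring.
  - eapply Rle_trans; [apply (mean_value_segm f' f'' x _ M) |].
    + intros s hs. pose proof (Seg (segm x y t) s hs). destruct (H (segm x (segm x y t) s) ltac:(lra)) as (_ & d2 & d3). auto.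
    + assert (0 <= M)%R.
      { destruct (H x) as (_ & _ & d3); [rewrite Cmod_sub_0; pose proof (Cmod_ge_0 (y - x)); lra |].
        pose proof (Cmod_ge_0 (f'' x)). lra. }
      apply Rmult_le_compat_l; assumption.
Qed.

(** The uniform bound on the second derivative makes the remainder of the integrand at most
    [M |y - x|^2], which survives integration. *)
Lemma cint_param_deriv (f f' f'' : R -> C -> C) (a b : R) (x : C) (r M : R) :
  (a <= b)%R -> (0 < r)%R ->
  (forall t z, (a <= t <= b)%R -> (Cmod (z - x) < r)%R ->
     cderiv (f t) z (f' t z) /\ cderiv (f' t) z (f'' t z) /\ (Cmod (f'' t z) <= M)%R) ->
  (forall z, (Cmod (z - x) < r)%R -> rcont_on a b (fun t => f t z)) -> rcont_on a b (fun t => f' t x) ->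
  cderiv (fun z => cint (fun t => f t z) a b) x (cint (fun t => f' t x) a b).
Proof.
  intros hab hr H Hc Hc'. apply deriv_intro; [auto |]. unfold cid. intros eps he.
  assert (Pp : (Cmod (x - x) < r)%R) by (rewrite Cmod_sub_0; exact hr).
  assert (hM : (0 <= M)%R).
  { destruct (H a x) as (_ & _ & h); [lra | exact Pp |]. pose proof (Cmod_ge_0 (f'' a x)). lra. }
  (* The [1] keeps [B] positive when [M (b - a)] is zero. *)
  set (B := (M * (b - a) + 1)%R). assert (hB : (0 < B)%R) by (unfold B; nra).
  exists (Rmin r (eps / B)). split; [apply Rmin_glb_lt; [exact hr | now apply Rdiv_lt_0_compat] |].
  unfold cid. intros y hy. pose proof (Rmin_l r (eps / B)). pose proof (Rmin_r r (eps / B)).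
  assert (hy' : (Cmod (y - x) < r)%R) by lra.
  assert (R1 : rcont_on a b (fun t => f t y - f t x)).
  { intros t ht. apply cont_minus; [now apply (Hc y) | now apply (Hc x)]. }
  assert (R2 : rcont_on a b (fun t => (y - x) * f' t x)).
  { intros t ht. apply cont_mult; [apply cont_const | now apply Hc']. }
  rewrite <- cint_minus, <- cint_scal, <- cint_minus by (auto; now apply Hc).
  eapply Rle_trans; [apply (cint_norm _ a b (M * Cmod (y - x) * Cmod (y - x))); [exact hab | |] |].
  - intros t ht. apply cont_minus; [now apply R1 | now apply R2].
  - intros t ht. apply (taylor2_bound (f t) (f' t) (f'' t) x y r M); [| exact hy']. intros z hz. now apply H.
  - pose proof (Cmod_ge_0 (y - x)). replace (M * Cmod (y - x) * Cmod (y - x) * (b - a))%R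
      with (M * (b - a) * Cmod (y - x) * Cmod (y - x))%R by ring.
    apply Rmult_le_compat_r; [assumption |].
    assert (hh : (Cmod (y - x) * B <= eps)%R).
    { apply (Rmult_le_reg_r (/ B)); [now apply Rinv_0_lt_compat |]. rewrite Rmult_assoc, Rinv_r by lra.
      fold (eps / B)%R. lra. }
    unfold B in hh. nra.
Qed.

(** The integral of [c (a + x b)^(-k/2)]. The family is closed under differentiation in [x], which
    sends [k] to [k + 2] and [c] to [- (k/2) c b], and it contains both [EK] and [EL]. *)
Definition ellint (a b c : R -> R) (k : nat) (x : C) : C :=
  cint (fun t => RtoC (c t) * / csqrt (RtoC (a t) + x * RtoC (b t)) ^ k) 0 (PI / 2).

Definition admissible (a b : R -> R) (x : C) : Prop :=
  forall t, (0 <= t <= PI / 2)%R -> slit (RtoC (a t) + x * RtoC (b t)).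

Lemma ell_arg_rcont (a b : R -> R) x t :
  continuous a t -> continuous b t -> rcont (fun t => RtoC (a t) + x * RtoC (b t)) t.
Proof.
  intros ha hb. apply cont_plus; [now apply rcont_of_R |].
  apply cont_mult; [apply cont_const | now apply rcont_of_R].
Qed.

Lemma ell_integrand_rcont (a b c : R -> R) k x t :
  continuous a t -> continuous b t -> continuous c t -> slit (RtoC (a t) + x * RtoC (b t)) ->
  rcont (fun t => RtoC (c t) * / csqrt (RtoC (a t) + x * RtoC (b t)) ^ k) t.
Proof.
  intros ha hb hc hs. apply cont_mult; [now apply rcont_of_R |].
  apply cont_inv; [| now apply Cpow_nz, csqrt_neq_0]. apply cont_pow.
  apply (cont_comp RtoC csqrt); [now apply csqrt_cont | now apply ell_arg_rcont].
Qed.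

Lemma inv_csqrt_pow_deriv {T} (io : T -> C) (f : T -> C) x l k :
  slit (f x) -> deriv_at io f x l ->
  deriv_at io (fun y => / csqrt (f y) ^ k) x (- RtoC (INR k / 2) * l * / csqrt (f x) ^ (k + 2)).
Proof.
  intros hs Hf. pose proof (csqrt_neq_0 _ hs) as hn. eapply deriv_eq.
  - apply deriv_inv; [| now apply Cpow_nz].
    apply deriv_pow, (deriv_comp io csqrt); [now apply csqrt_deriv | exact Hf].
  - cbv beta. destruct k.
    + simpl. unfold Rdiv. rewrite Rmult_0_l. unfold Cdiv. ring.
    + replace (S k - 1)%nat with k by lia. rewrite Cpow_add_r, RtoC_div by lra. simpl. field.
      split; [exact hn | now apply Cpow_nz].
Qed.

(** By compactness the real part of the root has a positive minimum [m] on the interval, so by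
    [slit_perturb] one disc about [x] serves for all [t]. *)
Lemma ellint_deriv (a b c : R -> R) k x :
  (forall t, continuous a t) -> (forall t, continuous b t) -> (forall t, continuous c t) ->
  admissible a b x ->
  cderiv (ellint a b c k) x (ellint a b (fun t => - (INR k / 2) * (c t * b t))%R (k + 2) x).
Proof.
  intros ha hb hc hx. pose proof PI_RGT_0 as hpi. assert (hpi2 : (0 <= PI / 2)%R) by lra.
  destruct (rcont_Re_lower (fun t => csqrt (RtoC (a t) + x * RtoC (b t))) 0 (PI / 2) hpi2) as (m & hm & Hm).
  { intros t ht. split; [| now apply csqrt_Re_pos, hx].
    apply (cont_comp RtoC csqrt); [now apply csqrt_cont, hx | now apply ell_arg_rcont]. }
  destruct (rcont_bounded (fun t => RtoC (b t)) 0 (PI / 2) hpi2) as (B & hB & HB).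
  { intros t _. now apply rcont_of_R. }
  destruct (rcont_bounded (fun t => RtoC (c t)) 0 (PI / 2) hpi2) as (G & hG & HG).
  { intros t _. now apply rcont_of_R. }
  (* With this radius [|(z - x) b t| <= m^2 / 2], the displacement allowed by [slit_perturb]. *)
  set (r := (m * m / (2 * B))%R). assert (hr : (0 < r)%R) by (apply Rdiv_lt_0_compat; nra).
  assert (P : forall t z, (0 <= t <= PI / 2)%R -> (Cmod (z - x) < r)%R ->
     slit (RtoC (a t) + z * RtoC (b t)) /\ (m / 2 <= Cmod (csqrt (RtoC (a t) + z * RtoC (b t))))%R).
  { intros t z ht hz. apply (slit_perturb (RtoC (a t) + x * RtoC (b t))); auto.
    replace (RtoC (a t) + z * RtoC (b t) - (RtoC (a t) + x * RtoC (b t))) with ((z - x) * RtoC (b t)) by ring.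
    rewrite Cmod_mult. specialize (HB t ht). cbv beta in HB.
    replace (m * m / 2)%R with (r * B)%R by (unfold r; field; lra).
    apply Rmult_le_compat; try apply Cmod_ge_0; lra. }
  set (f := fun t z => RtoC (c t) * / csqrt (RtoC (a t) + z * RtoC (b t)) ^ k).
  set (f' := fun t z => RtoC (- (INR k / 2) * (c t * b t)) * / csqrt (RtoC (a t) + z * RtoC (b t)) ^ (k + 2)).
  set (f'' := fun t z => RtoC (- (INR k / 2) * (c t * b t)) *
     (- RtoC (INR (k + 2) / 2) * RtoC (b t) * / csqrt (RtoC (a t) + z * RtoC (b t)) ^ (k + 2 + 2))).
  assert (Darg : forall t z, cderiv (fun z => RtoC (a t) + z * RtoC (b t)) z (RtoC (b t))).
  { intros t z. eapply deriv_eq.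
    - apply deriv_plus; [apply deriv_const |].
      apply (deriv_mult cid (fun z => z) (fun _ => RtoC (b t))); [apply deriv_id | apply deriv_const].
    - cbv beta. ring. }
  apply (cint_param_deriv f f' f'' 0 (PI / 2) x r
     (INR k / 2 * (G * B) * (INR (k + 2) / 2 * B * (/ (m / 2)) ^ (k + 2 + 2)))); auto.
  - intros t z ht hz. destruct (P t z ht hz) as [hs hl]. pose proof (csqrt_neq_0 _ hs) as hn.
    split; [| split].
    + eapply deriv_eq; [apply deriv_scal, (inv_csqrt_pow_deriv cid (fun z => RtoC (a t) + z * RtoC (b t))); [exact hs | apply Darg] |].
      unfold f'. rewrite !RtoC_mult, RtoC_opp. ring.
    + eapply deriv_eq; [apply deriv_scal, (inv_csqrt_pow_deriv cid (fun z => RtoC (a t) + z * RtoC (b t))); [exact hs | apply Darg] |].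
      reflexivity.
    + unfold f''. specialize (HB t ht). specialize (HG t ht). cbv beta in HB, HG. rewrite !Cmod_R in *.
      pose proof (pos_INR k). pose proof (pos_INR (k + 2)).
      rewrite !Cmod_mult, Cmod_opp, !Cmod_R, Cmod_inv, Cmod_pow by now apply Cpow_nz.
      rewrite !Rabs_mult, Rabs_Ropp, (Rabs_pos_eq (INR k / 2)), (Rabs_pos_eq (INR (k + 2) / 2)) by lra.
      rewrite <- pow_inv.
      assert (hpw : (0 <= / Cmod (csqrt (RtoC (a t) + z * RtoC (b t))) <= / (m / 2))%R).
      { split; [left; apply Rinv_0_lt_compat; lra | apply Rinv_le_contravar; lra]. }
      pose proof (Rabs_pos (c t)). pose proof (Rabs_pos (b t)).
      assert (hpw2 : (0 <= (/ Cmod (csqrt (RtoC (a t) + z * RtoC (b t)))) ^ (k + 2 + 2))%R) by (apply pow_le; lra).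
      pose proof (pow_incr _ _ (k + 2 + 2)%nat hpw).
      apply Rmult_le_compat.
      * apply Rmult_le_pos; [lra | now apply Rmult_le_pos].
      * apply Rmult_le_pos; [apply Rmult_le_pos; lra | exact hpw2].
      * apply Rmult_le_compat_l; [lra |]. apply Rmult_le_compat; assumption.
      * apply Rmult_le_compat; auto; [apply Rmult_le_pos; lra |]. apply Rmult_le_compat_l; lra.
  - intros z hz t ht. apply ell_integrand_rcont; auto. now apply P.
  - intros t ht. apply (ell_integrand_rcont a b (fun t => - (INR k / 2) * (c t * b t))%R); auto.
    apply (continuous_mult (fun _ => (- (INR k / 2))%R) (fun t => (c t * b t)%R)); [apply continuous_const |].
    now apply (continuous_mult c b).
Qed.

(** * Solutions of the period equation *)

(* The equation as a first order system, with [v = x (1 - x) u']. *)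
Definition sol (U : C -> Prop) (u v : C -> C) : Prop :=
  forall x, U x -> x <> 0 /\ x <> 1 /\ cderiv u x (/ (x * (1 - x)) * v x) /\ cderiv v x (u x / 4).

Definition star (U : C -> Prop) (c : C) : Prop :=
  forall z t, U z -> (0 <= t <= 1)%R -> U (segm c z t).

Lemma sol_unique U u v c :
  sol U u v -> star U c -> u c = 0 -> v c = 0 -> forall z, U z -> u z = 0 /\ v z = 0.
Proof.
  intros H St hu hv z hz. apply (ode_unique_segm u v (fun x => / (x * (1 - x))) c z); auto.
  intros t ht w. destruct (H w (St z t hz ht)) as (n0 & n1 & d1 & d2). split; [| split; assumption].
  apply (cont_inv cid (fun x => x * (1 - x))).
  - apply (cont_mult cid (fun x => x) (fun x => 1 - x)); [apply cont_id |].
    apply cont_minus; [apply cont_const | apply cont_id].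
  - intros E. destruct (Cmult_integral _ _ E) as [E' | E']; [tauto |]. apply n1.
    replace w with (1 - (1 - w)) by ring. rewrite E'. ring.
Qed.

Lemma sol_comb U u1 v1 u2 v2 (a b : C) :
  sol U u1 v1 -> sol U u2 v2 -> sol U (fun x => a * u1 x + b * u2 x) (fun x => a * v1 x + b * v2 x).
Proof.
  intros H1 H2 x hx. destruct (H1 x hx) as (n0 & n1 & d1 & e1), (H2 x hx) as (_ & _ & d2 & e2).
  split; [exact n0 |]. split; [exact n1 |]. split.
  - eapply deriv_eq; [apply deriv_plus; apply deriv_scal; eassumption | ring].
  - eapply deriv_eq; [apply deriv_plus; apply deriv_scal; eassumption |]. unfold Cdiv. ring.
Qed.

Lemma sol_subset (U V : C -> Prop) u v : (forall x, V x -> U x) -> sol U u v -> sol V u v.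
Proof. intros h H x hx. auto. Qed.

Lemma sol_reflect U u v :
  sol U u v -> sol (fun x => U (1 - x)) (fun x => u (1 - x)) (fun x => - v (1 - x)).
Proof.
  intros H x hx. destruct (H _ hx) as (n0 & n1 & d1 & e1).
  assert (Dx : cderiv (fun x => 1 - x) x (- (1))).
  { eapply deriv_eq; [apply deriv_minus; [apply deriv_const | apply deriv_id] | ring]. }
  split; [| split; [| split]].
  - intros ->. apply n1. ring.
  - intros ->. apply n0. ring.
  - eapply deriv_eq; [apply (deriv_comp cid u); eassumption |].
    replace (1 - (1 - x)) with x by ring. rewrite (Cmult_comm (1 - x) x). ring.
  - eapply deriv_eq; [apply deriv_opp, (deriv_comp cid v); eassumption |]. unfold Cdiv. ring.
Qed.

(** The difference of the two sides is the integral of an exact derivative whose primitive vanishes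
    at both ends. The last hypothesis is that identity between integrands, cleared of [A^(-5/2)] and
    constants. *)
Lemma ellint_ode (a b a' b' : R -> R) (x : C) :
  (forall t, is_derive a t (a' t)) -> (forall t, is_derive b t (b' t)) -> admissible a b x ->
  (forall t, let A := RtoC (a t) + x * RtoC (b t) in
     3 * x * (1 - x) * RtoC (b t) * RtoC (b t) - 2 * (1 - 2 * x) * RtoC (b t) * A - A * A
     = - (RtoC (cos t * cos t - sin t * sin t) * A - RtoC (3 / 2) * RtoC (sin t * cos t) * (RtoC (a' t) + x * RtoC (b' t)))) ->
  x * (1 - x) * ellint a b (fun t => - (INR 3 / 2) * (- (INR 1 / 2) * (1 * b t) * b t))%R 5 x
  + (1 - 2 * x) * ellint a b (fun t => - (INR 1 / 2) * (1 * b t))%R 3 x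
  = / 4 * ellint a b (fun _ => 1%R) 1 x.
Proof.
  intros Da Db hx Hid. pose proof PI_RGT_0 as hpi.
  assert (ca : forall t, continuous a t) by (intros t; apply (ex_derive_continuous a); eexists; apply Da).
  assert (cb : forall t, continuous b t) by (intros t; apply (ex_derive_continuous b); eexists; apply Db).
  set (c3 := (fun t => - (INR 1 / 2) * (1 * b t))%R).
  set (c5 := (fun t => - (INR 3 / 2) * (- (INR 1 / 2) * (1 * b t) * b t))%R).
  assert (k3 : forall t, continuous c3 t).
  { intros t. apply (continuous_mult (fun _ => (- (INR 1 / 2))%R) (fun t => (1 * b t)%R)); [apply continuous_const |].
    apply (continuous_mult (fun _ => 1%R) b); [apply continuous_const | apply cb]. }
  assert (k5 : forall t, continuous c5 t).
  { intros t. apply (continuous_mult (fun _ => (- (INR 3 / 2))%R) (fun t => (c3 t * b t)%R)); [apply continuous_const |].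
    apply (continuous_mult c3 b); auto. }
  assert (k1 : forall t, continuous (fun _ : R => 1%R) t) by (intros; apply continuous_const).
  set (f := fun (c : R -> R) k t => RtoC (c t) * / csqrt (RtoC (a t) + x * RtoC (b t)) ^ k).
  assert (Rf : forall c k, (forall t, continuous c t) -> rcont_on 0 (PI / 2) (f c k)).
  { intros c k hc t ht. apply ell_integrand_rcont; auto. }
  apply Cmod_eq_sub_0.
  match goal with |- Cmod ?e = 0%R => replace e with (RtoC 0); [apply Cmod_0 | symmetry] end.
  unfold ellint. fold (f c5 5%nat) (f c3 3%nat) (f (fun _ => 1%R) 1%nat).
  rewrite <- !cint_scal, <- cint_plus, <- cint_minus; try lra; try (now apply Rf);
    try (intros t ht; apply cont_mult; [apply cont_const | now apply Rf]).
  2:{ intros t ht. apply cont_plus; (apply cont_mult; [apply cont_const | now apply Rf]). }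
  (* [- (1/4) sin t cos t A^(-3/2)], which is zero at [0] and at [PI / 2]. *)
  set (Phi := fun t => - / 4 * (RtoC (sin t * cos t) * / csqrt (RtoC (a t) + x * RtoC (b t)) ^ 3)).
  rewrite (cint_FTC Phi).
  - unfold Phi. rewrite cos_PI2, sin_0, Rmult_0_l, Rmult_0_r. ring.
  - lra.
  - intros t ht. eapply deriv_eq.
    + unfold Phi. apply deriv_scal, deriv_mult.
      * apply (rderiv_of_R (fun t => (sin t * cos t)%R) t (cos t * cos t - sin t * sin t)%R). auto_derive; [trivial | ring].
      * apply (inv_csqrt_pow_deriv RtoC (fun t => RtoC (a t) + x * RtoC (b t))); [apply hx; exact ht |].
        apply deriv_plus; [apply rderiv_of_R, Da | apply deriv_scal, rderiv_of_R, Db].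
    + unfold f, c3, c5. set (A := RtoC (a t) + x * RtoC (b t)).
      pose proof (csqrt_neq_0 A (hx t ht)) as hn. pose proof (csqrt_sqr A) as hs.
      specialize (Hid t). cbv zeta in Hid. fold A in Hid. set (s := csqrt A) in *.
      replace (INR 1) with 1%R by reflexivity. replace (INR 3) with 3%R by (simpl; ring).
      transitivity (/ 4 * (3 * x * (1 - x) * RtoC (b t) * RtoC (b t) - 2 * (1 - 2 * x) * RtoC (b t) * A - A * A) * / s ^ 5).
      * rewrite Hid, <- hs. change (3 + 2)%nat with 5%nat. rewrite !RtoC_div by lra. field. exact hn.
      * rewrite <- hs. repeat (rewrite ?RtoC_mult, ?RtoC_opp). rewrite !RtoC_div by lra. field. exact hn.
  - intros t ht. apply cont_minus; [apply cont_plus |]; (apply cont_mult; [apply cont_const | now apply Rf]).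
Qed.

Definition sinsq (t : R) : R := (sin t * sin t)%R.
Definition msinsq (t : R) : R := (- (sin t * sin t))%R.

(* The complete elliptic integral of the first kind, and the solution which is
   holomorphic across the negative axis. *)
Definition EK : C -> C := ellint (fun _ => 1%R) msinsq (fun _ => 1%R) 1.
Definition EL : C -> C := ellint sinsq (fun _ => (- (1))%R) (fun _ => 1%R) 1.

(** [x (1 - x)] times the derivative of [EK]; the coefficient is kept in the form in which
    [ellint_deriv] produces it. *)
Definition vK (x : C) : C :=
  x * (1 - x) * ellint (fun _ => 1%R) msinsq (fun t => - (INR 1 / 2) * (1 * msinsq t))%R 3 x.
Definition vL (x : C) : C :=
  x * (1 - x) * ellint sinsq (fun _ => (- (1))%R) (fun t => - (INR 1 / 2) * (1 * - (1)))%R 3 x.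

Definition DK (x : C) : Prop := ~ (Im x = 0 /\ 1 <= Re x)%R.
Definition DL (x : C) : Prop := ~ (Im x = 0 /\ 0 <= Re x)%R.

Lemma sin_sqr_bounds t : (0 <= sin t * sin t <= 1)%R.
Proof. pose proof (sin2_cos2 t) as h. unfold Rsqr in h. nra. Qed.

Lemma admissible_K x : DK x -> admissible (fun _ => 1%R) msinsq x.
Proof.
  intros hx t _ [h1 h2]. apply hx. revert h1 h2. unfold msinsq. reim. pose proof (sin_sqr_bounds t).
  intros h1 h2. set (q := (sin t * sin t)%R) in *. assert (q <> 0)%R by (intros E; rewrite E in h2; lra).
  split; [nra |]. assert (Im x * q = 0)%R by lra. assert (Im x = 0)%R by nra. nra.
Qed.

Lemma admissible_L x : DL x -> admissible sinsq (fun _ => (- (1))%R) x.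
Proof.
  intros hx t _ [h1 h2]. apply hx. revert h1 h2. unfold sinsq. reim. pose proof (sin_sqr_bounds t).
  intros h1 h2. split; lra.
Qed.

Lemma continuous_sinsq t : continuous sinsq t.
Proof. apply (ex_derive_continuous sinsq). unfold sinsq. auto_derive. trivial. Qed.

Lemma continuous_msinsq t : continuous msinsq t.
Proof. apply (ex_derive_continuous msinsq). unfold msinsq. auto_derive. trivial. Qed.

Lemma sol_of_ellint (a b a' b' : R -> R) (U : C -> Prop) :
  (forall t, is_derive a t (a' t)) -> (forall t, is_derive b t (b' t)) ->
  (forall x, U x -> x <> 0 /\ x <> 1 /\ admissible a b x) ->
  (forall x t, let A := RtoC (a t) + x * RtoC (b t) in
     3 * x * (1 - x) * RtoC (b t) * RtoC (b t) - 2 * (1 - 2 * x) * RtoC (b t) * A - A * A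
     = - (RtoC (cos t * cos t - sin t * sin t) * A - RtoC (3 / 2) * RtoC (sin t * cos t) * (RtoC (a' t) + x * RtoC (b' t)))) ->
  sol U (ellint a b (fun _ => 1%R) 1)
    (fun x => x * (1 - x) * ellint a b (fun t => - (INR 1 / 2) * (1 * b t))%R 3 x).
Proof.
  intros Da Db HU Hid x hx. destruct (HU x hx) as (n0 & n1 & hadm).
  assert (ca : forall t, continuous a t) by (intros t; apply (ex_derive_continuous a); eexists; apply Da).
  assert (cb : forall t, continuous b t) by (intros t; apply (ex_derive_continuous b); eexists; apply Db).
  assert (k1 : forall t, continuous (fun _ : R => 1%R) t) by (intros; apply continuous_const).
  assert (k3 : forall t, continuous (fun t => - (INR 1 / 2) * (1 * b t))%R t).
  { intros t. apply (continuous_mult (fun _ => (- (INR 1 / 2))%R) (fun t => (1 * b t)%R)); [apply continuous_const |].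
    apply (continuous_mult (fun _ => 1%R) b); auto. }
  pose proof (ellint_deriv a b (fun _ => 1%R) 1 x ca cb k1 hadm) as d1. cbv beta in d1.
  pose proof (ellint_deriv a b _ 3 x ca cb k3 hadm) as d2. cbv beta in d2.
  pose proof (ellint_ode a b a' b' x Da Db hadm (Hid x)) as O. cbv beta in O.
  apply sub_neq_0 in n1 as n1'. assert (n2 : 1 - x <> 0) by (intros E; apply n1'; replace (x - 1) with (- (1 - x)) by ring; rewrite E; ring).
  split; [exact n0 |]. split; [exact n1 |]. split.
  - eapply deriv_eq; [exact d1 |]. change (1 + 2)%nat with 3%nat. cbv beta. field. auto.
  - eapply deriv_eq.
    + apply (deriv_mult cid (fun x => x * (1 - x))); [| exact d2].
      apply (deriv_mult cid (fun x => x) (fun x => 1 - x)); [apply deriv_id |].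
      apply deriv_minus; [apply deriv_const | apply deriv_id].
    + cbv beta. change (3 + 2)%nat with 5%nat. unfold Cdiv. rewrite (Cmult_comm _ (/ 4)), <- O. ring.
Qed.

Lemma RtoC_cos_sqr t : RtoC (cos t * cos t) = 1 - RtoC (sin t * sin t).
Proof. rewrite <- RtoC_minus. f_equal. pose proof (sin2_cos2 t) as h. unfold Rsqr in h. lra. Qed.

Lemma sol_K : sol (fun x => DK x /\ x <> 0) EK vK.
Proof.
  apply (sol_of_ellint (fun _ => 1%R) msinsq (fun _ => 0%R) (fun t => (- (2 * (sin t * cos t)))%R)).
  - intros t. auto_derive; [trivial | ring].
  - intros t. unfold msinsq. auto_derive; [trivial | ring].
  - intros x [hx n0]. split; [exact n0 |]. split; [| now apply admissible_K].
    intros ->. apply hx. simpl. lra.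
  - intros x t A. unfold A, msinsq. rewrite RtoC_minus, RtoC_cos_sqr.
    rewrite (RtoC_opp (2 * _)), (RtoC_mult 2), (RtoC_opp (sin t * sin t)).
    replace (RtoC (3 / 2)) with (RtoC 3 / RtoC 2) by (now rewrite RtoC_div by lra).
    replace (RtoC (sin t * cos t)) with (RtoC (sin t) * RtoC (cos t)) by now rewrite RtoC_mult.
    assert (E : RtoC (cos t) * RtoC (cos t) = 1 - RtoC (sin t * sin t)) by (rewrite <- RtoC_mult; apply RtoC_cos_sqr).
    set (S := RtoC (sin t * sin t)) in *.
    transitivity (- ((1 - S - S) * (1 + x * - S) + 3 * x * S * (RtoC (cos t) * RtoC (cos t)))).
    + rewrite E. ring.
    + unfold S. rewrite !(RtoC_mult (sin t) (sin t)). field.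
Qed.

Lemma sol_L : sol DL EL vL.
Proof.
  apply (sol_of_ellint sinsq (fun _ => (- (1))%R) (fun t => (2 * (sin t * cos t))%R) (fun _ => 0%R)).
  - intros t. unfold sinsq. auto_derive; [trivial | ring].
  - intros t. auto_derive; [trivial | ring].
  - intros x hx. split; [| split]; [| | now apply admissible_L]; intros ->; apply hx; simpl; lra.
  - intros x t A. unfold A, sinsq. rewrite RtoC_minus, RtoC_cos_sqr.
    rewrite (RtoC_mult 2), (RtoC_opp 1).
    replace (RtoC (3 / 2)) with (RtoC 3 / RtoC 2) by (now rewrite RtoC_div by lra).
    replace (RtoC (sin t * cos t)) with (RtoC (sin t) * RtoC (cos t)) by now rewrite RtoC_mult.
    assert (E : RtoC (cos t) * RtoC (cos t) = 1 - RtoC (sin t * sin t)) by (rewrite <- RtoC_mult; apply RtoC_cos_sqr).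
    set (S := RtoC (sin t * sin t)) in *.
    transitivity (- ((1 - S - S) * (S - x) - 3 * S * (RtoC (cos t) * RtoC (cos t)))).
    + rewrite E. ring.
    + unfold S. rewrite !(RtoC_mult (sin t) (sin t)). field.
Qed.

(** * Positivity of mixed products of elliptic integrals *)

Lemma cint_Re_pos f a b :
  (a < b)%R -> rcont_on a b f -> (forall t, (a <= t <= b)%R -> (0 < Re (f t))%R) -> (0 < Re (cint f a b))%R.
Proof.
  intros hab Hf Hp. simpl. apply RInt_gt_0; [exact hab | intros; apply Hp; lra |].
  intros t ht. apply rcont_Re, Hf, ht.
Qed.

(** [conj (1/s1) (1/s2)] has a real part of the sign of [Re (conj s1 * s2)], so the hypothesis says
    that the roots enclose an angle below [PI / 2]. Moving constants under each integral in turn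
    replaces the double integral. *)
Lemma ellint_pair_pos (a1 b1 a2 b2 : R -> R) (x y : C) :
  (forall t, continuous a1 t) -> (forall t, continuous b1 t) -> (forall t, continuous a2 t) -> (forall t, continuous b2 t) ->
  admissible a1 b1 x -> admissible a2 b2 y ->
  (forall t t', (0 <= t <= PI / 2)%R -> (0 <= t' <= PI / 2)%R ->
     let s1 := csqrt (RtoC (a1 t) + x * RtoC (b1 t)) in let s2 := csqrt (RtoC (a2 t') + y * RtoC (b2 t')) in
     (0 < Re s1 * Re s2 + Im s1 * Im s2)%R) ->
  (0 < Re (Cconj (ellint a1 b1 (fun _ => 1%R) 1 x) * ellint a2 b2 (fun _ => 1%R) 1 y))%R.
Proof.
  intros ca1 cb1 ca2 cb2 h1 h2 H. pose proof PI_RGT_0 as hpi.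
  assert (k1 : forall t, continuous (fun _ : R => 1%R) t) by (intros; apply continuous_const).
  set (I1 := ellint a1 b1 (fun _ => 1%R) 1 x). set (I2 := ellint a2 b2 (fun _ => 1%R) 1 y).
  set (f1 := fun t => RtoC 1 * / csqrt (RtoC (a1 t) + x * RtoC (b1 t)) ^ 1).
  set (f2 := fun t => RtoC 1 * / csqrt (RtoC (a2 t) + y * RtoC (b2 t)) ^ 1).
  assert (R1 : rcont_on 0 (PI / 2) f1) by (intros t ht; apply (ell_integrand_rcont a1 b1 (fun _ => 1%R)); auto).
  assert (R2 : rcont_on 0 (PI / 2) f2) by (intros t ht; apply (ell_integrand_rcont a2 b2 (fun _ => 1%R)); auto).
  replace (Re (Cconj I1 * I2)) with (Re (Cconj I2 * I1)) by (reim; ring).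
  unfold I1, ellint. fold f1. rewrite <- cint_scal by (auto; lra).
  apply cint_Re_pos; [lra | intros t ht; apply cont_mult; [apply cont_const | now apply R1] |].
  intros t ht. replace (Re (Cconj I2 * f1 t)) with (Re (Cconj (f1 t) * I2)) by (reim; ring).
  unfold I2, ellint. fold f2. rewrite <- cint_scal by (auto; lra).
  apply cint_Re_pos; [lra | intros t' ht'; apply cont_mult; [apply cont_const | now apply R2] |].
  intros t' ht'. specialize (H t t' ht ht'). cbv zeta in H. unfold f1, f2.
  pose proof (csqrt_Re_pos _ (h1 t ht)) as p1. pose proof (csqrt_Re_pos _ (h2 t' ht')) as p2.
  set (s1 := csqrt _) in *. set (s2 := csqrt (RtoC (a2 t') + _)) in *.
  destruct s1 as [u1 v1], s2 as [u2 v2]. simpl in *.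
  replace (_ - _)%R with ((u1 * u2 + v1 * v2) / ((u1 * u1 + v1 * v1) * (u2 * u2 + v2 * v2)))%R.
  - apply Rdiv_lt_0_compat; [exact H |]. apply Rmult_lt_0_compat; nra.
  - field. repeat split; nra.
Qed.

(** Suppose [y = Im x] is nonzero. The imaginary parts of the roots have weakly opposite signs,
    given by [y], so [Im (conj s1 * s2)] has weakly the sign of [y]. Its product with
    [2 Re (conj s1 * s2)] is [y (s + s' - s s')], where the bracket is nonnegative and vanishes only
    for [s = s' = 0]; a nonpositive real part is then impossible. *)
Lemma EK_reflect_pos x : DK x -> DK (1 - x) -> (0 < Re (Cconj (EK x) * EK (1 - x)))%R.
Proof.
  intros h1 h2. pose proof (admissible_K _ h1) as A1. pose proof (admissible_K _ h2) as A2.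
  apply ellint_pair_pos; auto using continuous_msinsq; try (intros; apply continuous_const).
  intros t t' ht ht' s1 s2.
  assert (p1 : (0 < Re s1)%R) by exact (csqrt_Re_pos _ (A1 t ht)).
  assert (p2 : (0 < Re s2)%R) by exact (csqrt_Re_pos _ (A2 t' ht')).
  pose proof (csqrt_sqr (RtoC 1 + x * RtoC (msinsq t))) as e1.
  pose proof (csqrt_sqr (RtoC 1 + (1 - x) * RtoC (msinsq t'))) as e2.
  fold s1 in e1. fold s2 in e2. clearbody s1 s2. unfold msinsq in e1, e2.
  pose proof (f_equal Re e1) as r1. pose proof (f_equal Im e1) as i1.
  pose proof (f_equal Re e2) as r2. pose proof (f_equal Im e2) as i2.
  revert r1 i1 r2 i2. reim. pose proof (sin_sqr_bounds t). pose proof (sin_sqr_bounds t').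
  set (s := (sin t * sin t)%R) in *. set (s' := (sin t' * sin t')%R) in *.
  destruct s1 as [u1 v1], s2 as [u2 v2]. simpl Re in *. simpl Im in *.
  set (y := Im x). set (X := Re x). intros r1 i1 r2 i2.
  assert (j1 : (2 * u1 * v1 = - (y * s))%R) by lra.
  assert (j2 : (2 * u2 * v2 = y * s')%R) by lra.
  (* Imaginary part of [(conj s1 * s2)^2 = conj (s1^2) * s2^2]. *)
  assert (key : (2 * (u1 * u2 + v1 * v2) * (u1 * v2 - v1 * u2) = y * (s + s' - s * s'))%R).
  { replace (2 * (u1 * u2 + v1 * v2) * (u1 * v2 - v1 * u2))%R
      with ((u1 * u1 - v1 * v1) * (2 * u2 * v2) - (2 * u1 * v1) * (u2 * u2 - v2 * v2))%R by ring.
    rewrite r1, r2, j1, j2. ring. }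
  destruct (Rtotal_order y 0) as [hy | [hy | hy]].
  - assert (v1 >= 0)%R by nra. assert (v2 <= 0)%R by nra.
    apply Rnot_le_lt. intros N. assert (N2 : (u1 * v2 - v1 * u2 <= 0)%R) by nra.
    assert (0 <= (u1 * u2 + v1 * v2) * (u1 * v2 - v1 * u2))%R by nra.
    assert (s + s' - s * s' <= 0)%R by nra. assert (z1 : s = 0%R) by nra.
    rewrite z1 in *. assert (z2 : s' = 0%R) by lra. rewrite z2 in *.
    assert (v1 = 0)%R by nra. assert (v2 = 0)%R by nra. nra.
  - rewrite hy in *. assert (v1 = 0)%R by nra. assert (v2 = 0)%R by nra. subst v1 v2. nra.
  - assert (v1 <= 0)%R by nra. assert (v2 >= 0)%R by nra.
    apply Rnot_le_lt. intros N. assert (N2 : (0 <= u1 * v2 - v1 * u2)%R) by nra.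
    assert ((u1 * u2 + v1 * v2) * (u1 * v2 - v1 * u2) <= 0)%R by nra.
    assert (s + s' - s * s' <= 0)%R by nra. assert (z1 : s = 0%R) by nra.
    rewrite z1 in *. assert (z2 : s' = 0%R) by lra. rewrite z2 in *.
    assert (v1 = 0)%R by nra. assert (v2 = 0)%R by nra. nra.
Qed.

Lemma DL_DK x : DL x -> DK x.
Proof. intros h [h1 h2]. apply h. lra. Qed.

(** Here the imaginary parts of both radicands have the sign of [- Im x], or vanish, so those of the
    roots have a nonnegative product. *)
Lemma EK_EL_pos x : DL x -> (0 < Re (Cconj (EK x) * EL x))%R.
Proof.
  intros h. pose proof (admissible_K _ (DL_DK _ h)) as A1. pose proof (admissible_L _ h) as A2.
  apply ellint_pair_pos; auto using continuous_msinsq, continuous_sinsq; try (intros; apply continuous_const).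
  intros t t' ht ht' s1 s2.
  assert (p1 : (0 < Re s1)%R) by exact (csqrt_Re_pos _ (A1 t ht)).
  assert (p2 : (0 < Re s2)%R) by exact (csqrt_Re_pos _ (A2 t' ht')).
  pose proof (csqrt_sqr (RtoC 1 + x * RtoC (msinsq t))) as e1.
  pose proof (csqrt_sqr (RtoC (sinsq t') + x * RtoC (- (1)))) as e2.
  fold s1 in e1. fold s2 in e2. clearbody s1 s2. unfold msinsq, sinsq in e1, e2.
  pose proof (f_equal Im e1) as i1. pose proof (f_equal Im e2) as i2.
  revert i1 i2. reim. pose proof (sin_sqr_bounds t).
  set (s := (sin t * sin t)%R) in *.
  destruct s1 as [u1 v1], s2 as [u2 v2]. simpl Re in *. simpl Im in *.
  set (y := Im x). intros i1 i2.
  assert (j1 : (2 * u1 * v1 = - (y * s))%R) by lra.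
  assert (j2 : (2 * u2 * v2 = - y)%R) by lra.
  assert (0 <= v1 * v2)%R.
  { assert (0 <= (2 * u1 * v1) * (2 * u2 * v2))%R by (rewrite j1, j2; nra). 
    assert (0 < u1 * u2)%R by nra. apply Rnot_lt_le. intros N. nra. }
  nra.
Qed.

(** * The logarithm *)

(** The half-angle formula: a single expression on the whole slit plane, without the case
    distinction in [Carg], from which continuity can be read off. *)
Lemma Carg_atan z : slit z -> Carg z = (2 * atan (Im z / (Cmod z + Re z)))%R.
Proof.
  intros hz. pose proof (Cmod_sqr z) as hm. pose proof (Cmod_ge_0 z) as h0.
  set (x := Re z) in *. set (y := Im z) in *. set (m := Cmod z) in *.
  assert (hmx : (0 < m + x)%R).
  { destruct (Rlt_dec x 0) as [h | h].
    - assert (y <> 0)%R by (intros E; apply hz; unfold x, y in *; lra). nra.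
    - destruct (Req_dec x 0) as [E | E]; [| lra].
      assert (y <> 0)%R by (intros E'; apply hz; unfold x, y in *; lra). nra. }
  assert (hm0 : (0 < m)%R) by nra.
  set (q := (y / (m + x))%R).
  assert (hc : cos (2 * atan q) = (x / m)%R).
  { rewrite cos_2a_cos, cos_atan. unfold Rsqr.
    assert (hq : (0 < 1 + q * q)%R) by nra.
    replace (2 * (1 / sqrt (1 + q * q)) * (1 / sqrt (1 + q * q)) - 1)%R
      with (2 / (sqrt (1 + q * q) * sqrt (1 + q * q)) - 1)%R by (field; apply Rgt_not_eq, sqrt_lt_R0, hq).
    rewrite sqrt_sqrt by lra.
    assert (e : (1 + q * q = 2 * m / (m + x))%R).
    { unfold q. replace (2 * m / (m + x))%R with ((2 * m * (m + x)) / ((m + x) * (m + x)))%R by (field; lra).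
      replace (2 * m * (m + x))%R with ((m + x) * (m + x) + y * y)%R by nra. field. lra. }
    rewrite e. field. lra. }
  pose proof (atan_bound q) as hb. unfold Carg. fold x y m. rewrite <- hc.
  destruct (Rle_dec 0 y) as [h | h].
  - apply acos_cos. assert (0 <= atan q)%R.
    { destruct h as [h | h].
      - left. rewrite <- atan_0. apply atan_increasing. unfold q. now apply Rdiv_lt_0_compat.
      - unfold q. rewrite <- h. unfold Rdiv. rewrite Rmult_0_l, atan_0. lra. }
    lra.
  - replace (2 * atan q)%R with (- (2 * atan (- q)))%R by (rewrite atan_opp; ring).
    rewrite cos_neg. f_equal. apply acos_cos. rewrite atan_opp. assert (atan q < 0)%R.
    { rewrite <- atan_0. apply atan_increasing. unfold q.
      replace (y / (m + x))%R with (- ((- y) / (m + x)))%R by (field; lra).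
      assert (0 < (- y) / (m + x))%R by (apply Rdiv_lt_0_compat; lra). lra. }
    lra.
Qed.

Lemma Cexp_Cln z : slit z -> Cexp (Cln z) = z.
Proof.
  intros hz. pose proof (Cmod_sqr z) as hm. pose proof (Cmod_ge_0 z) as h0.
  assert (hm0 : (0 < Cmod z)%R).
  { apply Cmod_gt_0. intros ->. apply hz. simpl. lra. }
  assert (hb : (-1 <= Re z / Cmod z <= 1)%R).
  { split; apply (Rmult_le_reg_r (Cmod z)); try exact hm0; unfold Rdiv; rewrite Rmult_assoc, Rinv_l by lra;
      pose proof (re_le_Cmod z) as h; apply Rabs_le_between in h; lra. }
  assert (hs : sqrt (1 - (Re z / Cmod z)²) = (Rabs (Im z) / Cmod z)%R).
  { replace (1 - (Re z / Cmod z)²)%R with ((Im z / Cmod z)²).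
    - rewrite sqrt_Rsqr_abs. unfold Rdiv. rewrite Rabs_mult, (Rabs_pos_eq (/ Cmod z)); [reflexivity |].
      left. now apply Rinv_0_lt_compat.
    - unfold Rsqr. replace (1 - Re z / Cmod z * (Re z / Cmod z))%R
        with ((Cmod z * Cmod z - Re z * Re z) / (Cmod z * Cmod z))%R by (field; lra).
      rewrite hm. replace (Re z * Re z + Im z * Im z - Re z * Re z)%R with (Im z * Im z)%R by ring.
      rewrite <- hm. field. lra. }
  unfold Cexp, Cln, Carg. simpl Re. simpl Im. rewrite exp_ln by exact hm0.
  destruct (Rle_dec 0 (Im z)) as [h | h].
  - rewrite cos_acos, sin_acos, hs, Rabs_pos_eq by assumption. apply C_ext; simpl; field; lra.
  - rewrite cos_neg, sin_neg, cos_acos, sin_acos, hs, Rabs_left by (try assumption; lra).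
    apply C_ext; simpl; field; lra.
Qed.

Lemma cont_real_comp {T} (io : T -> C) (f : T -> R) (g : R -> R) x :
  cont_at io (fun y => RtoC (f y)) x -> continuous g (f x) -> cont_at io (fun y => RtoC (g (f y))) x.
Proof.
  intros Hf Hg eps he. apply rcont_continuous in Hg. destruct (Hg eps he) as (d & hd & H).
  destruct (Hf d hd) as (d' & hd' & H'). exists d'. split; [exact hd' |]. intros y hy. apply H, H', hy.
Qed.

Lemma slit_Cmod_Re z : slit z -> (0 < Cmod z + Re z)%R /\ (0 < Cmod z)%R.
Proof.
  intros hz. pose proof (csqrt_Re_pos z hz) as h. unfold csqrt in h. simpl in h.
  assert (h1 : (0 < (Cmod z + Re z) / 2)%R).
  { apply Rnot_le_lt. intros N. rewrite sqrt_neg_0 in h by exact N. lra. }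
  pose proof (re_le_Cmod z) as h2. apply Rabs_le_between in h2. lra.
Qed.

Lemma slit_open z : slit z -> near cid z slit.
Proof.
  intros hz. pose proof (csqrt_Re_pos z hz) as hp. set (m := Re (csqrt z)) in *.
  exists (m * m / 2)%R. split; [nra |]. unfold cid. intros w hw.
  apply (slit_perturb z w m); auto; unfold m in *; lra.
Qed.

Lemma Cln_cont z : slit z -> ccont Cln z.
Proof.
  intros hz. destruct (slit_Cmod_Re z hz) as [h1 h2].
  apply (cont_ext cid (fun w => RtoC (ln (Cmod w)) + Ci * RtoC (2 * atan (Im w / (Cmod w + Re w))))).
  - refine (near_imp _ _ _ _ _ (slit_open z hz)). intros w hw. unfold Cln. rewrite Carg_atan by exact hw.
    apply C_ext; reim; simpl; ring.
  - apply cont_plus; [| apply cont_mult; [apply cont_const |]].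
    + apply (cont_real_comp cid (fun w => Cmod w) ln); [apply cont_Cmod, cont_id |].
      apply (ex_derive_continuous ln). auto_derive. exact h2.
    + apply (cont_real_comp cid (fun w => Im w / (Cmod w + Re w))%R (fun t => 2 * atan t)%R).
      * apply (cont_ext cid (fun w => RtoC (Im w) / (RtoC (Cmod w) + RtoC (Re w)))).
        -- refine (near_imp _ _ _ _ _ (slit_open z hz)). intros w hw. destruct (slit_Cmod_Re w hw) as [h3 _].
           rewrite RtoC_div, RtoC_plus by lra. reflexivity.
        -- apply cont_div; [apply (cont_Im cid (fun w => w)), cont_id | |].
           ++ apply cont_plus; [apply cont_Cmod, cont_id | apply (cont_Re cid (fun w => w)), cont_id].
           ++ rewrite <- RtoC_plus. intros E. apply RtoC_inj in E. lra.
      * apply (ex_derive_continuous (fun t => 2 * atan t)%R). auto_derive. trivial.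
Qed.

(** The slope function of [Cexp] at [Cln z], composed with the continuous [Cln] and inverted, is a
    slope function of [Cln]. *)
Lemma Cln_deriv z : slit z -> cderiv Cln z (/ z).
Proof.
  intros hz. pose proof (Cln_cont z hz) as hc. pose proof (Cexp_Cln z hz) as he.
  destruct (Cexp_deriv (Cln z)) as (p & Ep & Hp & Hn). rewrite he in Ep.
  assert (z0 : z <> 0) by (intros ->; apply hz; simpl; lra).
  assert (Hp' : ccont (fun w => p (Cln w)) z) by now apply cont_comp.
  exists (fun w => / p (Cln w)). split; [now rewrite Ep |]. split.
  - apply cont_inv; [exact Hp' | now rewrite Ep].
  - assert (N1 : near cid z (fun w => p (Cln w) <> 0)) by (apply cont_neq; [exact Hp' | now rewrite Ep]).
    pose proof (cont_near _ _ _ _ hc Hn) as N2.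
    refine (near_imp _ _ _ _ _ (near_and _ _ _ _ (slit_open z hz) (near_and _ _ _ _ N1 N2))).
    unfold cid. intros w (hw & n0 & E). rewrite he, Cexp_Cln in E by exact hw.
    replace (w - z) with ((Cln w - Cln z) * p (Cln w)) by (rewrite E at 3; ring). field. exact n0.
Qed.

(** * Power series *)

(* The radius of convergence is at least [1]. *)
Definition tame (c : nat -> R) : Prop :=
  forall r, (0 < r < 1)%R -> exists B, forall k, (Rabs (c k) * r ^ k <= B)%R.

Definition ps (c : nat -> R) (z : C) : C := CSeries (fun k => RtoC (c k) * z ^ k).

Lemma CSeries_has_sum (a : nat -> C) s : has_sum a s -> CSeries a = s.
Proof.
  intros H. unfold CSeries. apply (iota_filterlim_locally (V := C_CompleteNormedModule)).
  assert (hex : forall i : nat, exists N, forall n, (N <= n)%nat -> In i (seq 0 (S n))).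
  { intros i. exists i. intros n hn. apply in_seq. lia. }
  pose proof (has_sum_exhaustion a s (fun n => seq 0 (S n)) (fun n => seq_NoDup _ _) hex H) as F.
  eapply filterlim_ext; [| exact F]. intros n. cbv beta. now rewrite lsum_seq.
Qed.

Lemma rsum_geom (q : R) (l : list nat) : (0 <= q < 1)%R -> NoDup l -> (rsum (fun k => q ^ k)%R l <= / (1 - q))%R.
Proof.
  intros hq hl.
  assert (HN : exists N, incl l (seq 0 N)).
  { clear hl. induction l as [| n l (N & IH)]; [exists 0%nat; intros x [] |].
    exists (Nat.max N (S n)). intros x [<- | hx]; apply in_seq; [lia |]. apply IH, in_seq in hx. lia. }
  destruct HN as (N & HN). eapply Rle_trans.
  - apply (rsum_incl _ l (seq 0 N)); auto using seq_NoDup. intros i. apply pow_le. lra.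
  - assert (E : forall n, (rsum (fun k => q ^ k)%R (seq 0 n) = (1 - q ^ n) / (1 - q))%R).
    { induction n; [simpl; field; lra |]. rewrite seq_S, rsum_app, IHn. simpl. field. lra. }
    rewrite E. unfold Rdiv. assert (0 <= q ^ N)%R by (apply pow_le; lra).
    assert (0 < / (1 - q))%R by (apply Rinv_0_lt_compat; lra). nra.
Qed.

Lemma geom_summable q : (0 <= q < 1)%R -> summable (fun k : nat => q ^ k)%R.
Proof.
  intros hq. exists (/ (1 - q))%R. split; [intros i; apply pow_le; lra |]. intros l hl. now apply rsum_geom.
Qed.

Lemma tame_summable c r : tame c -> (0 <= r < 1)%R -> summable (fun k => Rabs (c k) * r ^ k)%R.
Proof.
  intros hc hr. set (r' := ((1 + r) / 2)%R). destruct (hc r') as (B & hB); [unfold r'; lra |].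
  assert (hr' : (0 < r')%R) by (unfold r'; lra).
  assert (hq : (0 <= r / r' < 1)%R).
  { split; [apply Rmult_le_pos; [lra | left; now apply Rinv_0_lt_compat] |].
    apply (Rmult_lt_reg_r r'); [exact hr' |]. unfold Rdiv. rewrite Rmult_assoc, Rinv_l by lra. unfold r'. lra. }
  apply (summable_le _ (fun k => B * (r / r') ^ k)%R).
  - intros k. split; [apply Rmult_le_pos; [apply Rabs_pos | apply pow_le; lra] |].
    unfold Rdiv. rewrite Rpow_mult_distr, pow_inv. specialize (hB k).
    assert (0 < r' ^ k)%R by (now apply pow_lt). assert (0 <= r ^ k)%R by (apply pow_le; lra).
    apply (Rmult_le_reg_r (r' ^ k)); [assumption |].
    replace (B * (r ^ k * / r' ^ k) * r' ^ k)%R with (B * r ^ k)%R by (field; lra). nra.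
  - apply summable_scal; [| now apply geom_summable]. specialize (hB 0%nat). pose proof (Rabs_pos (c 0%nat)). simpl in hB. lra.
Qed.

Lemma ps_has_sum c z : tame c -> (Cmod z < 1)%R -> has_sum (fun k => RtoC (c k) * z ^ k) (ps c z).
Proof.
  intros hc hz. pose proof (Cmod_ge_0 z).
  destruct (has_sum_exists (fun k => RtoC (c k) * z ^ k) (fun k => Rabs (c k) * Cmod z ^ k)%R) as (s & Hs).
  - intros k. rewrite Cmod_mult, Cmod_R, Cmod_pow. lra.
  - apply tame_summable; auto.
  - unfold ps. now rewrite (CSeries_has_sum _ s Hs).
Qed.

Lemma tame_bounded c B : (forall k, (Rabs (c k) <= B)%R) -> tame c.
Proof.
  intros h r hr. exists B. intros k. assert (0 < r ^ k <= 1)%R.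
  { split; [apply pow_lt; lra |]. rewrite <- (pow1 k). apply pow_incr. lra. }
  specialize (h k). pose proof (Rabs_pos (c k)). nra.
Qed.

Lemma tame_le c c' : (forall k, (Rabs (c k) <= Rabs (c' k))%R) -> tame c' -> tame c.
Proof.
  intros h H r hr. destruct (H r hr) as (B & hB). exists B. intros k. eapply Rle_trans; [| apply (hB k)].
  apply Rmult_le_compat_r; [apply pow_le; lra | apply h].
Qed.

Lemma tame_plus c d : tame c -> tame d -> tame (fun k => c k + d k)%R.
Proof.
  intros h1 h2 r hr. destruct (h1 r hr) as (B & hB), (h2 r hr) as (D & hD). exists (B + D)%R. intros k.
  specialize (hB k). specialize (hD k). pose proof (Rabs_triang (c k) (d k)).
  assert (0 < r ^ k)%R by (apply pow_lt; lra). nra.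
Qed.

Lemma tame_scal a c : tame c -> tame (fun k => a * c k)%R.
Proof.
  intros h r hr. destruct (h r hr) as (B & hB). exists (Rabs a * B)%R. intros k. rewrite Rabs_mult, Rmult_assoc.
  apply Rmult_le_compat_l; [apply Rabs_pos | apply hB].
Qed.

(** Each of the [k] terms of the geometric sum up to exponent [k - 1] is at least [q ^ k]. *)
Lemma nat_pow_bound (q : R) k : (0 <= q < 1)%R -> (INR k * q ^ k <= / (1 - q))%R.
Proof.
  intros hq. eapply Rle_trans; [| apply (rsum_geom q (seq 0 k) hq), seq_NoDup].
  rewrite <- (length_seq k 0) at 1.
  assert (H : forall l, (forall i, In i l -> (i <= k)%nat) -> (INR (length l) * q ^ k <= rsum (fun i => q ^ i)%R l)%R).
  { induction l as [| i l IH]; intros h; [simpl; lra |].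
    change (length (i :: l)) with (S (length l)). rewrite S_INR. simpl rsum.
    assert (q ^ k <= q ^ i)%R.
    { replace k with (i + (k - i))%nat by (specialize (h i (or_introl eq_refl)); lia). rewrite pow_add.
      assert (0 <= q ^ i)%R by (apply pow_le; lra).
      assert (q ^ (k - i) <= 1)%R by (rewrite <- (pow1 (k - i)); apply pow_incr; lra). nra. }
    specialize (IH (fun j hj => h j (or_intror hj))). lra. }
  apply H. intros i hi. apply in_seq in hi. lia.
Qed.

(** The Euler operator [z d/dz] on coefficients. It does not shift indices, and it puts the
    hypergeometric equation into a form that is a recurrence. *)
Definition theta (c : nat -> R) (k : nat) : R := (INR k * c k)%R.

Lemma tame_theta c : tame c -> tame (theta c).
Proof.
  intros h r hr. set (r' := ((1 + r) / 2)%R). destruct (h r') as (B & hB); [unfold r'; lra |].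
  assert (hr' : (0 < r')%R) by (unfold r'; lra).
  assert (hq : (0 <= r / r' < 1)%R).
  { split; [apply Rmult_le_pos; [lra | left; now apply Rinv_0_lt_compat] |].
    apply (Rmult_lt_reg_r r'); [exact hr' |]. unfold Rdiv. rewrite Rmult_assoc, Rinv_l by lra. unfold r'. lra. }
  exists (B * / (1 - r / r'))%R. intros k. unfold theta. rewrite Rabs_mult, (Rabs_pos_eq (INR k)) by apply pos_INR.
  assert (0 < r' ^ k)%R by (now apply pow_lt).
  replace (INR k * Rabs (c k) * r ^ k)%R with ((Rabs (c k) * r' ^ k) * (INR k * (r / r') ^ k))%R.
  - apply Rmult_le_compat; [| | apply hB | now apply nat_pow_bound].
    + apply Rmult_le_pos; [apply Rabs_pos | lra].
    + apply Rmult_le_pos; [apply pos_INR | apply pow_le; lra].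
  - unfold Rdiv. rewrite Rpow_mult_distr, pow_inv. field. lra.
Qed.

Lemma ps_deriv c (z : C) : tame c -> z <> 0 -> (Cmod z < 1)%R -> cderiv (ps c) z (ps (theta c) z / z).
Proof.
  intros hc z0 hz. pose proof (tame_theta c hc) as ht. apply Cmod_gt_0 in z0 as zm.
  set (rho := ((1 + Cmod z) / 2)%R).
  apply (has_sum_deriv (fun k z => RtoC (c k) * z ^ k) (fun k z => RtoC (c k) * (RtoC (INR k) * z ^ (k - 1) * 1))
    (fun k => / rho * (Rabs (theta c k) * rho ^ k))%R z (rho - Cmod z)).
  - unfold rho. lra.
  - apply summable_scal; [left; apply Rinv_0_lt_compat; unfold rho; lra |]. apply tame_summable; [exact ht | unfold rho; lra].
  - intros k w hw. assert (hw' : (Cmod w <= rho)%R) by (pose proof (Cmod_sub_ge w z); lra). split.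
    + apply deriv_scal, (deriv_pow cid (fun w => w)), deriv_id.
    + rewrite !Cmod_mult, Cmod_pow, !Cmod_R, Rabs_R1, Rmult_1_r. unfold theta. rewrite Rabs_mult.
      rewrite (Rabs_pos_eq (INR k)) by apply pos_INR. pose proof (Cmod_ge_0 w).
      assert (hr : (0 < rho)%R) by (unfold rho; lra).
      destruct k; [simpl; rewrite !Rmult_0_l, !Rmult_0_r; lra |].
      replace (S k - 1)%nat with k by lia.
      replace (/ rho * (INR (S k) * Rabs (c (S k)) * rho ^ S k))%R with (Rabs (c (S k)) * (INR (S k) * rho ^ k))%R by (simpl pow; field; lra).
      apply Rmult_le_compat_l; [apply Rabs_pos |]. apply Rmult_le_compat_l; [apply pos_INR |]. apply pow_incr. lra.
  - intros w hw. apply ps_has_sum; [exact hc |]. pose proof (Cmod_sub_ge w z). unfold rho in *. lra.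
  - eapply has_sum_ext; [| unfold Cdiv; rewrite Cmult_comm; apply has_sum_scal, (ps_has_sum _ z ht hz)].
    intros k. cbv beta. unfold theta. rewrite RtoC_mult. destruct k; [simpl; ring |].
    replace (S k - 1)%nat with k by lia. simpl Cpow. field. exact z0.
Qed.

(** Turns a recurrence between consecutive coefficients into a relation between series. *)
Lemma ps_shift (e c : nat -> R) z :
  tame e -> tame c -> (Cmod z < 1)%R -> e 0%nat = 0%R -> (forall k, e (S k) = c k) -> ps e z = z * ps c z.
Proof.
  intros he hc hz E0 ES. pose proof (has_sum_scal z _ _ (ps_has_sum c z hc hz)) as H.
  unfold ps at 1. apply CSeries_has_sum. intros eps hp. destruct (H eps hp) as (l0 & H0).
  exists (0%nat :: map S l0). intros l hl hi.
  assert (hin : In 0%nat l) by (apply hi; now left).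
  set (l' := map pred (outside (0%nat :: nil) l)).
  assert (NZ : forall i, In i (outside (0%nat :: nil) l) -> i <> 0%nat).
  { intros i h. apply outside_In in h. intros ->. apply h. now left. }
  assert (hS : map S l' = outside (0%nat :: nil) l).
  { unfold l'. rewrite map_map. rewrite <- (map_id (outside (0%nat :: nil) l)) at 2.
    apply map_ext_in. intros i h. specialize (NZ i h). lia. }
  assert (h1 : NoDup (0%nat :: nil)) by (constructor; [intros [] | constructor]).
  assert (h2 : incl (0%nat :: nil) l) by (intros i [<- | []]; exact hin).
  rewrite (lsum_perm _ _ _ (outside_perm (0%nat :: nil) l h1 hl h2)), lsum_app.
  rewrite <- hS, lsum_map. simpl lsum at 1. rewrite E0.
  rewrite (lsum_ext (fun i => RtoC (e (S i)) * z ^ S i) (fun k => z * (RtoC (c k) * z ^ k)) l').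
  2:{ intros i _. rewrite ES. simpl. ring. }
  replace (0 * 1 + 0 + lsum (fun k => z * (RtoC (c k) * z ^ k)) l') with (lsum (fun k => z * (RtoC (c k) * z ^ k)) l') by ring.
  apply H0.
  - apply (NoDup_map_inv S). rewrite hS. now apply outside_NoDup.
  - intros i h. assert (hSi : In (S i) (map S l')).
    { rewrite hS. apply outside_In. split; [apply hi; right; now apply in_map | intros [E | []]; discriminate]. }
    apply in_map_iff in hSi. destruct hSi as (j & Ej & hj). now injection Ej as ->.
Qed.

Lemma ps_plus c d z : tame c -> tame d -> (Cmod z < 1)%R -> ps (fun k => c k + d k)%R z = ps c z + ps d z.
Proof.
  intros hc hd hz. unfold ps at 1. apply CSeries_has_sum.
  eapply has_sum_ext; [| apply has_sum_plus; [apply (ps_has_sum c z hc hz) | apply (ps_has_sum d z hd hz)]].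
  intros k. cbv beta. rewrite RtoC_plus. ring.
Qed.

Lemma ps_scal a c z : tame c -> (Cmod z < 1)%R -> ps (fun k => a * c k)%R z = RtoC a * ps c z.
Proof.
  intros hc hz. unfold ps at 1. apply CSeries_has_sum.
  eapply has_sum_ext; [| apply has_sum_scal, (ps_has_sum c z hc hz)].
  intros k. cbv beta. rewrite RtoC_mult. ring.
Qed.

Lemma ps_near_0 c : tame c ->
  exists S, (0 < S)%R /\ forall z, (Cmod z <= 1 / 2)%R -> (Cmod (ps c z - RtoC (c 0%nat)) <= S * Cmod z)%R.
Proof.
  intros hc. destruct (tame_summable c (1 / 2) hc) as (S & hS0 & hS); [lra |].
  exists (2 * S + 1)%R. split; [specialize (hS nil (NoDup_nil _)); simpl in hS; lra |]. intros z hz.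
  assert (hz1 : (Cmod z < 1)%R) by lra. pose proof (Cmod_ge_0 z) as hz0.
  assert (H : has_sum (fun k => RtoC (c k) * z ^ k + (if excluded_middle_informative (k = 0%nat) then - RtoC (c 0%nat) else 0))
     (ps c z + - RtoC (c 0%nat))).
  { apply has_sum_plus; [now apply ps_has_sum | apply has_sum_single]. }
  apply (has_sum_norm _ _ _ H). exists nil. intros l hl _.
  (* For [k >= 1] and [|z| <= 1/2], [|z|^k <= 2 |z| (1/2)^k]. *)
  eapply Rle_trans; [apply (lsum_norm _ (fun k => (2 * Cmod z) * (Rabs (c k) * (1 / 2) ^ k))%R) |].
  - intros k _. assert (0 <= (2 * Cmod z) * (Rabs (c k) * (1 / 2) ^ k))%R by (apply Rmult_le_pos; [lra | apply hS0]).
    destruct (excluded_middle_informative (k = 0%nat)) as [-> | n].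
    + simpl. replace (RtoC (c 0%nat) * 1 + - RtoC (c 0%nat)) with (RtoC 0) by ring. rewrite Cmod_0. simpl in *. lra.
    + replace (RtoC (c k) * z ^ k + 0) with (RtoC (c k) * z ^ k) by ring. rewrite Cmod_mult, Cmod_R, Cmod_pow.
      destruct k; [tauto |]. simpl pow. pose proof (Rabs_pos (c (Datatypes.S k))).
      assert (0 <= Cmod z ^ k)%R by (now apply pow_le).
      assert (Cmod z ^ k <= (1 / 2) ^ k)%R by (apply pow_incr; lra).
      replace (2 * Cmod z * (Rabs (c (Datatypes.S k)) * (1 / 2 * (1 / 2) ^ k)))%R
        with (Rabs (c (Datatypes.S k)) * (Cmod z * (1 / 2) ^ k))%R by field.
      apply Rmult_le_compat_l; [assumption |]. now apply Rmult_le_compat_l.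
  - rewrite rsum_scal. specialize (hS l hl). nra.
Qed.

Open Scope R_scope.

(** * The regular singular point *)

Lemma real_mean_value (f df : R -> R) (a b M : R) :
  a <= b -> (forall t, a <= t <= b -> is_derive f t (df t) /\ Rabs (df t) <= M) ->
  Rabs (f b - f a) <= M * (b - a).
Proof.
  intros hab H. replace (b - a) with (Rabs (b - a)) by (apply Rabs_pos_eq; lra).
  destruct (MVT_gen f a b df) as (c & hc & E).
  - rewrite Rmin_left, Rmax_right by lra. intros t ht. apply H. lra.
  - rewrite Rmin_left, Rmax_right by lra. intros t ht. apply continuity_pt_filterlim, (ex_derive_continuous f).
    eexists. apply H. exact ht.
  - rewrite Rmin_left, Rmax_right in hc by lra. rewrite E, Rabs_mult.
    apply Rmult_le_compat_r; [apply Rabs_pos | now apply H].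
Qed.

Lemma real_increasing (f df : R -> R) (a b : R) :
  a <= b -> (forall t, a <= t <= b -> is_derive f t (df t) /\ 0 <= df t) -> f a <= f b.
Proof.
  intros hab H. destruct (MVT_gen f a b df) as (c & hc & E).
  - rewrite Rmin_left, Rmax_right by lra. intros t ht. apply H. lra.
  - rewrite Rmin_left, Rmax_right by lra. intros t ht. apply continuity_pt_filterlim, (ex_derive_continuous f).
    eexists. apply H. exact ht.
  - rewrite Rmin_left, Rmax_right in hc by lra. pose proof (proj2 (H c hc)). nra.
Qed.

(** The system of [sol] along the ray [x = e t] with [e = 1] or [e = -1]. Its coefficients are real
    there, so real and imaginary parts of a solution satisfy it separately. *)
Definition singular_system (e T : R) (u v : R -> R) : Prop :=
  forall t, 0 < t < T -> is_derive u t (v t / (t * (1 - e * t))) /\ is_derive v t (e * u t / 4).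

(* Otherwise [u] would grow logarithmically at [0]. *)
Lemma singular_v_bound (e T S : R) (u v : R -> R) :
  Rabs e = 1 -> T <= 1 / 2 -> singular_system e T u v ->
  (forall t, 0 < t < T -> Rabs (u t) <= S) -> forall t, 0 < t < T -> Rabs (v t) <= S / 4 * t.
Proof.
  intros he hT H HS t0 ht0. apply Rnot_lt_le. intros N.
  assert (hS : 0 <= S) by (specialize (HS t0 ht0); pose proof (Rabs_pos (u t0)); lra).
  set (d := Rabs (v t0) - S / 4 * t0). assert (hd : 0 < d) by (unfold d; lra).
  set (sg := if Rle_dec 0 (v t0) then 1 else -1).
  assert (hsg : sg * v t0 = Rabs (v t0)).
  { unfold sg. destruct (Rle_dec 0 (v t0)); [rewrite Rabs_pos_eq by lra | rewrite Rabs_left by lra]; ring. }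
  assert (hsg1 : Rabs sg = 1).
  { unfold sg. destruct (Rle_dec 0 (v t0)); [apply Rabs_R1 |]. rewrite Rabs_left by lra. ring. }
  assert (Hv : forall s, 0 < s <= t0 -> d <= sg * v s).
  { intros s hs. assert (B : Rabs (v t0 - v s) <= S / 4 * (t0 - s)).
    { apply (real_mean_value v (fun t => e * u t / 4)); [lra |]. intros t ht. split; [apply H; lra |].
      unfold Rdiv. rewrite !Rabs_mult, he, (Rabs_pos_eq (/ 4)) by lra. specialize (HS t ltac:(lra)). lra. }
    assert (B2 : sg * (v t0 - v s) <= Rabs (v t0 - v s)).
    { rewrite <- (Rmult_1_l (Rabs (v t0 - v s))), <- hsg1, <- Rabs_mult. apply Rle_abs. }
    rewrite Rmult_minus_distr_l, hsg in B2. assert (0 <= S / 4 * s) by (apply Rmult_le_pos; lra).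
    unfold d. lra. }
  (* Since [1 - e t <= 3/2], the derivative of [sg u] is at least [k / t] on [(0, t0]]. *)
  set (k := d / 2). assert (hk : 0 < k) by (unfold k; lra).
  (* So near [0] that [k (ln t0 - ln s) = 2 S + 1], more than [u] can vary within the bound [S]. *)
  set (s := t0 * exp (- ((2 * S + 1) / k))).
  assert (he1 : 0 < exp (- ((2 * S + 1) / k)) < 1).
  { split; [apply exp_pos |]. apply Rlt_le_trans with (exp 0); [| rewrite exp_0; lra]. apply exp_increasing.
    assert (0 < (2 * S + 1) / k) by (apply Rdiv_lt_0_compat; lra). lra. }
  assert (hs : 0 < s < t0) by (unfold s; split; nra).
  assert (M : sg * u s - k * ln s <= sg * u t0 - k * ln t0).
  { apply (real_increasing (fun t => sg * u t - k * ln t) (fun t => sg * (v t / (t * (1 - e * t))) - k * / t)); [lra |].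
    intros t ht. destruct (H t ltac:(lra)) as [h1 _]. split.
    - apply (is_derive_minus (V := R_NormedModule) (fun t => sg * u t) (fun t => k * ln t)).
      + apply (is_derive_scal u). exact h1.
      + auto_derive; [lra | field; lra].
    - assert (b1 : Rabs (e * t) <= 1 / 2) by (rewrite Rabs_mult, he, Rabs_pos_eq by lra; lra).
      apply Rabs_le_between in b1. specialize (Hv t ltac:(lra)).
      replace (sg * (v t / (t * (1 - e * t))) - k * / t) with ((sg * v t - k * (1 - e * t)) / (t * (1 - e * t))) by (field; split; lra).
      apply Rmult_le_pos; [unfold k; nra |]. left. apply Rinv_0_lt_compat. apply Rmult_lt_0_compat; lra. }
  assert (L : ln s = ln t0 - (2 * S + 1) / k).
  { unfold s. rewrite ln_mult, ln_exp by (try apply exp_pos; lra). ring. }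
  rewrite L in M.
  assert (B1 : Rabs (sg * u s) <= S) by (rewrite Rabs_mult, hsg1, Rmult_1_l; apply HS; lra).
  assert (B2 : Rabs (sg * u t0) <= S) by (rewrite Rabs_mult, hsg1, Rmult_1_l; apply HS; lra).
  apply Rabs_le_between in B1, B2.
  replace (k * (ln t0 - (2 * S + 1) / k)) with (k * ln t0 - (2 * S + 1)) in M by (field; lra). lra.
Qed.

(** A contraction: [|v| <= S t / 4] gives [|u'| <= S / 2], and [u] is recovered by integrating from
    [0], where it tends to [0], over a length below [1]. Iteration forces [u = 0]. *)
Lemma singular_u_halves (e T S : R) (u v : R -> R) :
  Rabs e = 1 -> T <= 1 / 2 -> singular_system e T u v ->
  (forall eps, 0 < eps -> exists d, 0 < d /\ forall t, 0 < t < d -> Rabs (u t) < eps) ->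
  (forall t, 0 < t < T -> Rabs (u t) <= S) -> forall t, 0 < t < T -> Rabs (u t) <= S / 2.
Proof.
  intros he hT H H0 HS t ht. pose proof (singular_v_bound e T S u v he hT H HS) as Hv.
  assert (hS : 0 <= S) by (specialize (HS t ht); pose proof (Rabs_pos (u t)); lra).
  apply le_epsilon. intros eps hp. destruct (H0 eps hp) as (d & hd & Hd).
  set (s := Rmin (t / 2) (d / 2)).
  assert (hs : 0 < s <= t / 2 /\ s <= d / 2).
  { unfold s. split; [split; [apply Rmin_glb_lt; lra | apply Rmin_l] | apply Rmin_r]. }
  assert (B : Rabs (u t - u s) <= S / 2 * (t - s)).
  { apply (real_mean_value u (fun t => v t / (t * (1 - e * t)))); [lra |]. intros x hx. split; [apply H; lra |].
    assert (b1 : Rabs (e * x) <= 1 / 2) by (rewrite Rabs_mult, he, Rabs_pos_eq by lra; lra).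
    apply Rabs_le_between in b1. specialize (Hv x ltac:(lra)).
    unfold Rdiv. rewrite Rabs_mult, (Rabs_pos_eq (/ (x * (1 - e * x)))).
    2:{ left. apply Rinv_0_lt_compat, Rmult_lt_0_compat; lra. }
    apply (Rmult_le_reg_r (x * (1 - e * x))); [apply Rmult_lt_0_compat; lra |].
    rewrite Rmult_assoc, Rinv_l, Rmult_1_r by (apply Rgt_not_eq, Rmult_lt_0_compat; lra).
    eapply Rle_trans; [exact Hv |].
    replace (S / 4 * x) with (S * / 2 * (x * (1 / 2))) by field.
    apply Rmult_le_compat_l; [lra |]. apply Rmult_le_compat_l; lra. }
  specialize (Hd s ltac:(lra)). pose proof (Rabs_triang (u t - u s) (u s)) as Tr.
  replace (u t - u s + u s) with (u t) in Tr by ring. nra.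
Qed.

Lemma singular_unique (e : R) (u v : R -> R) :
  Rabs e = 1 -> singular_system e (1 / 2) u v ->
  (forall eps, 0 < eps -> exists d, 0 < d /\ forall t, 0 < t < d -> Rabs (u t) < eps) ->
  exists T, 0 < T <= 1 / 2 /\ forall t, 0 < t < T -> u t = 0 /\ v t = 0.
Proof.
  intros he H H0. destruct (H0 1 Rlt_0_1) as (d & hd & Hd). set (T := Rmin d (1 / 2)).
  assert (hT : 0 < T <= 1 / 2) by (unfold T; split; [apply Rmin_glb_lt; lra | apply Rmin_r]).
  assert (hTd : T <= d) by apply Rmin_l.
  assert (HT : singular_system e T u v) by (intros t ht; apply H; lra).
  exists T. split; [exact hT |].
  assert (B : forall n t, 0 < t < T -> Rabs (u t) <= (1 / 2) ^ n).
  { induction n; intros t ht.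
    - simpl. left. apply Hd. lra.
    - replace ((1 / 2) ^ S n) with ((1 / 2) ^ n / 2) by (simpl; field).
      apply (singular_u_halves e T _ u v); auto; lra. }
  assert (Z : forall t, 0 < t < T -> u t = 0).
  { intros t ht. apply NNPP. intros N. apply Rabs_pos_lt in N.
    destruct (pow_lt_1_zero (1 / 2) ltac:(rewrite Rabs_pos_eq; lra) _ N) as (n & hn).
    specialize (hn n (Nat.le_refl _)). rewrite Rabs_pos_eq in hn by (apply pow_le; lra).
    specialize (B n t ht). lra. }
  intros t ht. split; [now apply Z |].
  pose proof (singular_v_bound e T 0 u v he ltac:(lra) HT) as Hv.
  specialize (Hv ltac:(intros s hs; rewrite Z, Rabs_R0 by exact hs; lra) t ht).
  replace (0 / 4 * t) with 0 in Hv by field.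
  apply NNPP. intros N. apply Rabs_pos_lt in N. lra.
Qed.

(** * Asymptotics of the periods *)

Lemma sqrt_pos_bound (c A y : R) : 0 <= c -> 0 <= y -> c * c <= A <= c * c + y -> 0 <= sqrt A - c <= sqrt y.
Proof.
  intros hc hy hA. split.
  - assert (c <= sqrt A); [| lra]. rewrite <- (sqrt_Rsqr c hc). apply sqrt_le_1_alt. unfold Rsqr. lra.
  - assert (sqrt A <= c + sqrt y); [| lra].
    rewrite <- (sqrt_Rsqr (c + sqrt y)) by (pose proof (sqrt_pos y); lra).
    apply sqrt_le_1_alt. unfold Rsqr. pose proof (sqrt_pos y). pose proof (sqrt_sqrt y hy). nra.
Qed.

Lemma ln2_integral : is_RInt (fun t => cos t / (1 + sin t)) 0 (PI / 2) (ln 2).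
Proof.
  pose proof PI_RGT_0 as hpi.
  assert (hs : forall t, 0 <= t <= PI / 2 -> 0 < 1 + sin t).
  { intros t ht. pose proof (sin_ge_0 t ltac:(lra) ltac:(lra)). lra. }
  evar_last.
  - apply (is_RInt_derive (fun t => ln (1 + sin t)) (fun t => cos t / (1 + sin t))); rewrite Rmin_left, Rmax_right by lra.
    + intros t ht. specialize (hs t ht). auto_derive; [lra | field; lra].
    + intros t ht. specialize (hs t ht). apply (ex_derive_continuous (fun t => cos t / (1 + sin t))). auto_derive. lra.
  - rewrite sin_PI2, sin_0, Rplus_0_r, ln_1. unfold minus, plus, opp; simpl. rewrite Ropp_0, Rplus_0_r.
    now replace (1 + 1) with 2 by ring.
Qed.

(* [1/sqrt A = sin/sqrt A + (1 - sin)/sqrt A]: the first part is elementary and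
   carries the logarithm, the second tends to [ln 2]. *)
Lemma period_asymptotics (q y : R) :
  0 < q -> 0 < y -> 1 - y <= q * q <= 1 ->
  Rabs (RInt (fun t => / sqrt (q * q * (cos t * cos t) + y)) 0 (PI / 2)
        - (/ q * (ln (q + sqrt (q * q + y)) - ln (sqrt y)) + ln 2)) <= sqrt y * (PI / 2).
Proof.
  intros hq hy hqy. pose proof PI_RGT_0 as hpi.
  (* [q^2] is [1 - y] for [EK (1 - y)] and [1] for [EL (- y)]; in the second case [A] is the
     radicand after [t -> PI/2 - t]. *)
  set (A := fun t => q * q * (cos t * cos t) + y).
  assert (hA : forall t, 0 < A t) by (intros t; unfold A; pose proof (Rle_0_sqr (q * cos t)) as h; unfold Rsqr in h; nra).
  assert (hsA : forall t, 0 < sqrt (A t)) by (intros t; apply sqrt_lt_R0, hA).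
  assert (hsc : forall t, 0 <= t <= PI / 2 -> 0 <= sin t <= 1 /\ 0 <= cos t /\ sin t * sin t + cos t * cos t = 1).
  { intros t ht. pose proof (sin_ge_0 t ltac:(lra) ltac:(lra)). pose proof (cos_ge_0 t ltac:(lra) ltac:(lra)).
    pose proof (sin2_cos2 t) as h. unfold Rsqr in h. pose proof (SIN_bound t). lra. }
  assert (cA : forall t, continuous (fun t => / sqrt (A t)) t).
  { intros t. apply (ex_derive_continuous (fun t => / sqrt (A t))). unfold A. specialize (hA t). unfold A in hA.
    specialize (hsA t). unfold A in hsA. auto_derive. repeat split; lra. }
  assert (I1 : is_RInt (fun t => sin t * / sqrt (A t)) 0 (PI / 2) (/ q * (ln (q + sqrt (q * q + y)) - ln (sqrt y)))).
  { assert (hp : forall t, 0 <= t <= PI / 2 -> 0 < q * cos t + sqrt (A t)).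
    { intros t ht. destruct (hsc t ht) as (_ & h & _). specialize (hsA t). nra. }
    evar_last.
    (* The primitive comes from the substitution [q cos t], which leaves an inverse hyperbolic
       sine. *)
    - apply (is_RInt_derive (fun t => - / q * ln (q * cos t + sqrt (A t))) (fun t => sin t * / sqrt (A t)));
        rewrite Rmin_left, Rmax_right by lra.
      + intros t ht. specialize (hp t ht). pose proof (hA t) as h1. pose proof (hsA t) as h2. unfold A in *.
        auto_derive; [repeat split; lra |].
        set (w := sqrt (q * q * (cos t * cos t) + y)) in *. field. repeat split; lra.
      + intros t ht. apply (continuous_mult sin (fun t => / sqrt (A t))); [apply continuous_sin | apply cA].
    - unfold minus, plus, opp; simpl. unfold A. rewrite cos_PI2, cos_0, !Rmult_0_r, !Rmult_1_r, !Rplus_0_l. field. lra. }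
  assert (E2 : ex_RInt (fun t => (1 - sin t) * / sqrt (A t) - cos t / (1 + sin t)) 0 (PI / 2)).
  { apply ex_RInt_cont_on; [lra |]. intros t ht. destruct (hsc t ht) as (h & _).
    apply (continuous_minus (V := R_NormedModule) (fun t => (1 - sin t) * / sqrt (A t)) (fun t => cos t / (1 + sin t))).
    - apply (continuous_mult (fun t => 1 - sin t) (fun t => / sqrt (A t))); [| apply cA].
      apply (ex_derive_continuous (fun t => 1 - sin t)). auto_derive. trivial.
    - apply (ex_derive_continuous (fun t => cos t / (1 + sin t))). auto_derive. lra. }
  destruct E2 as (J & HJ). change R in J.
  assert (Hsum : is_RInt (fun t => / sqrt (A t)) 0 (PI / 2) (/ q * (ln (q + sqrt (q * q + y)) - ln (sqrt y)) + (J + ln 2))).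
  { apply (is_RInt_ext (fun t => plus (sin t * / sqrt (A t)) (plus ((1 - sin t) * / sqrt (A t) - cos t / (1 + sin t)) (cos t / (1 + sin t))))).
    - intros t _. unfold plus; simpl. ring.
    - apply (is_RInt_plus (V := R_NormedModule)); [exact I1 |]. apply (is_RInt_plus (V := R_NormedModule)); [exact HJ | exact ln2_integral]. }
  change (fun t => / sqrt (q * q * (cos t * cos t) + y)) with (fun t => / sqrt (A t)).
  rewrite (is_RInt_unique _ _ _ _ Hsum).
  match goal with |- Rabs ?e <= _ => replace e with (J : R) by (change (NormedModule.sort _ _) with R in *; ring) end.
  assert (Hb : forall t, 0 <= t <= PI / 2 -> Rabs ((1 - sin t) * / sqrt (A t) - cos t / (1 + sin t)) <= sqrt y).
  { intros t ht. destruct (hsc t ht) as (h1 & h2 & h3). pose proof (hsA t) as h4.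
    assert (h5 : 0 <= sqrt (A t) - cos t <= sqrt y).
    { apply sqrt_pos_bound; [exact h2 | lra |]. unfold A. assert (0 <= cos t * cos t <= 1) by nra. nra. }
    (* with [1 - s = c^2/(1+s)] the difference is [(c/(1+s)) (c - sqrt A)/sqrt A] *)
    replace ((1 - sin t) * / sqrt (A t) - cos t / (1 + sin t)) with (- (cos t * / sqrt (A t) * / (1 + sin t) * (sqrt (A t) - cos t))).
    - rewrite Rabs_Ropp, Rabs_pos_eq.
      + rewrite <- (Rmult_1_l (sqrt y)). apply Rmult_le_compat; try lra.
        * repeat apply Rmult_le_pos; try lra; left; apply Rinv_0_lt_compat; lra.
        * rewrite <- (Rmult_1_l 1). apply Rmult_le_compat.
          -- apply Rmult_le_pos; [lra |]. left. now apply Rinv_0_lt_compat.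
          -- left. apply Rinv_0_lt_compat. lra.
          -- apply (Rmult_le_reg_r (sqrt (A t))); [exact h4 |]. rewrite Rmult_assoc, Rinv_l by lra. lra.
          -- rewrite <- Rinv_1. apply Rinv_le_contravar; lra.
      + repeat apply Rmult_le_pos; try lra; left; apply Rinv_0_lt_compat; lra.
    - apply (Rmult_eq_reg_r (sqrt (A t) * (1 + sin t))); [| apply Rgt_not_eq, Rmult_lt_0_compat; lra].
      replace (- (cos t * / sqrt (A t) * / (1 + sin t) * (sqrt (A t) - cos t)) * (sqrt (A t) * (1 + sin t)))
        with (- (cos t * (sqrt (A t) - cos t))) by (field; lra).
      replace (((1 - sin t) * / sqrt (A t) - cos t / (1 + sin t)) * (sqrt (A t) * (1 + sin t)))
        with (1 - sin t * sin t - cos t * sqrt (A t)) by (field; lra). nra. }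
  apply Rabs_le.
  assert (E : ex_RInt (fun t => (1 - sin t) * / sqrt (A t) - cos t / (1 + sin t)) 0 (PI / 2)) by (eexists; exact HJ).
  assert (U : J <= RInt (fun _ => sqrt y) 0 (PI / 2)).
  { rewrite <- (is_RInt_unique _ _ _ _ HJ). apply RInt_le; [lra | exact E | apply ex_RInt_const |].
    intros t ht. specialize (Hb t ltac:(lra)). apply Rabs_le_between in Hb. lra. }
  assert (L : RInt (fun _ => - sqrt y) 0 (PI / 2) <= J).
  { rewrite <- (is_RInt_unique _ _ _ _ HJ). apply RInt_le; [lra | apply ex_RInt_const | exact E |].
    intros t ht. specialize (Hb t ltac:(lra)). apply Rabs_le_between in Hb. lra. }
  rewrite RInt_const in U, L. unfold scal in U, L; simpl in U, L. unfold mult in U, L; simpl in U, L. lra.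
Qed.

(** * The digamma function *)

Definition gint (s t : R) : R := Rpower t (s - 1) * exp (- t).

Lemma gint_exp s t : gint s t = exp ((s - 1) * ln t - t).
Proof. unfold gint, Rpower. rewrite <- exp_plus. f_equal. Qed.

Lemma gint_pos s t : 0 < gint s t.
Proof. rewrite gint_exp. apply exp_pos. Qed.

Lemma gint_cont s t : 0 < t -> continuous (gint s) t.
Proof.
  intros ht. apply (ex_derive_continuous (gint s)). unfold gint, Rpower. auto_derive. exact ht.
Qed.

Lemma gint_ex s a b : 0 < a <= b -> ex_RInt (gint s) a b.
Proof. intros h. apply ex_RInt_cont_on; [lra |]. intros t ht. apply gint_cont. lra. Qed.

Lemma gint_RInt_nonneg s a b : 0 < a <= b -> 0 <= RInt (gint s) a b.
Proof.
  intros h. apply RInt_ge_0; [lra | now apply gint_ex |]. intros t _. left. apply gint_pos.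
Qed.

(** On [(0, 1]] the integrand is compared with [t^(s-1)], whose integral is at most [1/s]; on
    [[1, b]] with [K exp (- t / 2)]. *)
Lemma gint_bound s : 0 < s -> exists B, forall a b, 0 < a <= b -> RInt (gint s) a b <= B.
Proof.
  intros hs.
  set (P := s + 1). set (K := exp (P * ln (2 * P))).
  (* near infinity: [(s-1) ln t <= P ln t <= t/2 + P ln (2P)] *)
  assert (H2 : forall b, 1 <= b -> RInt (gint s) 1 b <= 2 * K).
  { intros b hb.
    assert (I : is_RInt (fun t => K * exp (- t / 2)) 1 b (K * (-2 * exp (- b / 2)) - K * (-2 * exp (- 1 / 2)))).
    { apply (is_RInt_derive (fun t => K * (-2 * exp (- t / 2))) (fun t => K * exp (- t / 2))); rewrite Rmin_left, Rmax_right by lra.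
      - intros t _. auto_derive; [trivial |]. unfold Rdiv. field.
      - intros t _. apply (ex_derive_continuous (fun t => K * exp (- t / 2))). auto_derive. trivial. }
    eapply Rle_trans; [apply (RInt_le _ (fun t => K * exp (- t / 2))); [exact hb | apply gint_ex; lra | eexists; exact I |] |].
    - intros t ht. rewrite gint_exp. unfold K. rewrite <- exp_plus.
      assert (L : ln t <= t / (2 * P) - 1 + ln (2 * P)).
      { assert (hP : 0 < 2 * P) by (unfold P; lra).
        replace t with (t / (2 * P) * (2 * P)) at 1 by (field; lra).
        assert (hq : 0 < t / (2 * P)) by (apply Rdiv_lt_0_compat; lra).
        rewrite ln_mult by assumption. pose proof (exp_ineq1_le (ln (t / (2 * P)))) as h. rewrite exp_ln in h by exact hq. lra. }
      assert (L0 : 0 <= ln t) by (rewrite <- ln_1; apply Rcomplements.ln_le; lra).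
      assert (L2 : (s - 1) * ln t <= P * ln t) by (apply Rmult_le_compat_r; unfold P; lra).
      assert (L3 : P * ln t <= P * (t / (2 * P) - 1 + ln (2 * P))) by (apply Rmult_le_compat_l; [unfold P; lra | exact L]).
      replace (P * (t / (2 * P) - 1 + ln (2 * P))) with (t / 2 - P + P * ln (2 * P)) in L3 by (field; unfold P; lra).
      assert (hP : 0 < P) by (unfold P; lra).
      set (A := (s - 1) * ln t - t). set (A' := P * ln (2 * P) + - t / 2).
      assert (hAA : A <= A') by (unfold A, A'; lra).
      destruct hAA as [hAA | ->]; [left; now apply exp_increasing | lra].
    - rewrite (is_RInt_unique _ _ _ _ I). assert (0 < K) by apply exp_pos. pose proof (exp_pos (- b / 2)).
      assert (exp (- 1 / 2) <= 1) by (rewrite <- exp_0; left; apply exp_increasing; lra). nra. }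
  assert (H1 : forall a, 0 < a <= 1 -> RInt (gint s) a 1 <= / s).
  { intros a ha.
    assert (I : is_RInt (fun t => exp ((s - 1) * ln t)) a 1 (/ s * exp (s * ln 1) - / s * exp (s * ln a))).
    { apply (is_RInt_derive (fun t => / s * exp (s * ln t)) (fun t => exp ((s - 1) * ln t))); rewrite Rmin_left, Rmax_right by lra.
      - intros t ht. auto_derive; [lra |].
        replace ((s - 1) * ln t) with (s * ln t + - ln t) by ring. rewrite exp_plus, exp_Ropp, exp_ln by lra. field. lra.
      - intros t ht. apply (ex_derive_continuous (fun t => exp ((s - 1) * ln t))). auto_derive. lra. }
    eapply Rle_trans; [apply (RInt_le _ (fun t => exp ((s - 1) * ln t))); [lra | apply gint_ex; lra | eexists; exact I |] |].
    - intros t ht. rewrite gint_exp. left. apply exp_increasing. lra.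
    - rewrite (is_RInt_unique _ _ _ _ I), ln_1, Rmult_0_r, exp_0, Rmult_1_r.
      assert (0 < / s) by now apply Rinv_0_lt_compat. pose proof (exp_pos (s * ln a)). nra. }
  exists (/ s + 2 * K). intros a b hab.
  set (a' := Rmin a 1). set (b' := Rmax b 1).
  assert (ha' : 0 < a' <= 1 /\ a' <= a) by (unfold a'; repeat split; [apply Rmin_glb_lt; lra | apply Rmin_r | apply Rmin_l]).
  assert (hb' : 1 <= b' /\ b <= b') by (unfold b'; split; [apply Rmax_r | apply Rmax_l]).
  rewrite <- (Rplus_0_r (RInt (gint s) a b)).
  specialize (H1 a' ltac:(lra)). specialize (H2 b' ltac:(lra)).
  assert (Ch : RInt (gint s) a' 1 + RInt (gint s) 1 b' = RInt (gint s) a' a + (RInt (gint s) a b + RInt (gint s) b b')).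
  { assert (C : forall x y z, 0 < x <= y -> y <= z -> RInt (gint s) x y + RInt (gint s) y z = RInt (gint s) x z).
    { intros x y z h1 h2. apply (RInt_Chasles (V := R_CompleteNormedModule) (gint s)); apply gint_ex; lra. }
    rewrite !C by lra. reflexivity. }
  pose proof (gint_RInt_nonneg s a' a ltac:(lra)). pose proof (gint_RInt_nonneg s b b' ltac:(lra)). lra.
Qed.

(** The integrand being positive, the improper integral is the supremum of the integrals over
    compact intervals. These two properties are the interface through which [Gamma] is used. *)
Lemma Gamma_spec s : 0 < s ->
  (forall a b, 0 < a <= b -> RInt (gint s) a b <= Gamma s) /\
  (forall eps, 0 < eps -> exists d N, 0 < d <= 1 /\ 1 <= N /\
     forall a b, 0 < a < d -> N < b -> Gamma s - eps < RInt (gint s) a b).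
Proof.
  intros hs. destruct (gint_bound s hs) as (B & HB).
  destruct (completeness (fun x => exists a b, 0 < a <= b /\ x = RInt (gint s) a b)) as (G & ub & lub).
  { exists B. intros x (a & b & h & ->). now apply HB. }
  { exists (RInt (gint s) 1 1), 1, 1. split; [lra | reflexivity]. }
  assert (U : forall a b, 0 < a <= b -> RInt (gint s) a b <= G).
  { intros a b h. apply ub. now exists a, b. }
  assert (Lo : forall eps, 0 < eps -> exists d N, 0 < d <= 1 /\ 1 <= N /\
     forall a b, 0 < a < d -> N < b -> G - eps < RInt (gint s) a b).
  { intros eps he.
    assert (E : exists a0 b0, 0 < a0 <= b0 /\ G - eps < RInt (gint s) a0 b0).
    { apply NNPP. intros N. assert (G <= G - eps); [| lra]. apply lub. intros x (a & b & h & ->).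
      apply Rnot_lt_le. intros h'. apply N. now exists a, b. }
    destruct E as (a0 & b0 & h0 & E). exists (Rmin a0 1), (Rmax b0 1).
    split; [split; [apply Rmin_glb_lt; lra | apply Rmin_r] |]. split; [apply Rmax_r |].
    intros a b ha hb. pose proof (Rmin_l a0 1). pose proof (Rmax_l b0 1).
    assert (C : forall x y z, 0 < x <= y -> y <= z -> RInt (gint s) x y + RInt (gint s) y z = RInt (gint s) x z).
    { intros x y z h1 h2. apply (RInt_Chasles (V := R_CompleteNormedModule) (gint s)); apply gint_ex; lra. }
    rewrite <- (C a a0 b), <- (C a0 b0 b) by lra.
    pose proof (gint_RInt_nonneg s a a0 ltac:(lra)). pose proof (gint_RInt_nonneg s b0 b ltac:(lra)). lra. }
  assert (EG : Gamma s = G).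
  { unfold Gamma. apply is_RInt_gen_unique. intros P [eps HP]. destruct (Lo eps (cond_pos eps)) as (d & N & hd & hN & H).
    apply (Filter_prod _ _ _ (fun a => 0 < a < d) (fun b => N < b)).
    - exists (mkposreal d (proj1 hd)). intros y hy h0. split; [exact h0 |].
      apply Rabs_lt_between in hy. unfold minus, plus, opp in hy; simpl in hy. lra.
    - exists N. auto.
    - intros a b ha hb. exists (RInt (gint s) a b). split.
      + simpl. apply (RInt_correct (V := R_CompleteNormedModule) (gint s)). apply gint_ex. lra.
      + apply HP. specialize (H a b ha hb). specialize (U a b ltac:(lra)).
        apply Rabs_lt_between. unfold minus, plus, opp; simpl. pose proof (cond_pos eps). lra. }
  rewrite EG. auto.
Qed.

Lemma Gamma_pos s : 0 < s -> 0 < Gamma s.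
Proof.
  intros hs. destruct (Gamma_spec s hs) as [U _]. apply Rlt_le_trans with (RInt (gint s) 1 2); [| apply U; lra].
  apply RInt_gt_0; [lra | intros; apply gint_pos | intros; apply gint_cont; lra].
Qed.

Lemma Gamma_succ s : 0 < s -> Gamma (s + 1) = s * Gamma s.
Proof.
  intros hs. destruct (Gamma_spec s hs) as [U1 L1]. destruct (Gamma_spec (s + 1) ltac:(lra)) as [U2 L2].
  assert (IBP : forall a b, 0 < a <= b ->
     RInt (gint (s + 1)) a b - s * RInt (gint s) a b = exp (s * ln a - a) - exp (s * ln b - b)).
  { intros a b h. assert (I : is_RInt (fun t => gint (s + 1) t - s * gint s t) a b (- exp (s * ln b - b) - - exp (s * ln a - a))).
    { apply (is_RInt_derive (fun t => - exp (s * ln t - t)) (fun t => gint (s + 1) t - s * gint s t)); rewrite Rmin_left, Rmax_right by lra.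
      - intros t ht. rewrite !gint_exp. auto_derive; [lra |].
        replace ((s + 1 - 1) * ln t - t) with (s * ln t - t) by ring.
        replace ((s - 1) * ln t - t) with ((s * ln t - t) + - ln t) by ring.
        rewrite (exp_plus (s * ln t - t) (- ln t)), (exp_Ropp (ln t)), exp_ln by lra. replace (s * ln t + - t) with (s * ln t - t) by ring. field. lra.
      - intros t ht. apply (continuous_minus (V := R_NormedModule) (gint (s + 1)) (fun t => s * gint s t)); [apply gint_cont; lra |].
        apply (continuous_scal_r (V := R_NormedModule) s (gint s)). apply gint_cont. lra. }
    assert (I2 : is_RInt (fun t => gint (s + 1) t - s * gint s t) a b (RInt (gint (s + 1)) a b - s * RInt (gint s) a b)).
    { apply (is_RInt_minus (V := R_NormedModule) (gint (s + 1)) (fun t => s * gint s t)).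
      - apply (RInt_correct (V := R_CompleteNormedModule) (gint (s + 1))), gint_ex, h.
      - apply (is_RInt_scal (V := R_NormedModule) (gint s)). apply (RInt_correct (V := R_CompleteNormedModule) (gint s)), gint_ex, h. }
    rewrite <- (is_RInt_unique _ _ _ _ I2). rewrite (is_RInt_unique _ _ _ _ I). ring. }
  (* boundary terms: [exp (s ln t - t)] is small for small and for large [t] *)
  assert (Bd : forall eps, 0 < eps -> exists d N, 0 < d /\ forall t, 0 < t < d \/ N < t -> 0 < t -> exp (s * ln t - t) < eps).
  { intros eps he. exists (exp (ln eps / s)), (Rmax 1 (2 * (s * ln (2 * s) + Rabs (ln eps)) + 1)). split; [apply exp_pos |].
    intros t ht ht0. rewrite <- (exp_ln eps he). apply exp_increasing. destruct ht as [ht | ht].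
    - assert (ln t < ln eps / s) by (rewrite <- (ln_exp (ln eps / s)); apply ln_increasing; lra).
      apply (Rmult_lt_compat_l s) in H; [| exact hs]. replace (s * (ln eps / s)) with (ln eps) in H by (field; lra). lra.
    - pose proof (Rmax_l 1 (2 * (s * ln (2 * s) + Rabs (ln eps)) + 1)).
      pose proof (Rmax_r 1 (2 * (s * ln (2 * s) + Rabs (ln eps)) + 1)).
      assert (hq : 0 < t / (2 * s)) by (apply Rdiv_lt_0_compat; lra).
      assert (L : ln t <= t / (2 * s) - 1 + ln (2 * s)).
      { replace t with (t / (2 * s) * (2 * s)) at 1 by (field; lra).
        rewrite ln_mult by lra. pose proof (exp_ineq1_le (ln (t / (2 * s)))) as h. rewrite exp_ln in h by exact hq. lra. }
      apply (Rmult_le_compat_l s) in L; [| lra].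
      replace (s * (t / (2 * s) - 1 + ln (2 * s))) with (t / 2 - s + s * ln (2 * s)) in L by (field; lra).
      pose proof (Rle_abs (- ln eps)) as h. rewrite Rabs_Ropp in h. lra. }
  apply Rminus_diag_uniq. apply NNPP. intros N. apply Rabs_pos_lt in N.
  (* The errors are [eps] for [Gamma (s + 1)], [s eps] for [s * Gamma s], and [eps] for each
     boundary term. *)
  set (eps := Rabs (Gamma (s + 1) - s * Gamma s) / (3 + s)). assert (he : 0 < eps) by (apply Rdiv_lt_0_compat; lra).
  destruct (L1 eps he) as (d1 & N1 & hd1 & hN1 & H1). destruct (L2 eps he) as (d2 & N2 & hd2 & hN2 & H2).
  destruct (Bd eps he) as (d3 & N3 & hd3 & H3).
  set (a := Rmin d1 (Rmin d2 d3) / 2). set (b := Rmax N1 (Rmax N2 N3) + 1).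
  assert (ha : 0 < a /\ a < d1 /\ a < d2 /\ a < d3).
  { unfold a. pose proof (Rmin_l d1 (Rmin d2 d3)). pose proof (Rmin_r d1 (Rmin d2 d3)).
    pose proof (Rmin_l d2 d3). pose proof (Rmin_r d2 d3).
    assert (0 < Rmin d1 (Rmin d2 d3)) by (repeat apply Rmin_glb_lt; lra). lra. }
  assert (hb : N1 < b /\ N2 < b /\ N3 < b).
  { unfold b. pose proof (Rmax_l N1 (Rmax N2 N3)). pose proof (Rmax_r N1 (Rmax N2 N3)).
    pose proof (Rmax_l N2 N3). pose proof (Rmax_r N2 N3). lra. }
  specialize (H1 a b ltac:(lra) ltac:(lra)). specialize (H2 a b ltac:(lra) ltac:(lra)).
  specialize (U1 a b ltac:(lra)). specialize (U2 a b ltac:(lra)). specialize (IBP a b ltac:(lra)).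
  pose proof (H3 a ltac:(lra) ltac:(lra)) as B1. pose proof (H3 b ltac:(lra) ltac:(lra)) as B2.
  pose proof (exp_pos (s * ln a - a)). pose proof (exp_pos (s * ln b - b)).
  assert (hlt : Rabs (Gamma (s + 1) - s * Gamma s) < eps * (3 + s)).
  { assert (s * (Gamma s - RInt (gint s) a b) < s * eps) by (apply Rmult_lt_compat_l; lra).
    assert (0 <= s * (Gamma s - RInt (gint s) a b)) by (apply Rmult_le_pos; lra).
    apply Rabs_def1; nra. }
  unfold eps in hlt. unfold Rdiv in hlt. rewrite Rmult_assoc, Rinv_l in hlt by lra. lra.
Qed.

(** * Logarithmic convexity of the Gamma function *)

(** The tangent inequality at the intermediate point [m], averaged. *)
Lemma exp_convex A B l : 0 <= l <= 1 -> exp (l * A + (1 - l) * B) <= l * exp A + (1 - l) * exp B.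
Proof.
  intros hl. set (m := l * A + (1 - l) * B).
  assert (T : forall x, exp m * (1 + (x - m)) <= exp x).
  { intros x. replace x with (m + (x - m)) at 2 by ring. rewrite exp_plus. apply Rmult_le_compat_l; [left; apply exp_pos |].
    pose proof (exp_ineq1_le (x - m)). lra. }
  pose proof (T A) as hA. pose proof (T B) as hB.
  apply (Rmult_le_compat_l l) in hA; [| lra]. apply (Rmult_le_compat_l (1 - l)) in hB; [| lra].
  replace (exp m) with (l * (exp m * (1 + (A - m))) + (1 - l) * (exp m * (1 + (B - m)))) at 1; [lra |].
  replace (l * (exp m * (1 + (A - m))) + (1 - l) * (exp m * (1 + (B - m))))
    with (exp m * (1 + (l * A + (1 - l) * B - m))) by ring.
  unfold m. ring.
Qed.

Definition lnG (s : R) : R := ln (Gamma s).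

(** Hoelder's inequality, proved by normalising both integrands to mass one and integrating the
    pointwise convexity of [exp]. *)
Lemma lnG_convex x y l : 0 < x -> 0 < y -> 0 <= l <= 1 -> lnG (l * x + (1 - l) * y) <= l * lnG x + (1 - l) * lnG y.
Proof.
  intros hx hy hl. set (z := l * x + (1 - l) * y). assert (hz : 0 < z) by (unfold z; nra).
  destruct (Gamma_spec x hx) as [Ux _]. destruct (Gamma_spec y hy) as [Uy _]. destruct (Gamma_spec z hz) as [_ Lz].
  set (K := exp (l * lnG x + (1 - l) * lnG y)). assert (hK : 0 < K) by apply exp_pos.
  pose proof (Gamma_pos x hx) as gx. pose proof (Gamma_pos y hy) as gy.
  assert (Pt : forall t, gint z t <= K * l * / Gamma x * gint x t + K * (1 - l) * / Gamma y * gint y t).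
  { intros t. pose proof (exp_convex ((x - 1) * ln t - t - lnG x) ((y - 1) * ln t - t - lnG y) l hl) as h.
    replace (l * ((x - 1) * ln t - t - lnG x) + (1 - l) * ((y - 1) * ln t - t - lnG y))
      with ((z - 1) * ln t - t + - (l * lnG x + (1 - l) * lnG y)) in h by (unfold z; ring).
    assert (Ed : forall s, 0 < s -> exp ((s - 1) * ln t - t - lnG s) = gint s t * / Gamma s).
    { intros s hs. unfold Rminus at 1. rewrite exp_plus, exp_Ropp, <- gint_exp. unfold lnG. now rewrite exp_ln by now apply Gamma_pos. }
    rewrite !Ed, exp_plus, exp_Ropp, <- gint_exp in h by assumption. fold K in h.
    apply (Rmult_le_compat_l K) in h; [| lra].
    replace (K * (gint z t * / K)) with (gint z t) in h by (field; lra).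
    eapply Rle_trans; [exact h |]. right. ring. }
  assert (B : forall a b, 0 < a <= b -> RInt (gint z) a b <= K).
  { intros a b h.
    assert (hi : is_RInt (fun t => K * l * / Gamma x * gint x t + K * (1 - l) * / Gamma y * gint y t) a b
       (K * l * / Gamma x * RInt (gint x) a b + K * (1 - l) * / Gamma y * RInt (gint y) a b)).
    { apply (is_RInt_plus (V := R_NormedModule) (fun t => K * l * / Gamma x * gint x t)); apply (is_RInt_scal (V := R_NormedModule));
        apply (RInt_correct (V := R_CompleteNormedModule)); now apply gint_ex. }
    eapply Rle_trans; [apply (RInt_le _ _ a b ltac:(lra) (gint_ex z a b h) (ex_intro _ _ hi)); intros t _; apply Pt |].
    rewrite (is_RInt_unique _ _ _ _ hi). specialize (Ux a b h). specialize (Uy a b h).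
    assert (0 < / Gamma x) by now apply Rinv_0_lt_compat. assert (0 < / Gamma y) by now apply Rinv_0_lt_compat.
    replace K with (K * l * / Gamma x * Gamma x + K * (1 - l) * / Gamma y * Gamma y) at 3 by (field; lra).
    apply Rplus_le_compat; apply Rmult_le_compat_l; auto; repeat apply Rmult_le_pos; lra. }
  assert (G : Gamma z <= K).
  { apply Rnot_lt_le. intros N. destruct (Lz (Gamma z - K) ltac:(lra)) as (d & M & hd & hM & H).
    specialize (H (d / 2) (M + 1) ltac:(lra) ltac:(lra)). specialize (B (d / 2) (M + 1) ltac:(lra)). lra. }
  unfold lnG at 1. rewrite <- (ln_exp (l * lnG x + (1 - l) * lnG y)). fold K.
  apply Rcomplements.ln_le; [now apply Gamma_pos | exact G].
Qed.

Lemma rsum_seq_S (a : nat -> R) n : rsum a (seq 0 (S n)) = rsum a (seq 0 n) + a n.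
Proof. rewrite seq_S, rsum_app. simpl. ring. Qed.

Lemma lnG_succ s : 0 < s -> lnG (s + 1) = ln s + lnG s.
Proof. intros hs. unfold lnG. rewrite Gamma_succ, ln_mult; auto. now apply Gamma_pos. Qed.

Lemma lnG_add s n : 0 < s -> lnG (s + INR n) = lnG s + rsum (fun j => ln (s + INR j)) (seq 0 n).
Proof.
  intros hs. induction n; [simpl; now rewrite !Rplus_0_r |].
  rewrite rsum_seq_S, S_INR.
  replace (s + (INR n + 1)) with (s + INR n + 1) by ring.
  rewrite lnG_succ, IHn by (pose proof (pos_INR n); lra). ring.
Qed.

(** By the functional equation the slopes of [lnG] on [[N - 1, N]] and [[N, N + 1]] are [ln (N - 1)]
    and [ln N]; convexity squeezes the slope of a shorter chord at [N] between them. *)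
Lemma lnG_slope N h : 1 < N -> h <> 0 -> Rabs h <= 1 ->
  ln (N - 1) <= (lnG (N + h) - lnG N) / h <= ln N.
Proof.
  intros hN h0 hh. apply Rabs_le_between in hh.
  assert (E1 : lnG (N + 1) = ln N + lnG N) by (apply lnG_succ; lra).
  assert (E0 : lnG N = ln (N - 1) + lnG (N - 1)).
  { replace N with (N - 1 + 1) at 1 by ring. apply lnG_succ. lra. }
  destruct (Rlt_dec 0 h) as [hp | hn].
  - pose proof (lnG_convex (N + 1) N h ltac:(lra) ltac:(lra) ltac:(lra)) as c1.
    replace (h * (N + 1) + (1 - h) * N) with (N + h) in c1 by ring.
    assert (hl : 0 <= / (1 + h) <= 1).
    { split; [left; apply Rinv_0_lt_compat; lra |]. rewrite <- Rinv_1. apply Rinv_le_contravar; lra. }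
    destruct (Rle_lt_or_eq_dec h 1 (proj2 hh)) as [h1 | h1].
    + pose proof (lnG_convex (N + h) (N - 1) (/ (1 + h)) ltac:(lra) ltac:(lra) hl) as c2.
      replace (/ (1 + h) * (N + h) + (1 - / (1 + h)) * (N - 1)) with N in c2 by (field; lra).
      apply (Rmult_le_compat_l (1 + h)) in c2; [| lra].
      replace ((1 + h) * (/ (1 + h) * lnG (N + h) + (1 - / (1 + h)) * lnG (N - 1)))
        with (lnG (N + h) + h * lnG (N - 1)) in c2 by (field; lra).
      split; (apply (Rmult_le_reg_r h); [exact hp |]; unfold Rdiv; rewrite Rmult_assoc, Rinv_l, Rmult_1_r by lra); nra.
    + subst h. rewrite E1. split; [| lra]. replace ((ln N + lnG N - lnG N) / 1) with (ln N) by field.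
      apply Rcomplements.ln_le; lra.
  - set (k := - h). assert (hk : 0 < k <= 1) by (unfold k; lra).
    replace (N + h) with (N - k) by (unfold k; ring).
    replace ((lnG (N - k) - lnG N) / h) with ((lnG N - lnG (N - k)) / k) by (unfold k; field; lra).
    pose proof (lnG_convex (N - 1) N k ltac:(lra) ltac:(lra) ltac:(lra)) as c1.
    replace (k * (N - 1) + (1 - k) * N) with (N - k) in c1 by ring.
    assert (hl : 0 <= / (1 + k) <= 1).
    { split; [left; apply Rinv_0_lt_compat; lra |]. rewrite <- Rinv_1. apply Rinv_le_contravar; lra. }
    pose proof (lnG_convex (N - k) (N + 1) (/ (1 + k)) ltac:(lra) ltac:(lra) hl) as c2.
    replace (/ (1 + k) * (N - k) + (1 - / (1 + k)) * (N + 1)) with N in c2 by (field; lra).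
    apply (Rmult_le_compat_l (1 + k)) in c2; [| lra].
    replace ((1 + k) * (/ (1 + k) * lnG (N - k) + (1 - / (1 + k)) * lnG (N + 1)))
      with (lnG (N - k) + k * lnG (N + 1)) in c2 by (field; lra).
    split; (apply (Rmult_le_reg_r k); [lra |]; unfold Rdiv; rewrite Rmult_assoc, Rinv_l, Rmult_1_r by lra); nra.
Qed.

Definition psi_approx (s : R) (n : nat) : R := ln (s + INR n) - rsum (fun j => / (s + INR j)) (seq 0 n).

Lemma ln_sum_derive s n : 0 < s ->
  is_derive (fun x => rsum (fun j => ln (x + INR j)) (seq 0 n)) s (rsum (fun j => / (s + INR j)) (seq 0 n)).
Proof.
  intros hs. generalize (seq 0 n). induction l; simpl.
  - apply (is_derive_const (V := R_NormedModule)).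
  - apply (is_derive_plus (V := R_NormedModule) (fun x => ln (x + INR a))); [| exact IHl].
    auto_derive; pose proof (pos_INR a); [lra | field; lra].
Qed.

(** The functional equation transports the increment of [lnG] from [s] to [s + n], where [lnG_slope]
    determines it up to [ln (s + n) - ln (s + n - 1) <= / (s + n - 1)]. The term [eta] absorbs the
    linearisation of the finite sum of logarithms. *)
Lemma lnG_quotient s n eta : 0 < s -> (1 <= n)%nat -> 0 < eta ->
  exists d, 0 < d /\ forall h, Rabs h < d ->
    Rabs (lnG (s + h) - lnG s - h * psi_approx s n) <= (/ (s + INR n - 1) + eta) * Rabs h.
Proof.
  intros hs hn he. apply le_INR in hn. simpl in hn.
  pose proof (rderiv_of_R _ _ _ (ln_sum_derive s n hs)) as HD.
  destruct (deriv_elim _ _ _ _ eta HD he) as (d & hd & H).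
  exists (Rmin d (Rmin 1 s)). split; [repeat apply Rmin_glb_lt; lra |]. intros h hh.
  pose proof (Rmin_l d (Rmin 1 s)). pose proof (Rmin_r d (Rmin 1 s)). pose proof (Rmin_l 1 s). pose proof (Rmin_r 1 s).
  destruct (Req_dec h 0) as [-> | h0]; [rewrite Rplus_0_r, Rabs_R0, Rmult_0_r, Rmult_0_l, !Rminus_0_r, Rminus_diag_eq, Rabs_R0 by reflexivity; lra |].
  assert (hb : - s < h) by (assert (hh2 : Rabs h < s) by lra; apply Rabs_def2 in hh2; lra).
  specialize (H (s + h)%R). rewrite Cmod_RtoC_sub in H. replace (s + h - s) with h in H by ring.
  specialize (H ltac:(lra)). cbv beta in H.
  rewrite <- !RtoC_minus, <- RtoC_mult, <- RtoC_minus, !Cmod_R in H. replace (s + h - s) with h in H by ring.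
  pose proof (lnG_add s n hs) as e1. pose proof (lnG_add (s + h) n ltac:(lra)) as e2.
  set (S0 := rsum (fun j => ln (s + INR j)) (seq 0 n)) in *.
  set (S1 := rsum (fun j => ln (s + h + INR j)) (seq 0 n)) in *.
  set (S' := rsum (fun j => / (s + INR j)) (seq 0 n)) in *.
  pose proof (lnG_slope (s + INR n) h ltac:(lra) h0 ltac:(lra)) as sl.
  replace (s + INR n + h) with (s + h + INR n) in sl by ring.
  set (q := (lnG (s + h + INR n) - lnG (s + INR n)) / h) in *.
  assert (Eq : lnG (s + h) - lnG s - h * psi_approx s n = h * (q - ln (s + INR n)) - (S1 - S0 - h * S')).
  { unfold psi_approx. fold S'. unfold q. rewrite e1, e2. field. exact h0. }
  assert (hln : ln (s + INR n) - ln (s + INR n - 1) <= / (s + INR n - 1)).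
  { assert (hx : 0 < s + INR n - 1) by lra.
    replace (s + INR n) with ((s + INR n - 1) * (1 + / (s + INR n - 1))) at 1 by (field; lra).
    assert (0 < / (s + INR n - 1)) by now apply Rinv_0_lt_compat.
    rewrite ln_mult by lra.
    pose proof (exp_ineq1_le (ln (1 + / (s + INR n - 1)))) as e. rewrite exp_ln in e by lra. lra. }
  rewrite Eq. eapply Rle_trans; [apply Rabs_triang |]. rewrite Rabs_Ropp, Rabs_mult, Rmult_plus_distr_r.
  apply Rplus_le_compat; [| exact H]. rewrite Rmult_comm. apply Rmult_le_compat_r; [apply Rabs_pos |].
  rewrite Rabs_minus_sym, Rabs_pos_eq; lra.
Qed.

(** Both approximate the same difference quotient of [lnG], for a common small [h]. The approximants
    are thus Cauchy before [lnG] is known to be differentiable. *)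
Lemma psi_approx_gap s n m : 0 < s -> (1 <= n)%nat -> (1 <= m)%nat ->
  Rabs (psi_approx s n - psi_approx s m) <= / (s + INR n - 1) + / (s + INR m - 1).
Proof.
  intros hs hn hm. apply le_epsilon. intros eps he.
  destruct (lnG_quotient s n (eps / 2) hs hn ltac:(lra)) as (d1 & h1 & H1).
  destruct (lnG_quotient s m (eps / 2) hs hm ltac:(lra)) as (d2 & h2 & H2).
  set (h := Rmin d1 d2 / 2). assert (hh : 0 < h /\ h < d1 /\ h < d2).
  { unfold h. pose proof (Rmin_l d1 d2). pose proof (Rmin_r d1 d2). assert (0 < Rmin d1 d2) by now apply Rmin_glb_lt. lra. }
  specialize (H1 h). specialize (H2 h). rewrite (Rabs_pos_eq h) in H1, H2 by lra.
  specialize (H1 ltac:(lra)). specialize (H2 ltac:(lra)).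
  apply (Rmult_le_reg_r h); [lra |]. rewrite <- (Rabs_pos_eq h) at 1 by lra. rewrite <- Rabs_mult.
  replace ((psi_approx s n - psi_approx s m) * h)
    with ((lnG (s + h) - lnG s - h * psi_approx s m) - (lnG (s + h) - lnG s - h * psi_approx s n)) by ring.
  eapply Rle_trans; [apply Rabs_triang |]. rewrite Rabs_Ropp. lra.
Qed.

Lemma inv_shift_small s eps : 0 < s -> 0 < eps ->
  exists N, (1 <= N)%nat /\ forall n, (N <= n)%nat -> / (s + INR n - 1) < eps.
Proof.
  intros hs he. destruct (archimed (/ eps)) as [h _]. exists (S (S (Z.to_nat (up (/ eps))))). split; [lia |].
  intros n hn. apply le_INR in hn. rewrite !S_INR in hn.
  assert (IZR (up (/ eps)) <= INR (Z.to_nat (up (/ eps)))).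
  { rewrite INR_IZR_INZ. apply IZR_le. lia. }
  assert (0 < / eps) by now apply Rinv_0_lt_compat.
  rewrite <- (Rinv_inv eps). apply Rinv_lt_contravar; [apply Rmult_lt_0_compat; lra | lra].
Qed.

(** The limit of the approximants is identified as the derivative of [lnG], and [Gamma] is [exp] of
    [lnG] near [s]; this avoids differentiating under the improper integral. *)
Lemma digamma_cv s : 0 < s -> Un_cv (psi_approx s) (digamma s).
Proof.
  intros hs. destruct (Rcomplete.R_complete (psi_approx s)) as (L & HL).
  { intros eps he. destruct (inv_shift_small s (eps / 2) hs ltac:(lra)) as (N & hN & H).
    exists N. intros n m hn hm. unfold Rdist. pose proof (psi_approx_gap s n m hs ltac:(lia) ltac:(lia)).
    pose proof (H n ltac:(lia)). pose proof (H m ltac:(lia)). lra. }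
  assert (D : is_derive lnG s L).
  { apply rderiv_is_derive, deriv_intro; [intros; now apply RtoC_inj |]. intros eps he.
    destruct (inv_shift_small s (eps / 3) hs ltac:(lra)) as (N & hN & H).
    destruct (HL (eps / 3) ltac:(lra)) as (N2 & H2).
    set (n := Nat.max N N2). specialize (H n ltac:(unfold n; lia)). specialize (H2 n ltac:(unfold n; lia)). unfold Rdist in H2.
    destruct (lnG_quotient s n (eps / 3) hs ltac:(unfold n; lia) ltac:(lra)) as (d & hd & Hd).
    exists d. split; [exact hd |]. intros y hy. rewrite Cmod_RtoC_sub in hy. specialize (Hd (y - s) hy).
    replace (s + (y - s)) with y in Hd by ring.
    rewrite <- !RtoC_minus, <- RtoC_mult, <- RtoC_minus, !Cmod_R.
    replace (lnG y - lnG s - (y - s) * L) with ((lnG y - lnG s - (y - s) * psi_approx s n) + (y - s) * (psi_approx s n - L)) by ring.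
    eapply Rle_trans; [apply Rabs_triang |]. rewrite (Rabs_mult (y - s)). pose proof (Rabs_pos (y - s)). nra. }
  replace (digamma s) with L; [exact HL |]. symmetry.
  assert (DG : is_derive Gamma s (L * exp (lnG s))).
  { apply (is_derive_ext_loc (fun x => exp (lnG x))).
    - exists (mkposreal s hs). intros y hy. apply Rabs_lt_between in hy. unfold minus, plus, opp in hy; simpl in hy.
      unfold lnG. apply exp_ln, Gamma_pos. lra.
    - apply (is_derive_comp (V := R_NormedModule) exp lnG s (exp (lnG s)) L); [| exact D].
      auto_derive; [trivial | ring]. }
  unfold digamma. rewrite (is_derive_unique _ _ _ DG). unfold lnG. rewrite exp_ln by now apply Gamma_pos.
  field. apply Rgt_not_eq. now apply Gamma_pos.
Qed.

Lemma digamma_succ s : 0 < s -> digamma (s + 1) = digamma s + / s.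
Proof.
  intros hs. apply (UL_sequence (psi_approx (s + 1))); [apply digamma_cv; lra |].
  intros eps he. destruct (digamma_cv s hs eps he) as (N & H). exists N. intros n hn.
  specialize (H (S n) ltac:(lia)). unfold Rdist in *.
  replace (psi_approx (s + 1) n - (digamma s + / s)) with (psi_approx s (S n) - digamma s); [exact H |].
  unfold psi_approx. rewrite S_INR. replace (s + 1 + INR n) with (s + (INR n + 1)) by ring.
  change (seq 0 (S n)) with (0%nat :: seq 1 n). simpl rsum at 1. rewrite <- seq_shift, rsum_map, Rplus_0_r.
  assert (E : rsum (fun i => / (s + INR (S i))) (seq 0 n) = rsum (fun j => / (s + 1 + INR j)) (seq 0 n)).
  { f_equal. apply functional_extensionality. intros i. rewrite S_INR. f_equal. ring. }
  rewrite E. ring.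
Qed.

(** Legendre's duplication at the level of the approximants: the harmonic sum of length [2n] splits
    into odd and even denominators, giving [psi(1) = psi(1/2)/2 + psi(1)/2 + ln 2] in the limit. *)
Lemma digamma_half : digamma (1 / 2) - digamma 1 = - 2 * ln 2.
Proof.
  assert (Dup : forall n, psi_approx 1 (2 * n) =
     / 2 * psi_approx (1 / 2) n + / 2 * psi_approx 1 n + ln 2 + / 2 * (ln (1 / 2 + INR n) - ln (1 + INR n))).
  { intros n. unfold psi_approx.
    assert (E : rsum (fun j => / (1 + INR j)) (seq 0 (2 * n)) =
       / 2 * rsum (fun j => / (1 / 2 + INR j)) (seq 0 n) + / 2 * rsum (fun j => / (1 + INR j)) (seq 0 n)).
    { induction n; [simpl; ring |]. replace (2 * S n)%nat with (S (S (2 * n))) by lia.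
      rewrite !rsum_seq_S, IHn, S_INR, mult_INR.
      replace (INR 2) with 2 by (simpl; ring). pose proof (pos_INR n). field. lra. }
    rewrite E, mult_INR. replace (INR 2) with 2 by (simpl; ring). pose proof (pos_INR n).
    replace (1 + 2 * INR n) with (2 * (1 / 2 + INR n)) by field. rewrite ln_mult by lra. field. }
  assert (C : digamma 1 = / 2 * digamma (1 / 2) + / 2 * digamma 1 + ln 2).
  { apply Rminus_diag_uniq. apply NNPP. intros N. apply Rabs_pos_lt in N.
    set (e := Rabs (digamma 1 - (/ 2 * digamma (1 / 2) + / 2 * digamma 1 + ln 2))) in *.
    destruct (digamma_cv 1 Rlt_0_1 (e / 4) ltac:(lra)) as (N1 & H1).
    destruct (digamma_cv (1 / 2) ltac:(lra) (e / 4) ltac:(lra)) as (N2 & H2).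
    destruct (inv_shift_small 1 (e / 4) Rlt_0_1 ltac:(lra)) as (N3 & hN3 & H3).
    set (n := Nat.max N1 (Nat.max N2 N3)).
    pose proof (H1 (2 * n)%nat ltac:(unfold n; lia)) as a1. pose proof (H1 n ltac:(unfold n; lia)) as a2.
    specialize (H2 n ltac:(unfold n; lia)). specialize (H3 n ltac:(unfold n; lia)). unfold Rdist in *.
    rewrite Dup in a1.
    assert (hn : 1 <= INR n) by (apply (le_INR 1); unfold n; lia).
    assert (B : Rabs (ln (1 / 2 + INR n) - ln (1 + INR n)) <= / (1 + INR n - 1)).
    { replace (1 + INR n - 1) with (INR n) by ring.
      assert (hi : 0 < / INR n) by (apply Rinv_0_lt_compat; lra).
      rewrite Rabs_left1 by (assert (ln (1 / 2 + INR n) <= ln (1 + INR n)) by (apply Rcomplements.ln_le; lra); lra).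
      assert (ln (1 + INR n) <= ln (INR n * (1 + / INR n))).
      { apply Rcomplements.ln_le; [lra |]. replace (INR n * (1 + / INR n)) with (1 + INR n) by (field; lra). lra. }
      rewrite ln_mult in H by lra.
      assert (ln (INR n) <= ln (1 / 2 + INR n)) by (apply Rcomplements.ln_le; lra).
      pose proof (exp_ineq1_le (ln (1 + / INR n))) as ee. rewrite exp_ln in ee by lra. lra. }
    apply Rabs_def2 in a1. apply Rabs_def2 in a2. apply Rabs_def2 in H2. apply Rabs_le_between in B.
    assert (Rabs (digamma 1 - (/ 2 * digamma (1 / 2) + / 2 * digamma 1 + ln 2)) < e); [| unfold e in *; lra].
    apply Rabs_def1; lra. }
  lra.
Qed.

Open Scope C_scope.

(** * The hypergeometric series *)

(** [hypa] are the coefficients of the hypergeometric series, [hypb] the bracket of [g] without its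
    logarithm, [hypg] their product; so [g] is [Cln x * ps hypa x + ps hypg x]. *)
Definition hypa (k : nat) : R := (pochhammer (1 / 2) k * pochhammer (1 / 2) k / INR (fact k) ^ 2)%R.
Definition hypb (k : nat) : R :=
  (digamma (1 / 2 + INR k) + digamma (1 / 2 + INR k) - 2 * digamma (INR k + 1))%R.
Definition hypg (k : nat) : R := (hypa k * hypb k)%R.

Lemma fact_pos k : (0 < INR (fact k))%R.
Proof. apply lt_0_INR, lt_O_fact. Qed.

Lemma pochhammer_1 k : pochhammer 1 k = INR (fact k).
Proof.
  induction k; [reflexivity |]. simpl pochhammer. rewrite IHk, fact_simpl, mult_INR, S_INR. ring.
Qed.

Lemma hypa_0 : hypa 0 = 1%R.
Proof. unfold hypa. simpl. field. Qed.

Lemma hypa_S k : ((INR k + 1) * (INR k + 1) * hypa (S k) = (INR k + 1 / 2) * (INR k + 1 / 2) * hypa k)%R.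
Proof.
  unfold hypa. simpl pochhammer. rewrite fact_simpl, mult_INR, S_INR.
  pose proof (fact_pos k). pose proof (pos_INR k). field. lra.
Qed.

Lemma hypa_bounds k : (0 < hypa k <= 1)%R.
Proof.
  induction k; [rewrite hypa_0; lra |]. pose proof (hypa_S k) as E. pose proof (pos_INR k).
  set (n := INR k) in *. set (a := hypa k) in *. set (a' := hypa (S k)) in *.
  assert (0 < (n + 1) * (n + 1))%R by nra. assert (0 < (n + 1 / 2) * (n + 1 / 2) <= (n + 1) * (n + 1))%R by nra.
  split; nra.
Qed.

Lemma hypb_0 : hypb 0 = (- 4 * ln 2)%R.
Proof.
  unfold hypb. simpl INR. rewrite Rplus_0_r, Rplus_0_l. pose proof digamma_half. lra.
Qed.

Lemma hypb_S k : hypb (S k) = (hypb k + 2 * / (1 / 2 + INR k) - 2 * / (INR k + 1))%R.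
Proof.
  unfold hypb. rewrite S_INR. pose proof (pos_INR k).
  replace (1 / 2 + (INR k + 1))%R with (1 / 2 + INR k + 1)%R by ring.
  rewrite !digamma_succ by lra. ring.
Qed.

Lemma hypb_bound k : (Rabs (hypb k) <= 4 * ln 2 + 4 * INR k)%R.
Proof.
  induction k.
  - rewrite hypb_0. simpl. assert (0 < ln 2)%R by (rewrite <- ln_1; apply ln_increasing; lra).
    rewrite Rabs_left by lra. lra.
  - rewrite hypb_S, S_INR. pose proof (pos_INR k).
    assert (0 < / (1 / 2 + INR k) <= 2)%R.
    { split; [apply Rinv_0_lt_compat; lra |]. replace 2%R with (/ (1 / 2))%R by field. apply Rinv_le_contravar; lra. }
    assert (0 < / (INR k + 1) <= 1)%R.
    { split; [apply Rinv_0_lt_compat; lra |]. rewrite <- Rinv_1. apply Rinv_le_contravar; lra. }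
    apply Rabs_le_between in IHk. apply Rabs_le. lra.
Qed.

Lemma tame_hypa : tame hypa.
Proof. apply (tame_bounded hypa 1). intros k. pose proof (hypa_bounds k). rewrite Rabs_pos_eq; lra. Qed.

Lemma tame_hypg : tame hypg.
Proof.
  apply (tame_le hypg (fun k => 4 * ln 2 * hypa k + 4 * theta hypa k)%R).
  - intros k. unfold hypg, theta. pose proof (hypa_bounds k). pose proof (hypb_bound k). pose proof (pos_INR k).
    assert (0 < ln 2)%R by (rewrite <- ln_1; apply ln_increasing; lra).
    rewrite Rabs_mult, (Rabs_pos_eq (hypa k)) by lra.
    replace (4 * ln 2 * hypa k + 4 * (INR k * hypa k))%R with (hypa k * (4 * ln 2 + 4 * INR k))%R by ring.
    rewrite (Rabs_pos_eq (hypa k * (4 * ln 2 + 4 * INR k))) by (apply Rmult_le_pos; lra).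
    apply Rmult_le_compat_l; lra.
  - apply tame_plus; apply tame_scal; [| apply tame_theta]; apply tame_hypa.
Qed.

Lemma hypergeometric_F_ps x : hypergeometric_F (1 / 2) (1 / 2) 1 x = ps hypa x.
Proof.
  unfold hypergeometric_F, ps. f_equal. apply functional_extensionality. intros k. f_equal. f_equal.
  unfold hypa. rewrite pochhammer_1. simpl pow. now rewrite Rmult_1_r.
Qed.

Lemma hypergeometric_g_ps (x : C) :
  (Cmod x < 1)%R -> hypergeometric_g (1 / 2) (1 / 2) x = Cln x * ps hypa x + ps hypg x.
Proof.
  intros hx. unfold hypergeometric_g. apply CSeries_has_sum.
  eapply has_sum_ext; [| apply has_sum_plus; [apply has_sum_scal, (ps_has_sum hypa x tame_hypa hx) | apply (ps_has_sum hypg x tame_hypg hx)]].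
  intros k. cbv beta. unfold hypg. rewrite RtoC_mult. fold (hypa k) (hypb k). ring.
Qed.

(** The hypergeometric equation in Euler form, [theta^2 F = x (theta + 1/2)^2 F], read off from
    [hypa_S]. *)
Lemma ps_hypa_ode (x : C) : (Cmod x < 1)%R ->
  ps (theta (theta hypa)) x = x * (ps (theta (theta hypa)) x + ps (theta hypa) x + / 4 * ps hypa x).
Proof.
  intros hx. pose proof tame_hypa as t0. pose proof (tame_theta _ t0) as t1. pose proof (tame_theta _ t1) as t2.
  rewrite (ps_shift _ (fun k => theta (theta hypa) k + theta hypa k + / 4 * hypa k)%R x) at 1; auto.
  - rewrite ps_plus, ps_plus, ps_scal by auto using tame_plus, tame_scal. rewrite RtoC_inv by lra. reflexivity.
  - auto using tame_plus, tame_scal.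
  - unfold theta. simpl. ring.
  - intros k. unfold theta. rewrite S_INR. pose proof (hypa_S k). lra.
Qed.

(** What remains of the Euler form for [ln x * F + G] once the terms with [ln x] cancel by the
    equation of [F]; [theta (ln x) = 1] produces the terms in [F] and [theta F]. *)
Lemma ps_hypg_ode (x : C) : (Cmod x < 1)%R ->
  2 * ps (theta hypa) x + ps (theta (theta hypg)) x =
  x * (2 * ps (theta hypa) x + ps hypa x + (ps (theta (theta hypg)) x + ps (theta hypg) x + / 4 * ps hypg x)).
Proof.
  intros hx. pose proof tame_hypa as t0. pose proof (tame_theta _ t0) as t1.
  pose proof tame_hypg as s0. pose proof (tame_theta _ s0) as s1. pose proof (tame_theta _ s1) as s2.
  rewrite <- ps_scal, <- ps_plus by auto using tame_plus, tame_scal.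
  rewrite (ps_shift _ (fun k => (2 * theta hypa k + hypa k) + ((theta (theta hypg) k + theta hypg k) + / 4 * hypg k))%R x); auto.
  - rewrite !ps_plus, !ps_scal by auto 10 using tame_plus, tame_scal. rewrite RtoC_inv by lra. reflexivity.
  - auto using tame_plus, tame_scal.
  - auto 10 using tame_plus, tame_scal.
  - unfold theta. simpl. ring.
  - intros k. unfold theta, hypg. rewrite S_INR, hypb_S. pose proof (hypa_S k) as E. pose proof (pos_INR k) as hk.
    set (n := INR k) in *. set (a := hypa k) in *. set (b := hypb k).
    assert (E' : hypa (S k) = ((n + 1 / 2) * (n + 1 / 2) * a / ((n + 1) * (n + 1)))%R) by (rewrite <- E; field; lra).
    rewrite E'. field. lra.
Qed.

Lemma Cmod_lt_1_neq (x : C) : (Cmod x < 1)%R -> x <> 1.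
Proof. intros h ->. rewrite Cmod_1 in h. lra. Qed.

Lemma sub_1_neq (x : C) : x <> 1 -> 1 - x <> 0.
Proof. intros h E. apply h. replace x with (1 - (1 - x)) by ring. rewrite E. ring. Qed.

Lemma sol_hyp_F (U : C -> Prop) :
  (forall x, U x -> x <> 0 /\ (Cmod x < 1)%R) -> sol U (ps hypa) (fun x => (1 - x) * ps (theta hypa) x).
Proof.
  intros HU x hx. destruct (HU x hx) as [n0 h1]. pose proof (Cmod_lt_1_neq x h1) as n1.
  pose proof tame_hypa as t0. pose proof (tame_theta _ t0) as t1.
  split; [exact n0 |]. split; [exact n1 |]. split.
  - eapply deriv_eq; [apply ps_deriv; assumption |]. field. split; auto using sub_1_neq.
  - eapply deriv_eq.
    + apply (deriv_mult cid (fun x => 1 - x)); [apply deriv_minus; [apply deriv_const | apply deriv_id] | apply ps_deriv; assumption].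
    + cbv beta. pose proof (ps_hypa_ode x h1) as E. rewrite E at 1.
      transitivity ((- x * ps (theta hypa) x + (1 - x) * ps (theta (theta hypa)) x) / x).
      * rewrite E at 2. field. exact n0.
      * replace (- x * ps (theta hypa) x + (1 - x) * ps (theta (theta hypa)) x)
          with (- x * ps (theta hypa) x + ps (theta (theta hypa)) x - x * ps (theta (theta hypa)) x) by ring.
        rewrite E at 1. field. exact n0.
Qed.

(** For any branch [l] of the logarithm: [Cln x] is used for [EK (1 - x)] and [Cln (- x)] for
    [EL x]. *)
Lemma sol_hyp_g (U : C -> Prop) (l : C -> C) :
  (forall x, U x -> x <> 0 /\ (Cmod x < 1)%R /\ cderiv l x (/ x)) ->
  sol U (fun x => l x * ps hypa x + ps hypg x)
    (fun x => (1 - x) * (ps hypa x + l x * ps (theta hypa) x + ps (theta hypg) x)).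
Proof.
  intros HU x hx. destruct (HU x hx) as (n0 & h1 & dl). pose proof (Cmod_lt_1_neq x h1) as n1.
  pose proof tame_hypa as t0. pose proof (tame_theta _ t0) as t1.
  pose proof tame_hypg as s0. pose proof (tame_theta _ s0) as s1.
  split; [exact n0 |]. split; [exact n1 |]. split.
  - eapply deriv_eq; [apply deriv_plus; [apply deriv_mult; [exact dl | apply ps_deriv; assumption] | apply ps_deriv; assumption] |].
    cbv beta. field. split; auto using sub_1_neq.
  - eapply deriv_eq.
    + apply (deriv_mult cid (fun x => 1 - x)); [apply deriv_minus; [apply deriv_const | apply deriv_id] |].
      apply deriv_plus; [apply deriv_plus; [apply ps_deriv; assumption |] | apply ps_deriv; assumption].
      apply deriv_mult; [exact dl | apply ps_deriv; assumption].
    + cbv beta. pose proof (ps_hypa_ode x h1) as E1. pose proof (ps_hypg_ode x h1) as E2.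
      set (F := ps hypa x) in *. set (F1 := ps (theta hypa) x) in *. set (F2 := ps (theta (theta hypa)) x) in *.
      set (G := ps hypg x) in *. set (G1 := ps (theta hypg) x) in *. set (G2 := ps (theta (theta hypg)) x) in *.
      assert (R1 : (1 - x) * F2 = x * (F1 + / 4 * F)).
      { replace ((1 - x) * F2) with (F2 - x * F2) by ring. rewrite E1 at 1. ring. }
      assert (R2 : (1 - x) * (2 * F1 + G2) = x * (F + G1 + / 4 * G)).
      { replace ((1 - x) * (2 * F1 + G2)) with ((2 * F1 + G2) - x * (2 * F1 + G2)) by ring. rewrite E2 at 1. ring. }
      transitivity (- (F + l x * F1 + G1) + (l x * ((1 - x) * F2) + (1 - x) * (2 * F1 + G2)) / x); [field; exact n0 |].
      rewrite R1, R2. field. exact n0.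
Qed.

(** * Uniqueness from the behaviour at the origin *)

Definition lim0 (f : R -> R) : Prop :=
  forall eps, (0 < eps)%R -> exists d, (0 < d)%R /\ forall t, (0 < t < d)%R -> (Rabs (f t) < eps)%R.

Lemma lim0_plus f g : lim0 f -> lim0 g -> lim0 (fun t => f t + g t)%R.
Proof.
  intros hf hg eps he. destruct (hf (eps / 2)%R ltac:(lra)) as (d1 & h1 & H1), (hg (eps / 2)%R ltac:(lra)) as (d2 & h2 & H2).
  exists (Rmin d1 d2). split; [now apply Rmin_glb_lt |]. intros t ht. pose proof (Rmin_l d1 d2). pose proof (Rmin_r d1 d2).
  specialize (H1 t ltac:(lra)). specialize (H2 t ltac:(lra)). pose proof (Rabs_triang (f t) (g t)). lra.
Qed.

Lemma lim0_le f g c : (0 < c)%R -> (forall t, (0 < t < c)%R -> (Rabs (f t) <= g t)%R) -> lim0 g -> lim0 f.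
Proof.
  intros hc H hg eps he. destruct (hg eps he) as (d & hd & Hd).
  exists (Rmin c d). split; [now apply Rmin_glb_lt |]. intros t ht. pose proof (Rmin_l c d). pose proof (Rmin_r c d).
  specialize (H t ltac:(lra)). specialize (Hd t ltac:(lra)). pose proof (Rle_abs (g t)). lra.
Qed.

Lemma lim0_cont (f : R -> R) : continuous f 0%R -> f 0%R = 0%R -> lim0 f.
Proof.
  intros hc E eps he. apply rcont_continuous in hc. destruct (hc eps he) as (d & hd & H).
  exists d. split; [exact hd |]. intros t ht. specialize (H t).
  rewrite !Cmod_RtoC_sub, E, !Rminus_0_r in H. apply H. rewrite Rabs_pos_eq; lra.
Qed.

Lemma lim0_scal c f : lim0 f -> lim0 (fun t => c * f t)%R.
Proof.
  intros hf eps he. pose proof (Rabs_pos c). destruct (hf (eps / (Rabs c + 1))%R) as (d & hd & H0); [apply Rdiv_lt_0_compat; lra |].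
  exists d. split; [exact hd |]. intros t ht. specialize (H0 t ht). rewrite Rabs_mult. pose proof (Rabs_pos (f t)).
  apply (Rmult_lt_compat_r (Rabs c + 1)) in H0; [| lra].
  unfold Rdiv in H0. rewrite Rmult_assoc, Rinv_l in H0 by lra. nra.
Qed.

Lemma lim0_abs f : lim0 f -> lim0 (fun t => Rabs (f t)).
Proof.
  intros hf eps he. destruct (hf eps he) as (d & hd & H). exists d. split; [exact hd |].
  intros t ht. rewrite Rabs_Rabsolu. now apply H.
Qed.

Lemma lim0_sqrt : lim0 sqrt.
Proof. apply lim0_cont; [apply continuous_sqrt | apply sqrt_0]. Qed.

Lemma lim0_xlnx : lim0 (fun t => t * Rabs (ln t))%R.
Proof.
  apply (lim0_le _ (fun t => 2 * sqrt t)%R 1); [lra | | apply lim0_scal, lim0_sqrt].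
  intros t ht. pose proof (sqrt_lt_R0 t ltac:(lra)) as hs. pose proof (sqrt_sqrt t ltac:(lra)) as hss.
  rewrite Rabs_mult, Rabs_Rabsolu, (Rabs_pos_eq t) by lra.
  assert (L : ln t = (2 * ln (sqrt t))%R) by (rewrite <- hss at 1; rewrite ln_mult by exact hs; ring).
  assert (N : (ln t < 0)%R) by (rewrite <- ln_1; apply ln_increasing; lra).
  rewrite Rabs_left by exact N. rewrite L.
  pose proof (exp_ineq1_le (- ln (sqrt t))) as h. rewrite exp_Ropp, exp_ln in h by exact hs.
  assert (h2 : (sqrt t * (- ln (sqrt t)) <= 1)%R).
  { apply Rle_trans with (sqrt t * (/ sqrt t))%R; [apply Rmult_le_compat_l; lra | rewrite Rinv_r; lra]. }
  rewrite <- hss at 1. nra.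
Qed.

Lemma sol_ray (U : C -> Prop) u v e t :
  sol U u v -> U (RtoC (e * t)) -> (e = 1 \/ e = -1)%R -> (t <> 0)%R -> (1 - e * t <> 0)%R ->
  rderiv (fun t => u (RtoC (e * t))) t (RtoC (/ (t * (1 - e * t))) * v (RtoC (e * t))) /\
  rderiv (fun t => v (RtoC (e * t))) t (RtoC e * (u (RtoC (e * t)) / 4)).
Proof.
  intros H hU he ht ht1. destruct (H _ hU) as (n0 & n1 & d1 & d2).
  assert (De : rderiv (fun t => RtoC (e * t)) t (RtoC e)).
  { apply rderiv_of_R. auto_derive; [trivial | ring]. }
  assert (e0 : (e <> 0)%R) by (destruct he; subst; lra).
  split.
  - eapply deriv_eq; [apply (deriv_comp RtoC u (fun t => RtoC (e * t))); eassumption |].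
    replace (RtoC (e * t) * (1 - RtoC (e * t))) with (RtoC (e * t * (1 - e * t))) by (rewrite RtoC_mult, RtoC_minus; reflexivity).
    rewrite <- RtoC_inv by (repeat apply Rmult_integral_contrapositive_currified; auto).
    replace (/ (t * (1 - e * t)))%R with (/ (e * t * (1 - e * t)) * e)%R by (field; auto). rewrite (RtoC_mult (/ (e * t * (1 - e * t))) e). ring.
  - eapply deriv_eq; [apply (deriv_comp RtoC v (fun t => RtoC (e * t))); eassumption |]. ring.
Qed.

(** Real and imaginary parts along the ray vanish near [0] by [singular_unique]; a point of the ray
    then serves as initial point for [sol_unique]. As that point is not known in advance, every
    point of the ray up to [1/2] has to be a centre of the star. *)
Lemma sol_singular_unique (U : C -> Prop) u v e :
  sol U u v -> (e = 1 \/ e = -1)%R -> (forall t, (0 < t < 1 / 2)%R -> U (RtoC (e * t)) /\ star U (RtoC (e * t))) ->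
  lim0 (fun t => Cmod (u (RtoC (e * t)))) -> forall z, U z -> u z = 0 /\ v z = 0.
Proof.
  intros H he HU Hl z hz.
  assert (ha : (Rabs e = 1)%R) by (destruct he as [-> | ->]; [apply Rabs_R1 | rewrite Rabs_left by lra; ring]).
  assert (Ray : forall t, (0 < t < 1 / 2)%R -> _) by
    (intros t ht; exact (sol_ray U u v e t H (proj1 (HU t ht)) he ltac:(lra) ltac:(destruct he; subst; lra))).
  destruct (singular_unique e (fun t => Re (u (RtoC (e * t)))) (fun t => Re (v (RtoC (e * t)))) ha) as (T1 & hT1 & Z1).
  { intros t ht. destruct (Ray t ht) as [r1 r2]. apply rderiv_Re in r1, r2. split.
    - evar_last; [exact r1 |]. cbv beta. reim. unfold Rdiv. ring.
    - evar_last; [exact r2 |]. cbv beta. unfold Cdiv. rewrite <- RtoC_inv by lra. reim. field. }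
  { intros eps hp. destruct (Hl eps hp) as (d & hd & Hd). exists d. split; [exact hd |]. intros t ht.
    specialize (Hd t ht). rewrite Rabs_pos_eq in Hd by apply Cmod_ge_0. pose proof (re_le_Cmod (u (RtoC (e * t)))). lra. }
  destruct (singular_unique e (fun t => Im (u (RtoC (e * t)))) (fun t => Im (v (RtoC (e * t)))) ha) as (T2 & hT2 & Z2).
  { intros t ht. destruct (Ray t ht) as [r1 r2]. apply rderiv_Im in r1, r2. split.
    - evar_last; [exact r1 |]. cbv beta. reim. unfold Rdiv. ring.
    - evar_last; [exact r2 |]. cbv beta. unfold Cdiv. rewrite <- RtoC_inv by lra. reim. field. }
  { intros eps hp. destruct (Hl eps hp) as (d & hd & Hd). exists d. split; [exact hd |]. intros t ht.
    specialize (Hd t ht). rewrite Rabs_pos_eq in Hd by apply Cmod_ge_0. pose proof (Im_le_Cmod (u (RtoC (e * t)))). lra. }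
  set (t := (Rmin T1 T2 / 2)%R). pose proof (Rmin_l T1 T2). pose proof (Rmin_r T1 T2).
  assert (ht : (0 < Rmin T1 T2)%R) by (apply Rmin_glb_lt; lra).
  destruct (Z1 t ltac:(unfold t; lra)) as [a1 a2]. destruct (Z2 t ltac:(unfold t; lra)) as [b1 b2].
  apply (sol_unique U u v (RtoC (e * t))); auto.
  - apply HU. unfold t. lra.
  - apply C_ext; assumption.
  - apply C_ext; assumption.
Qed.

Definition udisc (x : C) : Prop := (Cmod x < 1)%R.

Lemma cut_plane_DK x : cut_plane x -> DK x /\ DK (1 - x).
Proof. intros h. split; intros [h1 h2]; apply h; revert h1 h2; reim; intros; lra. Qed.

Lemma cut_plane_slit x : cut_plane x -> slit x.
Proof. intros h [h1 h2]. apply h. lra. Qed.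

Lemma DL_slit x : DL x -> slit (- x).
Proof. intros h [h1 h2]. apply h. revert h1 h2. reim. intros; lra. Qed.

Lemma segm_Re c z t : Re (segm c z t) = (Re c + t * (Re z - Re c))%R.
Proof. unfold segm. reim. ring. Qed.

Lemma segm_Im c z t : Im (segm c z t) = (Im c + t * (Im z - Im c))%R.
Proof. unfold segm. reim. ring. Qed.

Lemma star_udisc c : udisc c -> star udisc c.
Proof.
  unfold udisc. intros hc z t hz ht. unfold segm.
  replace (c + RtoC t * (z - c)) with (RtoC (1 - t) * c + RtoC t * z) by (rewrite RtoC_minus; ring).
  eapply Rle_lt_trans; [apply Cmod_triangle |]. rewrite !Cmod_mult, !Cmod_R, !Rabs_pos_eq by lra.
  pose proof (Cmod_ge_0 c). pose proof (Cmod_ge_0 z).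
  destruct (Rle_dec t (1 / 2)); nra.
Qed.

Lemma star_cut_plane (c : R) : (0 < c < 1)%R -> star cut_plane (RtoC c).
Proof.
  intros hc z t hz ht [h1 h2]. rewrite segm_Re, segm_Im in *. rewrite Re_RtoC, Im_RtoC in *.
  destruct (Req_dec t 0) as [-> | t0]; [lra |].
  assert (E : Im z = 0%R) by nra. apply hz. split; [exact E |]. destruct h2 as [h2 | h2]; [left | right]; nra.
Qed.

Lemma star_DL (c : R) : (c < 0)%R -> star DL (RtoC c).
Proof.
  intros hc z t hz ht [h1 h2]. rewrite segm_Re, segm_Im in *. rewrite Re_RtoC, Im_RtoC in *.
  destruct (Req_dec t 0) as [-> | t0]; [lra |].
  assert (E : Im z = 0%R) by nra. apply hz. split; [exact E |]. nra.
Qed.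

Lemma star_and U V c : star U c -> star V c -> star (fun x => U x /\ V x) c.
Proof. intros h1 h2 z t [a b] ht. split; auto. Qed.

(** * Asymptotics of [EK] and [EL], and their series *)

Lemma EK_RtoC (y : R) : (0 < y)%R ->
  EK (1 - RtoC y) = RtoC (RInt (fun t => / sqrt (1 - (1 - y) * (sin t * sin t)))%R 0 (PI / 2)).
Proof.
  intros hy. unfold EK, ellint. rewrite <- cint_RtoC. apply cint_ext; [pose proof PI_RGT_0; lra |].
  intros t _. unfold msinsq. pose proof (sin_sqr_bounds t).
  replace (RtoC 1 + (1 - RtoC y) * RtoC (- (sin t * sin t))) with (RtoC (1 - (1 - y) * (sin t * sin t))) by (apply C_ext; reim; ring).
  assert (0 < 1 - (1 - y) * (sin t * sin t))%R by (destruct (Rle_dec (1 - y) 0); nra).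
  rewrite csqrt_RtoC by lra. rewrite <- RtoC_pow, <- RtoC_inv, <- RtoC_mult.
  - f_equal. simpl. rewrite Rmult_1_r. ring.
  - apply pow_nonzero, Rgt_not_eq, sqrt_lt_R0. assumption.
Qed.

Lemma EL_RtoC (y : R) : (0 < y)%R ->
  EL (- RtoC y) = RtoC (RInt (fun t => / sqrt (sin t * sin t + y))%R 0 (PI / 2)).
Proof.
  intros hy. unfold EL, ellint. rewrite <- cint_RtoC. apply cint_ext; [pose proof PI_RGT_0; lra |].
  intros t _. unfold sinsq. pose proof (sin_sqr_bounds t).
  replace (RtoC (sin t * sin t) + - RtoC y * RtoC (- (1))) with (RtoC (sin t * sin t + y)) by (apply C_ext; reim; ring).
  rewrite csqrt_RtoC by lra. rewrite <- RtoC_pow, <- RtoC_inv, <- RtoC_mult.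
  - f_equal. simpl. rewrite Rmult_1_r. ring.
  - apply pow_nonzero, Rgt_not_eq, sqrt_lt_R0. lra.
Qed.

Lemma ln_sqrt y : (0 < y)%R -> ln (sqrt y) = (ln y / 2)%R.
Proof.
  intros hy. pose proof (sqrt_lt_R0 y hy) as hs. rewrite <- (sqrt_sqrt y) at 2 by lra.
  rewrite ln_mult by exact hs. field.
Qed.

Lemma RInt_reflect (f : R -> R) :
  (forall t, (0 <= t <= PI / 2)%R -> continuous f t) -> RInt (fun t => f (PI / 2 - t)%R) 0 (PI / 2) = RInt f 0 (PI / 2).
Proof.
  intros hf. pose proof PI_RGT_0 as hpi.
  apply is_RInt_unique.
  assert (E2 : ex_RInt f 0 (PI / 2)) by (apply ex_RInt_cont_on; [lra | exact hf]).
  pose proof (RInt_correct (V := R_CompleteNormedModule) f _ _ E2) as I. apply is_RInt_swap in I.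
  assert (I' : is_RInt f (-1 * 0 + PI / 2) (-1 * (PI / 2) + PI / 2) (opp (RInt f 0 (PI / 2)))).
  { replace (-1 * 0 + PI / 2)%R with (PI / 2)%R by ring. replace (-1 * (PI / 2) + PI / 2)%R with 0%R by field. exact I. }
  apply is_RInt_comp_lin in I'. apply is_RInt_opp in I'. rewrite opp_opp in I'.
  refine (is_RInt_ext _ _ _ _ _ _ I'). intros t _. unfold opp, scal, mult; simpl. unfold mult; simpl.
  replace (-1 * t + PI / 2)%R with (PI / 2 - t)%R by ring. ring.
Qed.

(** [1 - (1 - y) sin^2 = q^2 cos^2 + y] with [q^2 = 1 - y]. The factor [/ q] in front of the
    logarithm differs from [1] by at most [2 y], an error of order [y ln y]. *)
Lemma EK_log_asymptotics :
  lim0 (fun y => RInt (fun t => / sqrt (1 - (1 - y) * (sin t * sin t))) 0 (PI / 2) + ln y / 2 - 2 * ln 2)%R.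
Proof.
  apply (lim0_le _ (fun y => (PI / 2) * sqrt y + (Rabs (ln (1 + sqrt (1 - y)) / sqrt (1 - y) - ln 2) + 1 * (y * Rabs (ln y))))%R (1 / 2)); [lra | |].
  - intros y hy. set (q := sqrt (1 - y)).
    assert (qq : (q * q = 1 - y)%R) by (apply sqrt_sqrt; lra).
    assert (hq : (1 / 2 <= q <= 1)%R) by (assert (0 <= q)%R by apply sqrt_pos; nra).
    pose proof (period_asymptotics q y ltac:(lra) ltac:(lra) ltac:(lra)) as P.
    replace (fun t => / sqrt (q * q * (cos t * cos t) + y))%R with (fun t => / sqrt (1 - (1 - y) * (sin t * sin t)))%R in P.
    2:{ apply functional_extensionality. intros t. f_equal. f_equal. rewrite qq.
        pose proof (sin2_cos2 t) as h. unfold Rsqr in h. nra. }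
    replace (q * q + y)%R with 1%R in P by lra. rewrite sqrt_1, ln_sqrt in P by lra.
    set (I := RInt _ _ _) in *.
    replace (I + ln y / 2 - 2 * ln 2)%R
      with ((I - (/ q * (ln (q + 1) - ln y / 2) + ln 2)) + ((ln (1 + q) / q - ln 2) + ln y / 2 * (1 - / q)))%R
      by (rewrite (Rplus_comm q 1); field; lra).
    eapply Rle_trans; [apply Rabs_triang |]. apply Rplus_le_compat; [rewrite (Rmult_comm (PI / 2)); exact P |].
    eapply Rle_trans; [apply Rabs_triang |]. apply Rplus_le_compat; [lra |].
    unfold Rdiv at 1. rewrite !Rabs_mult, (Rabs_pos_eq (/ 2)) by lra.
    assert (h : (Rabs (1 - / q) <= 2 * y)%R).
    { assert (hi : (1 <= / q)%R) by (rewrite <- Rinv_1; apply Rinv_le_contravar; lra).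
      rewrite Rabs_left1 by lra. apply (Rmult_le_reg_r q); [lra |].
      replace (- (1 - / q) * q)%R with (1 - q)%R by (field; lra). nra. }
    pose proof (Rabs_pos (ln y)). nra.
  - apply lim0_plus; [apply lim0_scal, lim0_sqrt |]. apply lim0_plus; [| apply lim0_scal, lim0_xlnx].
    apply lim0_abs, lim0_cont.
    + apply (ex_derive_continuous (fun y => ln (1 + sqrt (1 - y)) / sqrt (1 - y) - ln 2)%R). auto_derive.
      rewrite Ropp_0, Rplus_0_r, sqrt_1. repeat split; lra.
    + rewrite Rminus_0_r, sqrt_1. replace (1 + 1)%R with 2%R by ring. field.
Qed.

(** The case [q = 1] of [period_asymptotics], after the reflection [t -> PI/2 - t]. *)
Lemma EL_log_asymptotics :
  lim0 (fun y => RInt (fun t => / sqrt (sin t * sin t + y)) 0 (PI / 2) + ln y / 2 - 2 * ln 2)%R.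
Proof.
  apply (lim0_le _ (fun y => (PI / 2) * sqrt y + Rabs (ln (1 + sqrt (1 + y)) - ln 2))%R 1); [lra | |].
  - intros y hy. pose proof (period_asymptotics 1 y ltac:(lra) ltac:(lra) ltac:(lra)) as P.
    replace (RInt (fun t => / sqrt (sin t * sin t + y))%R 0 (PI / 2))
      with (RInt (fun t => / sqrt (1 * 1 * (cos t * cos t) + y))%R 0 (PI / 2)).
    2:{ rewrite <- (RInt_reflect (fun t => / sqrt (sin t * sin t + y))%R).
        - f_equal. apply functional_extensionality. intros t. rewrite sin_shift. f_equal. f_equal. ring.
        - intros t _. apply (ex_derive_continuous (fun t => / sqrt (sin t * sin t + y))%R). pose proof (sin_sqr_bounds t).
          auto_derive. assert (0 < sqrt (sin t * sin t + y))%R by (apply sqrt_lt_R0; lra). repeat split; lra. }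
    replace (1 * 1 + y)%R with (1 + y)%R in P by ring. rewrite Rinv_1, ln_sqrt in P by lra.
    set (I := RInt _ _ _) in *.
    replace (I + ln y / 2 - 2 * ln 2)%R
      with ((I - (1 * (ln (1 + sqrt (1 + y)) - ln y / 2) + ln 2)) + (ln (1 + sqrt (1 + y)) - ln 2))%R by field.
    eapply Rle_trans; [apply Rabs_triang |]. apply Rplus_le_compat; [rewrite (Rmult_comm (PI / 2)); exact P | lra].
  - apply lim0_plus; [apply lim0_scal, lim0_sqrt |].
    apply lim0_abs, lim0_cont.
    + apply (ex_derive_continuous (fun y => ln (1 + sqrt (1 + y)) - ln 2)%R). auto_derive.
      rewrite Rplus_0_r, sqrt_1. repeat split; lra.
    + rewrite Rplus_0_r, sqrt_1. replace (1 + 1)%R with 2%R by ring. ring.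
Qed.

Lemma Cln_RtoC (t : R) : (0 < t)%R -> Cln (RtoC t) = RtoC (ln t).
Proof.
  intros ht. unfold Cln, Carg. rewrite Cmod_R, Rabs_pos_eq, Im_RtoC, Re_RtoC by lra.
  destruct (Rle_dec 0 0); [| lra]. replace (t / t)%R with 1%R by (field; lra). rewrite acos_1. reflexivity.
Qed.

(* The constant term [-4 ln 2] of [g] is what makes the limit vanish. *)
Lemma log_solution_limit (f : R -> R) (x : R -> C) :
  (forall t, (0 < t)%R -> Cmod (x t) = t) -> lim0 (fun t => f t + ln t / 2 - 2 * ln 2)%R ->
  lim0 (fun t => Cmod (RtoC (f t) + / 2 * (Cln (RtoC t) * ps hypa (x t) + ps hypg (x t)))).
Proof.
  intros hx Hf.
  destruct (ps_near_0 hypa tame_hypa) as (S1 & hS1 & H1). destruct (ps_near_0 hypg tame_hypg) as (S2 & hS2 & H2).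
  apply (lim0_le _ (fun t => Rabs (f t + ln t / 2 - 2 * ln 2) + (S1 * (t * Rabs (ln t)) + S2 * t))%R (1 / 2)); [lra | |].
  - intros t ht. rewrite Rabs_pos_eq by apply Cmod_ge_0. rewrite Cln_RtoC by lra.
    specialize (H1 (x t)). specialize (H2 (x t)). rewrite hx in H1, H2 by lra. specialize (H1 ltac:(lra)). specialize (H2 ltac:(lra)).
    rewrite hypa_0 in H1. unfold hypg at 2 in H2. rewrite hypa_0, hypb_0, Rmult_1_l in H2.
    replace (RtoC (f t) + / 2 * (RtoC (ln t) * ps hypa (x t) + ps hypg (x t)))
      with (RtoC (f t + ln t / 2 - 2 * ln 2) + (/ 2 * (RtoC (ln t) * (ps hypa (x t) - RtoC 1)) + / 2 * (ps hypg (x t) - RtoC (- 4 * ln 2)))).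
    2:{ rewrite RtoC_minus, RtoC_plus, RtoC_div, !RtoC_mult by lra. replace (RtoC (-4)) with (- RtoC 4) by (rewrite <- RtoC_opp; reflexivity). field. }
    eapply Rle_trans; [apply Cmod_triangle |]. rewrite Cmod_R. apply Rplus_le_compat_l.
    eapply Rle_trans; [apply Cmod_triangle |]. rewrite !Cmod_mult, Cmod_R, <- RtoC_inv, Cmod_R, (Rabs_pos_eq (/ 2)) by lra.
    pose proof (Rabs_pos (ln t)) as hl. pose proof (Cmod_ge_0 (ps hypa (x t) - RtoC 1)).
    pose proof (Cmod_ge_0 (ps hypg (x t) - RtoC (- 4 * ln 2))).
    assert (Rabs (ln t) * Cmod (ps hypa (x t) - RtoC 1) <= Rabs (ln t) * (S1 * t))%R by (apply Rmult_le_compat_l; assumption).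
    nra.
  - apply lim0_plus.
    + apply lim0_abs, Hf.
    + apply lim0_plus; apply lim0_scal; [apply lim0_xlnx |]. apply (lim0_cont (fun t => t)); [apply continuous_id | reflexivity].
Qed.

(** The sum of [EK (1 - x)] and half the logarithmic series solves the system and tends to [0] along
    the positive ray, hence vanishes. *)
Lemma EK_reflect_hyp x : cut_plane x -> udisc x -> EK (1 - x) = - / 2 * (Cln x * ps hypa x + ps hypg x).
Proof.
  intros hx hd.
  set (U := fun x => cut_plane x /\ udisc x).
  assert (S1 : sol U (fun x => EK (1 - x)) (fun x => - vK (1 - x))).
  { refine (sol_subset _ U _ _ _ (sol_reflect _ _ _ sol_K)). intros z [hz _]. split; [now apply cut_plane_DK |].
    intros E. apply hz. replace z with (1 - (1 - z)) by ring. rewrite E. simpl. lra. }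
  assert (S2 : sol U (fun x => Cln x * ps hypa x + ps hypg x)
    (fun x => (1 - x) * (ps hypa x + Cln x * ps (theta hypa) x + ps (theta hypg) x))).
  { apply sol_hyp_g. intros z [hz hzd]. split; [| split; [exact hzd | now apply Cln_deriv, cut_plane_slit]].
    intros ->. apply hz. simpl. lra. }
  pose proof (sol_comb U _ _ _ _ 1 (/ 2) S1 S2) as S3.
  destruct (sol_singular_unique U _ _ 1 S3 (or_introl eq_refl)) with (z := x) as [Z _].
  - intros t ht. rewrite Rmult_1_l. split; [split |].
    + intros [_ h]. rewrite Re_RtoC in h. lra.
    + unfold udisc. rewrite Cmod_R, Rabs_pos_eq; lra.
    + apply star_and; [apply star_cut_plane; lra |]. apply star_udisc. unfold udisc. rewrite Cmod_R, Rabs_pos_eq; lra.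
  - pose proof (log_solution_limit _ (fun t => RtoC (1 * t)) (fun t ht => eq_trans (Cmod_R _) (eq_trans (f_equal Rabs (Rmult_1_l t)) (Rabs_pos_eq t (Rlt_le _ _ ht)))) EK_log_asymptotics) as L.
    cbv beta in L. refine (lim0_le _ _ 1 Rlt_0_1 _ L). intros t ht. rewrite Rabs_pos_eq by apply Cmod_ge_0. right. f_equal.
    rewrite <- EK_RtoC by lra. rewrite Rmult_1_l. ring.
  - split; assumption.
  - cbv beta in Z. replace (EK (1 - x)) with ((1 * EK (1 - x) + / 2 * (Cln x * ps hypa x + ps hypg x)) - / 2 * (Cln x * ps hypa x + ps hypg x)) by ring.
    rewrite Z. ring.
Qed.

(** As for [EK (1 - x)], but along the negative ray, which lies inside [DL], and with the logarithm
    cut along the positive axis. *)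
Lemma EL_hyp x : DL x -> udisc x -> EL x = - / 2 * (Cln (- x) * ps hypa x + ps hypg x).
Proof.
  intros hx hd.
  set (U := fun x => DL x /\ udisc x).
  assert (S1 : sol U EL vL) by (refine (sol_subset _ U _ _ _ sol_L); intros z [hz _]; exact hz).
  assert (S2 : sol U (fun x => Cln (- x) * ps hypa x + ps hypg x)
    (fun x => (1 - x) * (ps hypa x + Cln (- x) * ps (theta hypa) x + ps (theta hypg) x))).
  { apply (sol_hyp_g U (fun x => Cln (- x))). intros z [hz hzd].
    assert (z0 : z <> 0) by (intros ->; apply hz; simpl; lra).
    split; [exact z0 | split; [exact hzd |]].
    eapply deriv_eq; [apply (deriv_comp cid Cln (fun x => - x)); [now apply Cln_deriv, DL_slit | apply deriv_opp, deriv_id] |].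
    field. exact z0. }
  pose proof (sol_comb U _ _ _ _ 1 (/ 2) S1 S2) as S3.
  destruct (sol_singular_unique U _ _ (-1) S3 (or_intror eq_refl)) with (z := x) as [Z _].
  - intros t ht. split; [split |].
    + intros [_ h]. rewrite Re_RtoC in h. lra.
    + unfold udisc. rewrite Cmod_R, Rabs_left; lra.
    + apply star_and; [apply star_DL; lra |]. apply star_udisc. unfold udisc. rewrite Cmod_R, Rabs_left; lra.
  - assert (hm : forall t, (0 < t)%R -> Cmod (RtoC (-1 * t)) = t) by (intros t ht; rewrite Cmod_R, Rabs_left; lra).
    pose proof (log_solution_limit _ (fun t => RtoC (-1 * t)) hm EL_log_asymptotics) as L.
    cbv beta in L. refine (lim0_le _ _ 1 Rlt_0_1 _ L). intros t ht. rewrite Rabs_pos_eq by apply Cmod_ge_0. right. f_equal.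
    rewrite <- EL_RtoC by lra. replace (RtoC (-1 * t)) with (- RtoC t) by (rewrite <- RtoC_opp; f_equal; ring).
    replace (- - RtoC t) with (RtoC t) by ring. ring.
  - split; assumption.
  - cbv beta in Z. replace (EL x) with ((1 * EL x + / 2 * (Cln (- x) * ps hypa x + ps hypg x)) - / 2 * (Cln (- x) * ps hypa x + ps hypg x)) by ring.
    rewrite Z. ring.
Qed.

Lemma EK_0 : EK 0 = RtoC (PI / 2).
Proof.
  unfold EK, ellint. rewrite (cint_ext _ (fun _ => 1)).
  - rewrite cint_const. rewrite Rminus_0_r. ring.
  - pose proof PI_RGT_0; lra.
  - intros t _. replace (RtoC 1 + 0 * RtoC (msinsq t)) with (RtoC 1) by ring. rewrite csqrt_RtoC, sqrt_1 by lra. field.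
Qed.

Lemma EK_cont x : DK x -> ccont EK x.
Proof.
  intros hx. eapply deriv_cont. apply (ellint_deriv (fun _ => 1%R) msinsq (fun _ => 1%R) 1);
    auto using continuous_msinsq, admissible_K; intros; apply continuous_const.
Qed.

(** Here both solutions are continuous at [0], with common value [PI / 2]. *)
Lemma EK_hyp x : cut_plane x -> udisc x -> EK x = RtoC (PI / 2) * ps hypa x.
Proof.
  intros hx hd.
  set (U := fun x => cut_plane x /\ udisc x).
  assert (S1 : sol U EK vK).
  { refine (sol_subset _ U _ _ _ sol_K). intros z [hz _]. split; [now apply cut_plane_DK |].
    intros ->. apply hz. simpl. lra. }
  assert (S2 : sol U (ps hypa) (fun x => (1 - x) * ps (theta hypa) x)).
  { apply sol_hyp_F. intros z [hz hzd]. split; [| exact hzd]. intros ->. apply hz. simpl. lra. }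
  pose proof (sol_comb U _ _ _ _ 1 (- RtoC (PI / 2)) S1 S2) as S3.
  destruct (sol_singular_unique U _ _ 1 S3 (or_introl eq_refl)) with (z := x) as [Z _].
  - intros t ht. rewrite Rmult_1_l. split; [split |].
    + intros [_ h]. rewrite Re_RtoC in h. lra.
    + unfold udisc. rewrite Cmod_R, Rabs_pos_eq; lra.
    + apply star_and; [apply star_cut_plane; lra |]. apply star_udisc. unfold udisc. rewrite Cmod_R, Rabs_pos_eq; lra.
  - destruct (ps_near_0 hypa tame_hypa) as (S0 & hS & H1). rewrite hypa_0 in H1.
    assert (DK0 : DK 0) by (intros [_ h]; simpl in h; lra).
    apply (lim0_le _ (fun t => Cmod (EK (RtoC t) - EK 0) + (PI / 2 * S0) * t)%R (1 / 2)); [lra | |].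
    + intros t ht. rewrite Rmult_1_l, Rabs_pos_eq by apply Cmod_ge_0.
      replace (1 * EK (RtoC t) + - RtoC (PI / 2) * ps hypa (RtoC t))
        with ((EK (RtoC t) - EK 0) + - RtoC (PI / 2) * (ps hypa (RtoC t) - RtoC 1)) by (rewrite EK_0; ring).
      eapply Rle_trans; [apply Cmod_triangle |]. apply Rplus_le_compat_l.
      specialize (H1 (RtoC t)). rewrite Cmod_R, Rabs_pos_eq in H1 by lra. specialize (H1 ltac:(lra)).
      pose proof PI_RGT_0. rewrite Cmod_mult, Cmod_opp, Cmod_R, Rabs_pos_eq, Rmult_assoc by lra.
      apply Rmult_le_compat_l; lra.
    + apply lim0_plus.
      * intros eps he. destruct (EK_cont 0 DK0 eps he) as (d & hd' & Hd). exists d. split; [exact hd' |].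
        intros t ht. rewrite Rabs_pos_eq by apply Cmod_ge_0. apply Hd. unfold cid.
        replace (RtoC t - 0) with (RtoC t) by ring. rewrite Cmod_R, Rabs_pos_eq; lra.
      * apply lim0_scal, (lim0_cont (fun t => t)); [apply continuous_id | reflexivity].
  - split; assumption.
  - cbv beta in Z. replace (EK x) with ((1 * EK x + - RtoC (PI / 2) * ps hypa x) + RtoC (PI / 2) * ps hypa x) by ring.
    rewrite Z. ring.
Qed.

(** * The periods *)

Lemma sol_solves u v : sol cut_plane u v -> solves_period_equation u.
Proof.
  intros H. exists (fun x => / (x * (1 - x)) * v x),
    (fun x => - (1 - 2 * x) / (x * (1 - x) * (x * (1 - x))) * v x + / (x * (1 - x)) * (u x / 4)).
  intros x hx. destruct (H x hx) as (n0 & n1 & d1 & d2). apply sub_1_neq in n1.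
  assert (n2 : x * (1 - x) <> 0) by (intros E; destruct (Cmult_integral _ _ E); tauto).
  split; [now apply is_derive_cderiv |]. split.
  - apply is_derive_cderiv. eapply deriv_eq.
    + apply deriv_mult; [| exact d2]. apply deriv_inv; [| exact n2].
      apply (deriv_mult cid (fun x => x) (fun x => 1 - x)); [apply deriv_id |].
      apply deriv_minus; [apply deriv_const | apply deriv_id].
    + cbv beta. field. auto.
  - field. auto.
Qed.

Lemma solves_sol w : solves_period_equation w -> exists v, sol cut_plane w v.
Proof.
  intros (w' & w'' & H). exists (fun x => x * (1 - x) * w' x). intros x hx. destruct (H x hx) as (d1 & d2 & E).
  apply is_derive_cderiv in d1, d2.
  assert (n0 : x <> 0) by (intros ->; apply hx; simpl; lra).
  assert (n1 : x <> 1) by (intros ->; apply hx; simpl; lra).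
  pose proof (sub_1_neq x n1) as n2.
  split; [exact n0 |]. split; [exact n1 |]. split.
  - eapply deriv_eq; [exact d1 |]. field. auto.
  - eapply deriv_eq.
    + apply (deriv_mult cid (fun x => x * (1 - x)) w'); [| exact d2].
      apply (deriv_mult cid (fun x => x) (fun x => 1 - x)); [apply deriv_id |].
      apply deriv_minus; [apply deriv_const | apply deriv_id].
    + cbv beta. transitivity (x * (1 - x) * w'' x + (1 - 2 * x) * w' x - / 4 * w x + / 4 * w x); [ring |].
      rewrite E. unfold Cdiv. ring.
Qed.

(** A function vanishing near [c] has derivative [0] at [c], so the second component vanishes there
    as well. *)
Lemma sol_zero_near U u v c :
  sol U u v -> star U c -> U c -> near cid c (fun x => u x = 0) -> forall z, U z -> u z = 0 /\ v z = 0.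
Proof.
  intros H St hc Hn. apply (sol_unique U u v c); auto; [exact (near_at _ _ _ Hn) |].
  destruct (H c hc) as (n0 & n1 & d1 & _).
  assert (d0 : cderiv u c 0).
  { apply (deriv_ext cid (fun _ => RtoC 0)); [| apply deriv_const].
    refine (near_imp _ _ _ _ _ Hn). cbv beta. auto. }
  pose proof (cderiv_unique _ _ _ _ d1 d0) as E. apply sub_1_neq in n1.
  destruct (Cmult_integral _ _ E) as [E' | E']; [| exact E']. exfalso.
  assert (E2 : c * (1 - c) * / (c * (1 - c)) = 1) by (field; auto). rewrite E' in E2.
  apply (f_equal Re) in E2. revert E2. reim. lra.
Qed.

Lemma udisc_open c : udisc c -> near cid c udisc.
Proof.
  intros hc. exists (1 - Cmod c)%R. unfold udisc in *. split; [lra |]. unfold cid. intros z hz.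
  pose proof (Cmod_sub_ge z c). lra.
Qed.

Lemma near_Im_neq z : Im z <> 0%R -> near cid z (fun w => (0 < Im z * Im w)%R).
Proof.
  intros h. exists (Rabs (Im z)). split; [now apply Rabs_pos_lt |]. unfold cid. intros w hw.
  pose proof (Im_le_Cmod (w - z)) as b. rewrite Im_minus in b.
  destruct (Rlt_dec (Im z) 0).
  - rewrite Rabs_left in hw by lra. assert (Rabs (Im w - Im z) < - Im z)%R by lra. apply Rabs_def2 in H. nra.
  - rewrite Rabs_pos_eq in hw by lra. assert (Rabs (Im w - Im z) < Im z)%R by lra. apply Rabs_def2 in H. nra.
Qed.

Lemma cut_plane_open x : cut_plane x -> near cid x cut_plane.
Proof.
  intros hx. assert (h1 : slit (1 - x)).
  { intros [a b]. apply hx. revert a b. reim. intros; lra. }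
  pose proof (slit_open x (cut_plane_slit x hx)) as N1.
  assert (N2 : near cid x (fun y => slit (1 - y))).
  { apply (cont_near cid (fun y => 1 - y)); [apply cont_minus; [apply cont_const | apply cont_id] | now apply slit_open]. }
  refine (near_imp _ _ _ _ _ (near_and _ _ _ _ N1 N2)). intros y [a b] [c [d | d]]; [apply a | apply b]; revert c d; reim; intros; lra.
Qed.

Lemma DL_open x : DL x -> near cid x DL.
Proof.
  intros hx. pose proof (cont_near cid (fun y => - y) x slit (cont_opp _ _ _ (cont_id x)) (slit_open _ (DL_slit x hx))) as N.
  refine (near_imp _ _ _ _ _ N). intros y h [a b]. apply h. reim. lra.
Qed.

Lemma period_unique w0 w1 w2 :
  is_period_given_by w0 w1 -> is_period_given_by w0 w2 -> forall x, cut_plane x -> w1 x = w2 x.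
Proof.
  intros [s1 e1] [s2 e2] x hx. destruct (solves_sol _ s1) as (v1 & h1), (solves_sol _ s2) as (v2 & h2).
  pose proof (sol_comb _ _ _ _ _ 1 (- (1)) h1 h2) as S.
  set (c := RtoC (1 / 2)).
  assert (hc : cut_plane c) by (intros [_ h]; unfold c in h; rewrite Re_RtoC in h; lra).
  assert (hd : udisc c) by (unfold udisc, c; rewrite Cmod_R, Rabs_pos_eq; lra).
  destruct (sol_zero_near _ _ _ c S (star_cut_plane (1 / 2) ltac:(lra)) hc) with (z := x) as [Z _].
  - refine (near_imp _ _ _ _ _ (near_and _ _ _ _ (cut_plane_open c hc) (udisc_open c hd))).
    intros y [a b]. rewrite (e1 y a b), (e2 y a b). ring.
  - exact hx.
  - cbv beta in Z. replace (w1 x) with (1 * w1 x + - (1) * w2 x + w2 x) by ring. rewrite Z. ring.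
Qed.

Lemma sol_K_cut : sol cut_plane EK vK.
Proof.
  refine (sol_subset _ _ _ _ _ sol_K). intros z hz. split; [now apply cut_plane_DK |].
  intros ->. apply hz. simpl. lra.
Qed.

Lemma sol_K_reflect_cut : sol cut_plane (fun x => EK (1 - x)) (fun x => - vK (1 - x)).
Proof.
  refine (sol_subset _ cut_plane _ _ _ (sol_reflect _ _ _ sol_K)). intros z hz. split; [now apply cut_plane_DK |].
  intros E. apply hz. replace z with (1 - (1 - z)) by ring. rewrite E. simpl. lra.
Qed.

(** [EK] satisfies the predicate, so [epsilon] returns some function satisfying it, and by
    [period_unique] that function is [EK] on the cut plane. Elsewhere its values remain unknown. *)
Lemma omega1_EK x : cut_plane x -> omega1 x = EK x.
Proof.
  apply (period_unique (fun x => RtoC (PI / 2) * hypergeometric_F (1 / 2) (1 / 2) 1 x)).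
  - unfold omega1. apply epsilon_spec. exists EK. split; [exact (sol_solves _ _ sol_K_cut) |].
    intros y hy hd. rewrite hypergeometric_F_ps. now apply EK_hyp.
  - split; [exact (sol_solves _ _ sol_K_cut) |]. intros y hy hd. rewrite hypergeometric_F_ps. now apply EK_hyp.
Qed.

Lemma sol_scal U u v a : sol U u v -> sol U (fun x => a * u x) (fun x => a * v x).
Proof.
  intros H x hx. destruct (H x hx) as (n0 & n1 & d & e). split; [exact n0 |]. split; [exact n1 |]. split.
  - eapply deriv_eq; [apply deriv_scal; eassumption | ring].
  - eapply deriv_eq; [apply deriv_scal; eassumption |]. unfold Cdiv. ring.
Qed.

Lemma omega2_EK x : cut_plane x -> omega2 x = Ci * EK (1 - x).
Proof.
  assert (P : is_period_given_by (fun x => - (Ci / 2) * hypergeometric_g (1 / 2) (1 / 2) x) (fun x => Ci * EK (1 - x))).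
  { split; [exact (sol_solves _ _ (sol_scal _ _ _ Ci sol_K_reflect_cut)) |].
    intros y hy hd. rewrite hypergeometric_g_ps by exact hd. rewrite EK_reflect_hyp by assumption. field. }
  apply (period_unique (fun x => - (Ci / 2) * hypergeometric_g (1 / 2) (1 / 2) x) omega2 (fun x => Ci * EK (1 - x))); [| exact P].
  unfold omega2. apply epsilon_spec. eexists. exact P.
Qed.

(* [sg = 1] on the upper and [sg = -1] on the lower half-plane. *)
Definition half (sg : R) (x : C) : Prop := (0 < sg * Im x)%R.

Lemma Cln_opp (sg : R) x : (sg = 1 \/ sg = -1)%R -> half sg x -> Cln (- x) = Cln x - RtoC (sg * PI) * Ci.
Proof.
  intros hs hx. unfold half in hx. unfold Cln, Carg. rewrite Cmod_opp, Re_opp, Im_opp.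
  replace (- Re x / Cmod x)%R with (- (Re x / Cmod x))%R by (unfold Rdiv; ring). rewrite acos_opp.
  apply C_ext; reim; simpl; destruct hs as [-> | ->]; destruct (Rle_dec 0 (- Im x)), (Rle_dec 0 (Im x)); try lra; ring.
Qed.

Lemma half_cut_plane (sg : R) x : half sg x -> cut_plane x /\ DL x /\ DL (1 - x).
Proof.
  unfold half. intros h. assert (Im x <> 0)%R by (intros E; rewrite E in h; lra).
  repeat split; intros [a b]; revert a; reim; lra.
Qed.

Lemma star_half (sg : R) c : half sg c -> star (half sg) c.
Proof.
  unfold half. intros hc z t hz ht. rewrite segm_Im.
  replace (sg * (Im c + t * (Im z - Im c)))%R with ((1 - t) * (sg * Im c) + t * (sg * Im z))%R by ring.
  destruct (Rle_dec t (1 / 2)); nra.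
Qed.

Lemma half_open sg x : half sg x -> near cid x (half sg).
Proof.
  unfold half. intros h. assert (h0 : Im x <> 0%R) by (intros E; rewrite E in h; lra).
  refine (near_imp _ _ _ _ _ (near_Im_neq x h0)). intros y hy. nra.
Qed.

(** Near a point of the half-disc both sides are given by the series. The logarithms of [- x] and
    [x] differ by [sg PI i], and [PI / 2] times the series of [F] is [EK]: this yields exactly
    [sg i EK]. *)
Lemma EL_relation (sg : R) x :
  (sg = 1 \/ sg = -1)%R -> half sg x -> EL x = EK (1 - x) + RtoC sg * Ci * EK x.
Proof.
  intros hs hx.
  assert (S1 : sol (half sg) EL vL) by (refine (sol_subset _ _ _ _ _ sol_L); intros; now apply (half_cut_plane sg)).
  assert (S2 : sol (half sg) EK vK) by (refine (sol_subset _ _ _ _ _ sol_K_cut); intros; now apply (half_cut_plane sg)).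
  assert (S3 : sol (half sg) (fun x => EK (1 - x)) (fun x => - vK (1 - x)))
    by (refine (sol_subset _ _ _ _ _ sol_K_reflect_cut); intros; now apply (half_cut_plane sg)).
  pose proof (sol_comb _ _ _ _ _ 1 1 (sol_comb _ _ _ _ _ 1 (- (1)) S1 S3) (sol_scal _ _ _ (- RtoC sg * Ci) S2)) as S.
  set (c := RtoC (sg / 2) * Ci).
  assert (hc : half sg c) by (unfold half, c; reim; destruct hs; subst; lra).
  assert (hd : udisc c).
  { unfold udisc, c. rewrite Cmod_mult, Cmod_Ci, Cmod_R. destruct hs; subst; [rewrite Rabs_pos_eq | rewrite Rabs_left]; lra. }
  destruct (sol_zero_near _ _ _ c S (star_half sg c hc) hc) with (z := x) as [Z _].
  - refine (near_imp _ _ _ _ _ (near_and _ _ _ _ (half_open sg c hc) (udisc_open c hd))).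
    intros y [a b]. destruct (half_cut_plane sg y a) as (h1 & h2 & _).
    rewrite EL_hyp, EK_reflect_hyp, EK_hyp, (Cln_opp sg) by assumption. rewrite RtoC_mult, RtoC_div by lra.
    replace (1 * (1 * (- / 2 * ((Cln y - RtoC sg * RtoC PI * Ci) * ps hypa y + ps hypg y)) +
      - (1) * (- / 2 * (Cln y * ps hypa y + ps hypg y))) + 1 * (- RtoC sg * Ci * (RtoC PI / 2 * ps hypa y))) with (RtoC 0); [reflexivity |].
    field.
  - exact hx.
  - cbv beta in Z. replace (EL x) with (1 * (1 * EL x + - (1) * EK (1 - x)) + 1 * (- RtoC sg * Ci * EK x) + (EK (1 - x) + RtoC sg * Ci * EK x)) by ring.
    rewrite Z. ring.
Qed.

(** * Three charts covering the punctured plane *)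

(* The planes cut along (-oo,0] u [1,+oo), [0,+oo) and (-oo,1], with
   half-periods (EK x, i EK(1-x)), (EK x, i EL x) and (EL(1-x), i EK(1-x)). *)
Inductive chart := chart01 | chart0 | chart1.

Definition dom (j : chart) (x : C) : Prop :=
  match j with chart01 => cut_plane x | chart0 => DL x | chart1 => DL (1 - x) end.

Definition ctr (j : chart) : C :=
  match j with chart01 => RtoC (1 / 2) | chart0 => RtoC (-1) | chart1 => RtoC 2 end.

Definition al (j : chart) (x : C) : C :=
  match j with chart01 | chart0 => EK x | chart1 => EL (1 - x) end.
Definition be (j : chart) (x : C) : C :=
  match j with chart0 => EL x | chart01 | chart1 => EK (1 - x) end.
(** Second components in the sense of [sol]; the reflection [x -> 1 - x] changes their sign. *)
Definition val (j : chart) (x : C) : C :=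
  match j with chart01 | chart0 => vK x | chart1 => - vL (1 - x) end.
Definition vbe (j : chart) (x : C) : C :=
  match j with chart0 => vL x | chart01 | chart1 => - vK (1 - x) end.

Lemma DL_neq_0 (x : C) : DL x -> x <> 0.
Proof. intros h ->. apply h. simpl. lra. Qed.

Lemma sol_K_DL : sol DL EK vK.
Proof.
  refine (sol_subset _ _ _ _ _ sol_K). intros z hz. split; [now apply DL_DK | now apply DL_neq_0].
Qed.

Lemma sol_al j : sol (dom j) (al j) (val j).
Proof.
  destruct j; [exact sol_K_cut | exact sol_K_DL | exact (sol_reflect _ _ _ sol_L)].
Qed.

Lemma sol_be j : sol (dom j) (be j) (vbe j).
Proof.
  destruct j; [exact sol_K_reflect_cut | exact sol_L | exact (sol_reflect _ _ _ sol_K_DL)].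
Qed.

Lemma segm_reflect c z t : 1 - segm c z t = segm (1 - c) (1 - z) t.
Proof. unfold segm. ring. Qed.

Lemma star_dom j : star (dom j) (ctr j).
Proof.
  destruct j; simpl.
  - apply star_cut_plane. lra.
  - apply star_DL. lra.
  - intros z t hz ht. change (DL (1 - segm (RtoC 2) z t)). rewrite segm_reflect.
    replace (1 - RtoC 2) with (RtoC (-1)) by (rewrite <- RtoC_minus; f_equal; ring).
    apply star_DL; [lra | exact hz | exact ht].
Qed.

Lemma dom_ctr j : dom j (ctr j).
Proof.
  destruct j; simpl; intros [_ h]; revert h; reim; lra.
Qed.

Lemma dom_open j x : dom j x -> near cid x (dom j).
Proof.
  destruct j; simpl; [apply cut_plane_open | apply DL_open |]. intros hx.
  apply (cont_near cid (fun y => 1 - y)); [apply cont_minus; [apply cont_const | apply cont_id] | now apply DL_open].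
Qed.

Lemma al_be_pos j x : dom j x -> (0 < Re (Cconj (al j x) * be j x))%R.
Proof.
  destruct j; simpl dom; simpl al; simpl be.
  - intros h. destruct (cut_plane_DK x h). now apply EK_reflect_pos.
  - apply EK_EL_pos.
  - intros h. pose proof (EK_EL_pos _ h) as p. revert p. reim. lra.
Qed.

Lemma dom_neq j (x : C) : dom j x -> x <> 0 /\ x <> 1.
Proof. intros h. destruct (sol_al j x h) as (a & b & _). auto. Qed.

Lemma dom_cover (x : C) : x <> 0 -> x <> 1 -> exists j, dom j x.
Proof.
  intros n0 n1. destruct (Req_dec (Im x) 0) as [E | N].
  2:{ exists chart01. intros [h _]. auto. }
  destruct (Rle_dec (Re x) 0) as [h | h].
  - exists chart0. intros [_ h2]. apply n0. apply C_ext; simpl; lra.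
  - destruct (Rle_dec 1 (Re x)) as [h' | h'].
    + exists chart1. intros [_ h2]. revert h2. reim. intros h2. apply n1. apply C_ext; simpl; lra.
    + exists chart01. intros [_ [h2 | h2]]; lra.
Qed.

Lemma half_dom sg x j : half sg x -> dom j x.
Proof. intros h. destruct (half_cut_plane sg x h) as (a & b & c). destruct j; assumption. Qed.

(** Each of the three open intervals of the real axis between [0] and [1] and beyond them lies in
    one chart only. *)
Lemma dom_two_charts j k x : j <> k -> dom j x -> dom k x -> half 1 x \/ half (-1) x.
Proof.
  intros hjk hj hk. unfold half. destruct (Rtotal_order (Im x) 0) as [h | [h | h]]; [right; lra | | left; lra].
  exfalso. destruct j, k; try congruence; simpl in hj, hk; unfold cut_plane, DL in hj, hk; revert hj hk; reim;
    intros hj hk; destruct (Rle_dec (Re x) 0); destruct (Rle_dec 1 (Re x)); first [apply hj; lra | apply hk; lra].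
Qed.

(** The zero sits at an arbitrary point: it is carried to the centre along one segment, and from
    there everywhere. *)
Lemma sol_zero_at U u v c p :
  sol U u v -> star U c -> U p -> u p = 0 -> v p = 0 -> forall z, U z -> u z = 0 /\ v z = 0.
Proof.
  intros H St hp hu hv.
  assert (Z : u c = 0 /\ v c = 0).
  { apply (ode_unique_segm u v (fun x => / (x * (1 - x))) p c); auto.
    intros t ht w. assert (hw : U w).
    { unfold w. replace (segm p c t) with (segm c p (1 - t)) by (unfold segm; rewrite RtoC_minus; ring). apply St; [exact hp | lra]. }
    destruct (H w hw) as (n0 & n1 & d1 & d2). split; [| split; assumption].
    apply (cont_inv cid (fun x => x * (1 - x))).
    - apply (cont_mult cid (fun x => x) (fun x => 1 - x)); [apply cont_id |].
      apply cont_minus; [apply cont_const | apply cont_id].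
    - intros E. apply sub_1_neq in n1. destruct (Cmult_integral _ _ E); tauto. }
  destruct Z. apply (sol_unique U u v c); auto.
Qed.

Lemma al_neq_0 j (x : C) : dom j x -> al j x <> 0.
Proof. intros h E. pose proof (al_be_pos j x h) as p. rewrite E in p. revert p. reim. lra. Qed.

(** The relation on one half-plane makes both components of [f - k g] vanish at [sg i], from where
    the zero spreads over the star. *)
Lemma proportional_extend U f vf g vg c (k : C) (sg : R) :
  sol U f vf -> sol U g vg -> star U c -> (sg = 1 \/ sg = -1)%R -> (forall x, half sg x -> U x) ->
  (forall x, half sg x -> f x = k * g x) -> forall x, U x -> f x = k * g x.
Proof.
  intros Hf Hg St hs Hh Hk x hx.
  pose proof (sol_comb _ _ _ _ _ 1 (- k) Hf Hg) as S.
  set (p := RtoC sg * Ci). assert (hp : half sg p) by (unfold half, p; reim; destruct hs; subst; lra).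
  assert (Sh : sol (half sg) (fun x => 1 * f x + - k * g x) (fun x => 1 * vf x + - k * vg x)) by exact (sol_subset _ _ _ _ Hh S).
  destruct (sol_zero_near _ _ _ p Sh (star_half sg p hp) hp) with (z := p) as [Z1 Z2].
  - refine (near_imp _ _ _ _ _ (half_open sg p hp)). intros y hy. rewrite (Hk y hy). ring.
  - exact hp.
  - destruct (sol_zero_at _ _ _ c p S St (Hh p hp) Z1 Z2 x hx) as [Z _]. cbv beta in Z.
    replace (f x) with (1 * f x + - k * g x + k * g x) by ring. rewrite Z. ring.
Qed.

Lemma two_slopes_absurd (k : C) (f g : C) : f = (k + Ci) * g -> f = (k - Ci) * g -> g = 0.
Proof.
  intros h1 h2. assert (E : RtoC 2 * Ci * g = 0) by (replace (RtoC 2 * Ci * g) with ((k + Ci) * g - (k - Ci) * g) by ring; rewrite <- h1, <- h2; ring).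
  destruct (Cmult_integral _ _ E) as [E' | E']; [| exact E']. exfalso. apply (f_equal Im) in E'. revert E'. reim. lra.
Qed.

(* The two continuations of [EK (1 - x)] across the negative axis differ, so
   [EK x] and [EK (1 - x)] cannot be proportional. *)
Lemma not_proportional_01 (k : C) : ~ forall x, cut_plane x -> EK (1 - x) = k * EK x.
Proof.
  intros H. assert (A : forall sg, (sg = 1 \/ sg = -1)%R -> forall x, DL x -> EL x = (k + RtoC sg * Ci) * EK x).
  { intros sg hs. apply (proportional_extend DL EL vL EK vK (RtoC (-1)) (k + RtoC sg * Ci) sg); auto.
    - exact sol_L.
    - exact sol_K_DL.
    - apply star_DL. lra.
    - intros x hx. now apply (half_cut_plane sg).
    - intros x hx. rewrite (EL_relation sg) by assumption. rewrite H by now apply (half_cut_plane sg). ring. }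
  pose proof (dom_ctr chart0) as hc. simpl in hc.
  apply (al_neq_0 chart0 (RtoC (-1)) hc). simpl.
  apply (two_slopes_absurd k (EL (RtoC (-1)))).
  - rewrite (A 1%R) by (auto; lra). ring.
  - rewrite (A (-1)%R) by (auto; lra). replace (RtoC (-1)) with (- RtoC 1) at 1 by (rewrite <- RtoC_opp; reflexivity). ring.
Qed.

(** The mirror argument: [EL] would continue to two different multiples of [EK] on the cut plane,
    from above and from below. *)
Lemma not_proportional_0 (k : C) : ~ forall x, DL x -> EL x = k * EK x.
Proof.
  intros H. assert (A : forall sg, (sg = 1 \/ sg = -1)%R -> forall x, cut_plane x -> EK (1 - x) = (k - RtoC sg * Ci) * EK x).
  { intros sg hs. apply (proportional_extend cut_plane (fun x => EK (1 - x)) (fun x => - vK (1 - x)) EK vK (RtoC (1 / 2)) (k - RtoC sg * Ci) sg); auto.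
    - exact sol_K_reflect_cut.
    - exact sol_K_cut.
    - apply star_cut_plane. lra.
    - intros x hx. now apply (half_cut_plane sg).
    - intros x hx. pose proof (EL_relation sg x hs hx) as E. rewrite H in E by now apply (half_cut_plane sg).
      replace ((k - RtoC sg * Ci) * EK x) with (k * EK x - RtoC sg * Ci * EK x) by ring. rewrite E. ring. }
  pose proof (dom_ctr chart01) as hc. simpl in hc.
  apply (al_neq_0 chart01 (RtoC (1 / 2)) hc). simpl.
  apply (two_slopes_absurd k (EK (1 - RtoC (1 / 2)))).
  - rewrite (A (-1)%R) by (auto; lra). replace (RtoC (-1)) with (- RtoC 1) by (rewrite <- RtoC_opp; reflexivity). ring.
  - rewrite (A 1%R) by (auto; lra). ring.
Qed.

(** Independence over the complex numbers, as functions. The pointwise independence over the reals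
    in [al_be_pos] would not do for complex parameters. *)
Lemma chart_independent j (a b : C) : (forall x, dom j x -> a * al j x + b * be j x = 0) -> a = 0 /\ b = 0.
Proof.
  assert (Main : forall (U : C -> Prop) (f g : C -> C) (c a b : C), U c -> g c <> 0 -> (forall k, ~ forall x, U x -> f x = k * g x) ->
     (forall x : C, U x -> a * g x + b * f x = 0) -> a = 0 /\ b = 0).
  { intros U f g c a' b' hc hg hk H. destruct (classic (b' = 0)) as [-> | nb].
    - split; [| reflexivity]. specialize (H c hc). replace (a' * g c + 0 * f c) with (a' * g c) in H by ring.
      destruct (Cmult_integral _ _ H); tauto.
    - exfalso. apply (hk (- a' / b')). intros x hx. specialize (H x hx).
      replace (f x) with ((a' * g x + b' * f x) / b' - a' / b' * g x) by (field; exact nb). rewrite H. field. exact nb. }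
  pose proof (dom_ctr j) as hc. intros H. destruct j; simpl in *.
  - apply (Main cut_plane (fun x => EK (1 - x)) EK (RtoC (1 / 2))); auto using not_proportional_01.
    exact (al_neq_0 chart01 _ hc).
  - apply (Main DL EL EK (RtoC (-1))); auto using not_proportional_0. exact (al_neq_0 chart0 _ hc).
  - destruct (Main DL EL EK (RtoC (-1)) b a) as [h1 h2]; auto using not_proportional_0.
    + exact (dom_ctr chart0).
    + exact (al_neq_0 chart0 _ (dom_ctr chart0)).
    + intros x hx. specialize (H (1 - x)). replace (1 - (1 - x)) with x in H by ring.
      rewrite <- (H hx). ring.
Qed.

(** Nonvanishing of the Wronskian, from uniqueness for the system instead of a computation. *)
Lemma chart_nondegenerate j (a b : C) p :
  dom j p -> a * al j p + b * be j p = 0 -> a * val j p + b * vbe j p = 0 -> a = 0 /\ b = 0.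
Proof.
  intros hp h1 h2. apply (chart_independent j). intros x hx.
  exact (proj1 (sol_zero_at _ _ _ (ctr j) p (sol_comb _ _ _ _ _ a b (sol_al j) (sol_be j)) (star_dom j) hp h1 h2 x hx)).
Qed.

(** * Picard solutions in the charts *)

(** [m1], [m2] are the coordinates of the argument of [wp] in the half-periods of chart [j]. *)
Definition pic (j : chart) (m1 m2 : C) (x : C) : C :=
  wp (m1 * al j x + m2 * (Ci * be j x)) (al j x) (Ci * be j x) + (x + 1) / 3.

Lemma chart_indep j x : dom j x -> indep (al j x) (Ci * be j x).
Proof.
  intros h. pose proof (al_be_pos j x h) as p. unfold indep. revert p. reim. lra.
Qed.

Lemma picard_pic n1 n2 x : cut_plane x -> picard n1 n2 x = pic chart01 n1 n2 x.
Proof. intros h. unfold picard, pic. simpl. now rewrite omega1_EK, omega2_EK. Qed.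

Lemma sol_deriv_cont U u v p : sol U u v -> U p -> ccont (fun x => / (x * (1 - x)) * v x) p.
Proof.
  intros H hp. destruct (H p hp) as (n0 & n1 & _ & d). apply sub_1_neq in n1. apply cont_mult; [| eapply deriv_cont, d].
  apply (cont_inv cid (fun x => x * (1 - x))).
  - apply (cont_mult cid (fun x => x) (fun x => 1 - x)); [apply cont_id |].
    apply cont_minus; [apply cont_const | apply cont_id].
  - intros E. destruct (Cmult_integral _ _ E); tauto.
Qed.

(** If the argument met the lattice point [(k, l)] at [p] with equal derivatives, the solution with
    coefficients [m1 - 2 k] and [(m2 - 2 l) Ci] would vanish at [p] to second order, and [(m1, m2)]
    would be [(2 k, 2 l)]. *)
Lemma pic_mero j m1 m2 p : ~ even_integral m1 m2 -> dom j p -> meromorphic_at p (pic j m1 m2).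
Proof.
  intros hm hp. unfold pic. apply mero_plus.
  2:{ apply holo_mero. apply (holo_mult p (fun x => x + 1)); [apply holo_plus; [apply holo_id | apply holo_const] | apply holo_const]. }
  set (d := fun x : C => / (x * (1 - x))).
  pose proof (sol_deriv_cont _ _ _ p (sol_al j) hp) as ca. pose proof (sol_deriv_cont _ _ _ p (sol_be j) hp) as cb.
  apply (wp_family_mero (fun x => m1 * al j x + m2 * (Ci * be j x)) (al j) (fun x => Ci * be j x)
    (fun x => m1 * (d x * val j x) + m2 * (Ci * (d x * vbe j x))) (fun x => d x * val j x) (fun x => Ci * (d x * vbe j x))).
  - refine (near_imp _ _ _ _ _ (dom_open j p hp)). intros z hz.
    destruct (sol_al j z hz) as (n0 & n1 & da & _), (sol_be j z hz) as (_ & _ & db & _).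
    split; [| split].
    + apply deriv_plus; apply deriv_scal; [exact da | now apply deriv_scal].
    + exact da.
    + now apply deriv_scal.
  - apply cont_plus; (apply cont_mult; [apply cont_const |]); [exact ca | apply cont_mult; [apply cont_const | exact cb]].
  - exact ca.
  - apply cont_mult; [apply cont_const | exact cb].
  - now apply chart_indep.
  - intros [k l] E E'. unfold lattice_point in E, E'. simpl fst in E, E'. simpl snd in E, E'.
    destruct (dom_neq j p hp) as [n0 n1]. apply sub_1_neq in n1.
    destruct (chart_nondegenerate j (m1 - 2 * RtoC (IZR k)) ((m2 - 2 * RtoC (IZR l)) * Ci) p hp) as [Z1 Z2].
    + transitivity (m1 * al j p + m2 * (Ci * be j p) - (2 * RtoC (IZR k) * al j p + 2 * RtoC (IZR l) * (Ci * be j p))); [ring |].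
      rewrite E. ring.
    + transitivity (p * (1 - p) * (m1 * (d p * val j p) + m2 * (Ci * (d p * vbe j p))
         - (2 * RtoC (IZR k) * (d p * val j p) + 2 * RtoC (IZR l) * (Ci * (d p * vbe j p))))); [unfold d; field; auto |].
      rewrite E'. ring.
    + apply hm. exists k, l. rewrite !mult_IZR, !RtoC_mult. split.
      * replace m1 with (m1 - 2 * RtoC (IZR k) + 2 * RtoC (IZR k)) by ring. rewrite Z1. ring.
      * destruct (Cmult_integral _ _ Z2) as [Z | Z].
        -- replace m2 with (m2 - 2 * RtoC (IZR l) + 2 * RtoC (IZR l)) by ring. rewrite Z. ring.
        -- exfalso. apply (f_equal Im) in Z. simpl in Z. lra.
Qed.

Lemma pic_opp j m1 m2 x : dom j x -> pic j (- m1) (- m2) x = pic j m1 m2 x.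
Proof.
  intros h. unfold pic. apply (f_equal (fun u => u + (x + 1) / 3)). rewrite <- wp_even by now apply chart_indep.
  apply (f_equal (fun u => wp u _ _)). ring.
Qed.

(* Coordinates of the argument change contragrediently to the half-periods. *)
Lemma pic_chart0 (s : Z) n1 n2 x : (s = 1 \/ s = -1)%Z -> half (IZR s) x ->
  pic chart01 n1 n2 x = pic chart0 (n1 + RtoC (IZR s) * n2) n2 x.
Proof.
  intros hs hx. pose proof (chart_indep chart0 x (half_dom _ _ chart0 hx)) as hi.
  assert (hr : (IZR s = 1 \/ IZR s = -1)%R) by (destruct hs; subst; auto).
  assert (E : Ci * EK (1 - x) = RtoC (IZR s) * EK x + Ci * EL x).
  { rewrite (EL_relation (IZR s)) by assumption.
    replace (Ci * (EK (1 - x) + RtoC (IZR s) * Ci * EK x)) with (Ci * EK (1 - x) + RtoC (IZR s) * (Ci * Ci) * EK x) by ring.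
    replace (Ci * Ci) with (- RtoC 1) by (apply C_ext; reim; ring). ring. }
  unfold pic. simpl al in *. simpl be in *. apply (f_equal (fun u => u + (x + 1) / 3)). rewrite E.
  rewrite <- (wp_change_basis _ (EK x) (Ci * EL x) 1 0 s 1) by (auto; lia). f_equal; ring.
Qed.

Lemma pic_chart1 (s : Z) n1 n2 x : (s = 1 \/ s = -1)%Z -> half (IZR s) x ->
  pic chart01 n1 n2 x = pic chart1 n1 (n2 + RtoC (IZR s) * n1) x.
Proof.
  intros hs hx. pose proof (chart_indep chart1 x (half_dom _ _ chart1 hx)) as hi.
  assert (hr : (- IZR s = 1 \/ - IZR s = -1)%R) by (destruct hs; subst; [right | left]; lra).
  (* Reflection exchanges the half-planes, so [EL_relation] is used at [1 - x] with the opposite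
     sign. *)
  assert (hx' : half (- IZR s) (1 - x)) by (unfold half in *; revert hx; reim; intros; lra).
  assert (E : EK x = EL (1 - x) + RtoC (IZR s) * (Ci * EK (1 - x))).
  { rewrite (EL_relation (- IZR s)) by assumption. replace (1 - (1 - x)) with x by ring. rewrite RtoC_opp. ring. }
  unfold pic. simpl al in *. simpl be in *. apply (f_equal (fun u => u + (x + 1) / 3)). rewrite E.
  rewrite <- (wp_change_basis _ (EL (1 - x)) (Ci * EK (1 - x)) 1 s 0 1) by (auto; lia). f_equal; ring.
Qed.

(** * Continuation along arbitrary loops *)

Definition act1 (a b : Z) (n1 n2 : C) : C := RtoC (IZR a) * n1 + RtoC (IZR b) * n2.

(** The inverse matrix is integral and preserves [(2Z)^2]; so a solution that is not identically
    infinite stays so after any transformation. *)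
Lemma even_integral_act (a b c d : Z) n1 n2 :
  (a * d - b * c = 1)%Z -> even_integral (act1 a b n1 n2) (act1 c d n1 n2) -> even_integral n1 n2.
Proof.
  intros hdet (k & l & E1 & E2). exists (d * k - b * l)%Z, (a * l - c * k)%Z.
  assert (hR : RtoC (IZR a) * RtoC (IZR d) - RtoC (IZR b) * RtoC (IZR c) = 1).
  { rewrite <- !RtoC_mult, <- RtoC_minus, <- !mult_IZR, <- minus_IZR, hdet. reflexivity. }
  unfold act1 in E1, E2. rewrite !mult_IZR, !minus_IZR, !mult_IZR in *. rewrite !RtoC_mult, !RtoC_minus, !RtoC_mult in *.
  set (A := RtoC (IZR a)) in *. set (B := RtoC (IZR b)) in *. set (C' := RtoC (IZR c)) in *. set (D := RtoC (IZR d)) in *.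
  set (K := RtoC (IZR k)) in *. set (L := RtoC (IZR l)) in *. split.
  - transitivity ((A * D - B * C') * n1); [rewrite hR; ring |].
    transitivity (D * (A * n1 + B * n2) - B * (C' * n1 + D * n2)); [ring |]. rewrite E1, E2. ring.
  - transitivity ((A * D - B * C') * n2); [rewrite hR; ring |].
    transitivity (A * (C' * n1 + D * n2) - C' * (A * n1 + B * n2)); [ring |]. rewrite E1, E2. ring.
Qed.

(* The matrices relating a chart to [chart01] modulo [Gamma(2)]. *)
Definition twist (j : chart) (a b c d : Z) : Prop :=
  (a * d - b * c = 1)%Z /\
  match j with
  | chart01 => (a mod 2 = 1 /\ b mod 2 = 0 /\ c mod 2 = 0 /\ d mod 2 = 1)%Z
  | chart0 => (a mod 2 = 1 /\ b mod 2 = 1 /\ c mod 2 = 0 /\ d mod 2 = 1)%Z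
  | chart1 => (a mod 2 = 1 /\ b mod 2 = 0 /\ c mod 2 = 1 /\ d mod 2 = 1)%Z
  end.

(** The invariant carried along a loop: in chart [j] the germ is a transform of the initial branch
    by a matrix in the coset prescribed by [twist j]. *)
Definition state (n1 n2 : C) (j : chart) (x : C) (f : C -> C) : Prop :=
  dom j x /\ exists a b c d, twist j a b c d /\
    pnear x (fun z => f z = pic j (act1 a b n1 n2) (act1 c d n1 n2) z).

Lemma half_pnear s x (P Q : C -> Prop) : half s x -> (forall z, half s z -> P z -> Q z) -> pnear x P -> pnear x Q.
Proof.
  intros h H HP. refine (pnear_imp _ _ _ _ (pnear_and _ _ _ (pnear_near _ _ (half_open s x h)) HP)). intros z [a b]. auto.
Qed.

Ltac parity s hs := cbv beta iota in *; destruct hs; subst s; Z.div_mod_to_equations; lia.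

(** The transition matrix has off-diagonal entry [1] or [-1] according to the half-plane; modulo 2
    the sign disappears, so the coset depends on the charts only. *)
Lemma state_to_01 n1 n2 j x f (s : Z) :
  (s = 1 \/ s = -1)%Z -> half (IZR s) x -> state n1 n2 j x f -> state n1 n2 chart01 x f.
Proof.
  intros hs hx [_ (a & b & c & d & [hdet hpar] & H)]. split; [now apply (half_dom (IZR s)) |]. destruct j.
  - exists a, b, c, d. split; [split; assumption | exact H].
  - exists (a - s * c)%Z, (b - s * d)%Z, c, d. split.
    + split; [rewrite <- hdet; ring |]. simpl. parity s hs.
    + refine (half_pnear _ _ _ _ hx _ H). intros z hz ->. rewrite (pic_chart0 s) by assumption. f_equal.
      unfold act1. rewrite !minus_IZR, !mult_IZR, !RtoC_minus, !RtoC_mult. ring.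
  - exists a, b, (c - s * a)%Z, (d - s * b)%Z. split.
    + split; [rewrite <- hdet; ring |]. simpl. parity s hs.
    + refine (half_pnear _ _ _ _ hx _ H). intros z hz ->. rewrite (pic_chart1 s) by assumption. f_equal.
      unfold act1. rewrite !minus_IZR, !mult_IZR, !RtoC_minus, !RtoC_mult. ring.
Qed.

Lemma state_from_01 n1 n2 j x f (s : Z) :
  (s = 1 \/ s = -1)%Z -> half (IZR s) x -> state n1 n2 chart01 x f -> state n1 n2 j x f.
Proof.
  intros hs hx [_ (a & b & c & d & [hdet hpar] & H)]. split; [now apply (half_dom (IZR s)) |]. destruct j.
  - exists a, b, c, d. split; [split; assumption | exact H].
  - exists (a + s * c)%Z, (b + s * d)%Z, c, d. split.
    + split; [rewrite <- hdet; ring |]. simpl in *. parity s hs.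
    + refine (half_pnear _ _ _ _ hx _ H). intros z hz ->. rewrite (pic_chart0 s) by assumption. f_equal.
      unfold act1. rewrite !plus_IZR, !mult_IZR, !RtoC_plus, !RtoC_mult. ring.
  - exists a, b, (c + s * a)%Z, (d + s * b)%Z. split.
    + split; [rewrite <- hdet; ring |]. simpl in *. parity s hs.
    + refine (half_pnear _ _ _ _ hx _ H). intros z hz ->. rewrite (pic_chart1 s) by assumption. f_equal.
      unfold act1. rewrite !plus_IZR, !mult_IZR, !RtoC_plus, !RtoC_mult. ring.
Qed.

(** Two different charts meet only off the real axis, where the passage can be made through
    [chart01]. *)
Lemma state_change n1 n2 j k x f : dom k x -> state n1 n2 j x f -> state n1 n2 k x f.
Proof.
  intros hk hj. assert (D : j = k \/ j <> k) by (destruct j, k; (left; congruence) || (right; congruence)).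
  destruct D as [<- | N]; [exact hj |].
  destruct (dom_two_charts j k x N (proj1 hj) hk) as [h | h].
  - apply (state_from_01 _ _ _ _ _ 1); auto. now apply (state_to_01 _ _ j _ _ 1); auto.
  - apply (state_from_01 _ _ _ _ _ (-1)); auto. now apply (state_to_01 _ _ j _ _ (-1)); auto.
Qed.

Lemma mero_near p f : meromorphic_at p f -> near cid p (fun q => meromorphic_at q f).
Proof.
  intros H. pose proof H as H'. apply meromorphic_at_iff in H' as (n & g & h1 & h2).
  pose proof (near_near _ _ _ h1) as h1'. pose proof (pnear_open _ _ h2) as h2'.
  refine (near_imp _ _ _ _ _ (near_and _ _ _ _ h1' h2')). cbv beta. intros q [a b].
  destruct (classic (q = p)) as [-> | N]; [exact H |].
  apply (mero_ext q (fun z => g z * / (z - p) ^ n)).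
  - refine (pnear_imp _ _ _ _ (pnear_and _ _ _ (pnear_near _ _ (near_neq q p N)) b)). intros z [c <-]. field.
    apply Cpow_nz, sub_neq_0, c.
  - apply holo_mero, holo_mult; [exact a |]. apply holo_inv; [| now apply Cpow_nz, sub_neq_0].
    apply holo_pow, holo_minus; [apply holo_id | apply holo_const].
Qed.

Lemma continuous_on_near (gam : R -> C) t eps :
  continuous_on unit_interval gam -> unit_interval t -> (0 < eps)%R ->
  exists d, (0 < d)%R /\ forall s, unit_interval s -> (Rabs (s - t) < d)%R -> (Cmod (gam s - gam t) < eps)%R.
Proof.
  intros H ht he.
  assert (N : locally (T := C_UniformSpace) (gam t) (fun y => (Cmod (y - gam t) < eps)%R)).
  { apply (locally_near (gam t)). exists eps. split; [exact he | auto]. }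
  destruct (H t ht _ N) as [d Hd]. exists d. split; [apply cond_pos |]. intros s hs hd. exact (Hd s hd hs).
Qed.

(** The existence of a chart in which [state] holds is an open and closed condition along the loop.
    At [x0] the chart can be taken to be [chart01] again, whose coset is Gamma(2). *)
Lemma branch_is_transform n1 n2 x0 g :
  ~ even_integral n1 n2 -> cut_plane x0 -> is_branch x0 (picard n1 n2) g ->
  exists a b c d, in_Gamma2 a b c d /\ germ_eq x0 g (picard (act1 a b n1 n2) (act1 c d n1 n2)).
Proof.
  intros hn hx0 (gam & (Hc & g0 & g1 & Hav) & F & F0 & F1 & HF).
  assert (Hpic : forall m1 m2, pnear x0 (fun z => picard m1 m2 z = pic chart01 m1 m2 z)).
  { intros m1 m2. apply pnear_near. refine (near_imp _ _ _ _ _ (cut_plane_open x0 hx0)). intros z hz. now apply picard_pic. }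
  rewrite g0 in F0. rewrite g1 in F1. apply germ_eq_pnear in F0, F1.
  assert (Q1 : exists j, state n1 n2 j (gam 1%R) (F 1%R)).
  { apply (unit_connected (fun t => exists j, state n1 n2 j (gam t) (F t))).
    - intros t ht. destruct (HF t ht) as (hm & delta & Hd). destruct (Hav t ht) as [z0 z1].
      destruct (classic (exists j, state n1 n2 j (gam t) (F t))) as [Y | N].
      (* Openness: the same chart and the same matrix serve for nearby parameters. *)
      + pose proof Y as (j & hj & a & b & c & d & htw & H).
        destruct (near_and _ _ _ _ (dom_open j _ hj) (pnear_open _ _ H)) as (r & hr & Hr). unfold cid in Hr.
        destruct (continuous_on_near gam t r Hc ht hr) as (e & he & He).
        exists (Rmin delta e). split; [apply Rmin_glb_lt; [apply cond_pos | exact he] |]. intros s hs hst.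
        pose proof (Rmin_l delta e). pose proof (Rmin_r delta e). split; [intros _; exact Y |]. intros _.
        destruct (Hr (gam s) (He s hs ltac:(lra))) as [h1 h2]. exists j. split; [exact h1 |].
        exists a, b, c, d. split; [exact htw |].
        specialize (Hd s hs ltac:(lra)). apply germ_eq_pnear in Hd.
        refine (pnear_imp _ _ _ _ (pnear_and _ _ _ Hd h2)). intros z [-> E]. exact E.
      (* Closedness: a state at a nearby [s] is rewritten in a chart containing [gam t] and carried
         to [gam t] along a segment inside that chart, where both germs have meromorphic
         representatives. *)
      + destruct (dom_cover _ z0 z1) as (j & hj).
        destruct (near_and _ _ _ _ (dom_open j _ hj) (mero_near _ _ hm)) as (r & hr & Hr). unfold cid in Hr.
        destruct (continuous_on_near gam t r Hc ht hr) as (e & he & He).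
        exists (Rmin delta e). split; [apply Rmin_glb_lt; [apply cond_pos | exact he] |]. intros s hs hst.
        pose proof (Rmin_l delta e). pose proof (Rmin_r delta e). split; [| intros Y; contradiction].
        intros (k & hk). exists j. specialize (He s hs ltac:(lra)).
        apply (state_change _ _ k j) in hk; [| now apply Hr]. destruct hk as [_ (a & b & c & d & htw & H1)].
        split; [exact hj |]. exists a, b, c, d. split; [exact htw |].
        specialize (Hd s hs ltac:(lra)). apply germ_eq_pnear in Hd.
        apply (identity_segm _ _ (gam s) (gam t)).
        * intros u hu. assert (hin : (Cmod (segm (gam s) (gam t) u - gam t) < r)%R).
          { unfold segm, unit_interval in *. replace (gam s + RtoC u * (gam t - gam s) - gam t) with (RtoC (1 - u) * (gam s - gam t)) by (rewrite RtoC_minus; ring).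
            rewrite Cmod_mult, Cmod_R, Rabs_pos_eq by lra. pose proof (Cmod_ge_0 (gam s - gam t)). nra. }
          destruct (Hr _ hin) as [h1 h2]. split; [exact h2 |]. apply pic_mero; [| exact h1].
          intros E. apply hn. exact (even_integral_act a b c d n1 n2 (proj1 htw) E).
        * refine (pnear_imp _ _ _ _ (pnear_and _ _ _ Hd H1)). intros z [<- E]. exact E.
    - exists chart01. rewrite g0. split; [exact hx0 |]. exists 1%Z, 0%Z, 0%Z, 1%Z. split; [split; [reflexivity | repeat split] |].
      refine (pnear_imp _ _ _ _ (pnear_and _ _ _ F0 (Hpic n1 n2))). intros z [-> ->]. f_equal; unfold act1; ring. }
  destruct Q1 as (j & hj). rewrite g1 in hj. apply (state_change _ _ j chart01) in hj; [| exact hx0].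
  destruct hj as [_ (a & b & c & d & [hdet hpar] & H)]. exists a, b, c, d.
  split; [split; [exact hdet | exact hpar] |]. apply germ_eq_pnear.
  refine (pnear_imp _ _ _ _ (pnear_and _ _ _ F1 (pnear_and _ _ _ (Hpic _ _) H))). intros z (<- & -> & E). exact E.
Qed.

(** * Realisation of the group *)

(** Continuation between different end points. The curve is continuous on the whole real line, which
    lets two curves be joined by reparametrising with clamped arguments. *)
Definition path_cont (p : C) (f : C -> C) (q : C) (g : C -> C) : Prop :=
  exists gam : R -> C, (forall t, rcont gam t) /\ gam 0%R = p /\ gam 1%R = q /\
    (forall t, unit_interval t -> gam t <> 0 /\ gam t <> 1) /\ continues_along gam f g.

Lemma germ_eq_sym p f g : germ_eq p f g -> germ_eq p g f.
Proof. rewrite !germ_eq_pnear. apply pnear_imp. auto. Qed.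

Lemma germ_eq_trans p f g h : germ_eq p f g -> germ_eq p g h -> germ_eq p f h.
Proof.
  rewrite !germ_eq_pnear. intros H1 H2. refine (pnear_imp _ _ _ _ (pnear_and _ _ _ H1 H2)). intros z [-> E]. exact E.
Qed.

Lemma germ_eq_refl p f : germ_eq p f f.
Proof. apply germ_eq_pnear, pnear_near, near_all. reflexivity. Qed.

Lemma path_cont_segm p q f :
  (forall t, unit_interval t -> segm p q t <> 0 /\ segm p q t <> 1 /\ meromorphic_at (segm p q t) f) ->
  path_cont p f q f.
Proof.
  intros H. exists (segm p q). split; [intros t; apply segm_rcont |]. split; [apply segm_0 |]. split; [apply segm_1 |].
  split; [intros t ht; destruct (H t ht) as (a & b & _); auto |].
  exists (fun _ => f). split; [apply germ_eq_refl |]. split; [apply germ_eq_refl |]. intros t ht.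
  split; [now apply H |]. exists (mkposreal 1 Rlt_0_1). intros. apply germ_eq_refl.
Qed.

Lemma path_cont_end p f q g g' : germ_eq q g g' -> path_cont p f q g -> path_cont p f q g'.
Proof.
  intros E (gam & h1 & h2 & h3 & h4 & F & F0 & F1 & HF). exists gam. do 4 (split; [assumption |]).
  exists F. split; [exact F0 |]. split; [| exact HF]. rewrite h3 in *. exact (germ_eq_trans _ _ _ _ F1 E).
Qed.

Lemma rcont_comp_lipschitz (gam : R -> C) (p : R -> R) t :
  (forall t, rcont gam t) -> (forall s t, (Rabs (p s - p t) <= 2 * Rabs (s - t))%R) -> rcont (fun s => gam (p s)) t.
Proof.
  intros H hp eps he. destruct (H (p t) eps he) as (d & hd & Hd). exists (d / 2)%R. split; [lra |].
  intros s hs. apply Hd. rewrite Cmod_RtoC_sub in *. specialize (hp s t). lra.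
Qed.

Lemma path_cont_trans p f q g r h : path_cont p f q g -> path_cont q g r h -> path_cont p f r h.
Proof.
  intros (ga & a1 & a2 & a3 & a4 & F & F0 & F1 & HF) (gb & b1 & b2 & b3 & b4 & G & G0 & G1 & HG).
  (* With the clamped [u] and [v] one of the two curves rests at [q] while the other moves, so [gam]
     is a single formula and continuous without a case distinction at [1/2]. *)
  set (u := fun t => Rmin (2 * t) 1). set (v := fun t => Rmax (2 * t - 1) 0).
  set (gam := fun t => ga (u t) + gb (v t) - q).
  assert (E1 : forall t, (t <= 1 / 2)%R -> gam t = ga (2 * t)%R).
  { intros t ht. unfold gam, u, v. rewrite Rmin_left, Rmax_right by lra. rewrite b2. ring. }
  assert (E2 : forall t, (1 / 2 <= t)%R -> gam t = gb (2 * t - 1)%R).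
  { intros t ht. unfold gam, u, v. rewrite Rmin_right, Rmax_left by lra. rewrite a3. ring. }
  assert (Cg : forall t, rcont gam t).
  { intros t. apply cont_minus; [apply cont_plus | apply cont_const]; apply rcont_comp_lipschitz; auto;
      intros x y; unfold u, v, Rmin, Rmax; repeat destruct Rle_dec; unfold Rabs; repeat destruct Rcase_abs; lra. }
  exists gam. split; [exact Cg |]. split; [rewrite E1, Rmult_0_r by lra; exact a2 |].
  split; [rewrite E2 by lra; replace (2 * 1 - 1)%R with 1%R by ring; exact b3 |].
  split.
  { intros t ht. unfold unit_interval in *. destruct (Rle_dec t (1 / 2)); [rewrite E1 by lra; apply a4; lra | rewrite E2 by lra; apply b4; lra]. }
  exists (fun t => if Rle_dec t (1 / 2) then F (2 * t)%R else G (2 * t - 1)%R).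
  split; [| split].
  - destruct (Rle_dec 0 (1 / 2)); [| lra]. rewrite E1, Rmult_0_r by lra. exact F0.
  - destruct (Rle_dec 1 (1 / 2)); [lra |]. rewrite E2 by lra. replace (2 * 1 - 1)%R with 1%R by ring. exact G1.
  - intros t ht. unfold unit_interval in *. destruct (Rtotal_order t (1 / 2)) as [hlt | [heq | hgt]].
    + destruct (Rle_dec t (1 / 2)) as [_ | n]; [| lra]. destruct (HF (2 * t)%R ltac:(lra)) as (hm & d & Hd).
      split; [rewrite E1 by lra; exact hm |].
      assert (hd : (0 < Rmin (d / 2) (1 / 2 - t))%R) by (pose proof (cond_pos d); apply Rmin_glb_lt; lra).
      exists (mkposreal _ hd). simpl. intros s hs hst. pose proof (Rmin_l (d / 2) (1 / 2 - t)). pose proof (Rmin_r (d / 2) (1 / 2 - t)).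
      assert (hs2 : (Rabs (s - t) < 1 / 2 - t)%R) by lra. apply Rabs_def2 in hs2.
      destruct (Rle_dec s (1 / 2)) as [_ | n]; [| lra]. rewrite E1 by lra. apply Hd; [lra |].
      replace (2 * s - 2 * t)%R with (2 * (s - t))%R by ring. rewrite Rabs_mult, (Rabs_pos_eq 2) by lra. lra.
    (* At the junction [F 1] and [G 0] agree on a punctured neighbourhood of [q], hence as germs at
       all nearby points of [gam]. *)
    + subst t. destruct (Rle_dec (1 / 2) (1 / 2)) as [_ | n]; [| lra].
      replace (2 * (1 / 2))%R with 1%R by field.
      destruct (HF 1%R ltac:(lra)) as (hm & d1 & Hd1). destruct (HG 0%R ltac:(lra)) as (_ & d2 & Hd2).
      assert (Eq : gam (1 / 2)%R = q) by (rewrite E1 by lra; replace (2 * (1 / 2))%R with 1%R by field; exact a3).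
      split; [rewrite Eq, <- a3; exact hm |].
      assert (J : pnear q (fun z => G 0%R z = F 1%R z)).
      { rewrite a3 in F1. rewrite b2 in G0. apply germ_eq_pnear. exact (germ_eq_trans _ _ _ _ G0 (germ_eq_sym _ _ _ F1)). }
      pose proof (pnear_open _ _ J) as JO. rewrite <- Eq in JO.
      destruct (cont_near _ _ _ _ (Cg (1 / 2)%R) JO) as (e & he & He).
      assert (hd : (0 < Rmin e (Rmin (d1 / 2) (d2 / 2)))%R).
      { pose proof (cond_pos d1). pose proof (cond_pos d2). repeat apply Rmin_glb_lt; lra. }
      exists (mkposreal _ hd). simpl. intros s hs hst.
      pose proof (Rmin_l e (Rmin (d1 / 2) (d2 / 2))). pose proof (Rmin_r e (Rmin (d1 / 2) (d2 / 2))).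
      pose proof (Rmin_l (d1 / 2) (d2 / 2)). pose proof (Rmin_r (d1 / 2) (d2 / 2)).
      assert (hh : (Rabs (2 * (s - 1 / 2)) < d1 /\ Rabs (2 * (s - 1 / 2)) < d2)%R).
      { rewrite Rabs_mult, (Rabs_pos_eq 2) by lra. lra. }
      destruct (Rle_dec s (1 / 2)) as [hle | hgt].
      * rewrite E1 by lra. apply Hd1; [lra |]. replace (2 * s - 1)%R with (2 * (s - 1 / 2))%R by field. tauto.
      * apply germ_eq_trans with (G 0%R).
        -- rewrite E2 by lra. apply Hd2; [lra |]. replace (2 * s - 1 - 0)%R with (2 * (s - 1 / 2))%R by field. tauto.
        -- apply germ_eq_pnear, He. rewrite Cmod_RtoC_sub. lra.
    + destruct (Rle_dec t (1 / 2)) as [n | _]; [lra |]. destruct (HG (2 * t - 1)%R ltac:(lra)) as (hm & d & Hd).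
      split; [rewrite E2 by lra; exact hm |].
      assert (hd : (0 < Rmin (d / 2) (t - 1 / 2))%R) by (pose proof (cond_pos d); apply Rmin_glb_lt; lra).
      exists (mkposreal _ hd). simpl. intros s hs hst. pose proof (Rmin_l (d / 2) (t - 1 / 2)). pose proof (Rmin_r (d / 2) (t - 1 / 2)).
      assert (hs2 : (Rabs (s - t) < t - 1 / 2)%R) by lra. apply Rabs_def2 in hs2.
      destruct (Rle_dec s (1 / 2)) as [n | _]; [lra |]. rewrite E2 by lra. apply Hd; [lra |].
      replace (2 * s - 1 - (2 * t - 1))%R with (2 * (s - t))%R by ring. rewrite Rabs_mult, (Rabs_pos_eq 2) by lra. lra.
Qed.

Lemma path_cont_is_branch x0 f g : path_cont x0 f x0 g -> is_branch x0 f g.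
Proof.
  intros (gam & h1 & h2 & h3 & h4 & h5). exists gam. split; [| exact h5]. split; [| auto].
  intros t ht P HP. apply locally_near in HP. destruct HP as (eps & he & HP). destruct (h1 t eps he) as (d & hd & Hd).
  exists (mkposreal d hd). intros s hs _. apply HP, Hd. rewrite Cmod_RtoC_sub. exact hs.
Qed.

(** Two segments through the centre of the star. *)
Lemma path_cont_chart j m1 m2 p q :
  ~ even_integral m1 m2 -> dom j p -> dom j q -> path_cont p (pic j m1 m2) q (pic j m1 m2).
Proof.
  intros hm hp hq.
  assert (Hd : forall z, dom j z -> z <> 0 /\ z <> 1 /\ meromorphic_at z (pic j m1 m2)).
  { intros z hz. destruct (dom_neq j z hz). split; [assumption |]. split; [assumption | now apply pic_mero]. }
  apply path_cont_trans with (ctr j) (pic j m1 m2); apply path_cont_segm; intros t ht; apply Hd; unfold unit_interval in ht.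
  - replace (segm p (ctr j) t) with (segm (ctr j) p (1 - t)) by (unfold segm; rewrite RtoC_minus; ring).
    apply star_dom; [exact hp | lra].
  - now apply star_dom.
Qed.

Definition half_point (s : R) : C := RtoC s * Ci.

Lemma half_point_half (s : Z) : (s = 1 \/ s = -1)%Z -> half (IZR s) (half_point (IZR s)).
Proof. intros hs. unfold half, half_point. reim. destruct hs; subst; lra. Qed.

Lemma half_germ s p (f g : C -> C) : half s p -> (forall z, half s z -> f z = g z) -> germ_eq p f g.
Proof.
  intros hp H. apply germ_eq_pnear, pnear_near. refine (near_imp _ _ _ _ _ (half_open s p hp)). auto.
Qed.

(** The loop around [0]: to [s i] in the cut plane, across the negative axis in [chart0] to [- s i],
    and back in the cut plane. Entering and leaving [chart0] contribute [s] each, since the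
    half-planes differ. *)
Lemma generator_0 x0 (s : Z) n1 n2 : cut_plane x0 -> (s = 1 \/ s = -1)%Z -> ~ even_integral n1 n2 ->
  path_cont x0 (pic chart01 n1 n2) x0 (pic chart01 (act1 1 (2 * s) n1 n2) (act1 0 1 n1 n2)).
Proof.
  intros hx hs hn. assert (hs' : (- s = 1 \/ - s = -1)%Z) by lia.
  pose proof (half_point_half s hs) as hp. pose proof (half_point_half (- s) hs') as hq.
  assert (hm : ~ even_integral (n1 + RtoC (IZR s) * n2) n2).
  { intros E. apply hn. apply (even_integral_act 1 s 0 1); [lia |]. unfold act1.
    replace (RtoC (IZR 1) * n1 + RtoC (IZR s) * n2) with (n1 + RtoC (IZR s) * n2) by ring.
    replace (RtoC (IZR 0) * n1 + RtoC (IZR 1) * n2) with n2 by ring. exact E. }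
  apply path_cont_trans with (half_point (IZR s)) (pic chart0 (n1 + RtoC (IZR s) * n2) n2).
  { apply path_cont_end with (pic chart01 n1 n2).
    - apply (half_germ (IZR s)); [exact hp |]. intros z hz. now apply pic_chart0.
    - apply path_cont_chart; [exact hn | exact hx | now apply (half_dom (IZR s))]. }
  apply path_cont_trans with (half_point (IZR (- s))) (pic chart01 (act1 1 (2 * s) n1 n2) (act1 0 1 n1 n2)).
  { apply path_cont_end with (pic chart0 (n1 + RtoC (IZR s) * n2) n2).
    - apply (half_germ (IZR (- s))); [exact hq |]. intros z hz. rewrite (pic_chart0 (- s)) by assumption.
      apply (f_equal2 (fun m1 m2 => pic chart0 m1 m2 z)).
      + unfold act1. rewrite opp_IZR, mult_IZR, RtoC_opp, RtoC_mult. ring.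
      + unfold act1. ring.
    - apply path_cont_chart; [exact hm | now apply (half_dom (IZR s)) | now apply (half_dom (IZR (- s)))]. }
  apply path_cont_chart; [| now apply (half_dom (IZR (- s))) | exact hx].
  intros E. apply hn. apply (even_integral_act 1 (2 * s) 0 1); [lia | exact E].
Qed.

(** The loop around [1], crossing the real axis beyond [1] in [chart1]. *)
Lemma generator_1 x0 (s : Z) n1 n2 : cut_plane x0 -> (s = 1 \/ s = -1)%Z -> ~ even_integral n1 n2 ->
  path_cont x0 (pic chart01 n1 n2) x0 (pic chart01 (act1 1 0 n1 n2) (act1 (2 * s) 1 n1 n2)).
Proof.
  intros hx hs hn. assert (hs' : (- s = 1 \/ - s = -1)%Z) by lia.
  pose proof (half_point_half s hs) as hp. pose proof (half_point_half (- s) hs') as hq.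
  assert (hm : ~ even_integral n1 (n2 + RtoC (IZR s) * n1)).
  { intros E. apply hn. apply (even_integral_act 1 0 s 1); [lia |]. unfold act1.
    replace (RtoC (IZR 1) * n1 + RtoC (IZR 0) * n2) with n1 by ring.
    replace (RtoC (IZR s) * n1 + RtoC (IZR 1) * n2) with (n2 + RtoC (IZR s) * n1) by ring. exact E. }
  apply path_cont_trans with (half_point (IZR s)) (pic chart1 n1 (n2 + RtoC (IZR s) * n1)).
  { apply path_cont_end with (pic chart01 n1 n2).
    - apply (half_germ (IZR s)); [exact hp |]. intros z hz. now apply pic_chart1.
    - apply path_cont_chart; [exact hn | exact hx | now apply (half_dom (IZR s))]. }
  apply path_cont_trans with (half_point (IZR (- s))) (pic chart01 (act1 1 0 n1 n2) (act1 (2 * s) 1 n1 n2)).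
  { apply path_cont_end with (pic chart1 n1 (n2 + RtoC (IZR s) * n1)).
    - apply (half_germ (IZR (- s))); [exact hq |]. intros z hz. rewrite (pic_chart1 (- s)) by assumption.
      apply (f_equal2 (fun m1 m2 => pic chart1 m1 m2 z)).
      + unfold act1. ring.
      + unfold act1. rewrite opp_IZR, mult_IZR, RtoC_opp, RtoC_mult. ring.
    - apply path_cont_chart; [exact hm | now apply (half_dom (IZR s)) | now apply (half_dom (IZR (- s)))]. }
  apply path_cont_chart; [| now apply (half_dom (IZR (- s))) | exact hx].
  intros E. apply hn. apply (even_integral_act 1 0 (2 * s) 1); [lia | exact E].
Qed.

Definition realised (x0 : C) (a b c d : Z) : Prop :=
  forall n1 n2, ~ even_integral n1 n2 ->
    path_cont x0 (pic chart01 n1 n2) x0 (pic chart01 (act1 a b n1 n2) (act1 c d n1 n2)).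

(** After a loop for the modified matrix, the generator with [- s] acts by left multiplication and
    subtracts [2 s] times the second row from the first. *)
Lemma realised_0 x0 (s a b c d : Z) : cut_plane x0 -> (s = 1 \/ s = -1)%Z -> (a * d - b * c = 1)%Z ->
  realised x0 (a + 2 * s * c) (b + 2 * s * d) c d -> realised x0 a b c d.
Proof.
  intros hx hs hdet H n1 n2 hn. specialize (H n1 n2 hn). eapply path_cont_trans; [exact H |].
  refine (path_cont_end _ _ _ _ _ _ (generator_0 x0 (- s) _ _ hx ltac:(lia) _)).
  - match goal with |- germ_eq _ ?f ?g => replace f with g; [apply germ_eq_refl |] end.
    unfold act1. apply (f_equal2 (pic chart01));
      repeat rewrite ?plus_IZR, ?mult_IZR, ?opp_IZR, ?RtoC_plus, ?RtoC_mult, ?RtoC_opp; ring.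
  - intros E. apply hn. refine (even_integral_act _ _ _ _ _ _ _ E). rewrite <- hdet. ring.
Qed.

(** The same with the rows exchanged. *)
Lemma realised_1 x0 (s a b c d : Z) : cut_plane x0 -> (s = 1 \/ s = -1)%Z -> (a * d - b * c = 1)%Z ->
  realised x0 a b (c + 2 * s * a) (d + 2 * s * b) -> realised x0 a b c d.
Proof.
  intros hx hs hdet H n1 n2 hn. specialize (H n1 n2 hn). eapply path_cont_trans; [exact H |].
  refine (path_cont_end _ _ _ _ _ _ (generator_1 x0 (- s) _ _ hx ltac:(lia) _)).
  - match goal with |- germ_eq _ ?f ?g => replace f with g; [apply germ_eq_refl |] end.
    unfold act1. apply (f_equal2 (pic chart01));
      repeat rewrite ?plus_IZR, ?mult_IZR, ?opp_IZR, ?RtoC_plus, ?RtoC_mult, ?RtoC_opp; ring.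
  - intros E. apply hn. refine (even_integral_act _ _ _ _ _ _ _ E). rewrite <- hdet. ring.
Qed.

(** The diagonal is [1, 1] or [-1, -1]; the even entry [b] is brought to [0] in steps of [2]. *)
Lemma realised_triangular x0 : cut_plane x0 ->
  forall k a b d, (Z.abs b <= Z.of_nat k)%Z -> (a * d = 1)%Z -> (b mod 2 = 0)%Z -> realised x0 a b 0 d.
Proof.
  intros hx. induction k; intros a b d hb had hpar.
  - replace b with 0%Z by lia. intros n1 n2 hn. destruct (Z.eq_mul_1 a d had) as [Ea | Ea].
    + replace a with 1%Z by lia. replace d with 1%Z by lia. apply path_cont_end with (pic chart01 n1 n2); [| now apply path_cont_chart].
      match goal with |- germ_eq _ ?f ?g => replace g with f; [apply germ_eq_refl |] end. f_equal; unfold act1; ring.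
    (* The matrix [-1] needs only a path inside the chart, because [wp] is even. *)
    + replace a with (-1)%Z by lia. replace d with (-1)%Z by lia. apply path_cont_end with (pic chart01 n1 n2); [| now apply path_cont_chart].
      apply germ_eq_pnear, pnear_near. refine (near_imp _ _ _ _ _ (cut_plane_open x0 hx)). intros z hz.
      rewrite <- (pic_opp chart01 n1 n2) by exact hz.
      assert (E : RtoC (IZR (-1)) = - RtoC 1) by (rewrite <- RtoC_opp; reflexivity).
      apply (f_equal2 (fun m1 m2 => pic chart01 m1 m2 z)); unfold act1; rewrite E; ring.
  - destruct (Z.eq_dec b 0) as [-> | nb]; [apply IHk; auto; lia |].
    destruct (Z.eq_mul_1 a d had) as [-> | ->].
    + assert (hd : d = 1%Z) by lia. subst d. destruct (Z_lt_le_dec b 0).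
      * apply (realised_0 x0 1); auto; [lia |]. rewrite Z.mul_0_r, Z.add_0_r. apply IHk; Z.div_mod_to_equations; lia.
      * apply (realised_0 x0 (-1)); auto; [lia |]. rewrite Z.mul_0_r, Z.add_0_r. apply IHk; Z.div_mod_to_equations; lia.
    + assert (hd : d = (-1)%Z) by lia. subst d. destruct (Z_lt_le_dec b 0).
      * apply (realised_0 x0 (-1)); auto; [lia |]. rewrite Z.mul_0_r, Z.add_0_r. apply IHk; Z.div_mod_to_equations; lia.
      * apply (realised_0 x0 1); auto; [lia |]. rewrite Z.mul_0_r, Z.add_0_r. apply IHk; Z.div_mod_to_equations; lia.
Qed.

(* Euclid's algorithm on the first column, which is odd over even. *)
Lemma realised_Gamma2 x0 : cut_plane x0 ->
  forall k a b c d, (Z.abs a + Z.abs c <= Z.of_nat k)%Z -> in_Gamma2 a b c d -> realised x0 a b c d.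
Proof.
  intros hx. induction k; intros a b c d hk (hdet & ha & hb & hc & hd).
  - exfalso. replace a with 0%Z in ha by lia. discriminate.
  - destruct (Z.eq_dec c 0) as [-> | nc].
    + apply (realised_triangular x0 hx (Z.abs_nat b)); lia.
    + assert (na : a <> 0%Z) by (intros ->; discriminate).
      destruct (Z_lt_le_dec (Z.abs c) (Z.abs a)) as [h | h].
      (* From [0 < |c| < |a|] follows [| |a| - 2 |c| | < |a|]; the sign [s] is taken opposite to
         that of [a c]. *)
      * assert (hs : exists s, (s = 1 \/ s = -1)%Z /\ (Z.abs (a + 2 * s * c) < Z.abs a)%Z).
        { destruct (Z_lt_le_dec 0 (a * c)); [exists (-1)%Z | exists 1%Z]; split; auto; nia. }
        destruct hs as (s & hs & hlt). apply (realised_0 x0 s); auto. apply IHk; [lia |].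
        split; [rewrite <- hdet; ring |]. parity s hs.
      * assert (hca : Z.abs a <> Z.abs c) by (Z.div_mod_to_equations; lia).
        assert (hs : exists s, (s = 1 \/ s = -1)%Z /\ (Z.abs (c + 2 * s * a) < Z.abs c)%Z).
        { destruct (Z_lt_le_dec 0 (a * c)); [exists (-1)%Z | exists 1%Z]; split; auto; nia. }
        destruct hs as (s & hs & hlt). apply (realised_1 x0 s); auto. apply IHk; [lia |].
        split; [rewrite <- hdet; ring |]. parity s hs.
Qed.

Theorem theorem1 (nu1 nu2 : C) (hnu : ~ even_integral nu1 nu2)
    (x0 : C) (hx0 : cut_plane x0) (g : C -> C) :
  is_branch x0 (picard nu1 nu2) g <->
  exists a b c d : Z,
    in_Gamma2 a b c d /\
    germ_eq x0 g
      (picard (RtoC (IZR a) * nu1 + RtoC (IZR b) * nu2)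
              (RtoC (IZR c) * nu1 + RtoC (IZR d) * nu2)).
Proof.
  split; [exact (branch_is_transform nu1 nu2 x0 g hnu hx0) |].
  intros (a & b & c & d & hG & hg).
  (* [picard] agrees with [pic chart01] on the cut plane, hence as a germ at [x0]; the continuation
     itself is kept and only its two end germs are exchanged. *)
  assert (Hpic : forall m1 m2, germ_eq x0 (picard m1 m2) (pic chart01 m1 m2)).
  { intros m1 m2. apply germ_eq_pnear, pnear_near. refine (near_imp _ _ _ _ _ (cut_plane_open x0 hx0)).
    intros z hz. now apply picard_pic. }
  destruct (realised_Gamma2 x0 hx0 (Z.to_nat (Z.abs a + Z.abs c)) a b c d ltac:(lia) hG nu1 nu2 hnu)
    as (gam & h1 & h2 & h3 & h4 & F & F0 & F1 & HF).
  apply path_cont_is_branch. exists gam. do 4 (split; [assumption |]).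
  exists F. rewrite h2, h3 in *. split; [| split; [| exact HF]].
  - exact (germ_eq_trans _ _ _ _ F0 (germ_eq_sym _ _ _ (Hpic _ _))).
  - apply (germ_eq_trans _ _ _ _ F1). apply germ_eq_sym, (germ_eq_trans _ _ _ _ hg), Hpic.
Qed.
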